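(* Let $T>1$ and $m>0$. Let $p\in L^\infty(0,1)$ with $\|p\|_{L^\infty(0,1)}\le m$. Assume: (Regularity) $(y^0,y^1)\in H^2(0,1)\times H^1(0,1)$, $g\in W^{1,1}(0,T;L^2(0,1))$, $(g^0,g^1)\in (H^2(0,T))^2$, with $g^0(0)=y^0(0)$, $g^1(0)=y^0(1)$, $\partial_t g^0(0)=y^1(0)$, $\partial_t g^1(0)=y^1(1)$. (Convergence of the data) For each $h=1/(N+1)$, $N\in\mathbb N$, discrete data $(y_h^0,y_h^1)$, $g_h$, $(g_h^0,g_h^1)$ are given such that, as $h\to0$, $$(\mathrm e_h^0(\Delta_h y_h^0),\mathrm e_h^0(\Delta_h y_h^1))\to(\partial_{xx}y^0,\partial_{xx}y^1)\ \text{ in } L^2(0,1)\times H^{-1}(0,1),$$ $$\mathrm e_h^0(g_h)\to g\ \text{ in } W^{1,1}(0,T;L^2(0,1)),\qquad (g_h^0,g_h^1)\to(g^0,g^1)\ \text{ in }(H^2(0,T))^2.$$ (Positivity) There is $r>0$ such that $\inf_{x\in(0,1)}|y^0(x)|\ge r$ and, for all $h$, $\inf_{1\le j\le N}|y^0_{j,h}|\ge r$. Let $q_h\in L^\infty_{h,\le m}(0,1)$ be such that $$\Theta_h(q_h)\to\Theta_0(p)\quad\text{strongly in } L^2(0,T)\times L^2((0,T)\times(0,1))\ \text{ as } h\to0.$$ Then $$\mathrm e_h^0(q_h)\to p\quad\text{in } L^2(0,1)\ \text{ as } h\to0.$$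
   Context: Grid: for $N\in\mathbb N$, $h=1/(N+1)$, $x_j=jh$. $(\Delta_h v)_j=(v_{j+1}-2v_j+v_{j-1})/h^2$ and $(\partial_h^- v)_{N+1}=(v_{N+1}-v_N)/h$. $L^\infty_{h,\le m}(0,1)=\{q_h=(q_{j,h})_{1\le j\le N}:\ \sup_{1\le j\le N}|q_{j,h}|\le m\}$. Continuous equation: $y[p]$ denotes the solution of $\partial_{tt}y-\partial_{xx}y+py=g$ in $(0,T)\times(0,1)$, $y(t,0)=g^0(t)$, $y(t,1)=g^1(t)$, $y(0,\cdot)=y^0$, $\partial_ty(0,\cdot)=y^1$. (Under the regularity assumption, $y[p]\in C^2([0,T];L^2(0,1))\cap C^1([0,T];H^1(0,1))\cap C^0([0,T];H^2(0,1))$ and $\partial_{tx}y[p](\cdot,1)\in L^2(0,T)$.) Semi-discrete equation: $y_h[q_h]=(y_{j,h}(t))_{0\le j\le N+1}$ denotes the solution of $\partial_{tt}y_{j,h}-(\Delta_hy_h)_j+q_{j,h}y_{j,h}=g_{j,h}$ for $t\in(0,T)$, $1\le j\le N$, with $y_{0,h}(t)=g_h^0(t)$, $y_{N+1,h}(t)=g_h^1(t)$, $y_{j,h}(0)=y^0_{j,h}$, $\partial_ty_{j,h}(0)=y^1_{j,h}$ for $1\le j\le N$. In $\Delta_hy_h^0$ and $\Delta_hy_h^1$ the boundary values are $y^0_{0,h}=g_h^0(0)$, $y^0_{N+1,h}=g_h^1(0)$, $y^1_{0,h}=\partial_tg_h^0(0)$, $y^1_{N+1,h}=\partial_tg_h^1(0)$.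 Extensions: for $(f_{j,h})_{0\le j\le N+1}$, $\mathrm e_h(f_h)$ is the continuous function on $[0,1]$, affine on each $[jh,(j+1)h]$, with value $f_{j,h}$ at $jh$. For $(f_{j,h})_{1\le j\le N}$, $\mathrm e_h^0(f_h)$ equals $f_{j,h}$ on $[(j-1/2)h,(j+1/2)h)$ for $1\le j\le N$ and $0$ on $[0,h/2)\cup[(N+1/2)h,1]$. Observation operators, with values in $L^2(0,T)\times L^2((0,T)\times(0,1))$: $\Theta_h(q_h)=\big(\partial_t(\partial_h^-y_h[q_h])_{N+1},\ h\,\partial_x\mathrm e_h(\partial_{tt}y_h[q_h])\big)$ for $q_h\in L^\infty_{h,\le m}(0,1)$, and $\Theta_0(p)=\big(\partial_t\partial_xy[p](\cdot,1),\,0\big)$. *)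

(* Defs.v *)
From HB Require Import structures.
From mathcomp Require Import all_boot all_order all_algebra.
From mathcomp Require Import all_classical all_reals all_analysis.
From mathcomp Require Import ring lra.

Set Implicit Arguments.
Unset Strict Implicit.
Unset Printing Implicit Defensive.

Import Order.TTheory GRing.Theory Num.Theory.
Import numFieldNormedType.Exports.

Local Open Scope classical_set_scope.
Local Open Scope ring_scope.

(* Functions on a domain [D] are total functions; only their values on [D]
   matter, which is why norms and memberships go through the restriction
   [f \_ D] (equal to 0 outside of [D]). *)
Section lebesgue_spaces.
Context {d : measure_display} {X : measurableType d} {R : realType}.
Variable mu : {measure set X -> \bar R}.

Definition in_Lp (D : set X) (p : \bar R) (f : X -> R) : Prop :=
  f \_ D \in Lfun mu p.

Definition Lp_norm (D : set X) (p : \bar R) (f : X -> R) : \bar R :=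
  'N[mu]_p[EFin \o (f \_ D)].

End lebesgue_spaces.

Section spaces.
Context {R : realType}.
Implicit Types (a b T : R) (p : \bar R).

Local Notation leb := (@lebesgue_measure R).
Local Notation leb2 := (leb \x leb)%E.

Definition L2_norm a b (f : R -> R) : \bar R := Lp_norm leb `]a, b[ 2%:E f.

Definition in_Linfty a b (f : R -> R) : Prop := in_Lp leb `]a, b[ +oo%E f.

Definition Linfty_norm a b (f : R -> R) : \bar R :=
  Lp_norm leb `]a, b[ +oo%E f.

Definition L2_norm2 (D : set (R * R)) (f : R * R -> R) : \bar R :=
  Lp_norm leb2 D 2%:E f.

Definition test_fun a b (phi : R -> R) : Prop :=
  (forall n x, derivable (derive1n n phi) x 1) /\
  (exists c e, [/\ a < c, e < b & forall x, phi x != 0 -> c <= x <= e]).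

Definition weak_derivative a b (f df : R -> R) : Prop :=
  forall phi, test_fun a b phi ->
  (\int[leb]_(x in `]a, b[) (f x * derive1 phi x) =
     - \int[leb]_(x in `]a, b[) (df x * phi x))%R.

(* An element of $W^{1,p}(a,b)$, given by its representative continuous on
   [a, b] and by (a representative of) its weak derivative.  Since the value is
   continuous on the compact [a, b], it is automatically in $L^p(a,b)$. *)
Record W1 p a b := MkW1 {
  W1_val :> R -> R;
  wder : R -> R;
  W1_cont : {within `[a, b], continuous W1_val};
  W1_wder : weak_derivative a b W1_val wder;
  W1_der_Lp : in_Lp leb `]a, b[ p wder }.

Definition H1 a b := W1 2%:E a b.
Definition W11 a b := W1 1%E a b.

(* An element of $H^2(a,b)$: its weak derivative is in $H^1(a,b)$, and [dH2]
   is the representative of that derivative which is continuous on [a, b]. *)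
Record H2 a b := MkH2 {
  H2_val :> R -> R;
  dH2 : H1 a b;
  H2_cont : {within `[a, b], continuous H2_val};
  H2_wder : weak_derivative a b H2_val dH2 }.

Definition ddH2 a b (u : H2 a b) : R -> R := wder (dH2 u).

(* These norms take the function together with its successive weak derivatives,
   so that they can be applied to differences. *)
Definition H1_norm a b (f df : R -> R) : \bar R :=
  (L2_norm a b f + L2_norm a b df)%E.

Definition H2_norm a b (f df ddf : R -> R) : \bar R :=
  (L2_norm a b f + L2_norm a b df + L2_norm a b ddf)%E.

Definition H1_dist a b (u v : H1 a b) : \bar R :=
  H1_norm a b (u \- v) (wder u \- wder v).

Definition H2_dist a b (u v : H2 a b) : \bar R :=
  H2_norm a b (u \- v) (dH2 u \- dH2 v) (ddH2 u \- ddH2 v).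

(* Distributions on (a, b) are represented by their action on test functions;
   [Hm1_norm] is the norm of $H^{-1}(a,b)$, the dual of $H^1_0(a,b)$, which is
   the closure of the test functions in $H^1(a,b)$. *)
Definition distribution_of a b (f : R -> R) (phi : R -> R) : R :=
  (\int[leb]_(x in `]a, b[) (f x * phi x))%R.

Definition distr_deriv (L : (R -> R) -> R) (phi : R -> R) : R := - L (derive1 phi).

Definition Hm1_norm a b (L : (R -> R) -> R) : \bar R :=
  ereal_sup [set `|L phi|%:E | phi in
    [set phi | test_fun a b phi /\ (H1_norm a b phi (derive1 phi) <= 1)%E]].

(* $L^1(0,T;L^2(0,1))$.  As $L^2(0,1)$ is separable, strongly measurable maps
   (0,T) -> $L^2(0,1)$ are those which have a jointly measurable
   representative. *)
Definition L1L2_norm T (f : R -> R -> R) : \bar R :=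
  (\int[leb]_(t in `]0%R, T[) L2_norm 0 1 (f t))%E.

Definition in_L1L2 T (f : R -> R -> R) : Prop :=
  measurable_fun (`]0, T[ `*` `]0, 1[ : set (R * R)) (fun z => f z.1 z.2) /\
  (L1L2_norm T f < +oo)%E.

(* $W^{1,1}(0,T;L^2(0,1))$.  The Bochner integrals of the definition of the
   weak time derivative are written pointwise in x. *)
Record W11L2 T := MkW11L2 {
  W11L2_val :> R -> R -> R;
  W11L2_dt : R -> R -> R;
  W11L2_in : in_L1L2 T W11L2_val;
  W11L2_dt_in : in_L1L2 T W11L2_dt;
  W11L2_wder : forall phi, test_fun 0 T phi ->
    {ae leb, forall x, x \in `]0, 1[ ->
      \int[leb]_(t in `]0, T[) (W11L2_val t x * derive1 phi t) =
        - \int[leb]_(t in `]0, T[) (W11L2_dt t x * phi t)} }.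

Definition W11L2_norm T (f df : R -> R -> R) : \bar R :=
  (L1L2_norm T f + L1L2_norm T df)%E.

(* The solution of
     y_tt - y_xx + p y = g,  y(., 0) = g0,  y(., 1) = g1,
     y(0, .) = y0,  y_t(0, .) = y1
   in $C^2([0,T];L^2) \cap C^1([0,T];H^1) \cap C^0([0,T];H^2)$ such that the
   normal derivative $y_x(\cdot,1)$, here [sol_flux], has a time derivative in
   $L^2(0,T)$.  Time derivatives at [s] are limits along [0, T] minus [s]. *)
Record wave_solution T (p : R -> R) (g : R -> R -> R) (g0 g1 y0 y1 : R -> R) :=
  MkWaveSolution {
  sol :> R -> H2 0 1;
  sol_t : R -> H1 0 1;
  sol_tt : R -> R -> R;
  sol_flux : H1 0 T;
  sol_tt_L2 : forall s, s \in `[0, T] ->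
    in_Lp leb `]0, 1[ 2%:E (sol_tt s);
  sol_cont : forall s, s \in `[0, T] ->
    H2_dist (sol t) (sol s) @[t --> within `[0, T] (nbhs s)] --> 0%E;
  sol_t_cont : forall s, s \in `[0, T] ->
    H1_dist (sol_t t) (sol_t s) @[t --> within `[0, T] (nbhs s)] --> 0%E;
  sol_tt_cont : forall s, s \in `[0, T] ->
    L2_norm 0 1 (sol_tt t \- sol_tt s) @[t --> within `[0, T] (nbhs s)]
      --> 0%E;
  sol_deriv : forall s, s \in `[0, T] ->
    H1_norm 0 1
      (fun x => (sol t x - sol s x) / (t - s) - sol_t s x)
      (fun x => (dH2 (sol t) x - dH2 (sol s) x) / (t - s) - wder (sol_t s) x)
      @[t --> within (`[0, T] `\ s) (nbhs s)] --> 0%E;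
  sol_t_deriv : forall s, s \in `[0, T] ->
    L2_norm 0 1
      (fun x => (sol_t t x - sol_t s x) / (t - s) - sol_tt s x)
      @[t --> within (`[0, T] `\ s) (nbhs s)] --> 0%E;
  sol_eq : {ae leb, forall t, t \in `]0, T[ ->
    {ae leb, forall x, x \in `]0, 1[ ->
      sol_tt t x - ddH2 (sol t) x + p x * sol t x = g t x}};
  sol_left : forall t, t \in `[0, T] -> sol t 0 = g0 t;
  sol_right : forall t, t \in `[0, T] -> sol t 1 = g1 t;
  sol_init : forall x, x \in `[0, 1] -> sol 0 x = y0 x;
  sol_t_init : forall x, x \in `[0, 1] -> sol_t 0 x = y1 x;
  sol_fluxE : forall t, t \in `[0, T] -> sol_flux t = dH2 (sol t) 1 }.

End spaces.

(* Grid functions are functions of the node index; for the grid with N interior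
   nodes only the values at 0, ..., N+1 (at 1, ..., N when no boundary values
   are prescribed) are relevant. *)
Section grid.
Context {R : realType}.
Implicit Types (N j : nat) (v f : nat -> R) (T : R).

Definition mesh N : R := N.+1%:R^-1.

Definition with_boundary N (l r : R) v j : R :=
  if j == 0%N then l else if j == N.+1 then r else v j.

Definition laplacian_h N v j : R :=
  (v j.+1 - 2 * v j + v j.-1) / mesh N ^+ 2.

Definition backward_h N v j : R := (v j - v j.-1) / mesh N.

(* Piecewise affine extension, written in the basis of hat functions; see
   [affine_extE]. *)
Definition affine_ext N f (x : R) : R :=
  \sum_(0 <= j < N.+2) f j * Num.max 0 (1 - `|x / mesh N - j%:R|).

Definition const_ext N f (x : R) : R :=
  \sum_(1 <= j < N.+1)
    f j * \1_(`[(j%:R - 1/2) * mesh N, (j%:R + 1/2) * mesh N[%classic) x.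

(* The solution of the semi-discrete equation.  All the components are in
   $H^2(0,T)$: the interior ones are of class $C^2$, but the boundary ones are
   only as regular as the boundary data. *)
Record semidiscrete_solution N T (q : nat -> R) (g : nat -> R -> R)
    (g0 g1 : R -> R) (y0 y1 : nat -> R) := MkSemidiscreteSolution {
  solh :> nat -> H2 0 T;
  solh_eq : forall j, (1 <= j <= N)%N -> forall t, t \in `]0, T[ ->
    ddH2 (solh j) t - laplacian_h N (fun k => solh k t) j + q j * solh j t
      = g j t;
  solh_left : forall t, t \in `[0, T] -> solh 0 t = g0 t;
  solh_right : forall t, t \in `[0, T] -> solh N.+1 t = g1 t;
  solh_init : forall j, (1 <= j <= N)%N -> solh j 0 = y0 j;
  solh_t_init : forall j, (1 <= j <= N)%N -> dH2 (solh j) 0 = y1 j }.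

(* The operator $\partial_x$ in the second component is the classical
   derivative, which exists except at the nodes. *)
Definition Theta_h N T q g g0 g1 y0 y1
    (y : @semidiscrete_solution N T q g g0 g1 y0 y1) :
    (R -> R) * (R * R -> R) :=
  (fun t => backward_h N (fun j => dH2 (y j) t) N.+1,
   fun z => mesh N * derive1 (affine_ext N (fun j => ddH2 (y j) z.1)) z.2).

Definition Theta_0 T p g g0 g1 y0 y1
    (y : @wave_solution R T p g g0 g1 y0 y1) : (R -> R) * (R * R -> R) :=
  (wder (sol_flux y), fun=> 0).

Definition observation_dist T (th th' : (R -> R) * (R * R -> R)) : \bar R :=
  (L2_norm 0%R T (th.1 \- th'.1)%R
   + L2_norm2 (`]0%R, T[ `*` `]0%R, 1%R[) (th.2 \- th'.2)%R)%E.

Lemma affine_extE N f k (s : R) : (k <= N)%N -> 0 <= s <= 1 ->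
  affine_ext N f ((k%:R + s) * mesh N) = (1 - s) * f k + s * f k.+1.
Proof.
move=> kN /andP[s0 s1]; rewrite /affine_ext mulfK; last first.
  by rewrite invr_eq0 pnatr_eq0.
rewrite big_mkord (bigD1 (inord k)) //= (bigD1 (inord k.+1)) /=; last first.
  by rewrite -val_eqE /= !inordK ?ltnS ?(leqW kN)// gtn_eqF.
rewrite !inordK ?ltnS ?(leqW kN)// big1 ?addr0 => [|i /andP[]].
  rewrite (_ : k%:R + s - k%:R = s); last by ring.
  rewrite (_ : k%:R + s - k.+1%:R = - (1 - s)); last by rewrite -natr1; ring.
  rewrite normrN !ger0_norm ?subr_ge0// subKr !max_r ?subr_ge0//.
  by rewrite !(mulrC (f _)).
rewrite -!val_eqE /= !inordK ?ltnS ?(leqW kN)// => ik ik1.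
rewrite max_l ?mulr0// subr_le0.
have [ki|] := ltnP k i; last rewrite leq_eqVlt (negbTE ik) /= => ik'.
  have ki2 : (k.+2 <= i)%N by rewrite ltn_neqAle eq_sym ik1.
  have : (k.+2%:R : R) <= i%:R by rewrite ler_nat.
  rewrite -!natr1 => h; rewrite ler0_norm; lra.
have : (i.+1%:R : R) <= k%:R by rewrite ler_nat.
rewrite -!natr1 => h; rewrite ger0_norm; lra.
Qed.

End grid.

(* Main.v *)
(* With f_j = p(jh) - q_j, the difference u = y_h - Y, where Y is a grid
   function obtained from y by integrating y_x over the grid and averaging three
   times over a short time e, solves u'' - lap u + q u = f Y - rho with rho
   small.  The energy of u' is driven by f Y', while at t = 0 the equation reads
   u'' = f Y up to small terms, and Y is bounded away from 0 there; so f is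
   estimated by u''(0).  A discrete Carleman estimate with the weight pospow,
   applied to the time difference quotients of u over a step kappa h, controls
   u''(0) by the flux at x = 1, the jumps h d_x e_h(u''), and f itself with a
   small factor, uniformly in h; this is where T > 1 is used.
   As e is fixed before h -> 0, the consistency errors are O(sqrt h / e^3).
   Convergence in H^-1 is needed for u'(0) only: it is tested against step
   functions smoothed near the middle of each edge. *)

Require Import Defs.
From HB Require Import structures.
From mathcomp Require Import all_boot all_order all_algebra.
From mathcomp Require Import all_classical all_reals all_analysis.
From mathcomp Require Import measurable_realfun ess_sup_inf.
From mathcomp Require Import ring lra.

Set Implicit Arguments.
Unset Strict Implicit.
Unset Printing Implicit Defensive.

Import Order.TTheory GRing.Theory Num.Theory.
Import numFieldNormedType.Exports.

Local Open Scope classical_set_scope.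
Local Open Scope ring_scope.

(** The weight is [(1 - beta (1 - x) - t)_+ ^ n] with [beta > 1]. It vanishes at [t = 1] and at
    [x = 0], so boundary terms remain at [x = 1] and [t = 0] only, and the margin [beta - 1] makes
    the multiplier identity coercive. A large [n] makes the weight small against its time
    derivative, which absorbs the sources [f Y'] and [q u]. Near [x = 0], where the weight
    degenerates, only [|f| <= 2 m] is available, on a region whose length tends to 0 with
    [beta - 1]. The step [kappa h] answers two obstacles. The quotient of [u'] at time 0 is a mean
    of [u''] over [[0, kappa h]], where the Laplacian of [u] must still be under control: on such a
    short time, two space differences of a Taylor remainder cost only [kappa ^ 2], which is
    absorbed. And the jump of this quotient along the last edge is an increment of the flux divided
    by [kappa], without any power of [h]. Hence the tolerance [d = kappa ^ 2]. As [p] has no point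
    values, its samples are those of a continuous function close to [p] in L2. *)

Lemma sqr_normr (R : realDomainType) (x : R) : `|x| ^+ 2 = x ^+ 2.
Proof. exact: real_normK (num_real x). Qed.

Ltac split_lra := apply/andP; split; lra.
Ltac norm_lra := rewrite !ler_norml; do ?case/andP=> ? ?; split_lra.

(** * Continuity of functions of a real variable *)

Section continuity.
Context {R : realType}.
Implicit Types f g : R -> R.

Lemma contD f g : continuous f -> continuous g -> continuous (fun x => f x + g x).
Proof. by move=> cf cg x; apply: continuousD; [exact: cf|exact: cg]. Qed.

Lemma contN f : continuous f -> continuous (fun x => - f x).
Proof. by move=> cf x; apply: (@continuousN _ _ _ f); exact: cf. Qed.

Lemma contB f g : continuous f -> continuous g -> continuous (fun x => f x - g x).
Proof. by move=> cf cg; apply: contD => //; exact: contN. Qed.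

Lemma contM f g : continuous f -> continuous g -> continuous (fun x => f x * g x).
Proof. by move=> cf cg x; apply: continuousM; [exact: cf|exact: cg]. Qed.

Lemma contC (c : R) : continuous (fun _ : R => c).
Proof. exact: cst_continuous. Qed.

Lemma contX f n : continuous f -> continuous (fun x => f x ^+ n).
Proof.
move=> cf; elim: n => [|n IH]; first exact: contC.
rewrite (_ : (fun x => _) = fun x => f x * f x ^+ n); first exact: contM.
by apply/funext => x; rewrite exprS.
Qed.

Lemma cont_norm f : continuous f -> continuous (fun x => `|f x|).
Proof. by move=> cf x; apply: cvg_norm; exact: cf. Qed.

Lemma cont_sum (I : Type) (r : seq I) (P : pred I) (f : I -> R -> R) :
  (forall i, P i -> continuous (f i)) ->
  continuous (fun x => \sum_(i <- r | P i) f i x).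
Proof.
move=> cf; elim: r => [|i r IH].
  rewrite (_ : (fun x => _) = fun=> 0); first exact: contC.
  by apply/funext => x; rewrite big_nil.
rewrite (_ : (fun x => _) = fun x => (if P i then f i x else 0) +
   \sum_(i <- r | P i) f i x); last first.
  by apply/funext => x; rewrite big_cons; case: ifP; rewrite ?add0r.
apply: contD; last exact: IH.
by have [Pi|_] := boolP (P i); [exact: cf|exact: contC].
Qed.

Lemma cont_shift f s : continuous f -> continuous (fun x => f (x + s)).
Proof.
move=> cf x; apply: (@continuous_comp _ _ _ (fun x => x + s) f); last exact: cf.
by apply: continuousD; [exact: id|exact: cst_continuous].
Qed.

End continuity.

Ltac cont := lazymatch goal with
  | |- continuous ?F => lazymatch F with
   | (fun x => @GRing.add _ (@?f x) (@GRing.opp _ (@?g x))) =>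
   apply: (@contB _ f g); cont
   | (fun x => @GRing.add _ (@?f x) (@?g x)) => apply: (@contD _ f g); cont
   | (fun x => @GRing.mul _ (@?f x) (@?g x)) => apply: (@contM _ f g); cont
   | (fun x => @GRing.opp _ (@?f x)) => apply: (@contN _ f); cont
   | (fun x => @GRing.exp _ (@?f x) ?n) => apply: (@contX _ f n); cont
   | (fun x => @Num.norm _ _ (@?f x)) => apply: (@cont_norm _ f); cont
   | (fun _ => ?c) => exact: contC
   | (fun x => bigop _ _ _) => first [assumption | apply: cont_sum => ? ?; cont]
   | (fun x => ?f (@GRing.add _ x ?s)) => apply: (@cont_shift _ f s); cont
   | _ => try assumption
   end
  end.

(** * Oriented integrals of continuous functions *)

Section primitive.
Context {R : realType}.
Implicit Types (f g F G : R -> R) (a b c t x : R).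
Local Notation leb := (@lebesgue_measure R).

(** Oriented from 0, so that [prim f] is a primitive on the whole line and [intg] satisfies Chasles'
    relation for endpoints in any order. *)
Definition prim f t : R :=
  if 0 <= t then \int[leb]_(x in `[0, t]) f x
  else - \int[leb]_(x in `[t, 0]) f x.

Definition intg f a b : R := prim f b - prim f a.

Lemma continuous_integrable f a b : continuous f ->
  leb.-integrable `[a, b] (EFin \o f).
Proof.
move=> cf; apply: continuous_compact_integrable; first exact: segment_compact.
exact: continuous_subspaceT.
Qed.

Lemma Rintegral_cc_split f a b c : continuous f -> a <= b -> b <= c ->
  \int[leb]_(x in `[a, c]) f x =
  \int[leb]_(x in `[a, b]) f x + \int[leb]_(x in `[b, c]) f x.
Proof.
move=> cf ab bc; apply/eqP; rewrite addrC -subr_eq Rintegral_itvB ?bnd_simp//.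
  rewrite Rintegral_itv_obnd_cbnd//.
  by apply: integrableS (continuous_integrable b c cf) => //; exact: subset_itv_oc_cc.
exact: continuous_integrable.
Qed.

(** Moving the base point from 0 to some [a] on its left removes the case distinction of [prim]: an
    integral from [a] minus a constant is left, to which the fundamental theorem applies. *)
Lemma primE f a t : continuous f -> a <= 0 -> a <= t ->
  prim f t = \int[leb]_(x in `[a, t]) f x - \int[leb]_(x in `[a, 0]) f x.
Proof.
move=> cf a0 at_; rewrite /prim; case: ifPn => [t0|].
  by rewrite (@Rintegral_cc_split _ a 0 t)// addrC addKr.
rewrite -ltNge => /ltW t0; rewrite (@Rintegral_cc_split _ a t 0)//.
by rewrite opprD addrA subrr add0r.
Qed.

Lemma intgE f a b : continuous f -> a <= b ->
  intg f a b = \int[leb]_(x in `[a, b]) f x.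
Proof.
move=> cf ab; pose m := Num.min a 0.
have [ma m0] : m <= a /\ m <= 0 by rewrite !ge_min !lexx orbT.
rewrite /intg (@primE _ m b)// ?(le_trans ma)// (@primE _ m a)//.
by rewrite (@Rintegral_cc_split _ m a b)//; ring.
Qed.

Lemma is_derive_prim f t : continuous f -> is_derive t 1 (prim f) (f t).
Proof.
(* A base point strictly to the left of both 0 and [t], so that [primE] is valid on a whole
   neighbourhood of [t]. *)
move=> cf; pose m := Num.min t 0 - 1.
have [m0 mt] : m < 0 /\ m < t.
  split; rewrite ltrBlDr.
   by rewrite gt_min; apply/orP; right; rewrite ltrDl.
  by rewrite gt_min; apply/orP; left; rewrite ltrDl.
have [d e] : derivable (fun x => \int[leb]_(y in `[m, x]) f y) t 1 /\
   derive1 (fun x => \int[leb]_(y in `[m, x]) f y) t = f t.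
  apply: (@continuous_FTC1_closed _ f m t (t + 1)) => //.
  - by rewrite ltrDl.
  - exact: continuous_integrable.
  - exact: cf.
pose g x := \int[leb]_(y in `[m, x]) f y - \int[leb]_(x in `[m, 0]) f x.
have H : is_derive t 1 g (f t).
  rewrite -[f t]subr0; apply: is_deriveB; apply: DeriveDef; first exact: d.
  by rewrite -derive1E e.
apply: near_eq_is_derive H.
near=> x; apply/esym/primE => //; first exact: ltW.
by apply/ltW; near: x; exact: lt_nbhsr.
Unshelve. all: by end_near. Qed.

Lemma derive_cont F f : (forall t, is_derive t 1 F (f t)) -> continuous F.
Proof.
move=> H x; apply/differentiable_continuous/derivable1_diffP.
by have [] := H x.
Qed.

Lemma continuous_prim f : continuous f -> continuous (prim f).
Proof. by move=> cf; apply: derive_cont => t; exact: is_derive_prim. Qed.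

Lemma is_derive_eq_fun F G f : (forall t, is_derive t 1 F (f t)) ->
  (forall t, is_derive t 1 G (f t)) -> forall a b, F b - F a = G b - G a.
Proof.
move=> dF dG a b; have H t : is_derive t (1 : R) (fun x => F x - G x) 0.
  by rewrite -(subrr (f t)); apply: is_deriveB.
by have := @is_derive_0_is_cst _ (fun x => F x - G x) a b H; lra.
Qed.

Lemma intg_FTC F f a b : continuous f -> (forall t, is_derive t 1 F (f t)) ->
  intg f a b = F b - F a.
Proof.
by move=> cf dF; apply: (@is_derive_eq_fun _ _ f) => // t; exact: is_derive_prim.
Qed.

Lemma is_derive_le F f a b : (forall t, is_derive t 1 F (f t)) -> a <= b ->
  (forall t, a <= t <= b -> 0 <= f t) -> F a <= F b.
Proof.
move=> dF ab f0; rewrite -subr_ge0.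
have [|c] := @MVT_segment _ F f a b ab (fun x _ => dF x).
  by apply: continuous_subspaceT; exact: derive_cont dF.
by rewrite in_itv/= => cab ->; rewrite mulr_ge0 ?subr_ge0// f0.
Qed.

Lemma intg_ge0 f a b : continuous f -> a <= b ->
  (forall t, a <= t <= b -> 0 <= f t) -> 0 <= intg f a b.
Proof.
by move=> cf ab f0; rewrite subr_ge0; apply: is_derive_le f0 => // t; exact: is_derive_prim.
Qed.

Lemma intgD f g a b : continuous f -> continuous g ->
  intg (fun x => f x + g x) a b = intg f a b + intg g a b.
Proof.
move=> cf cg.
have dH t : is_derive t 1 (fun x => prim f x + prim g x) (f t + g t).
  by apply: is_deriveD; exact: is_derive_prim.
rewrite (intg_FTC _ _ _ dH); first by rewrite /intg; ring.
by cont.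
Qed.

Lemma intgN f a b : continuous f -> intg (fun x => - f x) a b = - intg f a b.
Proof.
move=> cf; have dH t : is_derive t 1 (fun x => - prim f x) (- f t).
  by apply: is_deriveN; exact: is_derive_prim.
rewrite (intg_FTC _ _ _ dH); first by rewrite /intg; ring.
by cont.
Qed.

Lemma intgB f g a b : continuous f -> continuous g ->
  intg (fun x => f x - g x) a b = intg f a b - intg g a b.
Proof.
move=> cf cg; rewrite intgD ?intgN//; cont.
Qed.

Lemma is_deriveMl (c : R) F (f' t : R) : is_derive t 1 F f' ->
  is_derive t 1 (fun x => c * F x) (c * f').
Proof. by move=> dF; exact: is_deriveZ. Qed.

Lemma is_derive_mul F G (f' g' t : R) : is_derive t 1 F f' -> is_derive t 1 G g' ->
  is_derive t 1 (fun x => F x * G x) (f' * G t + F t * g').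
Proof.
move=> dF dG; have := is_deriveM dF dG; rewrite /GRing.scale/= => h.
by apply: is_derive_eq; rewrite addrC mulrC.
Qed.

Lemma is_derive_exp F (f' t : R) n : is_derive t 1 F f' ->
  is_derive t 1 (fun x => F x ^+ n.+1) (n.+1%:R * F t ^+ n * f').
Proof.
move=> dF; elim: n => [|n IH].
  by rewrite (_ : (fun x => _) = F) ?expr0 ?mulr1 ?mul1r//; apply/funext => x.
rewrite (_ : (fun x => _) = fun x => F x * F x ^+ n.+1); last first.
  by apply/funext => x; rewrite exprS.
have h := is_derive_mul dF IH; apply: is_derive_eq.
by rewrite exprS -(natr1 n.+1); ring.
Qed.

Lemma intgZ c f a b : continuous f -> intg (fun x => c * f x) a b = c * intg f a b.
Proof.
move=> cf; have dH t : is_derive t 1 (fun x => c * prim f x) (c * f t).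
  by apply: is_deriveMl; exact: is_derive_prim.
rewrite (intg_FTC _ _ _ dH); first by rewrite /intg; ring.
by cont.
Qed.

Lemma intg_cst c a b : intg (fun=> c) a b = c * (b - a).
Proof.
have dH t : is_derive t 1 (fun x => c * x) (cst c t).
  by rewrite -[cst c t]mulr1; apply: is_deriveMl; exact: is_derive_id.
rewrite (intg_FTC _ _ _ dH) ?mulrBr//; exact: contC.
Qed.

Lemma intg_le f g a b : continuous f -> continuous g -> a <= b ->
  (forall t, a <= t <= b -> f t <= g t) -> intg f a b <= intg g a b.
Proof.
move=> cf cg ab fg; rewrite -subr_ge0 -intgB//; apply: intg_ge0 => //.
  by cont.
by move=> t tab; rewrite subr_ge0 fg.
Qed.

Lemma eq_intg f g a b : continuous f -> continuous g -> a <= b ->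
  (forall t, a <= t <= b -> f t = g t) -> intg f a b = intg g a b.
Proof.
by move=> cf cg ab fg; apply/eqP; rewrite eq_le !intg_le// => t /fg ->.
Qed.

Lemma intg_cat f a b c : intg f a b + intg f b c = intg f a c.
Proof. by rewrite /intg; ring. Qed.

Lemma intg_chasles f c a b : intg f a b = intg f a c + intg f c b.
Proof. by rewrite intg_cat. Qed.

Lemma intg_norm f a b : continuous f -> a <= b ->
  `|intg f a b| <= intg (fun x => `|f x|) a b.
Proof.
move=> cf ab; have cn := cont_norm cf.
rewrite ler_norml -intgN//; apply/andP; split; apply: intg_le => //.
- by cont.
- by move=> t _; rewrite lerNl ler_normr lexx orbT.
- by move=> t _; exact: ler_norm.
Qed.

Lemma is_derive_sumf (I : Type) (r : seq I) (P : pred I) (F : I -> R -> R) (f : I -> R) t :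
  (forall i, P i -> is_derive t 1 (F i) (f i)) ->
  is_derive t 1 (fun x => \sum_(i <- r | P i) F i x) (\sum_(i <- r | P i) f i).
Proof.
move=> dF; elim: r => [|i r IH].
  rewrite big_nil (_ : (fun x => _) = fun=> 0); first exact: is_derive_cst.
  by apply/funext => x; rewrite big_nil.
rewrite (_ : (fun x => _) = fun x => (if P i then F i x else 0) +
   \sum_(i <- r | P i) F i x); last first.
  by apply/funext => x; rewrite big_cons; case: ifP; rewrite ?add0r.
rewrite big_cons; case: ifPn => [Pi|_].
  by apply: is_deriveD => //; exact: dF.
rewrite -[X in is_derive _ _ _ X]add0r; apply: is_deriveD => //.
Qed.

Lemma intg_sum (I : Type) (r : seq I) (P : pred I) (f : I -> R -> R) a b :
  (forall i, P i -> continuous (f i)) ->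
  intg (fun x => \sum_(i <- r | P i) f i x) a b = \sum_(i <- r | P i) intg (f i) a b.
Proof.
move=> cf; have dH t : is_derive t 1 (fun x => \sum_(i <- r | P i) prim (f i) x)
   (\sum_(i <- r | P i) f i t).
  by apply: is_derive_sumf => i Pi; apply: is_derive_prim; exact: cf.
by rewrite (intg_FTC _ _ _ dH) -?sumrB//; exact: cont_sum.
Qed.

Lemma is_derive_comp_addl F (f' s t : R) : is_derive (t + s) 1 F f' ->
  is_derive t 1 (fun x => F (x + s)) f'.
Proof.
move=> dF; rewrite -[f']mulr1.
apply: (@is_derive1_comp _ F (fun x => x + s)) => //.
by rewrite -[X in is_derive _ _ _ X]addr0; apply: is_deriveD.
Qed.

Lemma intg_shift f s a b : continuous f ->
  intg (fun x => f (x + s)) a b = intg f (a + s) (b + s).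
Proof.
move=> cf; have dH t : is_derive t 1 (fun x => prim f (x + s)) (f (t + s)).
  by apply: is_derive_comp_addl; exact: is_derive_prim.
by rewrite (intg_FTC _ _ _ dH)//; cont.
Qed.

(* The discriminant of the nonnegative quadratic form [intg (c + f)^2]. *)
Lemma intg_sqr_le f a b : continuous f -> a <= b ->
  (intg f a b) ^+ 2 <= (b - a) * intg (fun x => f x ^+ 2) a b.
Proof.
move=> cf; rewrite le_eqVlt => /predU1P[->|ab].
  by rewrite /intg !subrr expr0n mul0r.
have cf2 : continuous (fun x => f x ^+ 2).
  by cont.
have d0 : 0 < b - a by rewrite subr_gt0.
pose c := intg f a b / (b - a).
have : 0 <= intg (fun x => (f x ^+ 2 + c ^+ 2) - (2 * c) * f x) a b.
  apply: intg_ge0 => //; last first.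
  - move=> t _; rewrite (_ : _ - _ = (f t - c) ^+ 2); first exact: sqr_ge0.
   by ring.
  - exact: ltW.
  - by cont.
rewrite intgB ?intgD ?intg_cst ?intgZ//; try by cont.
have -> : intg f a b = c * (b - a) by rewrite /c mulfVK// gt_eqF.
clearbody c; set I2 := intg _ a b; set d := b - a in d0 *.
have -> : I2 + c ^+ 2 * d - 2 * c * (c * d) = I2 - c ^+ 2 * d by ring.
rewrite subr_ge0 => h; rewrite (_ : (c * d) ^+ 2 = d * (c ^+ 2 * d)); last by ring.
by rewrite ler_pM2l.
Qed.

End primitive.

(** * Finite sums: Cauchy-Schwarz and summation by parts *)

Section sums.
Context {R : realType}.
Implicit Types (x y : nat -> R).

(** The form [sum (c x - y)^2] is nonnegative for every [c], in particular at its minimiser [S / A];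
    the degenerate case [A = 0], where all the [x i] vanish, is treated apart. *)
Lemma sum_cauchy_schwarz n x y :
  (\sum_(i < n) x i * y i) ^+ 2 <= (\sum_(i < n) x i ^+ 2) * (\sum_(i < n) y i ^+ 2).
Proof.
set A := \sum_(i < n) x i ^+ 2; set B := \sum_(i < n) y i ^+ 2.
set S := \sum_(i < n) x i * y i.
have A0 : 0 <= A by apply: sumr_ge0 => i _; exact: sqr_ge0.
have key c : 0 <= A * c ^+ 2 - 2 * c * S + B.
  rewrite (_ : _ + B = \sum_(i < n) (c * x i - y i) ^+ 2).
   by apply: sumr_ge0 => i _; exact: sqr_ge0.
  rewrite /A /S /B mulr_suml mulr_sumr -sumrB -big_split/=.
  by apply: eq_bigr => i _; ring.
have [A00|An0] := eqVneq A 0.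
  have S0 : S = 0.
   rewrite /S big1// => i _; suff -> : x i = 0 by rewrite mul0r.
   apply/eqP; rewrite -sqrf_eq0; move/eqP: A00.
   by rewrite psumr_eq0 => [/allP/(_ i (mem_index_enum _))//|j _]; exact: sqr_ge0.
  by rewrite S0 A00 expr0n/= mul0r.
have A1 : 0 < A by rewrite lt_neqAle eq_sym An0.
have := key (S / A); rewrite (_ : _ + B = (A * B - S ^+ 2) / A); last by field.
by rewrite pmulr_lge0 ?invr_gt0// subr_ge0.
Qed.

Lemma sum_sqr_le n x : (\sum_(i < n) x i) ^+ 2 <= n%:R * \sum_(i < n) x i ^+ 2.
Proof.
have := sum_cauchy_schwarz n (fun=> 1) x.
under eq_bigr do rewrite mul1r.
rewrite (_ : \sum_(i < n) 1 ^+ 2 = n%:R)//.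
by under eq_bigr do rewrite expr1n; rewrite sumr_const card_ord.
Qed.

Lemma sum_abel n (th X : nat -> R) :
  \sum_(i < n) th i.+1 * (X i.+1 - X i) =
  th n * X n - th 0%N * X 0%N - \sum_(i < n) (th i.+1 - th i) * X i.
Proof.
elim: n => [|n IH]; first by rewrite !big_ord0; ring.
by rewrite !big_ord_recr/= IH; ring.
Qed.

Lemma sum_shift n x : \sum_(i < n) x i.+1 = \sum_(i < n) x i + x n - x 0%N.
Proof.
elim: n => [|n IH]; first by rewrite !big_ord0; ring.
by rewrite !big_ord_recr/= IH; ring.
Qed.

End sums.

(** * Powers of the positive part *)

Section positive_part_power.
Context {R : realType}.
Implicit Types (a b c x t mu : R) (n : nat).

(** The Carleman weight and its derivatives are such powers. The positive part confines the weight
    to the region [t < 1 - beta (1 - x)], and exponents above 1 keep it differentiable at the edge.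
    On [[0, 1]] a power of exponent [n] is at most [1 / n] times its derivative, the source of all
    smallness for large exponents. *)
Definition pospow n x : R := Num.max 0 x ^+ n.

Lemma pospow_ge0 n x : 0 <= pospow n x.
Proof. by rewrite exprn_ge0// le_max lexx. Qed.

Lemma pospow_le0 n x : x <= 0 -> pospow n.+1 x = 0.
Proof. by move=> x0; rewrite /pospow max_l// exprS mul0r. Qed.

Lemma pospow_le n x y : x <= y -> pospow n x <= pospow n y.
Proof.
move=> xy; apply: lerXn2r; rewrite ?nnegrE ?le_max ?lexx//.
by have [|] := leP 0 x; have [|] := leP 0 y; lra.
Qed.

Lemma pospow_le1 n x : x <= 1 -> pospow n x <= 1.
Proof.
by move=> x1; apply: exprn_ile1; [rewrite le_max lexx|rewrite ge_max ler01 x1].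
Qed.

Lemma pospow_decr n m x : x <= 1 -> (n <= m)%N -> pospow m x <= pospow n x.
Proof.
move=> x1 nm; apply: ler_wiXn2l => //; first by rewrite le_max lexx.
by rewrite ge_max ler01.
Qed.

Lemma pospowS n x : pospow n.+2 x = pospow n.+1 x * x.
Proof.
rewrite /pospow exprSr; have [x0|x0] := leP 0 x; first by [].
by rewrite exprS !mul0r.
Qed.

Lemma cont_pospow n : continuous (pospow n : R -> R).
Proof.
have -> : pospow n = fun x : R => ((x + `|x|) / 2) ^+ n.
  apply/funext => x; rewrite /pospow; congr (_ ^+ _).
  by have [x0|x0] := leP 0 x; [rewrite ger0_norm//|rewrite ltr0_norm//]; lra.
have cid : continuous (fun x : R => x) by move=> x; exact: cvg_id.
by cont.
Qed.

Lemma is_derive_pospow n x : is_derive x (1 : R) (pospow n.+2) (n.+2%:R * pospow n.+1 x).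
Proof.
have [x0|x0|->] := ltgtP x 0; last first.
(* At the edge, [pospowS] shows that the difference quotient is [pospow n.+1] itself, continuous and
   equal to 0 there. *)
- rewrite pospow_le0// mulr0; apply/is_derive1_caratheodory.
  exists (pospow n.+1); split; last by rewrite pospow_le0.
   by move=> z; rewrite pospowS (@pospow_le0 _ 0)// !subr0.
  exact: cont_pospow.
- have H : is_derive x (1 : R) (fun y => y ^+ n.+2) (n.+2%:R * pospow n.+1 x).
   rewrite /pospow max_r ?(ltW x0)//.
   have h := is_derive_exp n.+1 (is_derive_id x (1 : R)).
   by apply: is_derive_eq; rewrite mulr1.
  apply: near_eq_is_derive H; near=> y.
  by rewrite /pospow max_r//; apply/ltW; near: y; exact: lt_nbhsr.
- rewrite pospow_le0 ?(ltW x0)// mulr0.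
  apply: near_eq_is_derive (is_derive_cst 0 x 1); near=> y.
  by rewrite /= pospow_le0//; apply/ltW; near: y; exact: lt_nbhsl.
Unshelve. all: by end_near. Qed.

Lemma exprB_bounds n a b : 0 <= a <= b ->
  n.+1%:R * a ^+ n * (b - a) <= b ^+ n.+1 - a ^+ n.+1 <= n.+1%:R * b ^+ n * (b - a).
Proof.
move=> /andP[a0 ab]; have b0 := le_trans a0 ab.
elim: n => [|n /andP[l u]]; first by rewrite !expr0 !expr1 !mulr1 !mul1r lexx.
have d0 : 0 <= b - a by rewrite subr_ge0.
have anb : a ^+ n.+1 <= b ^+ n.+1 by apply: lerXn2r; rewrite ?nnegrE.
have an0 : 0 <= a ^+ n.+1 by exact: exprn_ge0.
have -> : b ^+ n.+2 - a ^+ n.+2 = b * (b ^+ n.+1 - a ^+ n.+1) + a ^+ n.+1 * (b - a).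
  by rewrite !(exprS _ n.+1); ring.
have e1 : a * (n.+1%:R * a ^+ n * (b - a)) = n.+1%:R * a ^+ n.+1 * (b - a).
  by rewrite exprS; ring.
have e2 : b * (n.+1%:R * b ^+ n * (b - a)) = n.+1%:R * b ^+ n.+1 * (b - a).
  by rewrite (exprS b n); ring.
have l2 := ler_wpM2l b0 l; have u2 := ler_wpM2l b0 u.
have l3 : a * (n.+1%:R * a ^+ n * (b - a)) <= b * (n.+1%:R * a ^+ n * (b - a)).
  by apply: ler_wpM2r => //; rewrite !mulr_ge0 ?exprn_ge0.
have u3 := ler_wpM2r d0 anb.
have e3 x : n.+2%:R * x ^+ n.+1 * (b - a) =
   n.+1%:R * x ^+ n.+1 * (b - a) + x ^+ n.+1 * (b - a).
  by rewrite -(natr1 n.+1); ring.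
rewrite !e3; move: l2 u2 l3 u3; rewrite e1 e2 => l2 u2 l3 u3.
by apply/andP; split; [apply: lerD (le_trans l3 l2) _|apply: lerD u2 u3].
Qed.

(** Convexity replaces the chain rule in space: the increment of the weight over one mesh is caught
    between multiples of its time derivative at the two neighbouring nodes. The exponents are those
    of [th] and [ka] in the multiplier argument. *)
Lemma pospow_convex n a b : a <= b ->
  n.+2%:R * pospow n.+1 a * (b - a) <= pospow n.+2 b - pospow n.+2 a
   <= n.+2%:R * pospow n.+1 b * (b - a).
Proof.
move=> ab; pose A := Num.max 0 a; pose B := Num.max 0 b.
have A0 : 0 <= A by rewrite le_max lexx.
have AB : A <= B by rewrite /A /B; have [|] := leP 0 a; have [|] := leP 0 b; lra.
have BA : B - A <= b - a.
  rewrite /A /B; have [|] := leP 0 a; have [|] := leP 0 b; lra.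
have /andP[l u] := @exprB_bounds n.+1 A B (introT andP (conj A0 AB)).
apply/andP; split; last first.
  apply: (le_trans u); apply: ler_wpM2l => //.
  by rewrite mulr_ge0// exprn_ge0// (le_trans A0).
have [a0|a0] := leP a 0.
  by rewrite (pospow_le0 _ a0) mulr0 mul0r subr_ge0 pospow_le.
apply: le_trans l; rewrite /pospow -/A.
suff -> : b - a = B - A by [].
by rewrite /A /B !max_r ?(ltW a0) ?(le_trans (ltW a0)).
Qed.

(** If [c <= v a] the sum is at most [(1 + v) a], otherwise it is at most [(1 + 1/v) c]. Near the
    edge of its support a translated weight is not bounded by a multiple of the original; hence the
    additive term, a power of the mesh when the shift is one mesh. *)
Lemma expr_add_le n mu : 0 < mu -> exists2 C : R, 0 <= C &
  forall a c : R, 0 <= a -> 0 <= c -> (a + c) ^+ n <= (1 + mu) * a ^+ n + C * c ^+ n.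
Proof.
move=> mu0; have B (v : R) k : 0 <= v <= 1 -> (1 + v) ^+ k <= 1 + 3 ^+ k * v.
  move=> /andP[v0 v1]; elim: k => [|k IH]; first by rewrite !expr0; lra.
  have e3 : 1 <= 3 ^+ k :> R by apply: exprn_ege1; lra.
  have v10 : 0 <= 1 + v by lra.
  rewrite !exprS (le_trans (ler_wpM2l v10 IH))//; set e := 3 ^+ k in e3 *.
  have h1 : v <= e * v by rewrite ler_peMl.
  have h2 : e * v * v <= e * v by rewrite ler_piMr// mulr_ge0// (le_trans ler01).
  by lra.
(* Chosen so that the crude expansion [(1 + v)^n <= 1 + 3^n v], valid for [v <= 1], stays below
   [1 + mu]. *)
pose v := Num.min 1 (mu / 3 ^+ n).
have v0 : 0 < v by rewrite lt_min ltr01 divr_gt0// exprn_gt0.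
have v1 : v <= 1 by rewrite ge_min lexx.
have vmu : (1 + v) ^+ n <= 1 + mu.
  apply: (le_trans (B _ _ (introT andP (conj (ltW v0) v1)))); rewrite lerD2l mulrC.
  by rewrite -ler_pdivlMr ?exprn_gt0// ge_min lexx orbT.
exists ((1 + v^-1) ^+ n) => [|a c a0 c0].
  by rewrite exprn_ge0// addr_ge0// invr_ge0 ltW.
have [cva|cva] := leP c (v * a).
  have h1 : (a + c) ^+ n <= (1 + v) ^+ n * a ^+ n.
   rewrite -exprMn; apply: lerXn2r; rewrite ?nnegrE; nra.
  apply: (le_trans h1); apply: ler_wpDr.
   by rewrite mulr_ge0 ?exprn_ge0// addr_ge0// invr_ge0 ltW.
  by apply: ler_wpM2r => //; exact: exprn_ge0.
have h1 : (a + c) ^+ n <= (1 + v^-1) ^+ n * c ^+ n.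
  have ac : a <= v^-1 * c by rewrite -ler_pdivrMl ?invr_gt0// invrK ltW.
  rewrite -exprMn; apply: lerXn2r; rewrite ?nnegrE ?addr_ge0//.
   by rewrite mulr_ge0// addr_ge0// invr_ge0 ltW.
  by rewrite mulrDl mul1r addrC lerD2l.
apply: (le_trans h1); apply: ler_wpDl => //.
by rewrite mulr_ge0 ?exprn_ge0//; lra.
Qed.

Lemma pospow_add_le n mu : 0 < mu -> exists2 C : R, 0 <= C &
  forall a c : R, 0 <= c -> pospow n (a + c) <= (1 + mu) * pospow n a + C * c ^+ n.
Proof.
move=> /(expr_add_le n)[C C0 H]; exists C => // a c c0.
apply: le_trans (H (Num.max 0 a) c _ c0); last by rewrite le_max lexx.
apply: lerXn2r; rewrite ?nnegrE ?addr_ge0 ?le_max ?lexx//.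
have [|] := leP 0 a; have [|] := leP 0 (a + c); lra.
Qed.

End positive_part_power.

(** * Weighted multiplier identities for the semi-discrete wave equation *)

Section multipliers.
Context {R : realType}.

(** The derivative [f] will contain [acc], which is known only as a pointwise derivative. It is
    therefore not integrated: the monotonicity of [prim g - F] gives the bound. *)
Lemma intg_ge_of_derive (F f g : R -> R) (a b : R) :
  (forall t, is_derive t (1 : R) F (f t)) -> continuous g -> a <= b ->
  (forall t, a <= t <= b -> f t <= g t) -> F b - F a <= intg g a b.
Proof.
move=> dF cg ab fg.
have H t : is_derive t (1 : R) (fun t => prim g t - F t) (g t - f t).
  by apply: is_deriveB; exact: is_derive_prim.
have := is_derive_le H ab; rewrite /intg => /(_ _); set P := prim g a; set Q := prim g b.
suff E : (forall t, a <= t <= b -> 0 <= g t - f t) by move=> /(_ E); lra.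
by move=> t /fg; rewrite subr_ge0.
Qed.

(** The intended weights, with [c j = 1 - beta (1 - j h)] and [k = n + 2], are
    [th j t = (c j - t)_+^(n+2)], [ka = - th'] and [sg j t = (c j - t)_+^(n+3)]. *)
Context (N : nat) (h beta mu M k omega : R).
Context (th ka sg : nat -> R -> R).
Hypothesis h0 : 0 < h.
Hypothesis hN : h * N.+1%:R = 1.
Hypothesis beta0 : 1 < beta.
Hypothesis mu0 : 0 < mu.
Hypothesis mu1 : mu <= 1.
Hypothesis M0 : 0 <= M.
Hypothesis k1 : 1 <= k.
Hypothesis omega0 : 0 < omega.

Hypothesis cth : forall j, continuous (th j).
Hypothesis cka : forall j, continuous (ka j).
Hypothesis dth : forall j (t : R), is_derive t (1 : R) (th j) (- ka j t).
Hypothesis th_ge0 : forall j (t : R), 0 <= th j t.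
Hypothesis ka_ge0 : forall j (t : R), 0 <= ka j t.
Hypothesis sg_ge0 : forall j (t : R), 0 <= sg j t.
Hypothesis th00 : forall t : R, 0 <= t -> th 0%N t = 0.
Hypothesis ka00 : forall t : R, 0 <= t -> ka 0%N t = 0.
Hypothesis th1 : forall j, (j <= N)%N -> th j 1 = 0.
Hypothesis th_le1 : forall j (t : R), (j <= N)%N -> 0 <= t -> th j t <= 1.
Hypothesis ka_lek : forall j (t : R), (j <= N)%N -> 0 <= t -> ka j t <= k.
Hypothesis th_step : forall j (t : R),
  h * beta * ka j t <= th j.+1 t - th j t <= h * beta * ka j.+1 t.
Hypothesis ka_step : forall j (t : R), ka j.+1 t <= (1 + mu) * ka j t + M * h ^+ 2.
Hypothesis th_step2 : forall j (t : R), th j.+1 t <= 2 * th j t + M * h ^+ 2.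
(** The arithmetic-geometric inequality, since [th^2 = ka sg / k] for the intended weights. The
    factor [1 / k] is the gain that makes the sources absorbable for a large exponent. *)
Hypothesis young : forall j (t x y : R),
  th j t * (x * y) <= omega * ka j t * y ^+ 2 + sg j t / (4 * omega * k) * x ^+ 2.
Hypothesis sg_th : forall j (t : R), (j <= N)%N -> 0 <= t -> sg j t <= th j 0.
Hypothesis sg_ka : forall j (s t : R), (j <= N)%N -> 0 <= s <= t -> sg j t <= ka j s / k.

Context (Z a acc : nat -> R -> R) (f q : nat -> R) (Rr rho : nat -> R -> R).
Context (Rb m K : R) (e : nat -> R).
Hypothesis dZ : forall j (t : R), (j <= N.+1)%N -> is_derive t (1 : R) (Z j) (a j t).
Hypothesis ca : forall j, (j <= N.+1)%N -> continuous (a j).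
Hypothesis da : forall i (t : R), (i < N)%N -> is_derive t (1 : R) (a i.+1) (acc i.+1 t).
Hypothesis crho : forall i, (i < N)%N -> continuous (rho i.+1).
Hypothesis Rb0 : 0 <= Rb.
Hypothesis m0 : 0 <= m.
Hypothesis K0 : 0 <= K.
Hypothesis Rr_le : forall i (t : R), (i < N)%N -> 0 <= t <= 1 -> `|Rr i.+1 t| <= Rb.
Hypothesis q_le : forall i, (i < N)%N -> `|q i.+1| <= m.
Hypothesis f_le : forall i, (i < N)%N ->
  f i.+1 ^+ 2 <= K * (a i.+1 0 ^+ 2 + e i.+1 ^+ 2).

Definition slope j t := (Z j.+1 t - Z j t) / h.
(** Also [h] times the time derivative of [slope]. It is the quantity that the second observation
    bounds once [a] is a time difference quotient. *)
Definition jump j t := a j.+1 t - a j t.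
Definition mean_slope j t := (slope j.+1 t + slope j t) / 2.
Definition source j t := f j * Rr j t - q j * Z j t - rho j t.
(** The kinetic part is split equally between the two ends of the edge, so that
    [W_j^2 + a_j a_(j+1) = 2 U_j - b_j^2 / 2]: the expression that telescopes differs from the
    energy by a jump only. *)
Definition half_energy j t := slope j t ^+ 2 / 2 + a j t ^+ 2 / 4 + a j.+1 t ^+ 2 / 4.

Local Notation W := slope.
Local Notation b := jump.
Local Notation av := mean_slope.
Local Notation S := source.
Local Notation U := half_energy.

Hypothesis wave_eq : forall i (t : R), (i < N)%N -> 0 <= t <= 1 ->
  acc i.+1 t = (W i.+1 t - W i t) / h + S i.+1 t.

Let cZ j : (j <= N.+1)%N -> continuous (Z j).
Proof. by move=> jN; apply: derive_cont => t; exact: dZ. Qed.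

Let cW j : (j <= N)%N -> continuous (W j).
Proof.
move=> jN; have c1 := @cZ j.+1 jN; have c2 := @cZ j (leqW jN).
by rewrite /W; cont.
Qed.

Let cb j : (j <= N)%N -> continuous (b j).
Proof. by move=> jN; have c1 := @ca j.+1 jN; have c2 := @ca j (leqW jN); rewrite /b; cont. Qed.

Let dW j t : (j <= N)%N -> is_derive t (1 : R) (W j) (b j t / h).
Proof.
move=> jN; rewrite /W /b -[_ / h]mulrC (_ : (fun t => _) = fun t => h^-1 * (Z j.+1 t - Z j t)).
  by apply: is_deriveMl; apply: is_deriveB; apply: dZ => //; exact: leqW.
by apply/funext => s; rewrite mulrC.
Qed.

Let cU j : (j < N)%N -> continuous (U j).
Proof.
move=> jN; have c1 := @cW j (ltnW jN); have c2 := @ca j (leqW (ltnW jN)).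
by have c3 := @ca j.+1 (leqW jN); rewrite /U; cont.
Qed.

Let h1 : h <= 1.
Proof. by rewrite -hN ler_peMr// ?ler1n// ltW. Qed.

Let U_ge0 j t : 0 <= U j t.
Proof. by rewrite /U !addr_ge0// divr_ge0// sqr_ge0. Qed.

Definition bdry t := W N t ^+ 2 + b N t ^+ 2 + a N.+1 t ^+ 2.
Definition jumps t := h * \sum_(i < N.+1) b i t ^+ 2.
Definition wenergy t := h * \sum_(i < N) ka i t * U i t.
Definition energy t := h * (\sum_(i < N) th i.+1 t * a i.+1 t ^+ 2) / 2
  + h * (\sum_(i < N.+1) th i t * W i t ^+ 2) / 2.
Definition rho_norm t := Num.sqrt (h * \sum_(i < N) rho i.+1 t ^+ 2).

(** Everything that is known to be small: the terms at [x = 1], the jumps, the initial values, the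
    defect [e] and the residual. The residual enters through the square of its L1-in-time norm, the
    norm in which it is controlled. *)
Definition data := intg bdry 0 1 + intg jumps 0 1 + h * (\sum_(i < N.+1) W i 0 ^+ 2)
  + h * (\sum_(i < N) Z i.+1 0 ^+ 2) + h * (\sum_(i < N) e i.+1 ^+ 2)
  + intg rho_norm 0 1 ^+ 2.
Definition err t := bdry t + jumps t + data.

Definition phi0 := h * \sum_(i < N) th i.+1 0 * a i.+1 0 ^+ 2.

Let cbdry : continuous bdry.
Proof.
have c1 := @cW N (leqnn N); have c2 := @cb N (leqnn N); have c3 := @ca N.+1 (leqnn _).
by rewrite /bdry; cont.
Qed.

Let cjumps : continuous jumps.
Proof.
rewrite /jumps; apply: contM; first exact: contC.
by apply: cont_sum => i _; apply: contX; apply: cb; rewrite -ltnS.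
Qed.

Let cwenergy : continuous wenergy.
Proof.
rewrite /wenergy; apply: contM; first exact: contC.
by apply: cont_sum => i _; apply: contM; [exact: cka|exact: cU].
Qed.

Let crho_norm : continuous rho_norm.
Proof.
move=> t; apply: (@continuous_comp _ _ _ (fun t => h * \sum_(i < N) rho i.+1 t ^+ 2)); last exact: sqrt_continuous.
apply: contM; first exact: contC.
by apply: cont_sum => i _; apply: contX; exact: crho.
Qed.

Let cerr : continuous err.
Proof. by rewrite /err; cont. Qed.

Let bdry_ge0 t : 0 <= bdry t.
Proof. by rewrite !addr_ge0// sqr_ge0. Qed.

Let jumps_ge0 t : 0 <= jumps t.
Proof. by rewrite mulr_ge0 ?(ltW h0)// sumr_ge0// => i _; exact: sqr_ge0. Qed.

Let hsum_ge0 n (x : nat -> R) : (forall i, 0 <= x i) -> 0 <= h * \sum_(i < n) x i.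
Proof. by move=> x0; rewrite mulr_ge0 ?(ltW h0)// sumr_ge0. Qed.

Let data_ge : [/\ intg bdry 0 1 <= data, intg jumps 0 1 <= data &
  [/\ h * (\sum_(i < N.+1) W i 0 ^+ 2) + intg jumps 0 1 <= data,
   h * (\sum_(i < N) Z i.+1 0 ^+ 2) <= data, h * (\sum_(i < N) e i.+1 ^+ 2) <= data,
   intg rho_norm 0 1 ^+ 2 <= data & 0 <= data]].
Proof.
have i1 : 0 <= intg bdry 0 1 by apply: intg_ge0.
have i2 : 0 <= intg jumps 0 1 by apply: intg_ge0.
have i3 : 0 <= h * (\sum_(i < N.+1) W i 0 ^+ 2) by apply: (@hsum_ge0 _ (fun i => W i 0 ^+ 2)) => i; exact: sqr_ge0.
have i4 : 0 <= h * (\sum_(i < N) Z i.+1 0 ^+ 2) by apply: (@hsum_ge0 _ (fun i => Z i.+1 0 ^+ 2)) => i; exact: sqr_ge0.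
have i5 : 0 <= h * (\sum_(i < N) e i.+1 ^+ 2) by apply: (@hsum_ge0 _ (fun i => e i.+1 ^+ 2)) => i; exact: sqr_ge0.
have i6 := sqr_ge0 (intg rho_norm 0 1).
by rewrite /data; split; [lra|lra|split; lra].
Qed.

Let data_ge0 : 0 <= data. Proof. by have [_ _ []] := data_ge. Qed.

Let err_ge : forall t, [/\ bdry t <= err t, jumps t <= err t, data <= err t & 0 <= err t].
Proof.
move=> t; have := bdry_ge0 t; have := jumps_ge0 t; have := data_ge0; rewrite /err.
by split; lra.
Qed.

Let int_err : intg err 0 1 <= 3 * data.
Proof.
rewrite /err (intgD _ _ (contD cbdry cjumps) (@contC R data)) (intgD _ _ cbdry cjumps).
by rewrite intg_cst; have [? ? _] := data_ge; lra.
Qed.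

(** Telescoping from [x = 1] costs a factor [1 / h] by Cauchy-Schwarz, so the jumps control [h a] at
    every node without any weight. This absorbs the errors [M h^2] left by shifting the weight from
    node to node. *)
Let crude_a j t : (j <= N.+1)%N -> h ^+ 2 * a j t ^+ 2 <= 2 * a N.+1 t ^+ 2 + 2 * jumps t.
Proof.
move=> jN; have e1 : a j t = a N.+1 t - \sum_(j <= i < N.+1) b i t.
  by rewrite telescope_sumr//; ring.
have n1 : `|\sum_(j <= i < N.+1) b i t| <= \sum_(i < N.+1) `|b i t|.
  rewrite (le_trans (ler_norm_sum _ _ _))// -(big_mkord xpredT (fun i => `|b i t|)).
  by rewrite [leRHS](@big_cat_nat _ _ _ j)//= lerDr sumr_ge0.
have n2 := sum_sqr_le N.+1 (fun i => `|b i t|).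
have n3 : h * (\sum_(i < N.+1) `|b i t|) ^+ 2 <= \sum_(i < N.+1) b i t ^+ 2.
  under [leRHS]eq_bigr do rewrite -sqr_normr//.
  by rewrite -[leRHS]mul1r -hN -mulrA ler_pM2l.
have n4 : (\sum_(j <= i < N.+1) b i t) ^+ 2 <= (\sum_(i < N.+1) `|b i t|) ^+ 2.
  rewrite -sqr_normr//; apply: lerXn2r; rewrite ?nnegrE//.
  by rewrite sumr_ge0.
set s := \sum_(j <= i < N.+1) b i t in e1 n1 n4.
have n5 : h ^+ 2 * s ^+ 2 <= jumps t.
  rewrite /jumps (le_trans (ler_wpM2l (sqr_ge0 h) n4))// expr2 -mulrA.
  by rewrite ler_pM2l.
have n6 : h ^+ 2 * a N.+1 t ^+ 2 <= a N.+1 t ^+ 2.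
  by rewrite ler_piMl ?sqr_ge0// exprn_ile1// ltW.
rewrite e1 (le_trans (_ : _ <= h ^+ 2 * (2 * a N.+1 t ^+ 2 + 2 * s ^+ 2)))//; last by lra.
rewrite ler_pM2l ?exprn_gt0//; have := sqr_ge0 (a N.+1 t + s); lra.
Qed.

(** Same role for the slopes, by integrating [(h W)' = b] in time. *)
Let crude_W j (t : R) : (j <= N)%N -> 0 <= t <= 1 ->
  h ^+ 2 * W j t ^+ 2 <= 2 * W j 0 ^+ 2 + 2 * intg (fun s => b j s ^+ 2) 0 1.
Proof.
move=> jN /andP[t0 t1]; have cbj := @cb j jN.
have e1 : h * W j t = h * W j 0 + intg (b j) 0 t.
  have H s : is_derive s (1 : R) (fun s => h * W j s) (b j s).
   have := is_deriveMl h (@dW j s jN) => H.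
   by apply: is_derive_eq; rewrite mulrC mulfVK// gt_eqF.
  by rewrite (intg_FTC 0 t cbj H) addrC subrK.
have e2 : intg (b j) 0 t ^+ 2 <= intg (fun s => b j s ^+ 2) 0 1.
  rewrite (le_trans (intg_sqr_le cbj t0))// subr0.
  have i0 : 0 <= intg (fun s => b j s ^+ 2) 0 t.
   by apply: intg_ge0 => //; [cont|move=> *; exact: sqr_ge0].
  rewrite (le_trans (ler_piMl i0 t1))//.
  rewrite (intg_chasles _ t 0 1) lerDl; apply: intg_ge0 => //; first by cont.
  by move=> *; exact: sqr_ge0.
rewrite -exprMn e1; set I := intg (b j) 0 t in e2 *.
have n6 : h ^+ 2 * W j 0 ^+ 2 <= W j 0 ^+ 2.
  by rewrite ler_piMl ?sqr_ge0// exprn_ile1// ltW.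
move: e2 n6; move: (W j 0) I (intg _ 0 1) => w I I2 e2 n6.
have := sqr_ge0 (h * w - I); lra.
Qed.

Let crude_sumW (t : R) : 0 <= t <= 1 ->
  h * \sum_(i < N.+1) h ^+ 2 * W i t ^+ 2 <= 2 * data.
Proof.
move=> t01; have [_ _ [D1 _ _ _ _]] := data_ge.
apply: (@le_trans _ _ (2 * (h * (\sum_(i < N.+1) W i 0 ^+ 2) + intg jumps 0 1))).
  rewrite /jumps intgZ ?intg_sum//; last first.
  - by apply: cont_sum => i _; apply: contX; apply: cb; rewrite -ltnS.
  - by move=> i _; apply: contX; apply: cb; rewrite -ltnS.
  rewrite -mulrDr mulrCA ler_pM2l// -big_split/= mulr_sumr ler_sum// => i _.
  by rewrite mulrDr; exact: (@crude_W i t (ltn_ord i) t01).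
by rewrite ler_pM2l.
Qed.

Let crude_U (t : R) : 0 <= t <= 1 -> h ^+ 3 * \sum_(i < N) U i t <= err t.
Proof.
move=> t01; have hW := crude_sumW t01.
have N1 : h * N%:R <= 1 by rewrite -[leRHS]hN ler_pM2l// ler_nat.
have e1 : h ^+ 3 * \sum_(i < N) U i t <=
   h * \sum_(i < N) (h ^+ 2 * W i t ^+ 2 / 2 + (a N.+1 t ^+ 2 + jumps t)).
  rewrite exprS -mulrA ler_pM2l// mulr_sumr ler_sum// => i _.
  have c1 := @crude_a i t (leqW (ltnW (ltn_ord i))).
  by have c2 := @crude_a i.+1 t (leqW (ltn_ord i)); rewrite /U; lra.
apply: (le_trans e1); rewrite big_split/= mulrDr sumr_const card_ord -mulr_suml.
rewrite -[_ *+ N]mulr_natl mulrA.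
have A0 : 0 <= a N.+1 t ^+ 2 + jumps t by rewrite addr_ge0 ?sqr_ge0.
have e2 := ler_piMl A0 N1.
have e3 : h * \sum_(i < N) h ^+ 2 * W i t ^+ 2 <= h * \sum_(i < N.+1) h ^+ 2 * W i t ^+ 2.
  by rewrite ler_pM2l// big_ord_recr/= lerDl mulr_ge0 ?sqr_ge0.
rewrite /err /bdry; have := sqr_ge0 (W N t); have := sqr_ge0 (b N t).
have := jumps_ge0 t; move: e2 e3 hW; lra.
Qed.

(** A common majorant of the weights [ka] at the two ends of an edge. *)
Let G i t := (1 + mu) * ka i t + M * h ^+ 2.

Let sumGU (t : R) : 0 <= t <= 1 ->
  h * \sum_(i < N) G i t * U i t <= (1 + mu) * wenergy t + M * err t.
Proof.
move=> t01; have := ler_wpM2l M0 (crude_U t01).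
have -> : \sum_(i < N) G i t * U i t = (1 + mu) * \sum_(i < N) ka i t * U i t
   + M * h ^+ 2 * \sum_(i < N) U i t.
  rewrite !mulr_sumr -big_split/=; apply: eq_bigr => i _; rewrite /G; ring.
rewrite /wenergy; move: (\sum_(i < N) ka i t * U i t) (\sum_(i < N) U i t) => s1 s2.
rewrite mulrDr (_ : h ^+ 3 = h * h ^+ 2) ?exprS//; lra.
Qed.

Let ka_leG i t : ka i t <= G i t.
Proof. by rewrite /G mulrDl mul1r -addrA lerDl addr_ge0// mulr_ge0 ?sqr_ge0 ?(ltW mu0). Qed.

Let G_ge0 i t : 0 <= G i t.
Proof. exact: le_trans (ka_ge0 i t) (ka_leG i t). Qed.

Let kaSG i t : ka i.+1 t <= G i t.
Proof. exact: ka_step. Qed.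

Let GU t := h * \sum_(i < N) G i t * U i t.

Let GU_le (t : R) : 0 <= t <= 1 -> GU t <= 2 * wenergy t + M * err t.
Proof.
move=> t01; apply: (le_trans (sumGU t01)); rewrite lerD2r.
apply: ler_wpM2r; last by have := mu1; lra.
by apply: (@hsum_ge0 _ (fun i => ka i t * U i t)) => i; rewrite mulr_ge0.
Qed.

Let prod_le (u w d : R) : 0 <= d -> u ^+ 2 <= 2 * d - 2 * w ^+ 2 -> u * w <= d.
Proof. by move=> d0 H; have := sqr_ge0 w; have := sqr_ge0 (u - w); lra. Qed.

Let bdry_aN (t : R) : a N t ^+ 2 <= 2 * bdry t - 2 * W N t ^+ 2.
Proof.
have := sqr_ge0 (a N.+1 t + b N t); rewrite /bdry /b; lra.
Qed.

Let le_h (x y : R) : 0 <= y -> x <= y -> h * x <= y.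
Proof.
move=> y0 xy; apply: (@le_trans _ _ (h * y)); first by rewrite ler_pM2l.
by rewrite ler_piMl.
Qed.

Let kaN_le (t x y : R) : 0 <= t -> 0 <= x -> x <= y -> h * (ka N t * x) <= k * y.
Proof.
move=> t0 x0 xy; have kN := ka_lek (leqnn N) t0.
have k0 : 0 <= k by have := k1; lra.
apply: le_h; first by rewrite mulr_ge0// (le_trans x0).
by apply: ler_pM.
Qed.

Let sum_ka_a t : h * \sum_(i < N) ka i.+1 t * a i.+1 t ^+ 2 <= 4 * GU t.
Proof.
rewrite /GU mulrCA ler_pM2l// mulr_sumr ler_sum// => i _.
rewrite [leRHS]mulrCA; apply: ler_pM; rewrite ?sqr_ge0 ?kaSG//.
by rewrite /U; have := sqr_ge0 (W i t); have := sqr_ge0 (a i t); lra.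
Qed.

Let sum_kaG (t : R) (x : nat -> R) : (forall i, 0 <= x i) ->
  \sum_(i < N) ka i.+1 t * x i <= \sum_(i < N) G i t * x i.
Proof. by move=> x0; apply: ler_sum => i _; apply: ler_wpM2r; rewrite ?kaSG. Qed.

(** Shifting the index by one leaves a term at node [N], which the boundary terms at [x = 1] will
    bound, and none at node 0, where the weight vanishes. *)
Let sum_kaG2 (t : R) (x : nat -> R) : 0 <= t -> (forall i, 0 <= x i) ->
  \sum_(i < N) ka i.+1 t * x i.+1 <= \sum_(i < N) G i t * x i + ka N t * x N.
Proof.
move=> t0 x0; rewrite (sum_shift N (fun i => ka i t * x i)) ka00// mul0r subr0 lerD2r.
by apply: ler_sum => i _; apply: ler_wpM2r; rewrite ?ka_leG.
Qed.

Let sum_ka_av (t : R) : 0 <= t ->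
  h * \sum_(i < N) ka i.+1 t * av i t ^+ 2 <= 2 * GU t + k * bdry t.
Proof.
move=> t0; have x0 i : 0 <= W i t ^+ 2 by exact: sqr_ge0.
have h2 := sum_kaG2 t0 x0; have h3 := sum_kaG t x0.
have h4 : \sum_(i < N) ka i.+1 t * av i t ^+ 2 <=
   2^-1 * (\sum_(i < N) ka i.+1 t * W i.+1 t ^+ 2 + \sum_(i < N) ka i.+1 t * W i t ^+ 2).
  rewrite -big_split/= mulr_sumr ler_sum// => i _; rewrite -mulrDr [leRHS]mulrCA.
  apply: ler_wpM2l => //; rewrite /av; have := sqr_ge0 (W i.+1 t - W i t); lra.
have h5 : \sum_(i < N) G i t * W i t ^+ 2 <= 2 * \sum_(i < N) G i t * U i t.
  rewrite mulr_sumr ler_sum// => i _; rewrite [leRHS]mulrCA; apply: ler_wpM2l => //.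
  rewrite /U; have := sqr_ge0 (a i.+1 t); have := sqr_ge0 (a i t); lra.
have h6 : h * (ka N t * W N t ^+ 2) <= k * bdry t.
  apply: kaN_le; rewrite ?sqr_ge0// /bdry.
  by have := sqr_ge0 (b N t); have := sqr_ge0 (a N.+1 t); lra.
have h7 : 0 <= h * (ka N t * W N t ^+ 2) by rewrite (mulr_ge0 (ltW h0))// mulr_ge0// sqr_ge0.
rewrite /GU; apply: (@le_trans _ _ (h * (2 * \sum_(i < N) G i t * U i t + 2^-1 * (ka N t * W N t ^+ 2)))).
  by rewrite ler_pM2l//; lra.
by rewrite mulrDr; lra.
Qed.

Let cross_ka (t : R) : 0 <= t ->
  `|h * \sum_(i < N) ka i.+1 t * (a i.+1 t * av i t)| <= GU t + k * bdry t.
Proof.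
move=> t0; have hn : `|h| = h by rewrite gtr0_norm.
rewrite normrM hn.
have x0 i : 0 <= `|a i t| * `|W i t| by rewrite mulr_ge0.
have y0 i : 0 <= `|a i.+1 t| * `|W i t| by rewrite mulr_ge0.
have h2 := sum_kaG2 t0 x0; have h3 := sum_kaG t y0.
have h4 : `|\sum_(i < N) ka i.+1 t * (a i.+1 t * av i t)| <=
   2^-1 * (\sum_(i < N) ka i.+1 t * (`|a i.+1 t| * `|W i.+1 t|) +
   \sum_(i < N) ka i.+1 t * (`|a i.+1 t| * `|W i t|)).
  rewrite -big_split/= mulr_sumr (le_trans (ler_norm_sum _ _ _))// ler_sum// => i _.
  rewrite -mulrDr [leRHS]mulrCA normrM (ger0_norm (ka_ge0 _ _)); apply: ler_wpM2l => //.
  rewrite /av (normrM (a i.+1 t)) (normrM _ 2^-1) -mulrDr [leRHS]mulrCA; apply: ler_wpM2l => //.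
  by rewrite mulrC (@ger0_norm _ 2^-1)// ler_pM2l// ler_normD.
have h5 : \sum_(i < N) G i t * (`|a i t| * `|W i t|) + \sum_(i < N) G i t * (`|a i.+1 t| * `|W i t|)
   <= 2 * \sum_(i < N) G i t * U i t.
  rewrite -big_split/= mulr_sumr ler_sum// => i _; rewrite -mulrDr [leRHS]mulrCA; apply: ler_wpM2l => //.
  rewrite /U -(real_normK (num_real (W i t))) -(real_normK (num_real (a i t))).
  rewrite -(real_normK (num_real (a i.+1 t))).
  move: `|W i t| `|a i t| `|a i.+1 t| => w u v.
  have := sqr_ge0 (w - u); have := sqr_ge0 (w - v); lra.
have h6 : h * (ka N t * (`|a N t| * `|W N t|)) <= k * bdry t.
  apply: kaN_le; rewrite ?mulr_ge0//.
  have := bdry_aN t; rewrite -(real_normK (num_real (W N t))) -(real_normK (num_real (a N t))).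
  move: (bdry_ge0 t).
  exact: prod_le.
have h7 : 0 <= h * (ka N t * (`|a N t| * `|W N t|)) by rewrite !mulr_ge0// ltW.
rewrite /GU; apply: (@le_trans _ _ (h * (\sum_(i < N) G i t * U i t + 2^-1 * (ka N t * (`|a N t| * `|W N t|))))).
  by rewrite ler_pM2l//; lra.
by rewrite mulrDr; lra.
Qed.

Let cG i : continuous (G i).
Proof.
rewrite /G; apply: contD; last exact: contC.
by apply: contM; [exact: contC|exact: cka].
Qed.

Let cGU : continuous GU.
Proof.
rewrite /GU; apply: contM; first exact: contC.
by apply: cont_sum => i _; apply: contM; [exact: cG|exact: cU].
Qed.

Let J := intg wenergy 0 1.

Let intGU : intg GU 0 1 <= 2 * J + 3 * M * data.
Proof.
apply: (@le_trans _ _ (intg (fun t => 2 * wenergy t + M * err t) 0 1)).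
  by apply: intg_le => //; cont.
have c1 : continuous (fun t => 2 * wenergy t) by cont.
have c2 : continuous (fun t => M * err t) by cont.
rewrite (intgD _ _ c1 c2) (intgZ _ _ _ cwenergy) (intgZ _ _ _ cerr) lerD2l.
by have := ler_wpM2l M0 int_err; lra.
Qed.

Let GU_ge0 t : 0 <= GU t.
Proof. by apply: (@hsum_ge0 _ (fun i => G i t * U i t)) => i; rewrite mulr_ge0. Qed.

(** Zero-order term: [Z(t)] is [Z(0)] plus the integral of [a], and [sg(t) <= ka(s) / k] for
    [s <= t] lets the weight pass under the integral. The weighted energy thus bounds it with a
    factor [1 / k]. *)
Let Z_bound (t : R) : 0 <= t <= 1 ->
  h * \sum_(i < N) sg i.+1 t * Z i.+1 t ^+ 2 <= 2 * data + 8 / k * intg GU 0 1.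
Proof.
move=> /andP[t0 t1]; have k0 : 0 < k by have := k1; lra.
have ci i : (i < N)%N -> continuous (fun s => ka i.+1 s * a i.+1 s ^+ 2).
  by move=> iN; have c1 := @ca i.+1 (leqW iN); have c2 := @cka i.+1; cont.
have step i : (i < N)%N -> sg i.+1 t * Z i.+1 t ^+ 2 <=
   2 * Z i.+1 0 ^+ 2 + 2 / k * intg (fun s => ka i.+1 s * a i.+1 s ^+ 2) 0 1.
  move=> iN; have cai := @ca i.+1 (leqW iN); have cfi := ci i iN.
  have ca2 : continuous (fun s => a i.+1 s ^+ 2) by cont.
  have e1 : Z i.+1 t = Z i.+1 0 + intg (a i.+1) 0 t.
   by rewrite (intg_FTC 0 t cai (fun s => @dZ i.+1 s (leqW iN))) addrC subrK.
  have e2 : sg i.+1 t * intg (a i.+1) 0 t ^+ 2 <=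
   k^-1 * intg (fun s => ka i.+1 s * a i.+1 s ^+ 2) 0 1.
   have i0 : 0 <= intg (fun s => a i.+1 s ^+ 2) 0 t.
   by apply: intg_ge0 => // *; exact: sqr_ge0.
   apply: (@le_trans _ _ (sg i.+1 t * intg (fun s => a i.+1 s ^+ 2) 0 t)).
   apply: ler_wpM2l => //; rewrite (le_trans (intg_sqr_le cai t0))// subr0.
   by rewrite ler_piMl.
   rewrite -(intgZ _ _ _ ca2).
   apply: (@le_trans _ _ (intg (fun s => k^-1 * (ka i.+1 s * a i.+1 s ^+ 2)) 0 t)).
   apply: intg_le => //; [by cont|by cont|move=> s /andP[s0 st]].
   rewrite [leRHS]mulrA; apply: ler_wpM2r; first exact: sqr_ge0.
   by rewrite mulrC; apply: sg_ka; [exact: iN|rewrite s0 st].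
   rewrite intgZ// ler_pM2l ?invr_gt0//.
   rewrite [leRHS](intg_chasles _ t) lerDl; apply: intg_ge0 => // s _.
   by rewrite mulr_ge0// sqr_ge0.
  have s1 : sg i.+1 t <= 1 by rewrite (le_trans (@sg_th i.+1 t iN t0))// th_le1.
  have e3 : sg i.+1 t * Z i.+1 0 ^+ 2 <= Z i.+1 0 ^+ 2 by rewrite ler_piMl// sqr_ge0.
  rewrite e1; move: e2 e3; set I1 := intg _ 0 t; set I2 := intg _ 0 1.
  have := mulr_ge0 (sg_ge0 i.+1 t) (sqr_ge0 (Z i.+1 0 - I1)).
  move: (sg i.+1 t) (Z i.+1 0) I1 I2 (k^-1) => x z y y2 kk; lra.
have [_ _ [_ D2 _ _ _]] := data_ge.
apply: (@le_trans _ _ (h * \sum_(i < N) (2 * Z i.+1 0 ^+ 2 +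
   2 / k * intg (fun s => ka i.+1 s * a i.+1 s ^+ 2) 0 1))).
  by rewrite ler_pM2l// ler_sum// => i _; exact: step.
rewrite big_split/= -!mulr_sumr mulrDr; apply: lerD.
  by rewrite mulrCA ler_pM2l.
rewrite mulrCA (_ : 8 / k = 2 / k * 4); last by ring.
rewrite -[leRHS]mulrA ler_pM2l ?divr_gt0//.
have cs : continuous (fun s => \sum_(i < N) ka i.+1 s * a i.+1 s ^+ 2).
  by apply: cont_sum => i _; exact: ci.
have -> : \sum_(i < N) intg (fun s => ka i.+1 s * a i.+1 s ^+ 2) 0 1 =
   intg (fun s => \sum_(i < N) ka i.+1 s * a i.+1 s ^+ 2) 0 1.
  by rewrite intg_sum// => i _; exact: ci.
rewrite -(intgZ _ _ _ cs) -(intgZ _ _ _ cGU); apply: intg_le => //.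
- by apply: contM => //; exact: contC.
- by apply: contM => //; exact: contC.
Qed.

(** The weight is largest at time 0, where [f] is controlled by [a] and the defect [e]; so the
    unknown coefficient is bounded by [phi0], the very quantity to be estimated. *)
Let f_bound (t : R) : 0 <= t -> h * \sum_(i < N) sg i.+1 t * f i.+1 ^+ 2 <= K * (phi0 + data).
Proof.
move=> t0; have [_ _ [_ _ D3 _ _]] := data_ge.
apply: (@le_trans _ _ (K * (phi0 + h * (\sum_(i < N) e i.+1 ^+ 2)))); last first.
  by apply: ler_wpM2l => //; rewrite lerD2l.
rewrite /phi0 -mulrDr mulrCA ler_pM2l// -big_split/= mulr_sumr ler_sum// => i _.
have hs := @sg_th i.+1 t (ltn_ord i) t0; have hf := f_le (ltn_ord i).
have h01 := @th_le1 i.+1 0 (ltn_ord i) (lexx 0).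
apply: (@le_trans _ _ (th i.+1 0 * (K * (a i.+1 0 ^+ 2 + e i.+1 ^+ 2)))).
  by apply: ler_pM => //; exact: sqr_ge0.
rewrite mulrCA; apply: ler_wpM2l => //; rewrite mulrDr lerD2l.
by rewrite ler_piMl// sqr_ge0.
Qed.

Definition sigma := (Rb ^+ 2 * (K * (phi0 + data)) +
  m ^+ 2 * (2 * data + 8 / k * intg GU 0 1)) / (4 * omega * k).

(** The sources [f R] and [q Z] go through [young], hence [omega] in front of the energy and
    [1 / (4 omega k)] in [sigma]. The residual, small in L1 in time only, goes through
    Cauchy-Schwarz in space and keeps the test quantity as a factor. *)
Let source_le (t : R) (y : nat -> R) : 0 <= t <= 1 ->
  `|h * \sum_(i < N) th i.+1 t * (S i.+1 t * y i)| <=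
  2 * omega * (h * \sum_(i < N) ka i.+1 t * y i ^+ 2) + sigma +
  rho_norm t * Num.sqrt (h * \sum_(i < N) th i.+1 t * y i ^+ 2).
Proof.
move=> t01; have /andP[t0 t1] := t01; have k0 : 0 < k by have := k1; lra.
have c0 : 0 < 4 * omega * k by rewrite !mulr_gt0//; have := omega0; lra.
have hn : `|h| = h by rewrite gtr0_norm.
pose X1 := \sum_(i < N) ka i.+1 t * y i ^+ 2.
pose X2 := \sum_(i < N) sg i.+1 t * f i.+1 ^+ 2.
pose X3 := \sum_(i < N) sg i.+1 t * Z i.+1 t ^+ 2.
pose X4 := \sum_(i < N) `|rho i.+1 t| * (th i.+1 t * `|y i|).
have e1 : `|\sum_(i < N) th i.+1 t * (S i.+1 t * y i)| <=
   2 * omega * X1 + Rb ^+ 2 / (4 * omega * k) * X2 + m ^+ 2 / (4 * omega * k) * X3 + X4.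
  rewrite /X1 /X2 /X3 /X4 !mulr_sumr -!big_split/=.
  rewrite (le_trans (ler_norm_sum _ _ _))// ler_sum// => i _.
  have hR := @Rr_le i t (ltn_ord i) t01; have hq := q_le (ltn_ord i).
  have s1 : `|S i.+1 t| <= `|f i.+1| * Rb + m * `|Z i.+1 t| + `|rho i.+1 t|.
   rewrite /S (le_trans (ler_normB _ _))// lerD2r (le_trans (ler_normB _ _))//.
   by rewrite (normrM (f i.+1)) (normrM (q i.+1)) lerD ?ler_wpM2l ?ler_wpM2r.
  rewrite normrM (ger0_norm (th_ge0 _ _)) normrM.
  have s2 : th i.+1 t * (`|S i.+1 t| * `|y i|) <=
   th i.+1 t * ((`|f i.+1| * Rb) * `|y i|) + th i.+1 t * ((m * `|Z i.+1 t|) * `|y i|)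
   + `|rho i.+1 t| * (th i.+1 t * `|y i|).
   rewrite [X in _ + X]mulrCA -!mulrDr -!mulrDl; apply: ler_wpM2l => //.
   by apply: ler_wpM2r.
  apply: (le_trans s2); rewrite lerD2r.
  have y1 := young i.+1 t (`|f i.+1| * Rb) `|y i|.
  have y2 := young i.+1 t (m * `|Z i.+1 t|) `|y i|.
  rewrite exprMn !sqr_normr// in y1; rewrite exprMn !sqr_normr// in y2.
  apply: le_trans (lerD y1 y2) _; rewrite le_eqVlt; apply/orP; left; apply/eqP.
  by rewrite [in RHS]mulrAC; ring.
have hX4 : h * X4 <= rho_norm t * Num.sqrt (h * \sum_(i < N) th i.+1 t * y i ^+ 2).
  rewrite /rho_norm -sqrtrM; last by apply: (@hsum_ge0 _ (fun i => rho i.+1 t ^+ 2)) => i; exact: sqr_ge0.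
  rewrite -[leLHS]ger0_norm; last first.
   by apply: (@hsum_ge0 _ (fun i => `|rho i.+1 t| * (th i.+1 t * `|y i|))) => i; rewrite !mulr_ge0.
  rewrite -sqrtr_sqr ler_wsqrtr// expr2 mulrACA [leRHS]mulrACA -expr2 -[X4 * X4]expr2.
  rewrite ler_pM2l ?exprn_gt0//; apply: le_trans (@sum_cauchy_schwarz _ N (fun i => `|rho i.+1 t|) (fun i => th i.+1 t * `|y i|)) _.
  apply: ler_pM.
  - by apply: sumr_ge0 => i _; exact: sqr_ge0.
  - by apply: sumr_ge0 => i _; exact: sqr_ge0.
  - by apply: ler_sum => i _; rewrite real_normK ?num_real.
  apply: ler_sum => i _; rewrite exprMn sqr_normr//.
  apply: ler_wpM2r; first exact: sqr_ge0.
  by rewrite expr2 ler_piMl// th_le1.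
rewrite normrM hn; apply: (le_trans (ler_wpM2l (ltW h0) e1)).
have f1 := f_bound t0; have z1 := Z_bound t01.
rewrite -/X1 -/X2 -/X3 in f1 z1 *.
have i0 : 0 <= (4 * omega * k)^-1 by rewrite invr_ge0 ltW.
have f2 := ler_wpM2l (mulr_ge0 (sqr_ge0 Rb) i0) f1.
have z2 := ler_wpM2l (mulr_ge0 (sqr_ge0 m) i0) z1.
rewrite /sigma; move: f2 z2 hX4.
move: (4 * omega * k)^-1 (rho_norm t * _) (8 / k * _) => c r2 g; lra.
Qed.

(** Discrete form of the integral of [th Z_t Z_x]. The slope is averaged over the two edges at a
    node so that the time derivative telescopes exactly. *)
Definition sideways t := h * \sum_(i < N) th i.+1 t * (a i.+1 t * av i t).

Let srcA t := h * \sum_(i < N) th i.+1 t * (S i.+1 t * av i t).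
Let srcB t := h * \sum_(i < N) th i.+1 t * (S i.+1 t * a i.+1 t).

Let dsideways t := h * \sum_(i < N) (- ka i.+1 t * (a i.+1 t * av i t) + th i.+1 t *
  (acc i.+1 t * av i t + a i.+1 t * (2^-1 * (b i.+1 t / h + b i t / h)))).

Let is_derive_sideways t : is_derive t (1 : R) sideways (dsideways t).
Proof.
apply: is_deriveMl; apply: is_derive_sumf => i _.
have d1 : is_derive t (1 : R) (av i) (2^-1 * (b i.+1 t / h + b i t / h)).
  rewrite /av (_ : (fun t => _) = fun t => 2^-1 * (W i.+1 t + W i t)); last first.
   by apply/funext => s; rewrite mulrC.
  exact: is_deriveMl (is_deriveD (@dW i.+1 t (ltn_ord i)) (@dW i t (ltnW (ltn_ord i)))).
exact: is_derive_mul (dth i.+1 t) (is_derive_mul (@da i t (ltn_ord i)) d1).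
Qed.

Let V i t := W i t ^+ 2 + a i t * a i.+1 t.

(** Once the equation replaces [acc], the terms at node [i + 1] add up to half of [V_(i+1) - V_i]:
    indeed [b_(i+1) + b_i = a_(i+2) - a_i]. Summation by parts moves the difference onto the weight,
    and the left boundary term vanishes with [th 0]. *)
Let dsidewaysE (t : R) : 0 <= t <= 1 -> dsideways t =
  - (h * \sum_(i < N) ka i.+1 t * (a i.+1 t * av i t)) + srcA t
  + 2^-1 * (th N t * V N t - \sum_(i < N) (th i.+1 t - th i t) * V i t).
Proof.
move=> t01; have /andP[t0 _] := t01.
have -> : th N t * V N t - \sum_(i < N) (th i.+1 t - th i t) * V i t =
   \sum_(i < N) th i.+1 t * (V i.+1 t - V i t).
  by rewrite (sum_abel N (fun i => th i t) (fun i => V i t)) th00// mul0r subr0.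
rewrite /dsideways /srcA !mulr_sumr -sumrN -!big_split/=; apply: eq_bigr => i _.
rewrite (wave_eq (ltn_ord i) t01) /V /av /b.
by field; rewrite gt_eqF.
Qed.

Let nu := beta - 1 - mu.
Definition cA := M + k * (1 + beta) + 1.

Let weight_diff i (t : R) : h * beta * ka i t <= th i.+1 t - th i t <= h * beta * ka i.+1 t.
Proof. exact: th_step. Qed.

(** Coercivity: the space increments of the weight yield [- beta wenergy], while its time derivative
    costs at most [(1 + mu) wenergy] through the cross term. The difference [nu] is where a slope
    [beta] above 1 pays off. *)
Let dsideways_le (t : R) : 0 <= t <= 1 ->
  dsideways t <= - (nu * wenergy t) + cA * err t + srcA t.
Proof.
move=> t01; have /andP[t0 t1] := t01; rewrite dsidewaysE//.
have h1' := cross_ka t0; have h2 := sumGU t01.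
have k0 : 0 <= k by have := k1; lra.
have h3 : th N t * V N t <= 2 * bdry t.
  have n1 := th_le1 (leqnn N) t0.
  have v1 : `|V N t| <= 2 * bdry t.
   have := bdry_aN t; have := bdry_ge0 t; rewrite /V.
   have := sqr_ge0 (a N t - a N.+1 t); have := sqr_ge0 (a N t + a N.+1 t).
   have : a N.+1 t ^+ 2 <= bdry t - W N t ^+ 2 by rewrite /bdry; have := sqr_ge0 (b N t); lra.
   have := sqr_ge0 (W N t); rewrite ler_norml.
   move: (a N t) (a N.+1 t) (W N t) (bdry t) => x y z d *.
   by split_lra.
  apply: (le_trans (ler_norm _)); rewrite normrM (ger0_norm (th_ge0 _ _)).
  by apply: le_trans v1; rewrite ler_piMl.
have h4 : - (\sum_(i < N) (th i.+1 t - th i t) * V i t) <=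
   - (2 * beta * wenergy t) + beta * k * jumps t.
  have bk : 0 <= beta * k by rewrite mulr_ge0//; have := beta0; lra.
  apply: (@le_trans _ _ (- (2 * beta * wenergy t) + beta * k * (h * \sum_(i < N) b i t ^+ 2))); last first.
   rewrite lerD2l; apply: ler_wpM2l => //; rewrite /jumps ler_pM2l// big_ord_recr/= lerDl.
   exact: sqr_ge0.
  rewrite /wenergy !mulr_sumr -!sumrN -big_split/=; apply: ler_sum => i _.
  (* The jump in this identity has an unfavourable sign, but it carries the increment of [th], of
     order [h], and so goes to [jumps]. *)
  have -> : V i t = 2 * U i t - b i t ^+ 2 / 2 by rewrite /V /U /b; field.
  have /andP[d1 d2] := weight_diff i t.
  have d3 : th i.+1 t - th i t <= h * beta * k.
   apply: (le_trans d2); apply: ler_wpM2l; first by rewrite mulr_ge0 ?(ltW h0)//; have := beta0; lra.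
   exact: ka_lek.
  have d4 := ler_wpM2r (U_ge0 i t) d1; have d5 := ler_wpM2r (sqr_ge0 (b i t)) d3.
  have d6 : 0 <= h * beta * k * b i t ^+ 2.
   by rewrite mulr_ge0 ?sqr_ge0// -mulrA mulr_ge0 ?(ltW h0).
  move: d4 d5 d6; move: (U i t) (b i t ^+ 2) (th i.+1 t - th i t) (ka i t) => u bb dd kk; lra.
have e1 : - (h * \sum_(i < N) ka i.+1 t * (a i.+1 t * av i t)) <=
   GU t + k * bdry t by apply: le_trans h1'; rewrite -normrN ler_norm.
have h2' : GU t <= (1 + mu) * wenergy t + M * err t by [].
have [g1 g2 g3 g4] := err_ge t; have g5 := bdry_ge0 t; have g6 := jumps_ge0 t; have g7 := data_ge0.
have g8 : k * bdry t + beta * k * jumps t + bdry t <= (k * (1 + beta) + 1) * err t.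
  have k2 : 0 <= beta * k by rewrite mulr_ge0//; have := beta0; lra.
  have k3 := ler_wpM2l k0 g1; have k4 := ler_wpM2l k2 g2; lra.
have k5 : 0 <= beta * k * jumps t by rewrite mulr_ge0// mulr_ge0//; have := beta0; lra.
move: e1 h2' h3 h4 g8 k5; rewrite /nu /cA; move: (srcA t) (GU t) (wenergy t) (err t) (bdry t) (jumps t).
move=> s g w er bd ju; lra.
Qed.

Let denergy t := h * (\sum_(i < N) (- ka i.+1 t * a i.+1 t ^+ 2 +
   th i.+1 t * (2%:R * a i.+1 t ^+ 1 * acc i.+1 t))) * 2^-1
  + h * (\sum_(i < N.+1) (- ka i t * W i t ^+ 2 + th i t * (2%:R * W i t ^+ 1 * (b i t / h)))) * 2^-1.

Let is_derive_energy t : is_derive t (1 : R) energy (denergy t).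
Proof.
have H (n : nat) (F : 'I_n -> R -> R) (F' : 'I_n -> R) :
   (forall i, is_derive t (1 : R) (F i) (F' i)) ->
   is_derive t (1 : R) (fun t => h * (\sum_(i < n) F i t) / 2) (h * (\sum_(i < n) F' i) * 2^-1).
  move=> dF; rewrite (_ : (fun t => _) = fun t => 2^-1 * (h * (\sum_(i < n) F i t))).
   by rewrite mulrC; apply: is_deriveMl; apply: is_deriveMl; apply: is_derive_sumf.
  by apply/funext => s; rewrite mulrC.
apply: is_deriveD; apply: H => i.
  exact: is_derive_mul (dth i.+1 t) (is_derive_exp 1 (@da i t (ltn_ord i))).
exact: is_derive_mul (dth i t) (is_derive_exp 1 (@dW i t (ltn_ord i))).
Qed.

Let denergyE (t : R) : 0 <= t <= 1 -> denergy t =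
  - (h * (\sum_(i < N) ka i.+1 t * a i.+1 t ^+ 2) / 2)
  - h * (\sum_(i < N.+1) ka i t * W i t ^+ 2) / 2
  + th N t * (W N t * a N.+1 t) - \sum_(i < N) (th i.+1 t - th i t) * (a i.+1 t * W i t) + srcB t.
Proof.
move=> t01; have /andP[t0 _] := t01.
have e1 : th N t * (W N t * a N.+1 t) - \sum_(i < N) (th i.+1 t - th i t) * (a i.+1 t * W i t)
   = \sum_(i < N) th i.+1 t * a i.+1 t * (W i.+1 t - W i t) + \sum_(i < N.+1) th i t * W i t * b i t.
  rewrite (sum_abel N (fun i => th i t * a i t) (fun i => W i t)) th00// !mul0r subr0.
  have -> : \sum_(i < N) (th i.+1 t - th i t) * (a i.+1 t * W i t) =
   \sum_(i < N) (th i.+1 t * a i.+1 t - th i t * a i t) * W i t - \sum_(i < N) th i t * W i t * b i t.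
   by rewrite -sumrB; apply: eq_bigr => i _; rewrite /b; ring.
  by rewrite big_ord_recr/= /b; ring.
have s1 : \sum_(i < N) (- ka i.+1 t * a i.+1 t ^+ 2 + th i.+1 t * (2%:R * a i.+1 t ^+ 1 * acc i.+1 t))
   = - \sum_(i < N) ka i.+1 t * a i.+1 t ^+ 2
   + 2 / h * \sum_(i < N) th i.+1 t * a i.+1 t * (W i.+1 t - W i t)
   + 2 * \sum_(i < N) th i.+1 t * (S i.+1 t * a i.+1 t).
  rewrite !mulr_sumr -!sumrN -!big_split/=; apply: eq_bigr => i _.
  by rewrite (wave_eq (ltn_ord i) t01) expr1; field; rewrite gt_eqF.
have s2 : \sum_(i < N.+1) (- ka i t * W i t ^+ 2 + th i t * (2%:R * W i t ^+ 1 * (b i t / h)))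
   = - \sum_(i < N.+1) ka i t * W i t ^+ 2 + 2 / h * \sum_(i < N.+1) th i t * W i t * b i t.
  rewrite !mulr_sumr -!sumrN -!big_split/=; apply: eq_bigr => i _.
  by rewrite expr1; field; rewrite gt_eqF.
have -> : \sum_(i < N) (th i.+1 t - th i t) * (a i.+1 t * W i t) = th N t * (W N t * a N.+1 t)
   - (\sum_(i < N) th i.+1 t * a i.+1 t * (W i.+1 t - W i t) + \sum_(i < N.+1) th i t * W i t * b i t).
  by rewrite -e1; ring.
rewrite /denergy s1 s2 /srcB; field; rewrite gt_eqF//.
Qed.

Definition cB := k + 1 + (2 + 2 * beta) * M.

(** No sign is gained here: every term is bounded by the weighted energy that the sideways identity
    controls. The purpose is to pass from the time integral [J] to the energy at single times. *)
Let denergy_le (t : R) : 0 <= t <= 1 ->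
  `|denergy t| <= (5 + 4 * beta) * wenergy t + cB * err t + `|srcB t|.
Proof.
move=> t01; have /andP[t0 t1] := t01; rewrite denergyE//.
have k0 : 0 <= k by have := k1; lra.
have b0 : 0 <= beta by have := beta0; lra.
have hg : 0 <= h by exact: ltW.
have h2 := GU_le t01; have h3 := sum_ka_a t.
have h3' : 0 <= h * \sum_(i < N) ka i.+1 t * a i.+1 t ^+ 2.
  by apply: (@hsum_ge0 _ (fun i => ka i.+1 t * a i.+1 t ^+ 2)) => i; rewrite mulr_ge0// sqr_ge0.
have h4 : h * (\sum_(i < N.+1) ka i t * W i t ^+ 2) / 2 <= wenergy t + k * bdry t.
  rewrite big_ord_recr/= mulrDr mulrDl; apply: lerD.
   rewrite /wenergy -mulrA ler_pM2l// mulr_suml ler_sum// => i _.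
   rewrite -mulrA; apply: ler_wpM2l => //; rewrite /U.
   by have := sqr_ge0 (a i.+1 t); have := sqr_ge0 (a i t); lra.
  have : h * (ka N t * W N t ^+ 2) <= k * bdry t.
   apply: kaN_le; rewrite ?sqr_ge0// /bdry.
   by have := sqr_ge0 (b N t); have := sqr_ge0 (a N.+1 t); lra.
  have : 0 <= k * bdry t by rewrite mulr_ge0.
  move: (h * _) (k * _) => x y; lra.
have h4' : 0 <= h * (\sum_(i < N.+1) ka i t * W i t ^+ 2) / 2.
  rewrite divr_ge0//; apply: (@hsum_ge0 _ (fun i => ka i t * W i t ^+ 2)) => i.
  by rewrite mulr_ge0// sqr_ge0.
have h5 : `|th N t * (W N t * a N.+1 t)| <= bdry t.
  rewrite normrM (ger0_norm (th_ge0 _ _)).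
  have : `|W N t * a N.+1 t| <= bdry t.
   rewrite /bdry ler_norml; have := sqr_ge0 (b N t).
   have := sqr_ge0 (W N t + a N.+1 t); have := sqr_ge0 (W N t - a N.+1 t).
   have := sqr_ge0 (W N t); have := sqr_ge0 (a N.+1 t).
   by move: (W N t) (a N.+1 t) (b N t) => x y z *; split_lra.
  apply: le_trans; rewrite ler_piMl// th_le1//.
have h6 : `|\sum_(i < N) (th i.+1 t - th i t) * (a i.+1 t * W i t)| <= 2 * beta * GU t.
  rewrite (le_trans (ler_norm_sum _ _ _))// /GU !mulr_sumr ler_sum// => i _.
  have /andP[d1 d2] := weight_diff i t.
  have d0 : 0 <= th i.+1 t - th i t by apply: le_trans d1; rewrite !mulr_ge0.
  have d3 : th i.+1 t - th i t <= h * beta * G i t.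
   by apply: (le_trans d2); apply: ler_wpM2l; rewrite ?mulr_ge0 ?kaSG.
  have d4 : `|a i.+1 t * W i t| <= 2 * U i t.
   rewrite ler_norml /U; have := sqr_ge0 (a i.+1 t + W i t); have := sqr_ge0 (a i.+1 t - W i t).
   have := sqr_ge0 (W i t); have := sqr_ge0 (a i t).
   by move: (a i.+1 t) (a i t) (W i t) => x y z *; split_lra.
  rewrite normrM (ger0_norm d0); apply: (le_trans (ler_pM d0 (normr_ge0 _) d3 d4)).
  by rewrite le_eqVlt; apply/orP; left; apply/eqP; ring.
have [g1 g2 g3 g4] := err_ge t; have g5 := bdry_ge0 t.
have g8 : (k + 1) * bdry t <= (k + 1) * err t by apply: ler_wpM2l => //; lra.
have g9 := ler_wpM2l (addr_ge0 (ler0n R 2) (mulr_ge0 (ler0n R 2) b0)) h2.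
move: h5 h6; rewrite !ler_norml => /andP[h5a h5b] /andP[h6a h6b].
have : - `|srcB t| <= srcB t <= `|srcB t| by rewrite -ler_norml.
have w0 : 0 <= wenergy t.
  by apply: (@hsum_ge0 _ (fun i => ka i t * U i t)) => i; rewrite mulr_ge0.
move: h3 h3' h4 h4' h5a h5b h6a h6b g8 g9 w0; rewrite /cB.
move: (srcB t) `|srcB t| (GU t) (wenergy t) (err t) (bdry t) (th N t * _).
move: (h * (\sum_(i < N.+1) _) / 2) (\sum_(i < N) (th i.+1 t - th i t) * _) (h * _) => x1 x2 x3.
move=> s1 s2 g w er bd x4 * ; split_lra.
Qed.

Let energy_ge0 t : 0 <= energy t.
Proof.
have hg : 0 <= h by exact: ltW.
apply: addr_ge0; rewrite divr_ge0//.
  by apply: (@hsum_ge0 _ (fun i => th i.+1 t * a i.+1 t ^+ 2)) => i; rewrite mulr_ge0// sqr_ge0.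
by apply: (@hsum_ge0 _ (fun i => th i t * W i t ^+ 2)) => i; rewrite mulr_ge0// sqr_ge0.
Qed.

Let th_a (t : R) : h * (\sum_(i < N) th i.+1 t * a i.+1 t ^+ 2) <= 2 * energy t.
Proof.
have : 0 <= h * (\sum_(i < N.+1) th i t * W i t ^+ 2).
  by apply: (@hsum_ge0 _ (fun i => th i t * W i t ^+ 2)) => i; rewrite mulr_ge0// sqr_ge0.
by rewrite /energy; move: (h * _) (h * _) => x y; lra.
Qed.

(** [W i] comes with the weight of the next node; the shift costs a factor 2 and an error in [h^2],
    which [crude_sumW] absorbs. *)
Let th_av (t : R) : 0 <= t <= 1 ->
  h * (\sum_(i < N) th i.+1 t * av i t ^+ 2) <= 3 * energy t + M * data.
Proof.
move=> t01; have hg : 0 <= h by exact: ltW.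
have h1' : h * (\sum_(i < N.+1) th i t * W i t ^+ 2) <= 2 * energy t.
  have : 0 <= h * (\sum_(i < N) th i.+1 t * a i.+1 t ^+ 2).
   by apply: (@hsum_ge0 _ (fun i => th i.+1 t * a i.+1 t ^+ 2)) => i; rewrite mulr_ge0// sqr_ge0.
  by rewrite /energy; move: (h * _) (h * _) => x y; lra.
have h2 := ler_wpM2l M0 (crude_sumW t01).
have n0 i : 0 <= th i t * W i t ^+ 2 by rewrite mulr_ge0// sqr_ge0.
have s1 : \sum_(i < N) th i.+1 t * W i.+1 t ^+ 2 <= \sum_(i < N.+1) th i t * W i t ^+ 2.
  by rewrite big_ord_recl/= lerDr.
have s2 : \sum_(i < N) th i.+1 t * W i t ^+ 2 <=
   2 * \sum_(i < N.+1) th i t * W i t ^+ 2 + M * \sum_(i < N.+1) h ^+ 2 * W i t ^+ 2.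
  rewrite !mulr_sumr -big_split/= big_ord_recr/=; apply: ler_wpDr.
   by rewrite addr_ge0// mulr_ge0// mulr_ge0// sqr_ge0.
  apply: ler_sum => i _; have := ler_wpM2r (sqr_ge0 (W i t)) (th_step2 i t).
  by move: (W i t ^+ 2) => w; lra.
have s3 : \sum_(i < N) th i.+1 t * av i t ^+ 2 <= 2^-1 * (\sum_(i < N) th i.+1 t * W i.+1 t ^+ 2
   + \sum_(i < N) th i.+1 t * W i t ^+ 2).
  rewrite -big_split/= mulr_sumr ler_sum// => i _; rewrite -mulrDr [leRHS]mulrCA.
  apply: ler_wpM2l => //; rewrite /av; have := sqr_ge0 (W i.+1 t - W i t); lra.
have s4 : \sum_(i < N) th i.+1 t * av i t ^+ 2 <=
   3 / 2 * (\sum_(i < N.+1) th i t * W i t ^+ 2) + M / 2 * \sum_(i < N.+1) h ^+ 2 * W i t ^+ 2 by lra.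
apply: (le_trans (ler_wpM2l hg s4)); move: h1' h2.
move: (\sum_(i < N.+1) th i t * W i t ^+ 2) (\sum_(i < N.+1) h ^+ 2 * W i t ^+ 2) => x y; lra.
Qed.

Section with_energy_bound.
(** Pairing the solution with a residual that is small in L1 in time requires a supremum of the
    energy. It is kept as a third unknown [Q], besides [J] and [phi0]. *)
Context (Q : R).
Hypothesis energyQ : forall t : R, 0 <= t <= 1 -> energy t <= Q.

Let g := Num.sqrt (3 * Q + M * data).

Let Q0 : 0 <= Q.
Proof. by apply: le_trans (energyQ (t := 0) _); rewrite ?energy_ge0 ?lexx ?ler01. Qed.

Let MD0 : 0 <= M * data. Proof. by rewrite mulr_ge0. Qed.

Let srcA_le (t : R) : 0 <= t <= 1 ->
  srcA t <= 2 * omega * (2 * GU t + k * err t) + sigma + rho_norm t * g.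
Proof.
move=> t01; have /andP[t0 _] := t01.
apply: (le_trans (ler_norm _)); rewrite /srcA.
apply: (le_trans (source_le (fun i => av i t) t01)).
have [g1 _ _ _] := err_ge t; have k0 : 0 <= k by have := k1; lra.
apply: lerD; last first.
  apply: ler_wpM2l; first exact: sqrtr_ge0.
  by apply: ler_wsqrtr; apply: (le_trans (th_av t01)); rewrite lerD2r ler_pM2l// energyQ.
rewrite lerD2r ler_pM2l ?mulr_gt0//; apply: (le_trans (sum_ka_av t0)).
by rewrite lerD2l ler_wpM2l.
Qed.

Let srcB_le (t : R) : 0 <= t <= 1 ->
  `|srcB t| <= 2 * omega * (4 * GU t) + sigma + rho_norm t * g.
Proof.
move=> t01; rewrite /srcB; apply: (le_trans (source_le (fun i => a i.+1 t) t01)).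
apply: lerD; last first.
  apply: ler_wpM2l; first exact: sqrtr_ge0.
  apply: ler_wsqrtr; apply: (le_trans (th_a t)); have := energyQ t01; have := Q0; have := MD0; lra.
by rewrite lerD2r ler_pM2l ?mulr_gt0//; exact: sum_ka_a.
Qed.

(** Time integral of all source terms. The last two summands are Young's inequality for the product
    of the L1 norm of the residual with [g]. *)
Definition src_bound := 2 * omega * (4 * (2 * J + 3 * M * data) + 3 * k * data) + sigma
  + omega * (3 * Q + M * data) + data / (4 * omega).

Let rho_g : intg rho_norm 0 1 * g <= omega * (3 * Q + M * data) + data / (4 * omega).
Proof.
have [_ _ [_ _ _ D4 _]] := data_ge.
have q0 : 0 <= 3 * Q + M * data by have := Q0; have := MD0; lra.
have <- : g ^+ 2 = 3 * Q + M * data by rewrite sqr_sqrtr.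
have o0 : 0 < 4 * omega by have := omega0; lra.
apply: (@le_trans _ _ (omega * g ^+ 2 + intg rho_norm 0 1 ^+ 2 / (4 * omega))); last first.
  by rewrite lerD2l ler_pM2r ?invr_gt0.
rewrite -subr_ge0 (_ : _ - _ = (2 * omega * g - intg rho_norm 0 1) ^+ 2 / (4 * omega)).
  by rewrite divr_ge0 ?sqr_ge0// ltW.
by field; rewrite gt_eqF.
Qed.

Let th1N i : (i < N)%N -> th i.+1 1 = 0. Proof. by move=> iN; rewrite th1. Qed.

(** The weight vanishes at time 1, so only the value of [sideways] at time 0 remains; there the
    slopes belong to [data] and Young's inequality leaves a small multiple of [phi0]. *)
Lemma multiplier_sideways : nu * J <= omega * phi0 + data / (4 * omega) + 3 * cA * data + src_bound.
Proof.
pose RA t := - nu * wenergy t + (cA + 2 * omega * k) * err t + 4 * omega * GU t + g * rho_norm t + sigma.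
have k0 : 0 <= k by have := k1; lra.
have c1 : continuous (fun t => - nu * wenergy t) by cont.
have c2 : continuous (fun t => (cA + 2 * omega * k) * err t) by cont.
have c3 : continuous (fun t => 4 * omega * GU t) by cont.
have c4 : continuous (fun t => g * rho_norm t) by cont.
have c12 := contD c1 c2; have c123 := contD c12 c3; have c1234 := contD c123 c4.
have cRA : continuous RA by apply: contD c1234 (@contC R sigma).
have H := intg_ge_of_derive is_derive_sideways cRA (@ler01 R).
have : forall t : R, 0 <= t <= 1 -> dsideways t <= RA t.
  move=> t t01; apply: (le_trans (dsideways_le t01)); have := srcA_le t01; rewrite /RA; lra.
move=> /H; rewrite /RA (intgD _ _ c1234 (@contC R sigma)) (intgD _ _ c123 c4) (intgD _ _ c12 c3) (intgD _ _ c1 c2).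
rewrite (intgZ _ _ _ cwenergy) (intgZ _ _ _ cerr) (intgZ _ _ _ cGU) (intgZ _ _ _ crho_norm) intg_cst -/J.
have -> : sideways 1 = 0.
  by rewrite /sideways big1 ?mulr0// => i _; rewrite th1N// mul0r.
have s0 : sideways 0 <= omega * phi0 + data / (4 * omega).
  have [_ _ [D1 _ _ _ _]] := data_ge.
  have o0 : 0 < 4 * omega by have := omega0; lra.
  have iB : 0 <= intg jumps 0 1 by apply: intg_ge0.
  have D1' : h * (\sum_(i < N.+1) W i 0 ^+ 2) <= data by lra.
  apply: (@le_trans _ _ (omega * phi0 + h * (\sum_(i < N.+1) W i 0 ^+ 2) / (4 * omega))); last first.
   by rewrite lerD2l ler_pM2r ?invr_gt0.
  have av2 : \sum_(i < N) av i 0 ^+ 2 <= \sum_(i < N.+1) W i 0 ^+ 2.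
   have x1 : \sum_(i < N) W i 0 ^+ 2 <= \sum_(i < N.+1) W i 0 ^+ 2.
   by rewrite big_ord_recr/= lerDl sqr_ge0.
   have x2 : \sum_(i < N) W i.+1 0 ^+ 2 <= \sum_(i < N.+1) W i 0 ^+ 2.
   by rewrite big_ord_recl/= lerDr sqr_ge0.
   apply: (@le_trans _ _ (2^-1 * (\sum_(i < N) W i.+1 0 ^+ 2 + \sum_(i < N) W i 0 ^+ 2))); last by lra.
   rewrite -big_split/= mulr_sumr ler_sum// => i _.
   by rewrite /av; have := sqr_ge0 (W i.+1 0 - W i 0); lra.
  apply: (@le_trans _ _ (omega * phi0 + h * (\sum_(i < N) av i 0 ^+ 2) / (4 * omega))); last first.
   by rewrite lerD2l ler_pM2r ?invr_gt0// ler_pM2l.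
  rewrite /sideways /phi0 mulrCA -[X in _ <= _ + X]mulrA -mulrDr ler_pM2l//.
  rewrite mulr_sumr mulr_suml -big_split/=; apply: ler_sum => i _.
  have t1' := @th_le1 i.+1 0 (ltn_ord i) (lexx 0).
  apply: (@le_trans _ _ (th i.+1 0 * (omega * a i.+1 0 ^+ 2 + av i 0 ^+ 2 / (4 * omega)))).
   apply: ler_wpM2l => //.
   rewrite -subr_ge0 (_ : _ - _ = (2 * omega * a i.+1 0 - av i 0) ^+ 2 / (4 * omega)).
   by rewrite divr_ge0 ?sqr_ge0// ltW.
   by field; rewrite gt_eqF.
  rewrite mulrDr mulrCA lerD2l ler_piMl// divr_ge0 ?sqr_ge0// ltW//.
have i1 := int_err; have i2 := intGU; have i3 := rho_g.
have cA0 : 0 <= cA + 2 * omega * k.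
  have := mulr_ge0 (ltW omega0) k0; have := mulr_ge0 k0 (ltW (lt_trans (ltr01) beta0)).
  by rewrite /cA; have := M0; lra.
have i4 := ler_wpM2l cA0 i1.
have o4 : 0 <= 4 * omega by have := omega0; lra.
have i5 := ler_wpM2l o4 i2.
have i6 : 0 <= omega * (2 * J + 3 * M * data) by rewrite mulr_ge0 ?(ltW omega0)// (le_trans _ i2)// intg_ge0.
move: s0 i3 i4 i5 i6; rewrite /src_bound.
move: (intg rho_norm 0 1) (intg err 0 1) (intg GU 0 1) (sideways 0) (data / (4 * omega)) sigma.
move=> x1 x2 x3 x4 x5 x6; lra.
Qed.

Let energy_var (t1 t2 : R) : 0 <= t1 -> t1 <= t2 -> t2 <= 1 ->
  `|energy t2 - energy t1| <= (5 + 4 * beta) * J + 3 * cB * data + src_bound.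
Proof.
move=> t10 t12 t21.
pose RB t := (5 + 4 * beta) * wenergy t + cB * err t + 8 * omega * GU t + g * rho_norm t + sigma.
have k0 : 0 <= k by have := k1; lra.
have c1 : continuous (fun t => (5 + 4 * beta) * wenergy t) by cont.
have c2 : continuous (fun t => cB * err t) by cont.
have c3 : continuous (fun t => 8 * omega * GU t) by cont.
have c4 : continuous (fun t => g * rho_norm t) by cont.
have c12 := contD c1 c2; have c123 := contD c12 c3; have c1234 := contD c123 c4.
have cRB : continuous RB by apply: contD c1234 (@contC R sigma).
have hb : forall t : R, 0 <= t <= 1 -> `|denergy t| <= RB t.
  move=> t t01; apply: (le_trans (denergy_le t01)); have := srcB_le t01; rewrite /RB; lra.
have RB0 t : 0 <= t <= 1 -> 0 <= RB t by move=> /hb; apply: le_trans.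
have in12 t : t1 <= t <= t2 -> 0 <= t <= 1.
  by move=> /andP[x y]; rewrite (le_trans t10 x) (le_trans y t21).
have iRB : intg RB t1 t2 <= (5 + 4 * beta) * J + 3 * cB * data + src_bound.
  apply: (@le_trans _ _ (intg RB 0 1)).
   rewrite (intg_chasles _ t1 0 1) (intg_chasles _ t2 t1 1).
   have : 0 <= intg RB 0 t1.
   by apply: intg_ge0 => // t /andP[x y]; apply: RB0; rewrite x (le_trans y)// (le_trans t12).
   have : 0 <= intg RB t2 1.
   by apply: intg_ge0 => // t /andP[x y]; apply: RB0; rewrite y (le_trans _ x)// (le_trans t10).
   lra.
  rewrite /RB (intgD _ _ c1234 (@contC R sigma)) (intgD _ _ c123 c4) (intgD _ _ c12 c3) (intgD _ _ c1 c2).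
  rewrite (intgZ _ _ _ cwenergy) (intgZ _ _ _ cerr) (intgZ _ _ _ cGU) (intgZ _ _ _ crho_norm) intg_cst -/J.
  have i1 := int_err; have i2 := intGU; have i3 := rho_g.
  have cB0 : 0 <= cB.
   by rewrite /cB !addr_ge0// mulr_ge0//; have := beta0; lra.
  have i4 := ler_wpM2l cB0 i1.
  have o8 : 0 <= 8 * omega by have := omega0; lra.
  have i5 := ler_wpM2l o8 i2.
  have i6 : 0 <= omega * (k * data) by rewrite mulr_ge0 ?(ltW omega0)// mulr_ge0.
  move: i3 i4 i5 i6; rewrite /src_bound.
  move: (intg rho_norm 0 1) (intg err 0 1) (intg GU 0 1) (data / (4 * omega)) sigma => x1 x2 x3 x5 x6.
  lra.
apply: le_trans iRB; rewrite ler_norml.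
have n1 := intg_ge_of_derive is_derive_energy cRB t12.
have dNE t : is_derive t (1 : R) (fun t => - energy t) (- denergy t) by apply: is_deriveN.
have n2 := intg_ge_of_derive dNE cRB t12.
have : forall t, t1 <= t <= t2 -> denergy t <= RB t.
  by move=> t /in12/hb; apply: le_trans; rewrite ler_norm.
move=> /n1 m1; have : forall t, t1 <= t <= t2 -> - denergy t <= RB t.
  by move=> t /in12/hb; apply: le_trans; rewrite -normrN ler_norm.
by move=> /n2 m2; split_lra.
Qed.

(** The energy is 0 at time 1, hence its value at time 0, which is at least [phi0 / 2], is bounded
    by its variation. *)
Lemma multiplier_energy : phi0 / 2 <= (5 + 4 * beta) * J + 3 * cB * data + src_bound.
Proof.
apply: le_trans (energy_var (lexx 0) ler01 (lexx 1)); rewrite -normrN.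
apply: le_trans (ler_norm _).
have -> : energy 1 = 0.
  rewrite /energy !big1 ?mulr0 ?mul0r ?addr0// => i _; first by rewrite th1 ?mul0r// -ltnS.
  by rewrite th1N// mul0r.
have : 0 <= h * (\sum_(i < N.+1) th i 0 * W i 0 ^+ 2).
  by apply: (@hsum_ge0 _ (fun i => th i 0 * W i 0 ^+ 2)) => i; rewrite mulr_ge0// sqr_ge0.
by rewrite /energy /phi0; move: (h * _) (h * _) => x y; lra.
Qed.

Lemma multiplier_energy_le (t : R) : 0 <= t <= 1 ->
  energy t <= phi0 / 2 + data + (5 + 4 * beta) * J + 3 * cB * data + src_bound.
Proof.
move=> /andP[t0 t1]; have := energy_var (lexx 0) t0 t1.
have e0 : energy 0 <= phi0 / 2 + data.
  have [_ _ [D1 _ _ _ _]] := data_ge.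
  have iB : 0 <= intg jumps 0 1 by apply: intg_ge0.
  rewrite /energy /phi0 lerD2l; apply: (@le_trans _ _ (h * (\sum_(i < N.+1) W i 0 ^+ 2))); last by lra.
  apply: (@le_trans _ _ (h * (\sum_(i < N.+1) th i 0 * W i 0 ^+ 2))).
   rewrite ler_pdivrMr// ler_peMr//; last by rewrite ler1n.
   by apply: (@hsum_ge0 _ (fun i => th i 0 * W i 0 ^+ 2)) => i; rewrite mulr_ge0// sqr_ge0.
  rewrite ler_pM2l// ler_sum// => i _; rewrite ler_piMl ?sqr_ge0// th_le1//.
  by rewrite -ltnS.
move=> /(le_trans (ler_norm _)); lra.
Qed.

End with_energy_bound.

(** [Q] is the maximum of the energy on [[0, 1]]. The first inequality bounds [J] by terms that
    [omega], and [1 / k] for those with [Rb] and [m], make small; the other two bound [phi0] and [Q]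
    through [J]. *)
Lemma multiplier_system : exists Q,
  let src := 2 * omega * (4 * (2 * intg wenergy 0 1 + 3 * M * data) + 3 * k * data)
   + (Rb ^+ 2 * (K * (phi0 + data)) +
   m ^+ 2 * (2 * data + 8 / k * (2 * intg wenergy 0 1 + 3 * M * data))) / (4 * omega * k)
   + omega * (3 * Q + M * data) + data / (4 * omega) in
  [/\ [/\ 0 <= intg wenergy 0 1, 0 <= data, 0 <= phi0 & 0 <= Q],
   (beta - 1 - mu) * intg wenergy 0 1 <= omega * phi0 + data / (4 * omega) + 3 * cA * data + src,
   phi0 / 2 <= (5 + 4 * beta) * intg wenergy 0 1 + 3 * cB * data + src &
   Q <= phi0 / 2 + data + (5 + 4 * beta) * intg wenergy 0 1 + 3 * cB * data + src].
Proof.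
have [t0 t01 max0] := @EVT_max _ energy 0 1 ler01
  (continuous_subspaceT (derive_cont is_derive_energy)).
have eQ (t : R) : 0 <= t <= 1 -> energy t <= energy t0 by move=> tI; apply: max0; rewrite in_itv.
exists (energy t0); have k0 : 0 < k by have := k1; lra.
have c0 : 0 < 4 * omega * k by rewrite !mulr_gt0//; have := omega0; lra.
have hs : sigma <= (Rb ^+ 2 * (K * (phi0 + data)) +
   m ^+ 2 * (2 * data + 8 / k * (2 * J + 3 * M * data))) / (4 * omega * k).
  rewrite /sigma ler_pM2r ?invr_gt0// lerD2l; apply: ler_wpM2l; first exact: sqr_ge0.
  by rewrite lerD2l ler_pM2l ?divr_gt0// intGU.
have w0 t : 0 <= wenergy t.
  by apply: (@hsum_ge0 _ (fun i => ka i t * U i t)) => i; rewrite mulr_ge0.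
have p0 : 0 <= phi0.
  by apply: (@hsum_ge0 _ (fun i => th i.+1 0 * a i.+1 0 ^+ 2)) => i; rewrite mulr_ge0// sqr_ge0.
have h1' := multiplier_sideways eQ; have h2 := multiplier_energy eQ.
have h3 := @multiplier_energy_le _ eQ t0.
have {}h3 := h3 t01; rewrite /nu /src_bound in h1' h2 h3.
split; first by split => //; apply: intg_ge0.
- by apply: (le_trans h1'); rewrite lerD2l !lerD2r lerD2l.
- by apply: (le_trans h2); rewrite lerD2l !lerD2r lerD2l.
- by apply: (le_trans h3); rewrite lerD2l !lerD2r lerD2l.
Qed.

End multipliers.

(** * The discrete Carleman estimate *)

Section carleman.
Context {R : realType}.

(** Let [T = J + P + Q]. The last two inequalities give [T <= (1 + 4 c1) J + 68 omega T + 4 C D],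
    the first gives [J <= (17 omega T + C D) / nu], and [omega] makes the total factor of [T] equal
    to [1/2]. It is chosen before [C], which may therefore contain negative powers of [omega]. *)
Lemma linear_system (nu c1 : R) : 0 < nu -> 0 <= c1 -> exists2 omega, 0 < omega &
  forall C, 0 <= C -> exists2 C', 0 <= C' & forall J P Q D : R,
  0 <= J -> 0 <= P -> 0 <= Q -> 0 <= D ->
  nu * J <= omega * (2 * P + 17 * J + 3 * Q) + C * D ->
  P / 2 <= c1 * J + omega * (P + 17 * J + 3 * Q) + C * D ->
  Q <= P / 2 + c1 * J + omega * (P + 17 * J + 3 * Q) + C * D -> P <= C' * D.
Proof.
move=> nu0 c10; pose A := (1 + 4 * c1) * 17 / nu + 68.
have d0 : 0 <= (1 + 4 * c1) / nu by rewrite divr_ge0 ?(ltW nu0)//; lra.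
have A0 : 0 < A by rewrite /A mulrAC; lra.
have o0 : 0 < (2 * A)^-1 by rewrite invr_gt0; lra.
exists (2 * A)^-1 => // C C0.
exists (2 * (((1 + 4 * c1) / nu + 4) * C)) => [|J P Q D J0 P0 Q0 D0 h1 h2 h3].
  by rewrite !mulr_ge0//; lra.
set om := (2 * A)^-1 in o0 h1 h2 h3.
pose T := J + P + Q; have T0 : 0 <= T by rewrite /T; lra.
have CD : 0 <= C * D by rewrite mulr_ge0.
have x1 : 2 * P + 17 * J + 3 * Q <= 17 * T by rewrite /T; lra.
have x2 : P + 17 * J + 3 * Q <= 17 * T by rewrite /T; lra.
have y1 := ler_wpM2l (ltW o0) x1; have y2 := ler_wpM2l (ltW o0) x2.
have z1 : J <= (17 * (om * T) + C * D) / nu by rewrite ler_pdivlMr// mulrC; lra.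
have c4 : 0 <= 1 + 4 * c1 by lra.
have z2 := ler_wpM2l c4 z1.
have z3 : T <= (1 + 4 * c1) * ((17 * (om * T) + C * D) / nu) + 68 * (om * T) + 4 * (C * D).
  by rewrite {1}/T; lra.
have e1 : (1 + 4 * c1) * ((17 * (om * T) + C * D) / nu) + 68 * (om * T) + 4 * (C * D) =
   A * om * T + ((1 + 4 * c1) / nu + 4) * C * D by rewrite /A; field; rewrite gt_eqF.
have e2 : A * om = 2^-1 by rewrite /om; field; rewrite gt_eqF.
rewrite e1 e2 in z3.
have : P <= T by rewrite /T; lra.
move: (((1 + 4 * c1) / nu + 4) * C) z3 => Y z3; lra.
Qed.

Lemma mesh_gt0 N : 0 < mesh N :> R.
Proof. by rewrite invr_gt0 ltr0n. Qed.

Lemma meshM N : mesh N * N.+1%:R = 1 :> R.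
Proof. by rewrite mulVf// pnatr_eq0. Qed.

Lemma mesh_le1 N : mesh N <= 1 :> R.
Proof. by rewrite invf_le1 ?ltr0n// ler1n. Qed.

Lemma node_le1 N j : (j <= N.+1)%N -> j%:R * mesh N <= 1 :> R.
Proof. by move=> jN; rewrite ler_pdivrMr ?ltr0n// mul1r ler_nat. Qed.

(** For [beta > 1] the argument is nonpositive at every node when [t >= 1], and at node 0 when
    [t >= 0]; its largest value over [t >= 0] is 1, at [x = 1] and [t = 0]. *)
Definition weight (beta : R) n N (j : nat) (t : R) : R :=
  pospow n (1 - beta * (1 - j%:R * mesh N) - t).

(** The source is bounded by the initial velocity that is being estimated, so the estimate closes
    only because the exponent [n] makes its factor small. Neither [n] nor [C] depends on [N]. *)
Lemma discrete_carleman (beta Rb m K : R) : 1 < beta -> 0 <= K ->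
  exists n C, 0 <= C /\ forall N (Z a acc : nat -> R -> R) (f q : nat -> R)
   (Rr rho : nat -> R -> R) (e : nat -> R),
  (forall j t, (j <= N.+1)%N -> is_derive t (1 : R) (Z j) (a j t)) ->
  (forall j, (j <= N.+1)%N -> continuous (a j)) ->
  (forall i t, (i < N)%N -> is_derive t (1 : R) (a i.+1) (acc i.+1 t)) ->
  (forall i, (i < N)%N -> continuous (rho i.+1)) ->
  (forall i (t : R), (i < N)%N -> 0 <= t <= 1 -> `|Rr i.+1 t| <= Rb) ->
  (forall i, (i < N)%N -> `|q i.+1| <= m) ->
  (forall i, (i < N)%N -> f i.+1 ^+ 2 <= K * (a i.+1 0 ^+ 2 + e i.+1 ^+ 2)) ->
  (forall i (t : R), (i < N)%N -> 0 <= t <= 1 ->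
   acc i.+1 t - laplacian_h N (Z^~ t) i.+1 + q i.+1 * Z i.+1 t = f i.+1 * Rr i.+1 t - rho i.+1 t) ->
  mesh N * \sum_(i < N) weight beta n N i.+1 0 * a i.+1 0 ^+ 2 <= C * data N (mesh N) Z a rho e.
Proof.
move=> b1 K0; have b0 : 0 < beta by apply: lt_trans b1.
pose mu := Num.min 1 ((beta - 1) / 2).
have mu0 : 0 < mu by rewrite lt_min ltr01 divr_gt0// subr_gt0.
have mu1 : mu <= 1 by rewrite ge_min lexx.
have mub : mu <= (beta - 1) / 2 by rewrite ge_min lexx orbT.
have nu0 : 0 < beta - 1 - mu by lra.
have c10 : 0 <= 5 + 4 * beta by lra.
have [om om0 H] := linear_system nu0 c10.
(* With [k >= x] the coefficients [Rb^2 K / (4 omega k)] and [16 m^2 / (4 omega k)] of the sources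
   are at most [omega]; the 16 comes from [8 / k * 2 J] and [k >= 1]. *)
pose x := (Rb ^+ 2 * K + 16 * m ^+ 2) / (4 * om ^+ 2).
have x0 : 0 <= x.
  by apply: divr_ge0; [apply: addr_ge0|]; apply: mulr_ge0 => //; exact: sqr_ge0.
pose n := (Num.bound x).+1.
pose k : R := n.+2%:R.
have xk : x <= k.
  rewrite (le_trans (ltW (archi_boundP x0)))// ler_nat.
  by rewrite /n; do 3 apply: leqW.
have k1 : 1 <= k by rewrite ler1n.
have k0 : 0 < k by apply: lt_le_trans k1.
have [C1 C10 P1] := @pospow_add_le R n.+1 mu mu0.
have [C2 C20 P2] := @pospow_add_le R n.+2 1 ltr01.
(* Additive constants of [pospow_add_le] for a shift by [beta h]; powers of [h] beyond the second
   are bounded by means of [h <= 1]. *)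
pose M := k * C1 * beta ^+ n.+1 + C2 * beta ^+ n.+2.
have bn i : 0 <= beta ^+ i by rewrite exprn_ge0// ltW.
have M0 : 0 <= M by rewrite /M addr_ge0// mulr_ge0// mulr_ge0// ltW.
pose Cs := (Rb ^+ 2 * K + m ^+ 2 * (2 + 24 * M)) / (4 * om * k).
have ok0 : 0 < 4 * om * k by rewrite !mulr_gt0.
have Cs0 : 0 <= Cs.
  rewrite /Cs divr_ge0 ?(ltW ok0)// addr_ge0// mulr_ge0 ?sqr_ge0//; lra.
pose C := (4 * om)^-1 + 1 + 3 * (M + k * (1 + beta) + 1) + 3 * (k + 1 + (2 + 2 * beta) * M)
  + 2 * om * (12 * M + 3 * k) + Cs + om * M + (4 * om)^-1.
have o4 : 0 <= (4 * om)^-1 by rewrite invr_ge0 mulr_ge0// ltW.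
have kb : 0 <= k * (1 + beta) by rewrite mulr_ge0 ?(ltW k0)//; lra.
have bM : 0 <= (2 + 2 * beta) * M by rewrite mulr_ge0//; lra.
have oM : 0 <= om * M by rewrite mulr_ge0// ltW.
have ok : 0 <= om * k by rewrite mulr_ge0// ltW.
have C0 : 0 <= C by rewrite /C; lra.
have [C' C'0 {}H] := H C C0.
exists n.+2, C'; split=> // N Z a acc f q Rr rho e dZ ca da crho HR Hq Hf Heq.
pose c j : R := 1 - beta * (1 - j%:R * mesh N).
pose th j (t : R) := pospow n.+2 (c j - t).
pose ka j (t : R) := k * pospow n.+1 (c j - t).
pose sg j (t : R) := pospow n.+3 (c j - t).
have h0 := mesh_gt0 N.
have cS j : c j.+1 = c j + beta * mesh N by rewrite /c -natr1; ring.
have c_le1 j : (j <= N.+1)%N -> c j <= 1.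
  by move=> /node_le1 jN; rewrite /c lerBlDr lerDl mulr_ge0 ?(ltW b0)// subr_ge0.
have bh0 : 0 <= beta * mesh N by rewrite mulr_ge0// ltW.
have cth j : continuous (ka j).
  apply: contM; first exact: contC.
  move=> t; apply: (@continuous_comp _ _ _ (fun t => c j - t) (pospow n.+1)); last exact: cont_pospow.
  by apply: continuousB; [exact: cst_continuous|exact: cvg_id].
have dth j (t : R) : is_derive t (1 : R) (th j) (- ka j t).
  have d1 : is_derive t (1 : R) (fun t => c j - t) (- 1).
   by rewrite -[- 1]add0r; apply: is_deriveB.
  have d2 := @is_derive_pospow R n (c j - t).
  have := @is_derive1_comp _ (pospow n.+2) (fun t => c j - t) t _ _ d2 d1.
  by rewrite mulrN1.
have hn1 i : (2 <= i)%N -> mesh N ^+ i <= mesh N ^+ 2 :> R.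
  by move=> i2; apply: ler_wiXn2l => //; [exact: ltW|exact: mesh_le1].
have kaS j (t : R) : ka j.+1 t <= (1 + mu) * ka j t + M * mesh N ^+ 2.
  rewrite /ka cS (addrAC (c j)).
  have := ler_wpM2l (ltW k0) (P1 (c j - t) _ bh0).
  rewrite exprMn => /le_trans; apply; rewrite mulrDr mulrCA lerD2l.
  have := hn1 n.+1 isT => hh.
  apply: (@le_trans _ _ (k * C1 * beta ^+ n.+1 * mesh N ^+ 2)).
   rewrite (_ : k * (C1 * _) = k * C1 * beta ^+ n.+1 * mesh N ^+ n.+1); last by ring.
   by apply: ler_wpM2l => //; rewrite mulr_ge0// mulr_ge0// ltW.
  apply: ler_wpM2r; first exact: sqr_ge0.
  by rewrite /M lerDl mulr_ge0.
have thS j (t : R) : th j.+1 t <= 2 * th j t + M * mesh N ^+ 2.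
  rewrite /th cS (addrAC (c j)); apply: (le_trans (P2 _ _ bh0)).
  rewrite lerD2l exprMn; have hh := hn1 n.+2 isT.
  apply: (@le_trans _ _ (C2 * beta ^+ n.+2 * mesh N ^+ 2)).
   rewrite (_ : C2 * _ = C2 * beta ^+ n.+2 * mesh N ^+ n.+2); last by ring.
   by apply: ler_wpM2l => //; rewrite mulr_ge0.
  apply: ler_wpM2r; first exact: sqr_ge0.
  by rewrite /M lerDr mulr_ge0// mulr_ge0// ltW.
have Weq : forall (i : nat) (t : R), (i < N)%N -> 0 <= t <= 1 ->
  acc i.+1 t = (slope (mesh N) Z i.+1 t - slope (mesh N) Z i t) / mesh N + source Z f q Rr rho i.+1 t.
  move=> i t iN t01; have /eqP := Heq i t iN t01; rewrite addrAC subr_eq => /eqP.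
  rewrite /laplacian_h /slope /source /= => /(canRL (addrK _)) ->.
  by field; rewrite gt_eqF.
have kan j t : 0 <= ka j t by rewrite /ka mulr_ge0 ?pospow_ge0// ltW.
have c00 (t : R) : 0 <= t -> c 0%N - t <= 0 by rewrite /c mul0r subr0 mulr1; lra.
have [] := @multiplier_system R N (mesh N) beta mu M k om th ka sg h0 (meshM N) b1 mu0 mu1 M0 k1 om0
  cth dth _ kan _ _ _ _ _ _ _ kaS thS _ _ _ Z a acc f q Rr rho Rb m K e dZ ca da crho K0 HR Hq Hf Weq.
- by move=> j t; exact: pospow_ge0.
- by move=> j t; exact: pospow_ge0.
- by move=> t t0; apply: pospow_le0; exact: c00.
- by move=> t t0; rewrite /ka pospow_le0 ?mulr0//; exact: c00.
- by move=> j jN; apply: pospow_le0; rewrite subr_le0; apply: c_le1; exact: leqW.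
- move=> j t jN t0; apply: pospow_le1; rewrite lerBlDr ler_wpDr//; apply: c_le1; exact: leqW.
- move=> j t jN t0; rewrite /ka ler_piMr ?(ltW k0)//; apply: pospow_le1.
  by rewrite lerBlDr ler_wpDr//; apply: c_le1; exact: leqW.
- move=> j t; rewrite /th /ka cS.
  have -> : mesh N * beta * (k * pospow n.+1 (c j - t)) = k * pospow n.+1 (c j - t) * (c j + beta * mesh N - t - (c j - t)).
   by ring.
  have -> : mesh N * beta * (k * pospow n.+1 (c j + beta * mesh N - t)) =
   k * pospow n.+1 (c j + beta * mesh N - t) * (c j + beta * mesh N - t - (c j - t)) by ring.
  by apply: pospow_convex; rewrite lerD2r lerDl.
- move=> j t u v; rewrite /th /ka /sg /pospow; set p := Num.max 0 (c j - t).
  have p0 : 0 <= p by rewrite le_max lexx.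
  rewrite -subr_ge0 (_ : _ - _ = p ^+ n.+1 * ((2 * om * k * v - p * u) ^+ 2 / (4 * om * k))).
   by rewrite mulr_ge0 ?exprn_ge0// divr_ge0 ?sqr_ge0// ltW.
  rewrite !(exprS p n.+2) (exprS p n.+1); field.
  by rewrite !gt_eqF.
- move=> j t jN t0; rewrite /sg /th subr0; apply: (@le_trans _ _ (pospow n.+3 (c j))).
   by apply: pospow_le; rewrite lerBlDr lerDl.
  by apply: pospow_decr => //; apply: c_le1; exact: leqW.
- move=> j s t jN /andP[s0 st]; rewrite /sg /ka mulrAC divff ?gt_eqF// mul1r.
  apply: (@le_trans _ _ (pospow n.+1 (c j - t))); last by apply: pospow_le; rewrite lerD2l lerN2.
  apply: pospow_decr; last by do 2 apply: leqW.
  by rewrite lerBlDr ler_wpDr ?(le_trans s0)//; apply: c_le1; exact: leqW.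
move=> Q [[J0 D0 P0 Q0] i1 i2 i3].
set D := data N (mesh N) Z a rho e in i1 i2 i3 D0 *.
set P := phi0 N (mesh N) th a in i1 i2 i3 P0 *.
have -> : mesh N * (\sum_(i < N) weight beta n.+2 N i.+1 0 * a i.+1 0 ^+ 2) = P by [].
set J := intg _ 0 1 in i1 i2 i3 J0 *.
have hs : (Rb ^+ 2 * (K * (P + D)) + m ^+ 2 * (2 * D + 8 / k * (2 * J + 3 * M * D))) / (4 * om * k)
   <= om * (P + J) + Cs * D.
  have kx : Rb ^+ 2 * K + 16 * m ^+ 2 <= om * (4 * om * k).
   have := ler_wpM2r (ltW (mulr_gt0 (ltr0n R 4) (exprn_gt0 2 om0))) xk.
   rewrite /x mulfVK ?gt_eqF// ?mulr_gt0 ?exprn_gt0//.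
   by rewrite (_ : k * (4 * om ^+ 2) = om * (4 * om * k))//; ring.
  have ki : k^-1 <= 1 by rewrite invf_le1.
  have JD0 : 0 <= 2 * J + 3 * M * D by rewrite addr_ge0// ?mulr_ge0.
  have k8 : 8 / k * (2 * J + 3 * M * D) <= 8 * (2 * J + 3 * M * D).
   by apply: ler_wpM2r => //; rewrite ler_piMr.
  have m8 := ler_wpM2l (sqr_ge0 m) k8.
  have mm := sqr_ge0 m; have RK : 0 <= Rb ^+ 2 * K by rewrite mulr_ge0 ?sqr_ge0.
  rewrite ler_pdivrMr// (_ : (om * (P + J) + Cs * D) * (4 * om * k) = om * (4 * om * k) * (P + J)
   + (Rb ^+ 2 * K + m ^+ 2 * (2 + 24 * M)) * D); last first.
   by rewrite /Cs; field; rewrite !gt_eqF.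
  have q1 := ler_wpM2r P0 kx; have q2 := ler_wpM2r J0 kx.
  have q3 := mulr_ge0 mm P0; have q4 := mulr_ge0 RK J0.
  move: q1 q2 q3 q4 m8; move: (om * (4 * om * k)) (8 / k * _) (m ^+ 2) (Rb ^+ 2) => Y U m2 Rb2.
  by move=> *; lra.
pose CA := (4 * om)^-1 + 3 * cA beta M k + 2 * om * (12 * M + 3 * k) + Cs + om * M + (4 * om)^-1.
pose CB := 1 + 3 * cB beta M k + 2 * om * (12 * M + 3 * k) + Cs + om * M + (4 * om)^-1.
have CAC : CA <= C by rewrite /CA /C /cA; lra.
have CBC : CB <= C by rewrite /CB /C /cB; lra.
have CAD := ler_wpM2r D0 CAC; have CBD := ler_wpM2r D0 CBC.
have D4 : D / (4 * om) = (4 * om)^-1 * D by rewrite mulrC.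
rewrite D4 in i1 i2 i3; apply: (H J P Q D) => //.
- move: hs i1 CAD; rewrite /CA; move: (_ / (4 * om * k)) (4 * om)^-1 => X y; lra.
- move: hs i2 CBD; rewrite /CB; move: (_ / (4 * om * k)) (4 * om)^-1 => X y; lra.
- move: hs i3 CBD; rewrite /CB; move: (_ / (4 * om * k)) (4 * om)^-1 => X y; lra.
Qed.

End carleman.

(** * Lp norms as integrals *)

Section Lp_norms.
Context {d : measure_display} {X : measurableType d} {R : realType}.
Variable mu : {measure set X -> \bar R}.
Implicit Types (D : set X) (f : X -> R) (e : R).

Lemma Lp_norm2E D f : Lp_norm mu D 2%:E f =
  ((\int[mu]_(x in D) ((f x) ^+ 2)%:E) `^ 2^-1)%E.
Proof.
rewrite /Lp_norm unlock; congr (_ `^ _)%E; rewrite [RHS]integral_mkcond.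
apply: eq_integral => x _; rewrite /= !patchE.
case: ifPn => _; last by rewrite normr0 powR0.
by rewrite powR_mulrn// real_normK ?num_real.
Qed.

Lemma sq_integral_ge0 D f : (0 <= \int[mu]_(x in D) ((f x) ^+ 2)%:E)%E.
Proof. by apply: integral_ge0 => x _; rewrite lee_fin sqr_ge0. Qed.

Lemma Lp_norm2_le D f e : 0 <= e ->
  (Lp_norm mu D 2%:E f <= e%:E)%E = (\int[mu]_(x in D) ((f x) ^+ 2)%:E <= (e ^+ 2)%:E)%E.
Proof.
move=> e0; rewrite Lp_norm2E; have := sq_integral_ge0 D f.
case: (\int[mu]_(x in D) ((f x) ^+ 2)%:E)%E => [r||] //=; last first.
  by rewrite invr_eq0 pnatr_eq0.
rewrite lee_fin => r0; rewrite !lee_fin powR12_sqrt//.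
apply/idP/idP => h.
  rewrite -(sqr_sqrtr r0); apply: lerXn2r => //; rewrite nnegrE ?sqrtr_ge0//.
by rewrite -(ger0_norm e0) -sqrtr_sqr ler_wsqrtr.
Qed.

Lemma Lp_norm2_lty D f : (Lp_norm mu D 2%:E f < +oo)%E ->
  (\int[mu]_(x in D) ((f x) ^+ 2)%:E < +oo)%E.
Proof.
rewrite Lp_norm2E; have := sq_integral_ge0 D f.
case: (\int[mu]_(x in D) ((f x) ^+ 2)%:E)%E => [r _ _||] //=; first exact: ltry.
by rewrite invr_eq0 pnatr_eq0.
Qed.

Lemma Lp_norm1E D f : Lp_norm mu D 1%E f = (\int[mu]_(x in D) (`|f x|)%:E)%E.
Proof.
rewrite /Lp_norm Lnorm1 [RHS]integral_mkcond; apply: eq_integral => x _.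
by rewrite /= !patchE; case: ifPn => // _; rewrite normr0.
Qed.

Lemma Lp_norm_ge0 D p f : (0 <= Lp_norm mu D p f)%E.
Proof. exact: Lnorm_ge0. Qed.

Lemma in_Lp_measurable D p f : measurable D -> in_Lp mu D p f -> measurable_fun D f.
Proof.
move=> mD; rewrite /in_Lp inE => /andP[/[!inE]/= mf _].
exact/(measurable_restrictT _ mD).
Qed.

Lemma in_Lp_norm D p f : in_Lp mu D p f -> (Lp_norm mu D p f < +oo)%E.
Proof. by rewrite /in_Lp inE => /andP[_ /[!inE]/=]. Qed.

End Lp_norms.

(** * Integrable and square integrable functions on an interval *)

Section interval_integrals.
Context {R : realType}.
Implicit Types (a b c s t e : R) (f g u v : R -> R).
Local Notation leb := (@lebesgue_measure R).

(** Integration over the open interval matches the norms of the statement and suits functions given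
    almost everywhere; [intg] is kept for continuous integrands, and [intL_intg] links the two. *)
Definition intL v a b : R := \int[leb]_(x in `]a, b[) v x.
Definition ible v a b := leb.-integrable `]a, b[ (EFin \o v).
Definition L2 v a b := measurable_fun `]a, b[ v /\ ible (fun x => v x ^+ 2) a b.

Lemma leb_oo a b : a <= b -> leb `]a, b[ = (b - a)%:E.
Proof.
move=> ab; rewrite lebesgue_measure_itv/= lte_fin; case: ltP => // ba.
by rewrite (_ : b - a = 0)//; apply/eqP; rewrite subr_eq0 eq_le ab ba.
Qed.

Lemma leb_oo_fin a b : (leb `]a, b[ < +oo)%E.
Proof.
have [/leb_oo->|ba] := leP a b; first exact: ltry.
by rewrite set_itv_ge ?measure0// -leNgt bnd_simp ltW.
Qed.

Lemma sub_oo a b s t : a <= s -> t <= b -> `]s, t[%classic `<=` `]a, b[%classic.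
Proof. by move=> as_ tb; apply: subset_itv; rewrite bnd_simp. Qed.

Lemma ible_sub v a b s t : a <= s -> t <= b -> ible v a b -> ible v s t.
Proof. by move=> as_ tb; apply: integrableS => //; exact: sub_oo. Qed.

Lemma ible_meas v a b : ible v a b -> measurable_fun `]a, b[ v.
Proof. by move=> /integrableP[/measurable_EFinP]. Qed.

Lemma ibleD u v a b : ible u a b -> ible v a b -> ible (fun x => u x + v x) a b.
Proof. by move=> iu iv; exact: (integrableD _ iu iv). Qed.

Lemma ibleZ c v a b : ible v a b -> ible (fun x => c * v x) a b.
Proof. by move=> iv; exact: (integrableZl _ c iv). Qed.

Lemma ibleN v a b : ible v a b -> ible (fun x => - v x) a b.
Proof.
by move=> iv; have := ibleZ (-1) iv; congr ible; apply/funext => x; rewrite mulN1r.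
Qed.

Lemma ibleB u v a b : ible u a b -> ible v a b -> ible (fun x => u x - v x) a b.
Proof. by move=> iu iv; exact: ibleD iu (ibleN iv). Qed.

Lemma ible_cst c a b : ible (fun=> c) a b.
Proof.
apply: measurable_bounded_integrable => //; first exact: leb_oo_fin.
by exists `|c|; split; [exact: num_real|move=> x cx y _; exact: ltW].
Qed.

Lemma ible_norm v a b : ible v a b -> ible (fun x => `|v x|) a b.
Proof. by move=> iv; exact: (integrable_norm iv). Qed.

Lemma ible_le u v a b : measurable_fun `]a, b[ u ->
  (forall x, a < x < b -> `|u x| <= v x) -> ible v a b -> ible u a b.
Proof.
move=> mu uv; apply: le_integrable => //; first exact/measurable_EFinP.
move=> x; rewrite /= in_itv/= => xab; rewrite lee_fin.
by apply: (le_trans (uv x xab)); exact: ler_norm.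
Qed.

Lemma ible_sum (I : Type) (r : seq I) (P : pred I) (v : I -> R -> R) a b :
  (forall i, P i -> ible (v i) a b) -> ible (fun x => \sum_(i <- r | P i) v i x) a b.
Proof.
move=> iv; have := @integrable_sum _ _ _ leb _ (measurable_itv `]a, b[) _ r P (fun i => EFin \o v i) iv.
by congr integrable; apply/funext => x /=; rewrite sumEFin.
Qed.

Lemma ible_cont v a b : {within `[a, b], continuous v} -> ible v a b.
Proof.
move=> cv; apply: (@integrableS _ _ _ leb `[a, b]) => //; first exact: subset_itv_oo_cc.
by apply: continuous_compact_integrable => //; exact: segment_compact.
Qed.

Lemma intLD u v a b : ible u a b -> ible v a b ->
  intL (fun x => u x + v x) a b = intL u a b + intL v a b.
Proof. by move=> iu iv; rewrite /intL RintegralD. Qed.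

Lemma intLB u v a b : ible u a b -> ible v a b ->
  intL (fun x => u x - v x) a b = intL u a b - intL v a b.
Proof. by move=> iu iv; rewrite /intL RintegralB. Qed.

Lemma intLZ c v a b : ible v a b -> intL (fun x => c * v x) a b = c * intL v a b.
Proof. by move=> iv; rewrite /intL RintegralZl. Qed.

Lemma intL_cst c a b : a <= b -> intL (fun=> c) a b = c * (b - a).
Proof. by move=> ab; rewrite /intL Rintegral_cst//= leb_oo. Qed.

Lemma intL_sum (I : Type) (r : seq I) (P : pred I) (v : I -> R -> R) a b :
  (forall i, P i -> ible (v i) a b) ->
  intL (fun x => \sum_(i <- r | P i) v i x) a b = \sum_(i <- r | P i) intL (v i) a b.
Proof.
move=> iv; elim: r => [|i r IH].
  rewrite big_nil (_ : (fun x => _) = fun=> 0).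
   by rewrite /intL Rintegral_cst// mul0r.
  by apply/funext => x; rewrite big_nil.
rewrite big_cons (_ : (fun x => _) = fun x => (if P i then v i x else 0) +
   \sum_(i <- r | P i) v i x); last first.
  by apply/funext => x; rewrite big_cons; case: ifP; rewrite ?add0r.
case: ifPn => Pi; first by rewrite intLD ?IH//; [exact: iv|exact: ible_sum].
rewrite intLD; [|exact: ible_cst|exact: ible_sum].
by rewrite IH /intL Rintegral_cst// mul0r add0r.
Qed.

Lemma intL_le u v a b : ible u a b -> ible v a b ->
  (forall x, a < x < b -> u x <= v x) -> intL u a b <= intL v a b.
Proof.
move=> iu iv uv; apply: le_Rintegral => // x; rewrite /= in_itv/=; exact: uv.
Qed.

Lemma intL_ge0 v a b : (forall x, a < x < b -> 0 <= v x) -> 0 <= intL v a b.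
Proof. by move=> v0; apply: Rintegral_ge0 => x; rewrite /= in_itv/=; exact: v0. Qed.

Lemma intL_norm v a b : ible v a b -> `|intL v a b| <= intL (fun x => `|v x|) a b.
Proof. by move=> iv; exact: le_normr_Rintegral. Qed.

Lemma eq_Rint u v a b : (forall x, a < x < b -> u x = v x) -> intL u a b = intL v a b.
Proof.
move=> uv; apply: eq_Rintegral => x; rewrite inE/= in_itv/=; exact: uv.
Qed.

Lemma eq_ible u v a b : (forall x, a < x < b -> u x = v x) -> ible u a b -> ible v a b.
Proof.
by move=> uv; apply: eq_integrable => // x; rewrite inE/= in_itv/= => /uv ->.
Qed.

Lemma intL_ge a b v : b <= a -> intL v a b = 0.
Proof.
by move=> ba; rewrite /intL set_itv_ge ?Rintegral_set0// bnd_simp -leNgt.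
Qed.

Lemma intL_cat v a b c : a <= b -> b <= c -> ible v a c ->
  intL v a c = intL v a b + intL v b c.
Proof.
move=> ab; rewrite le_eqVlt => /predU1P[->|bc] iv.
  by rewrite (intL_ge v (lexx c)) addr0.
move: (ab); rewrite le_eqVlt => /predU1P[->|ab'].
  by rewrite (intL_ge v (lexx b)) add0r.
have := @Rintegral_itvB _ v (BRight a) (BLeft c) b iv.
rewrite !bnd_simp => /(_ ab bc) h.
rewrite /intL -h (@Rintegral_itv_bndo_bndc _ (BRight a) b); first by rewrite addrC subrK.
exact: ible_sub (lexx a) (ltW bc) iv.
Qed.

Lemma intL_sub_le v a b s t : a <= s -> s <= t -> t <= b -> ible v a b ->
  (forall x, a < x < b -> 0 <= v x) -> intL v s t <= intL v a b.
Proof.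
move=> as_ st tb iv v0.
rewrite (@intL_cat v a s b)// ?(le_trans st)// (@intL_cat v s t b)//; last first.
  exact: ible_sub iv.
have : 0 <= intL v a s.
  by apply: intL_ge0 => x /andP[x1 x2]; apply: v0; rewrite x1 (lt_le_trans x2)// (le_trans st).
have : 0 <= intL v t b.
  apply: intL_ge0 => x /andP[x1 x2]; apply: v0; rewrite x2 andbT (le_lt_trans _ x1)//.
  exact: le_trans st.
lra.
Qed.

Lemma intL_intg v a b : continuous v -> a <= b -> intL v a b = intg v a b.
Proof.
move=> cv ab; rewrite (intgE cv ab) /intL.
have iv := continuous_integrable a b cv.
rewrite Rintegral_itv_bndo_bndc; last first.
  by apply: integrableS iv => //; exact: subset_itv_oo_cc.
rewrite Rintegral_itv_obnd_cbnd//.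
by apply: integrableS iv => //; exact: subset_itv_oc_cc.
Qed.

Lemma L2_sub v a b s t : a <= s -> t <= b -> L2 v a b -> L2 v s t.
Proof.
move=> as_ tb [mv iv]; split; last exact: ible_sub iv.
by apply: measurable_funS mv => //; exact: sub_oo.
Qed.

Lemma L2_ible v a b : L2 v a b -> ible v a b.
Proof.
move=> [mv iv]; apply: (@ible_le v (fun x => 1 + v x ^+ 2)) => // [x _|].
  have := sqr_ge0 (`|v x| - 1); rewrite sqrrB1 sqr_normr//.
  by have := sqr_ge0 (v x); lra.
by apply: ibleD => //; exact: ible_cst.
Qed.

Lemma L2M_ible u v a b : L2 u a b -> L2 v a b -> ible (fun x => u x * v x) a b.
Proof.
move=> [mu iu] [mv iv]; apply: (@ible_le _ (fun x => u x ^+ 2 + v x ^+ 2)) => [|x _|].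
- exact: measurable_funM.
- rewrite ler_norml; have := sqr_ge0 (u x + v x); have := sqr_ge0 (u x - v x).
  have := sqr_ge0 (u x); have := sqr_ge0 (v x).
  by move: (u x) (v x) => x1 x2 *; split_lra.
- exact: ibleD.
Qed.

Lemma L2D u v a b : L2 u a b -> L2 v a b -> L2 (fun x => u x + v x) a b.
Proof.
move=> Lu Lv; have iuv := L2M_ible Lu Lv; case: Lu Lv => mu iu [mv iv].
split; first exact: measurable_funD.
apply: (@eq_ible (fun x => u x ^+ 2 + v x ^+ 2 + 2 * (u x * v x))) => [x _|]; first by ring.
by apply: ibleD; [exact: ibleD|exact: ibleZ].
Qed.

Lemma L2Z c v a b : L2 v a b -> L2 (fun x => c * v x) a b.
Proof.
move=> [mv iv]; split; first exact: measurable_funM.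
by apply: (@eq_ible (fun x => c ^+ 2 * v x ^+ 2)) => [x _|]; [ring|exact: ibleZ].
Qed.

Lemma L2N v a b : L2 v a b -> L2 (fun x => - v x) a b.
Proof. by move=> /(L2Z (-1)); congr L2; apply/funext => x; rewrite mulN1r. Qed.

Lemma L2B u v a b : L2 u a b -> L2 v a b -> L2 (fun x => u x - v x) a b.
Proof. by move=> Lu Lv; exact: L2D Lu (L2N Lv). Qed.

Lemma L2_cst c a b : L2 (fun=> c) a b.
Proof. by split => //; exact: ible_cst. Qed.

Lemma L2_cont v a b : {within `[a, b], continuous v} -> L2 v a b.
Proof.
move=> cv; split; first exact: ible_meas (ible_cont cv).
apply: ible_cont => x; rewrite (_ : (fun x => v x ^+ 2) = (fun x => v x * v x))//.
by apply: (@continuousM R (subspace `[a, b])); exact: cv.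
Qed.

Lemma L2_bounded v a b M : measurable_fun `]a, b[ v ->
  (forall x, a < x < b -> `|v x| <= M) -> L2 v a b.
Proof.
move=> mv vM; split=> //; apply: (@ible_le _ (fun=> M ^+ 2)) => [|x xab|].
- exact: measurable_funX.
- by rewrite normrX; apply: lerXn2r; rewrite ?nnegrE ?(le_trans _ (vM x xab))// vM.
- exact: ible_cst.
Qed.

Lemma L2M_bounded u v a b M : measurable_fun `]a, b[ u ->
  (forall x, a < x < b -> `|u x| <= M) -> L2 v a b -> L2 (fun x => u x * v x) a b.
Proof.
move=> mu uM [mv iv]; split; first exact: measurable_funM.
apply: (@ible_le _ (fun x => M ^+ 2 * v x ^+ 2)) => [|x xab|].
- by apply: measurable_funX; exact: measurable_funM.
- rewrite ger0_norm ?sqr_ge0// exprMn; apply: ler_wpM2r; first exact: sqr_ge0.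
  rewrite -[leLHS]sqr_normr//.
  by apply: lerXn2r; rewrite ?nnegrE ?(le_trans _ (uM x xab))// uM.
- exact: ibleZ.
Qed.

Lemma intL_sqr_ge0 v a b : 0 <= intL (fun x => v x ^+ 2) a b.
Proof. by apply: intL_ge0 => x _; exact: sqr_ge0. Qed.

Lemma intL_cauchy_schwarz u v a b : L2 u a b -> L2 v a b ->
  (intL (fun x => u x * v x) a b) ^+ 2 <=
  intL (fun x => u x ^+ 2) a b * intL (fun x => v x ^+ 2) a b.
Proof.
move=> Lu Lv; have iuv := L2M_ible Lu Lv; have [mu iu] := Lu; have [mv iv] := Lv.
set A := intL (fun x => u x ^+ 2) a b; set B := intL (fun x => v x ^+ 2) a b.
set S := intL _ a b; have A0 : 0 <= A by exact: intL_sqr_ge0.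
have key c : 0 <= A * c ^+ 2 - 2 * c * S + B.
  rewrite (_ : _ + B = intL (fun x => (c ^+ 2 * u x ^+ 2 - (2 * c) * (u x * v x)) + v x ^+ 2) a b).
   apply: intL_ge0 => x _; rewrite (_ : _ + _ = (c * u x - v x) ^+ 2); last by ring.
   exact: sqr_ge0.
  rewrite intLD//; last by apply: ibleB; exact: ibleZ.
  by rewrite intLB ?intLZ//; [rewrite mulrC|exact: ibleZ|exact: ibleZ].
have [A00|An0] := eqVneq A 0.
  rewrite A00 mul0r; have B0 : 0 <= B by exact: intL_sqr_ge0.
  have [->|Sn0] := eqVneq S 0; first by rewrite expr0n.
  (* With [A = 0] the form is affine in [c]; this value of [c] would make it equal to -1. *)
  have := key ((B + 1) / (2 * S)); rewrite A00 mul0r sub0r.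
  rewrite (_ : 2 * _ * S = B + 1); last by field.
  lra.
have A1 : 0 < A by rewrite lt_neqAle eq_sym An0.
have := key (S / A); rewrite (_ : _ + B = (A * B - S ^+ 2) / A); last by field.
by rewrite pmulr_lge0 ?invr_gt0// subr_ge0.
Qed.

Lemma intL_sqr_le v a b : a <= b -> L2 v a b ->
  (intL v a b) ^+ 2 <= (b - a) * intL (fun x => v x ^+ 2) a b.
Proof.
move=> ab Lv; have := intL_cauchy_schwarz (L2_cst 1 a b) Lv.
rewrite (_ : (fun x => 1 * v x) = v); last by apply/funext => x; rewrite mul1r.
by rewrite intL_cst// expr1n mul1r.
Qed.

Lemma intL_sqrD_le u v a b : L2 u a b -> L2 v a b ->
  intL (fun x => (u x + v x) ^+ 2) a b <=
  2 * intL (fun x => u x ^+ 2) a b + 2 * intL (fun x => v x ^+ 2) a b.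
Proof.
move=> Lu Lv; have [mu iu] := Lu; have [mv iv] := Lv; have [_ iuv] := L2D Lu Lv.
rewrite -intLZ// -intLZ// -intLD; [|exact: ibleZ|exact: ibleZ].
apply: intL_le => // [|x _]; first by apply: ibleD; exact: ibleZ.
by have := sqr_ge0 (u x - v x); lra.
Qed.

Lemma intL_sqrB_le u v a b : L2 u a b -> L2 v a b ->
  intL (fun x => (u x - v x) ^+ 2) a b <=
  2 * intL (fun x => u x ^+ 2) a b + 2 * intL (fun x => v x ^+ 2) a b.
Proof.
move=> Lu Lv; apply: (le_trans (intL_sqrD_le Lu (L2N Lv))).
by rewrite le_eqVlt; apply/orP; left; apply/eqP; congr (_ + 2 * intL _ _ _); apply/funext => x; rewrite sqrrN.
Qed.

Lemma intLE v a b : ible v a b -> (\int[leb]_(x in `]a, b[) (v x)%:E)%E = (intL v a b)%:E.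
Proof. by move=> iv; rewrite /intL /Rintegral fineK//; exact: integrable_fin_num. Qed.

Lemma L2_norm_le v a b e : 0 <= e -> L2 v a b ->
  (L2_norm a b v <= e%:E)%E = (intL (fun x => v x ^+ 2) a b <= e ^+ 2).
Proof. by move=> e0 [mv iv]; rewrite /L2_norm Lp_norm2_le// intLE// lee_fin. Qed.

Lemma L2_of_norm v a b : measurable_fun `]a, b[ v -> (L2_norm a b v < +oo)%E -> L2 v a b.
Proof.
move=> mv /Lp_norm2_lty nv; split => //; apply/integrableP; split.
  by apply/measurable_EFinP; exact: measurable_funX.
under eq_integral do rewrite /= ger0_norm ?sqr_ge0//; exact: nv.
Qed.

Lemma L2_of_in_Lp v a b : in_Lp leb `]a, b[ 2%:E v -> L2 v a b.
Proof.
by move=> Lv; apply: L2_of_norm; [exact: in_Lp_measurable Lv|exact: in_Lp_norm Lv].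
Qed.

Lemma ible_of_in_Lp v a b : in_Lp leb `]a, b[ 1%E v -> ible v a b.
Proof.
move=> Lv; apply/integrableP; split; first exact/measurable_EFinP/in_Lp_measurable/Lv.
by have := in_Lp_norm Lv; rewrite Lp_norm1E.
Qed.

Lemma L2_normE v a b : L2 v a b ->
  L2_norm a b v = (Num.sqrt (intL (fun x => v x ^+ 2) a b))%:E.
Proof.
move=> [mv iv]; rewrite /L2_norm Lp_norm2E intLE// poweR_EFin powR12_sqrt//.
exact: intL_sqr_ge0.
Qed.

End interval_integrals.

(** * Smooth functions and a smooth step *)

Section smooth_functions.
Context {R : realType}.
Implicit Types (f g : R -> R) (P Q : {poly R}) (x y : R).

(** [n]-fold differentiability with each derivative as a witness, which makes induction through
    products and affine changes of variable direct; [smooth_derivable] translates it to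
    [derive1n]. *)
Fixpoint ncont n f : Prop :=
  if n is k.+1 then exists2 df, (forall x, is_derive x (1 : R) f (df x)) & ncont k df
  else True.

Definition smooth f := forall n, ncont n f.

Lemma ncontW n f : ncont n.+1 f -> ncont n f.
Proof. by elim: n f => [//|n IH] f [df dfE /IH cdf]; exists df. Qed.

Lemma derive1_fun f df : (forall x, is_derive x (1 : R) f (df x)) -> derive1 f = df.
Proof. by move=> H; apply/funext => x; have [_ <-] := H x; rewrite derive1E. Qed.

Lemma smooth_derivable f : smooth f -> forall n x, derivable (derive1n n f) x 1.
Proof.
move=> sf n; have := sf n.+1; elim: n f {sf} => [|n IH] f [df dfE cdf] x.
  by have [] := dfE x.
by rewrite derive1Sn (derive1_fun dfE); exact: IH.
Qed.

Lemma ncontD n f g : ncont n f -> ncont n g -> ncont n (fun x => f x + g x).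
Proof.
elim: n f g => [//|n IH] f g [df fE cf] [dg gE cg].
by exists (fun x => df x + dg x); [move=> x; apply: is_deriveD|exact: IH].
Qed.

Lemma ncontM n f g : ncont n f -> ncont n g -> ncont n (fun x => f x * g x).
Proof.
elim: n f g => [//|n IH] f g cf cg.
have [df fE cdf] := cf; have [dg gE cdg] := cg.
exists (fun x => df x * g x + f x * dg x); first by move=> x; exact: is_derive_mul.
by apply: ncontD; apply: IH => //; exact: ncontW.
Qed.

Lemma ncont_affine n f (a b c : R) : ncont n f -> ncont n (fun x => c * f (a * x + b)).
Proof.
elim: n f c => [//|n IH] f c [df fE cf].
exists (fun x => (c * a) * df (a * x + b)); last exact: IH.
move=> x; rewrite -mulrA; apply: is_deriveMl.
have d1 : is_derive x (1 : R) (fun x => a * x + b) a.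
  rewrite -[X in is_derive _ _ _ X]addr0; apply: is_deriveD.
  by rewrite -[X in is_derive _ _ _ X]mulr1; apply: is_deriveMl; exact: is_derive_id.
by have := @is_derive1_comp _ f (fun x => a * x + b) x _ _ (fE _) d1; rewrite mulrC.
Qed.

Lemma ncont_cst n (c : R) : ncont n (fun=> c).
Proof.
elim: n c => [//|n IH] c; exists (fun=> 0); [move=> x; exact: is_derive_cst|exact: IH].
Qed.

Lemma ncont_sum (I : Type) (r : seq I) (f : I -> R -> R) n :
  (forall i, ncont n (f i)) -> ncont n (fun x => \sum_(i <- r) f i x).
Proof.
move=> cf; elim: r => [|i r IH].
  rewrite (_ : (fun x => _) = fun=> 0); first exact: ncont_cst.
  by apply/funext => x; rewrite big_nil.
rewrite (_ : (fun x => _) = fun x => f i x + \sum_(i <- r) f i x); first exact: ncontD.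
by apply/funext => x; rewrite big_cons.
Qed.

Lemma expr_expN_bounded n : exists2 C, 0 <= C & forall y, 0 <= y -> y ^+ n * expR (- y) <= C.
Proof.
case: n => [|n].
  exists 1 => // y y0; rewrite expr0 mul1r -[leRHS]expR0 ler_expR; lra.
exists n.+1`!%:R => // y y0; rewrite expRN ler_pdivrMr ?expR_gt0// mulrC -ler_pdivrMr.
  by have := expR_ge1Dxn n y0; lra.
by rewrite ltr0n fact_gt0.
Qed.

Lemma poly_expN_bounded P : exists2 C, 0 <= C & forall y, 0 <= y -> `|P.[y] * expR (- y)| <= C.
Proof.
(* The extra factor [y^k] makes the induction on the polynomial close: taking out a factor [X]
   raises [k] by one. *)
suff H k : exists2 C, 0 <= C & forall y, 0 <= y -> `|y ^+ k * P.[y] * expR (- y)| <= C.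
  have [C C0 HC] := H 0%N; exists C => // y y0.
  by have := HC y y0; rewrite expr0 mul1r.
elim/poly_ind: P k => [|P c IH] k.
  by exists 0 => // y _; rewrite horner0 mulr0 mul0r normr0.
have [C1 C10 H1] := IH k.+1; have [C2 C20 H2] := expr_expN_bounded k.
exists (C1 + `|c| * C2) => [|y y0]; first by rewrite addr_ge0// mulr_ge0.
rewrite hornerMXaddC.
rewrite (_ : _ * _ = y ^+ k.+1 * P.[y] * expR (- y) + c * (y ^+ k * expR (- y))); last first.
  by rewrite exprS; ring.
apply: (le_trans (ler_normD _ _)); apply: lerD; first exact: H1.
rewrite normrM; apply: ler_wpM2l => //.
by rewrite ger0_norm ?H2// mulr_ge0 ?exprn_ge0// expR_ge0.
Qed.

(** With [P = 1] this is the classical [exp(-1/x)]. Allowing a polynomial in [1/x] makes the family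
    closed under differentiation, whence smoothness by induction. *)
Definition flat P x : R := if 0 < x then P.[x^-1] * expR (- x^-1) else 0.

Lemma flat_bound P : exists2 C, 0 <= C & forall x, `|flat P x| <= C * `|x|.
Proof.
have [C C0 H] := poly_expN_bounded (P * 'X); exists C => // x; rewrite /flat.
case: ifPn => [x0|_]; last by rewrite normr0 mulr_ge0.
rewrite -ler_pdivrMr; last by rewrite normr_gt0 gt_eqF.
have := H x^-1; rewrite invr_ge0 (ltW x0) => /(_ isT); rewrite hornerMX.
rewrite -[`|x|^-1]normfV -normrM; congr (`|_| <= _); ring.
Qed.

Lemma is_derive_flat P x : is_derive x (1 : R) (flat P) (flat ((P - P^`()) * 'X^2) x).
Proof.
have [x0|x0|->] := ltgtP x 0.
- rewrite {2}/flat ltNge (ltW x0)/=.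
  apply: near_eq_is_derive (is_derive_cst 0 x 1); near=> y.
  rewrite /flat /cst ltNge; case: leP => // y0.
  by exfalso; move: y0; apply/negP; rewrite -leNgt ltW//; near: y; exact: lt_nbhsl.
- have H : is_derive x (1 : R) (fun y => P.[y^-1] * expR (- y^-1)) (flat ((P - P^`()) * 'X^2) x).
   rewrite /flat x0.
   have xn0 : x != 0 by rewrite gt_eqF.
   have d1 : is_derive x (1 : R) (fun y => y^-1) (- x ^- 2).
   have := @is_deriveV _ (id : R -> R) x 1 1 xn0 (is_derive_id x 1).
   by rewrite /GRing.scale/= mulr1.
   have d2 := @is_derive1_comp _ expR (fun y => - y^-1) x _ _ (is_derive_expR (- x^-1)) (is_deriveN d1).
   have d3 := @is_derive1_comp _ (horner P) (fun y => y^-1) x _ _ (is_derive_poly P x^-1) d1.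
   have d4 := is_derive_mul d3 d2.
   apply: is_derive_eq.
   rewrite /= hornerM hornerD hornerN hornerXn; field.
   by [].
  apply: near_eq_is_derive H; near=> y.
  by rewrite /flat ifT//; near: y; exact: lt_nbhsr.
(* At 0 the slope function is [flat (P * 'X)], since multiplication by [z] cancels a factor [1/z];
   [flat_bound] gives its continuity there. *)
- rewrite {2}/flat ltxx; apply/is_derive1_caratheodory.
  exists (flat (P * 'X)); split; last by rewrite /flat ltxx.
   move=> z; rewrite {2}/flat ltxx !subr0 /flat; case: ifPn => [z0|]; last by rewrite mul0r.
   by rewrite hornerMX; field; rewrite gt_eqF.
  have [C C0 H] := flat_bound (P * 'X).
  have f00 : flat (P * 'X) 0 = 0 by rewrite /flat ltxx.
  apply/cvgrPdist_le => e e0; have C1 : 0 < C + 1 by lra.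
  have nz : \forall z \near (0 : R), `|z| <= e / (C + 1).
   exists (e / (C + 1)) => /=; first exact: divr_gt0.
   by move=> z /=; rewrite sub0r normrN => /ltW.
  near=> z.
  rewrite f00 sub0r normrN (le_trans (H z))//.
  apply: (@le_trans _ _ ((C + 1) * `|z|)); first by apply: ler_wpM2r => //; lra.
  by rewrite -ler_pdivlMl// mulrC; near: z; exact: nz.
Unshelve. all: by end_near. Qed.

Lemma ncont_flat n P : ncont n (flat P).
Proof.
elim: n P => [//|n IH] P; exists (flat ((P - P^`()) * 'X^2)); last exact: IH.
by move=> x; exact: is_derive_flat.
Qed.

(** Normalised primitive of [exp(-1/x) exp(-1/(1-x))]. The derivative and its bound are exported
    because rescaled copies of [ds] serve as approximations of the identity. *)
Lemma smooth_step : exists s ds : R -> R, exists B : R,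
  [/\ smooth s, forall x, is_derive x (1 : R) s (ds x), continuous ds,
   forall x, 0 <= ds x <= B &
   [/\ forall x, x <= 0 -> s x = 0, forall x, 1 <= x -> s x = 1,
   forall x, 0 <= s x <= 1 & forall x, (x <= 0) || (1 <= x) -> ds x = 0]].
Proof.
pose e : R -> R := flat 1; pose b x := e x * (1 * e (- 1 * x + 1)).
have e0 x : 0 <= e x.
  by rewrite /e /flat; case: ifP => // _; rewrite hornerC mul1r expR_ge0.
have b0 x : 0 <= b x by rewrite /b mulr_ge0// mul1r.
have nb n : ncont n b by apply: ncontM; [exact: ncont_flat|apply: ncont_affine; exact: ncont_flat].
have cb : continuous b.
  by have [db dbE _] := nb 1%N; exact: derive_cont dbE.
have bz x : (x <= 0) || (1 <= x) -> b x = 0.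
  rewrite /b /e /flat; case: ltP => /= x0; first by case: ltP => //= x1 ?; [lra|rewrite mul1r mulr0].
  by rewrite mul0r.
have el x : 4^-1 <= x -> expR (- 4) <= e x.
  move=> x4; have x0 : 0 < x by lra.
  rewrite /e /flat x0 hornerC mul1r ler_expR lerN2.
  by rewrite -[leRHS]invrK lef_pV2// posrE invr_gt0.
pose I := intg b 0 1.
have I0 : 0 < I.
  rewrite /I (intg_chasles b (4^-1)) (intg_chasles b (3 / 4) 4^-1).
  have i1 : 0 <= intg b 0 4^-1 by apply: intg_ge0 => //; rewrite invr_ge0.
  have i2 : 0 <= intg b (3 / 4) 1 by apply: intg_ge0 => //; lra.
  have i3 : intg (fun=> expR (- 4) * expR (- 4)) 4^-1 (3 / 4) <= intg b 4^-1 (3 / 4).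
   apply: intg_le => //; [exact: contC|lra|move=> x /andP[x1 x2]].
   by rewrite /b; apply: ler_pM; rewrite ?expR_ge0 ?mul1r ?el//; lra.
  rewrite intg_cst in i3.
  have : 0 < expR (- 4) * expR (- 4) * (3 / 4 - 4^-1) :> R.
   by rewrite mulr_gt0 ?mulr_gt0 ?expR_gt0//; lra.
  lra.
have [t0 _ bmax] := @EVT_max _ b 0 1 ler01 (continuous_subspaceT cb).
have bM x : b x <= b t0.
  have [x0|x0] := leP x 0; first by rewrite bz ?x0.
  have [x1|x1] := leP 1 x; first by rewrite bz ?x1 ?orbT.
  by apply: bmax; rewrite in_itv/= !ltW.
exists (fun x => I^-1 * intg b 0 x), (fun x => I^-1 * b x), (I^-1 * b t0).
have dI x : is_derive x (1 : R) (fun x => intg b 0 x) (b x).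
  by rewrite -[b x]subr0; apply: is_deriveB; exact: is_derive_prim.
have Iz x : x <= 0 -> intg b 0 x = 0.
  move=> x0; have : intg b x 0 = 0.
   rewrite (@eq_intg _ _ (fun=> 0)) ?intg_cst ?mul0r//; first exact: contC.
   by move=> t /andP[_ t0']; rewrite bz ?t0'.
  by rewrite /intg; lra.
have Io x : 1 <= x -> intg b 0 x = I.
  move=> x1; rewrite (intg_chasles b 1).
  rewrite (@eq_intg _ _ (fun=> 0) 1) ?intg_cst ?mul0r ?addr0//; first exact: contC.
  by move=> t /andP[t1 _]; rewrite bz ?t1 ?orbT.
split.
- case=> [//|n]; exists (fun x => I^-1 * b x).
   by move=> x; apply: is_deriveMl.
  have := @ncont_affine n b 1 0 I^-1 (nb n); congr ncont; apply/funext => x.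
  by rewrite mul1r addr0.
- by move=> x; apply: is_deriveMl.
- by cont.
- move=> x; rewrite mulr_ge0 ?invr_ge0 ?(ltW I0)//=.
  by rewrite ler_pM2l ?invr_gt0.
- split.
  + by move=> x /Iz ->; rewrite mulr0.
  + by move=> x /Io ->; rewrite mulVf// gt_eqF.
  + move=> x; have [x0|x0] := leP x 0; first by rewrite Iz// mulr0 lexx ler01.
   have [x1|x1] := leP 1 x; first by rewrite Io// mulVf ?gt_eqF// ler01 lexx.
   have i1 : 0 <= intg b 0 x by apply: intg_ge0 => //; exact: ltW.
   have i2 : 0 <= intg b x 1 by apply: intg_ge0 => //; exact: ltW.
   rewrite mulr_ge0 ?invr_ge0 ?(ltW I0)//= mulrC ler_pdivrMr// mul1r.
   by rewrite /I (intg_chasles b x 0 1) lerDl.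
  + by move=> x /bz ->; rewrite mulr0.
Qed.

End smooth_functions.

(** * Functions continuous on a segment and their extension *)

Section continuity_on_segments.
Context {R : realType}.
Implicit Types (a b x y e d : R) (f : R -> R).

Lemma near_within_dist (A P : set R) x :
  (\forall y \near within A (nbhs x), P y) ->
  exists2 d, 0 < d & forall y, `|x - y| < d -> A y -> P y.
Proof. by move=> [d d0 H]; exists d => // y xy Ay; exact: (H y xy Ay). Qed.

Lemma within_continuous_dist f a b : {within `[a, b], continuous f} ->
  forall x, a <= x <= b -> forall e, 0 < e ->
  exists2 d, 0 < d & forall y, a <= y <= b -> `|x - y| < d -> `|f x - f y| <= e.
Proof.
move=> /subspace_continuousP cf x xab e e0.
have := cf x; rewrite /= in_itv/= => /(_ xab)/cvgrPdist_le/(_ _ e0)/near_within_dist[d d0 H].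
by exists d => // y yab xy; apply: H => //=; rewrite in_itv.
Qed.

Lemma dist_continuous f : (forall x e, 0 < e ->
  exists2 d, 0 < d & forall y, `|x - y| < d -> `|f x - f y| <= e) -> continuous f.
Proof.
move=> H x; apply/cvgrPdist_le => e e0; have [d d0 Hd] := H x e e0.
by exists d => // y xy; exact: Hd.
Qed.

(** Retraction on [[a, b]]. Applied to the argument, it extends functions continuous on a segment to
    continuous functions on the line, as [prim], [avg] and [dq] require; applied to the value, it
    truncates. *)
Definition clamp a b x := Num.max a (Num.min b x).

Lemma clamp_in a b x : a <= b -> a <= clamp a b x <= b.
Proof. by move=> ab; rewrite /clamp le_max lexx/= ge_max ab ge_min lexx. Qed.

Lemma clamp_id a b x : a <= x <= b -> clamp a b x = x.
Proof. by move=> /andP[ax xb]; rewrite /clamp min_r// max_r. Qed.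

Lemma clamp_dist a b x y : `|clamp a b x - clamp a b y| <= `|x - y|.
Proof.
wlog xy : x y / x <= y.
  by move=> H; have [/H//|/ltW/H] := leP x y; rewrite distrC (distrC y).
rewrite [leRHS]distrC [leRHS]ger0_norm ?subr_ge0// ler_norml /clamp.
have [] := leP b x; have [] := leP b y; have [] := leP a b => *; apply/andP; split;
  repeat (match goal with |- context [Num.max ?u ?v] => have [] := leP u v end); lra.
Qed.

Lemma clamp_cont f a b : a <= b -> {within `[a, b], continuous f} ->
  continuous (fun x => f (clamp a b x)).
Proof.
move=> ab cf; apply: dist_continuous => x e e0.
have [d d0 H] := within_continuous_dist cf (clamp_in x ab) e0.
exists d => // y xy; apply: H; first exact: clamp_in.
exact: le_lt_trans (clamp_dist _ _ _ _) xy.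
Qed.

End continuity_on_segments.

(** * From weak derivatives to the fundamental theorem of calculus *)

Section du_bois_reymond.
Context {R : realType}.
Implicit Types (a b s t e : R) (f df : R -> R).
Local Notation leb := (@lebesgue_measure R).

Lemma ger0_ge_eps (x y : R) : (forall e, 0 < e -> x <= y + e) -> x <= y.
Proof. by move=> H; apply/ler_addgt0Pr => e /H. Qed.

(** The weak derivative is tested against smoothed indicators of [[s, t]], whose derivative is the
    difference of two approximations of the identity, at [s] and at [t]. *)
Let du_bois_reymond_interior a b f df : a < b -> {within `[a, b], continuous f} ->
  ible df a b -> weak_derivative a b f df ->
  forall s t, a < s -> s < t -> t < b -> f t - f s = intL df s t.
Proof.
move=> ab cf idf wd s t as_ st tb.
have [sg [ds [B [ssg dsg cds dsB [sg0 sg1 sg01 dsz]]]]] := @smooth_step R.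
pose F x := f (clamp a b x).
have cF : continuous F by apply: clamp_cont => //; exact: ltW.
pose k (n : nat) : R := n.+1%:R.
have k0 n : 0 < k n by rewrite ltr0n.
(* The first ramp starts at [s]; the second, shifted by 1, is completed at [t]. The support thus
   stays in [[s, t]]. *)
pose phi n x := sg (k n * (x - s)) - sg (k n * (x - t) + 1).
pose A n x := k n * ds (k n * (x - s)).
pose C n x := k n * ds (k n * (x - t) + 1).
have daff n c x : is_derive x (1 : R) (fun x => sg (k n * x + c)) (k n * ds (k n * x + c)).
  have d1 : is_derive x (1 : R) (fun x => k n * x + c) (k n).
   rewrite -[X in is_derive _ _ _ X]addr0; apply: is_deriveD.
   by rewrite -[X in is_derive _ _ _ X]mulr1; apply: is_deriveMl; exact: is_derive_id.
  by have := @is_derive1_comp _ sg (fun x => k n * x + c) x _ _ (dsg _) d1; rewrite mulrC.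
have dA n x : is_derive x (1 : R) (fun x => sg (k n * (x - s))) (A n x).
  have := daff n (- (k n * s)) x; rewrite /A -mulrBr.
  by rewrite (_ : (fun x => sg (k n * x - k n * s)) = (fun x => sg (k n * (x - s))))//; apply/funext => y; rewrite mulrBr.
have dC n x : is_derive x (1 : R) (fun x => sg (k n * (x - t) + 1)) (C n x).
  have := daff n (1 - (k n * t)) x; rewrite /C.
  have e1 y : k n * y + (1 - k n * t) = k n * (y - t) + 1 by ring.
  by rewrite e1 (_ : (fun x => sg (k n * x + (1 - k n * t))) = (fun x => sg (k n * (x - t) + 1)))//; apply/funext => y; rewrite e1.
have dphi n x : is_derive x (1 : R) (phi n) (A n x - C n x) by apply: is_deriveB.
have caff n c : continuous (fun x => k n * ds (k n * x + c)).
  have ci : continuous (fun x : R => k n * x + c).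
   by apply: contD; [apply: contM; [exact: contC|move=> x; exact: cvg_id]|exact: contC].
  apply: contM; first exact: contC.
  by move=> x; apply: (@continuous_comp _ _ _ (fun x => k n * x + c) ds); [exact: ci|exact: cds].
have cA n : continuous (A n).
  rewrite (_ : A n = fun x => k n * ds (k n * x + - (k n * s))); first exact: caff.
  by apply/funext => x; rewrite /A mulrBr.
have cC n : continuous (C n).
  rewrite (_ : C n = fun x => k n * ds (k n * x + (1 - k n * t))); first exact: caff.
  by apply/funext => x; rewrite /C; congr (_ * ds _); ring.
have cphi n : continuous (phi n) by exact: derive_cont (dphi n).
have phi_test n : 1 < k n * (t - s) -> test_fun a b (phi n).
  move=> kts; split.
   apply: smooth_derivable => i; rewrite /phi.
   have h1 := @ncont_affine R i sg (k n) (- (k n * s)) 1 (ssg i).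
   have h2 := @ncont_affine R i sg (k n) (1 - k n * t) (- 1) (ssg i).
   have := ncontD h1 h2; congr ncont; apply/funext => x.
   by rewrite mul1r mulN1r; congr (sg _ - sg _); ring.
  exists s, t; split => // x; apply: contra_neqP => /negP; rewrite negb_and -!ltNge /phi => /orP[xs|tx].
   rewrite !sg0 ?subrr//; last by rewrite pmulr_rle0// subr_le0 ltW.
   have : k n * (t - s) <= k n * (t - x) by rewrite ler_pM2l//; lra.
   lra.
  rewrite !sg1 ?subrr//.
   by rewrite -lerBlDr subrr mulr_ge0 ?(ltW (k0 n))// subr_ge0 ltW.
  have : k n * (t - s) <= k n * (x - s) by rewrite ler_pM2l//; lra.
  lra.
have big_k M : \forall n \near \oo, M < k n.
  near=> n; have : M < n%:R by near: n; exact: nbhs_infty_gtr.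
  by move=> /lt_le_trans; apply; rewrite ler_nat.
(* left-hand side: [A n] and [C n] are approximations of the identity *)
have lhs e : 0 < e -> \forall n \near \oo,
   `|intg (fun x => F x * (A n x - C n x)) a b - (F s - F t)| <= e.
  move=> e0; have e2 : 0 < e / 2 by lra.
  have cFA n : continuous (fun x => F x * A n x) by cont.
  have cFC n : continuous (fun x => F x * C n x) by cont.
  have cF' x : exists2 d, 0 < d & forall y, `|x - y| < d -> `|F x - F y| <= e / 2.
   by have /cvgrPdist_le/(_ _ e2)[d d0 H] := cF x; exists d.
  have [d1 d10 H1] := cF' s; have [d2 d20 H2] := cF' t.
  have approx (c : R) (D : R -> R) : continuous D -> (forall x, 0 <= D x) ->
   (forall x, D x != 0 -> `|F c - F x| <= e / 2) -> intg D a b = 1 ->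
   `|intg (fun x => F x * D x) a b - F c| <= e / 2.
   move=> cD D0 HD ID; rewrite ler_norml.
   have cFD : continuous (fun x => F x * D x) by cont.
   have cl : continuous (fun x => (F c - e / 2) * D x) by cont.
   have cr : continuous (fun x => (F c + e / 2) * D x) by cont.
   have il : intg (fun x => (F c - e / 2) * D x) a b <= intg (fun x => F x * D x) a b.
   apply: intg_le => //; first exact: ltW.
   move=> x _; have [->|/HD] := eqVneq (D x) 0; first by rewrite !mulr0.
   by rewrite ler_norml => /andP[x1 x2]; apply: ler_wpM2r => //; lra.
   have ir : intg (fun x => F x * D x) a b <= intg (fun x => (F c + e / 2) * D x) a b.
   apply: intg_le => //; first exact: ltW.
   move=> x _; have [->|/HD] := eqVneq (D x) 0; first by rewrite !mulr0.
   by rewrite ler_norml => /andP[x1 x2]; apply: ler_wpM2r => //; lra.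
   move: il ir; rewrite !intgZ// ID !mulr1 => il ir.
   by split_lra.
  near=> n.
  have kn0 := k0 n.
  have K1 : 1 / d1 < k n by near: n; exact: big_k.
  have K2 : 1 / d2 < k n by near: n; exact: big_k.
  have K3 : 1 / (b - s) < k n by near: n; exact: big_k.
  have K4 : 1 / (t - a) < k n by near: n; exact: big_k.
  rewrite ltr_pdivrMr// in K1; rewrite ltr_pdivrMr// in K2.
  rewrite ltr_pdivrMr ?subr_gt0// in K3; last exact: lt_trans tb.
  rewrite ltr_pdivrMr ?subr_gt0// in K4; last exact: lt_trans st.
  have n1 : `|intg (fun x => F x * A n x) a b - F s| <= e / 2.
   apply: approx => //.
   - by move=> x; rewrite mulr_ge0 ?(ltW kn0)//; have /andP[] := dsB (k n * (x - s)).
   - move=> x Ax; apply: H1; have : ~~ ((k n * (x - s) <= 0) || (1 <= k n * (x - s))).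
   by apply: contra Ax => /dsz; rewrite /A => ->; rewrite mulr0.
   rewrite negb_or -!ltNge pmulr_rgt0// subr_gt0 => /andP[sx xs].
   rewrite distrC ger0_norm ?subr_ge0 1?ltW//.
   by rewrite -(ltr_pM2l kn0) (lt_trans xs).
   - rewrite (intg_FTC a b (cA n) (dA n)) sg1 ?sg0 ?subr0//; last exact: ltW.
   by rewrite pmulr_rle0// subr_le0 ltW.
  have n2 : `|intg (fun x => F x * C n x) a b - F t| <= e / 2.
   apply: approx => //.
   - by move=> x; rewrite mulr_ge0 ?(ltW kn0)//; have /andP[] := dsB (k n * (x - t) + 1).
   - move=> x Cx; apply: H2.
   have : ~~ ((k n * (x - t) + 1 <= 0) || (1 <= k n * (x - t) + 1)).
   by apply: contra Cx => /dsz; rewrite /C => ->; rewrite mulr0.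
   rewrite negb_or -!ltNge => /andP[tx]; rewrite gtrDr pmulr_rlt0// subr_lt0 => xt.
   rewrite ger0_norm ?subr_ge0 1?ltW//.
   rewrite -(ltr_pM2l kn0) (lt_trans _ K2)//.
   by rewrite -subr_gt0 (_ : 1 - _ = k n * (x - t) + 1)//; ring.
   - rewrite (intg_FTC a b (cC n) (dC n)) sg1 ?sg0 ?subr0//.
   + rewrite -lerBrDr sub0r -lerN2 opprK -mulrN opprB ltW//.
   + by rewrite lerDr mulr_ge0// ?(ltW kn0)// subr_ge0 ltW.
  rewrite (_ : (fun x => F x * (A n x - C n x)) = (fun x => F x * A n x - F x * C n x)); last first.
   by apply/funext => x; rewrite mulrBr.
  rewrite (intgB a b (cFA n) (cFC n)).
  move: n1 n2; norm_lra.
(* right-hand side: dominated convergence *)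
have mphi n : measurable_fun `]a, b[ (phi n).
  by apply: measurable_funS (continuous_measurable_fun (cphi n)).
have phi_le n x : `|phi n x| <= 1.
  have := sg01 (k n * (x - s)); have := sg01 (k n * (x - t) + 1).
  by rewrite /phi ler_norml => /andP[? ?] /andP[? ?]; split_lra.
have rhs : intL (fun x => df x * phi n x) a b @[n --> \oo] --> intL df s t.
  pose ind x : R := \1_(`]s, t[ : set R) x.
  have mdf := ible_meas idf.
  have ptw x : phi n x @[n --> \oo] --> ind x.
   apply/cvgrPdist_le => e e0; rewrite /ind indicE.
   have [xs|xs] := leP x s.
   rewrite memNset; last by rewrite /= in_itv/= ltNge xs.
   near=> n; rewrite /phi !sg0 ?subrr ?normr0 ?(ltW e0)//.
   have : 1 / (t - s) < k n by near: n; exact: big_k.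
   rewrite ltr_pdivrMr ?subr_gt0// => K.
   have : k n * (t - s) <= k n * (t - x) by rewrite ler_pM2l//; lra.
   lra.
   by rewrite pmulr_rle0// subr_le0.
   have [tx|tx] := leP t x.
   rewrite memNset; last by rewrite /= in_itv/= [x < t]ltNge tx andbF.
   near=> n; rewrite /phi !sg1 ?subrr ?normr0 ?(ltW e0)//.
   by rewrite lerDr mulr_ge0 ?subr_ge0 ?(ltW (k0 n)).
   have : 1 / (t - s) < k n by near: n; exact: big_k.
   rewrite ltr_pdivrMr ?subr_gt0// => K.
   have : k n * (t - s) <= k n * (x - s) by rewrite ler_pM2l//; lra.
   lra.
   rewrite mem_set; last by rewrite /= in_itv/= xs tx.
   near=> n; rewrite /phi.
   have K1 : 1 / (x - s) < k n by near: n; exact: big_k.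
   have K2 : 1 / (t - x) < k n by near: n; exact: big_k.
   rewrite ltr_pdivrMr ?subr_gt0// in K1; rewrite ltr_pdivrMr ?subr_gt0// in K2.
   rewrite sg1 ?sg0 ?subr0 ?subrr ?normr0 ?(ltW e0)//; last exact: ltW.
   by lra.
  have mlim : measurable_fun `]a, b[ (fun x => (df x * ind x)%:E).
   by apply/measurable_EFinP; apply: measurable_funM => //; exact: measurable_indic.
  have idf' : leb.-integrable `]a, b[ (fun x => (`|df x|)%:E) by exact: ible_norm.
  have [] := @dominated_convergence _ _ _ leb `]a, b[ (measurable_itv _)
   (fun n x => (df x * phi n x)%:E) (fun x => (df x * ind x)%:E) (fun x => (`|df x|)%:E) _ mlim _ idf' _.
  - by move=> n; apply/measurable_EFinP; apply: measurable_funM; [exact: mdf|exact: mphi].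
  - apply: aeW => x _; apply: cvg_EFin; first by near=> n.
   by apply: cvgM; [exact: cvg_cst|exact: ptw].
  - by apply: aeW => x n _; rewrite lee_fin normrM ler_piMr.
  move=> idl _ H.
  have -> : intL df s t = intL (fun x => df x * ind x) a b.
   rewrite /intL [LHS]Rintegral_mkcond [RHS]Rintegral_mkcond; congr Rintegral.
   apply/funext => x; rewrite !patchE /ind indicE.
   case: ifPn => xst.
   rewrite mem_set ?mulr1//; have := set_mem xst; rewrite /= !in_itv/= => /andP[x1 x2].
   by rewrite (lt_trans as_ x1) (lt_trans x2 tb).
   by rewrite mulr0; case: ifP.
  by rewrite (intLE idl) in H; exact: (fine_cvg H).
have H e : 0 < e -> `|(F s - F t) + intL df s t| <= e.
  move=> e0; have e2 : 0 < e / 2 by lra.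
  have /cvgrPdist_le/(_ _ e2) r := rhs.
  have l := lhs _ e2; near \oo => n.
  have n1 : `|intL df s t - intL (fun x => df x * phi n x) a b| <= e / 2 by near: n; exact: r.
  have n2 : `|intg (fun x => F x * (A n x - C n x)) a b - (F s - F t)| <= e / 2 by near: n; exact: l.
  have K : 1 / (t - s) < k n by near: n; exact: big_k.
  rewrite ltr_pdivrMr ?subr_gt0// in K.
  have := wd (phi n) (phi_test n K); rewrite (derive1_fun (dphi n)).
  have cFAC : continuous (fun x => F x * (A n x - C n x)).
   by apply: contM => //; exact: contB.
  have -> : \int[leb]_(x in `]a, b[) (f x * (A n x - C n x)) = intg (fun x => F x * (A n x - C n x)) a b.
   rewrite -(intL_intg cFAC (ltW ab)); apply: eq_Rint => x /andP[x1 x2].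
   by rewrite /F clamp_id// !ltW.
  rewrite -/(intL _ a b) => wde; rewrite wde in n2.
  move: n1 n2; norm_lra.
have Fs : F s = f s by rewrite /F clamp_id// !ltW// (lt_trans st).
have Ft : F t = f t by rewrite /F clamp_id// !ltW// (lt_trans _ st).
have : `|(F s - F t) + intL df s t| <= 0.
  by apply: ger0_ge_eps => e /H; rewrite add0r.
by rewrite normr_le0 Fs Ft => /eqP; lra.
Unshelve. all: by end_near. Qed.

Let restr df a b : R -> R := df \_ `]a, b[.

Let restr_integrable df a b : ible df a b -> leb.-integrable `[a, b] (EFin \o restr df a b).
Proof.
move=> idf; rewrite /restr -restrict_EFin; apply/integrable_restrict => //=.
by rewrite setIidr//; exact: subset_itv_oo_cc.
Qed.

Let intL_restr df a b s t : ible df a b -> a <= s -> s <= t -> t <= b ->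
  intL df s t = (\int[leb]_(x in `[a, t]) restr df a b x) - \int[leb]_(x in `[a, s]) restr df a b x.
Proof.
move=> idf as_ st tb; have ir := restr_integrable idf.
have ist (i : interval R) : ([set` i] `<=` `[a, b])%classic -> leb.-integrable [set` i] (EFin \o restr df a b).
  by move=> ii; apply: integrableS ir.
rewrite Rintegral_itvB ?bnd_simp//; last by apply: ist; apply: subset_itv; rewrite bnd_simp.
rewrite -Rintegral_itv_bndo_bndc; last by apply: ist; apply: subset_itv; rewrite bnd_simp.
apply: eq_Rintegral => x; rewrite inE/= in_itv/= => /andP[x1 x2].
rewrite /restr patchE ifT// mem_set//= in_itv/= (le_lt_trans as_ x1).
exact: lt_le_trans tb.
Qed.

Lemma intL_continuous v a b : a <= b -> ible v a b ->
  {within `[a, b], continuous (fun x => intL v a x)}.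
Proof.
move=> ab iv; have := @parameterized_integral_continuous R a b (restr v a b) ab (restr_integrable iv).
move=> /subspace_continuousP H; apply/subspace_continuousP => x xab.
have e1 y : `[a, b]%classic y -> intL v a y = parameterized_integral leb a y (restr v a b).
  rewrite /= in_itv/= => /andP[ay yb]; rewrite (@intL_restr v a b a y)// set_itv1.
  by rewrite Rintegral_set1 subr0.
rewrite /from_subspace /= (e1 x xab); apply: cvg_trans (H x xab); apply: near_eq_cvg.
by rewrite near_withinE; near=> y => yab; rewrite e1.
Unshelve. all: by end_near. Qed.

(** Test functions see the open interval only: there [f] minus the integral of [df] is constant, and
    continuity carries the constant to the endpoints. *)
Lemma weak_derivative_FTC a b f df : a < b -> {within `[a, b], continuous f} ->
  ible df a b -> weak_derivative a b f df ->
  forall s t, a <= s -> s <= t -> t <= b -> f t - f s = intL df s t.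
Proof.
move=> ab cf idf wd.
pose P x := intL df a x; pose c := (a + b) / 2.
have cP : {within `[a, b], continuous P} by apply: intL_continuous => //; exact: ltW.
have cH : {within `[a, b], continuous (fun x => f x - P x)}.
  by move=> x; apply: (@continuousB _ _ (subspace `[a, b])); [exact: cf|exact: cP].
have PB s t : a <= s -> s <= t -> t <= b -> intL df s t = P t - P s.
  move=> as_ st tb; rewrite /P (@intL_cat _ _ a s t)//; first by ring.
  exact: ible_sub idf.
have Hin x y : a < x < b -> a < y < b -> f x - P x = f y - P y.
  move=> /andP[ax xb] /andP[ay yb].
  wlog xy : x y ax xb ay yb / x < y.
   by move=> W; have [xy|xy|->//] := ltgtP x y; [exact: W|apply/esym; exact: W].
  have := du_bois_reymond_interior ab cf idf wd ax xy yb.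
  by rewrite (PB x y) ?ltW//; lra.
have acb : a < c < b by rewrite /c; split_lra.
have Hx x : a <= x <= b -> f x - P x = f c - P c.
  move=> xab; apply/eqP; rewrite -subr_eq0 -normr_le0; apply: ger0_ge_eps => e e0.
  rewrite add0r; have [d d0 Hd] := within_continuous_dist cH xab e0.
  have [y yab xy] : exists2 y, a < y < b & `|x - y| < d.
   have /andP[ax xb] := xab; have [xc|cx] := leP x c.
   (* A step towards the midpoint [c], short enough to stay inside [(a, b)] and within [d] of
      [x]. *)
   pose m := Num.min (d / 2) ((b - a) / 4).
   have m0 : 0 < m by rewrite lt_min; split_lra.
   have [m1 m2] : m <= d / 2 /\ m <= (b - a) / 4 by rewrite !ge_min !lexx orbT.
   exists (x + m); first by rewrite /c in xc; split_lra.
   by rewrite distrC (_ : x + m - x = m) ?gtr0_norm//; [lra|ring].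
   pose m := Num.min (d / 2) ((b - a) / 4).
   have m0 : 0 < m by rewrite lt_min; split_lra.
   have [m1 m2] : m <= d / 2 /\ m <= (b - a) / 4 by rewrite !ge_min !lexx orbT.
   exists (x - m); first by rewrite /c in cx; split_lra.
   by rewrite (_ : x - (x - m) = m) ?gtr0_norm//; [lra|ring].
  rewrite (Hin c y) //; apply: Hd => //.
  by case/andP: yab => /ltW -> /ltW ->.
move=> s t as_ st tb; rewrite (PB s t)//.
have h1 : a <= s <= b by rewrite as_ (le_trans st).
have h2 : a <= t <= b by rewrite tb (le_trans as_).
by have := Hx s h1; have := Hx t h2; lra.
Qed.

(** Common interface of the Sobolev records, of C1 functions and of their linear combinations; [df]
    is a representative of the derivative. *)
Definition abs_cont f df a b := ible df a b /\
  forall s t, a <= s -> s <= t -> t <= b -> f t - f s = intL df s t.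

Lemma W1_2_L2 a b (u : H1 a b) : L2 (wder u) a b.
Proof. exact: L2_of_in_Lp (W1_der_Lp u). Qed.

Lemma W1_1_ible a b (u : W11 a b) : ible (wder u) a b.
Proof. exact: ible_of_in_Lp (W1_der_Lp u). Qed.

Lemma H1_abs_cont a b (u : H1 a b) : a < b -> abs_cont u (wder u) a b.
Proof.
move=> ab; have iu := L2_ible (W1_2_L2 u); split=> //.
exact: weak_derivative_FTC ab (@W1_cont _ _ _ _ u) iu (@W1_wder _ _ _ _ u).
Qed.

Lemma W11_abs_cont a b (u : W11 a b) : a < b -> abs_cont u (wder u) a b.
Proof.
move=> ab; have iu := W1_1_ible u; split=> //.
exact: weak_derivative_FTC ab (@W1_cont _ _ _ _ u) iu (@W1_wder _ _ _ _ u).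
Qed.

Lemma H2_abs_cont a b (u : H2 a b) : a < b -> abs_cont u (dH2 u) a b.
Proof.
move=> ab; have iu := ible_cont (@W1_cont _ _ _ _ (dH2 u)); split=> //.
exact: weak_derivative_FTC ab (@H2_cont _ _ _ u) iu (@H2_wder _ _ _ u).
Qed.

Lemma abs_contD f df g dg a b : abs_cont f df a b -> abs_cont g dg a b ->
  abs_cont (fun x => f x + g x) (fun x => df x + dg x) a b.
Proof.
move=> [idf fE] [idg gE]; split=> [|s t as_ st tb]; first exact: ibleD.
rewrite intLD; [|exact: ible_sub idf|exact: ible_sub idg].
by rewrite -fE// -gE//; ring.
Qed.

Lemma abs_contZ c f df a b : abs_cont f df a b -> abs_cont (fun x => c * f x) (fun x => c * df x) a b.
Proof.
move=> [idf fE]; split=> [|s t as_ st tb]; first exact: ibleZ.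
by rewrite intLZ; [rewrite -fE//; ring|exact: ible_sub idf].
Qed.

Lemma abs_contB f df g dg a b : abs_cont f df a b -> abs_cont g dg a b ->
  abs_cont (fun x => f x - g x) (fun x => df x - dg x) a b.
Proof.
move=> [idf fE] [idg gE]; split=> [|s t as_ st tb]; first exact: ibleB.
rewrite intLB; [|exact: ible_sub idf|exact: ible_sub idg].
by rewrite -fE// -gE//; ring.
Qed.

Lemma abs_cont_sub f df a b s t : a <= s -> t <= b -> abs_cont f df a b -> abs_cont f df s t.
Proof.
move=> as_ tb [idf fE]; split=> [|x y sx xy yt]; first exact: ible_sub idf.
by apply: fE => //; [exact: le_trans sx|exact: le_trans tb].
Qed.

(** Cauchy-Schwarz on the integral of the derivative. The Holder exponent [1/2] obtained here is the
    origin of the consistency errors of order [sqrt h]. *)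
Lemma abs_cont_dist2 f df a b s t : abs_cont f df a b -> L2 df a b ->
  a <= s <= b -> a <= t <= b -> (f t - f s) ^+ 2 <= `|t - s| * intL (fun x => df x ^+ 2) a b.
Proof.
move=> [idf fE] Ldf; wlog st : s t / s <= t.
  move=> W sI tI; have [/W|/ltW/W] := leP s t; first exact.
  by rewrite -sqrrN opprB distrC; apply.
move=> /andP[as_ sb] /andP[at_ tb]; rewrite fE// ger0_norm ?subr_ge0//.
apply: (le_trans (intL_sqr_le st (L2_sub as_ tb Ldf))).
apply: ler_wpM2l; first by rewrite subr_ge0.
by apply: intL_sub_le => //; [have [] := Ldf|move=> x _; exact: sqr_ge0].
Qed.

(** Sobolev's inequality: integrate over [y] the bound of [f(x)^2] by
    [2 f(y)^2 + 2 (f(x) - f(y))^2], the last square being controlled by [abs_cont_dist2]. *)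
Lemma abs_cont_sup f df a b x : a < b -> abs_cont f df a b -> L2 f a b -> L2 df a b ->
  a <= x <= b ->
  (b - a) * f x ^+ 2 <= 2 * intL (fun x => f x ^+ 2) a b + 2 * (b - a) ^+ 2 * intL (fun x => df x ^+ 2) a b.
Proof.
move=> ab af Lf Ldf xab; set D := intL (fun x => df x ^+ 2) a b.
have D0 : 0 <= D by exact: intL_sqr_ge0.
have [_ if2] := Lf.
have : intL (fun=> f x ^+ 2) a b <= intL (fun y => 2 * f y ^+ 2 + 2 * (b - a) * D) a b.
  apply: intL_le; first exact: ible_cst.
   by apply: ibleD; [exact: ibleZ|exact: ible_cst].
  move=> y /andP[ay yb]; have yab : a <= y <= b by rewrite !ltW.
  have h1 := abs_cont_dist2 af Ldf yab xab; rewrite -/D in h1.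
  have h2 : `|x - y| <= b - a.
   by case/andP: xab => ? ?; rewrite ler_norml; split_lra.
  have h3 := ler_wpM2r D0 h2.
  have := sqr_ge0 (f x - 2 * f y); lra.
rewrite intLD; [|exact: ibleZ|exact: ible_cst].
by rewrite intLZ// !intL_cst ?(ltW ab)//; lra.
Qed.

End du_bois_reymond.

(** * Limits equal to 0 in the extended reals *)

Section extended_limits.
Context {R : realType} {T : Type} {F : set_system T} {FF : Filter F}.

Lemma cvge0_near (f : T -> \bar R) : f x @[x --> F] --> 0%E ->
  forall e : R, 0 < e -> \forall x \near F, (f x <= e%:E)%E.
Proof.
move=> /fine_cvgP[ffin cf] e e0.
have /cvgrPdist_le/(_ e e0) h := cf.
near=> x; have h1 : f x \is a fin_num by near: x.
rewrite -(fineK h1) lee_fin.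
have : `|0 - fine (f x)| <= e by near: x.
by rewrite sub0r normrN; apply: le_trans; exact: ler_norm.
Unshelve. all: by end_near. Qed.

Lemma near_cvge0 (f : T -> \bar R) : (forall x, (0 <= f x)%E) ->
  (forall e : R, 0 < e -> \forall x \near F, (f x <= e%:E)%E) ->
  f x @[x --> F] --> 0%E.
Proof.
move=> f0 H; apply/fine_cvgP; split.
  near=> x; rewrite ge0_fin_numE//; apply: (@le_lt_trans _ _ 1%:E); last exact: ltry.
  by near: x; apply: H; exact: ltr01.
apply/cvgrPdist_le => e e0; near=> x.
have h : (f x <= e%:E)%E by near: x; exact: H.
rewrite sub0r normrN ger0_norm; last exact: fine_ge0.
have xf : f x \is a fin_num by rewrite ge0_fin_numE// (le_lt_trans h)// ltry.
by rewrite -lee_fin fineK.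
Unshelve. all: by end_near. Qed.

End extended_limits.

(** * The discrete L2 norm *)

Section discrete_norm.
Context {R : realType}.
Implicit Types (v w : nat -> R) (N : nat) (c : R).

(** Only the interior nodes count: this is the L2 norm of [const_ext N v] on [(0, 1)]. *)
Definition l2 N v := Num.sqrt (mesh N * \sum_(i < N) v i.+1 ^+ 2).

Lemma l2_ge0 N v : 0 <= l2 N v. Proof. exact: sqrtr_ge0. Qed.

Lemma sqr_sum_ge0 n v : 0 <= \sum_(i < n) v i ^+ 2.
Proof. by apply: sumr_ge0 => i _; exact: sqr_ge0. Qed.

Lemma l2_sqr N v : l2 N v ^+ 2 = mesh N * \sum_(i < N) v i.+1 ^+ 2.
Proof.
by rewrite sqr_sqrtr// mulr_ge0 ?(ltW (mesh_gt0 _))//; exact: (sqr_sum_ge0 _ (fun i => v i.+1)).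
Qed.

Lemma l2_le N v c : 0 <= c -> mesh N * \sum_(i < N) v i.+1 ^+ 2 <= c ^+ 2 -> l2 N v <= c.
Proof. by move=> c0; rewrite -l2_sqr ler_sqr ?nnegrE ?l2_ge0. Qed.

Lemma meshN_le1 N : mesh N * N%:R <= 1 :> R.
Proof. by rewrite mulrC node_le1. Qed.

Lemma l2_le_sup N v c : 0 <= c -> (forall i, (i < N)%N -> `|v i.+1| <= c) -> l2 N v <= c.
Proof.
move=> c0 vc; apply: l2_le => //.
have : \sum_(i < N) v i.+1 ^+ 2 <= \sum_(i < N) c ^+ 2.
  by apply: ler_sum => i _; rewrite -sqr_normr// ler_sqr ?nnegrE// vc.
rewrite sumr_const card_ord -[c ^+ 2 *+ N]mulr_natr => h.
have := ler_wpM2l (ltW (mesh_gt0 N)) h; have := ler_wpM2l (sqr_ge0 c) (meshN_le1 N).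
by rewrite mulr1 [mesh N * (_ * _)]mulrCA => h1 h2; exact: le_trans h2 h1.
Qed.

Lemma l2_dot N v w : mesh N * \sum_(i < N) v i.+1 * w i.+1 <= l2 N v * l2 N w.
Proof.
have h0 := ltW (@mesh_gt0 R N).
rewrite -[leRHS]ger0_norm ?mulr_ge0 ?l2_ge0//; apply: le_trans (ler_norm _) _.
rewrite -ler_sqr ?nnegrE// !sqr_normr// exprMn [leRHS]exprMn !l2_sqr.
have := sum_cauchy_schwarz N (fun i => v i.+1) (fun i => w i.+1).
move=> h; have := ler_wpM2l (sqr_ge0 (mesh N)) h; congr (_ <= _); ring.
Qed.

(** A bound of the square by [c] times the norm can be divided by the norm. The triangle and
    Minkowski inequalities below follow this pattern, pairing a vector with itself. *)
Lemma l2_le_dot N v c : 0 <= c ->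
  mesh N * \sum_(i < N) v i.+1 ^+ 2 <= c * l2 N v -> l2 N v <= c.
Proof.
rewrite -l2_sqr => c0; have := l2_ge0 N v; rewrite le_eqVlt => /predU1P[<-//|v0].
by rewrite expr2 ler_pM2r.
Qed.

Lemma l2D N v w : l2 N (fun j => v j + w j) <= l2 N v + l2 N w.
Proof.
apply: l2_le_dot; first by rewrite addr_ge0 ?l2_ge0.
have h1 := l2_dot N v (fun j => v j + w j); have h2 := l2_dot N w (fun j => v j + w j).
rewrite mulrDl; apply: le_trans (lerD h1 h2); rewrite -mulrDr -big_split/=.
by rewrite ler_wpM2l ?(ltW (mesh_gt0 _))//; apply: ler_sum => i _; rewrite expr2 mulrDl.
Qed.

Lemma l2Z N c v : l2 N (fun j => c * v j) = `|c| * l2 N v.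
Proof.
rewrite /l2 -sqrtr_sqr -sqrtrM ?sqr_ge0//; congr Num.sqrt.
by rewrite mulrCA; congr (_ * _); rewrite mulr_sumr; apply: eq_bigr => i _; rewrite exprMn.
Qed.

Lemma l2N N v : l2 N (fun j => - v j) = l2 N v.
Proof.
have := l2Z N (-1) v; rewrite normrN1 mul1r => <-; congr l2.
by apply/funext => j; rewrite mulN1r.
Qed.

Lemma l2B N v w : l2 N (fun j => v j - w j) <= l2 N v + l2 N w.
Proof. by have := l2D N v (fun j => - w j); rewrite l2N. Qed.

Lemma eq_l2 N v w : (forall i, (i < N)%N -> v i.+1 = w i.+1) -> l2 N v = l2 N w.
Proof. by move=> vw; congr (Num.sqrt (_ * _)); apply: eq_bigr => i _; rewrite vw. Qed.

Lemma le_l2 N v w : (forall i, (i < N)%N -> `|v i.+1| <= w i.+1) -> l2 N v <= l2 N w.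
Proof.
move=> vw; apply: ler_wsqrtr; apply: ler_wpM2l; first exact: ltW (mesh_gt0 _).
apply: ler_sum => i _; have := vw i (ltn_ord i) => h.
by rewrite -sqr_normr// ler_sqr ?nnegrE// (le_trans _ h).
Qed.

Lemma l2_le_sum N v : l2 N v <= \sum_(i < N) `|v i.+1|.
Proof.
have s0 : 0 <= \sum_(i < N) `|v i.+1| by apply: sumr_ge0.
apply: l2_le => //; apply: (@le_trans _ _ (\sum_(i < N) v i.+1 ^+ 2)).
  by rewrite -[leRHS]mul1r ler_wpM2r ?mesh_le1//; exact: (sqr_sum_ge0 _ (fun i => v i.+1)).
rewrite expr2 mulr_suml; apply: ler_sum => i _.
rewrite -sqr_normr// expr2 ler_wpM2l//.
by rewrite (bigD1 i)//= lerDl; apply: sumr_ge0.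
Qed.

Lemma l2_meas N (v : nat -> R -> R) (a b : R) : (forall i, (i < N)%N -> measurable_fun `]a, b[ (v i.+1)) ->
  measurable_fun `]a, b[ (fun t => l2 N (v^~ t)).
Proof.
move=> mv; apply: (@measurableT_comp _ _ _ _ _ _ (@Num.sqrt R)).
  by apply: continuous_measurable_fun; exact: sqrt_continuous.
apply: measurable_funM => //; apply: measurable_sum => i.
by apply: measurable_funX; exact: mv.
Qed.

Lemma l2_ible N (v : nat -> R -> R) a b : (forall i, (i < N)%N -> ible (v i.+1) a b) ->
  ible (fun t => l2 N (v^~ t)) a b.
Proof.
move=> iv; apply: (@ible_le _ _ (fun t => \sum_(i < N) `|v i.+1 t|)).
- by apply: l2_meas => i /iv; exact: ible_meas.
- by move=> t _; rewrite ger0_norm ?l2_ge0//; exact: (l2_le_sum N (v^~ t)).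
- by apply: ible_sum => i _; apply: ible_norm; exact: iv.
Qed.

Lemma l2_continuous N (v : nat -> R -> R) : (forall i, (i < N)%N -> continuous (v i.+1)) ->
  continuous (fun t => l2 N (v^~ t)).
Proof.
move=> cv t; apply: (@continuous_comp _ _ _ (fun t => mesh N * \sum_(i < N) v i.+1 t ^+ 2) Num.sqrt).
  move: t; apply: (@contM _ (fun=> mesh N)); first exact: contC.
  by apply: cont_sum => i _; apply: contX; exact: cv.
exact: sqrt_continuous.
Qed.

(* Minkowski's inequality, by duality. *)
Lemma l2_intL N (v : nat -> R -> R) a b : (forall i, (i < N)%N -> ible (v i.+1) a b) ->
  l2 N (fun j => intL (v j) a b) <= intL (fun t => l2 N (v^~ t)) a b.
Proof.
move=> iv; set x := fun j => intL (v j) a b.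
apply: l2_le_dot; first by apply: intL_ge0 => t _; exact: l2_ge0.
rewrite mulrC [leRHS]mulrC -intLZ; last exact: l2_ible.
have -> : (\sum_(i < N) x i.+1 ^+ 2) * mesh N = intL (fun t => \sum_(i < N) (mesh N * x i.+1) * v i.+1 t) a b.
  rewrite intL_sum => [|i _]; last by apply: ibleZ; exact: iv.
  rewrite mulr_suml; apply: eq_bigr => i _; rewrite intLZ; last exact: iv.
  by rewrite /x; ring.
apply: intL_le.
- by apply: ible_sum => i _; apply: ibleZ; exact: iv.
- by apply: ibleZ; exact: l2_ible.
move=> t _; apply: le_trans (l2_dot N x (v^~ t)).
by rewrite mulr_sumr; apply: ler_sum => i _; rewrite mulrA.
Qed.

End discrete_norm.

Section continuous_integrands.
Context {R : realType}.
Implicit Types (f : R -> R) (a b : R).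

Lemma cont_ible f a b : continuous f -> ible f a b.
Proof. by move=> cf; apply: ible_cont; exact: continuous_subspaceT. Qed.

Lemma cont_L2 f a b : continuous f -> L2 f a b.
Proof. by move=> cf; apply: L2_cont; exact: continuous_subspaceT. Qed.

End continuous_integrands.
Arguments cont_ible {R f} a b.
Arguments cont_L2 {R f} a b.

(** * Steklov means and difference quotients in time *)

Section steklov.
Context {R : realType}.
Implicit Types (f g : R -> R) (e t a b c : R).

(** Forward means look at later times only, so the initial time is kept; three of them use an
    interval of length [3 e] beyond [t]. *)
Definition avg e f t := intg f t (t + e) / e.
Definition dq e f t := (f (t + e) - f t) / e.

Lemma dq_cont e f : continuous f -> continuous (dq e f).
Proof. by move=> cf; rewrite /dq; cont; exact: cont_shift. Qed.

Lemma avg_derive e f t : continuous f -> is_derive t (1 : R) (avg e f) (dq e f t).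
Proof.
move=> cf; have d1 := is_derive_prim t cf.
have d2 : is_derive t (1 : R) (fun t => prim f (t + e)) (f (t + e)).
  by apply: is_derive_comp_addl; exact: is_derive_prim.
have d3 : is_derive t (1 : R) (fun t => prim f (t + e) - prim f t) (f (t + e) - f t).
  by apply: is_deriveB.
have := is_deriveMl e^-1 d3; rewrite /avg /dq /intg.
by rewrite mulrC (_ : (fun x => _ * _) = (fun x => (prim f (x + e) - prim f x) / e))//; apply/funext => x; rewrite mulrC.
Qed.

Lemma avg_cont e f : continuous f -> continuous (avg e f).
Proof. by move=> cf; apply: derive_cont => t; exact: avg_derive. Qed.

Lemma dq_derive e f df t : (forall t, is_derive t (1 : R) f (df t)) ->
  is_derive t (1 : R) (dq e f) (dq e df t).
Proof.
move=> d1; have d2 : is_derive t (1 : R) (fun t => f (t + e)) (df (t + e)).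
  by apply: is_derive_comp_addl.
have d3 : is_derive t (1 : R) (fun t => f (t + e) - f t) (df (t + e) - df t).
  by apply: is_deriveB.
have := is_deriveMl e^-1 d3; rewrite /dq.
by rewrite mulrC (_ : (fun x => _ * _) = (fun x => (f (x + e) - f x) / e))//; apply/funext => x; rewrite mulrC.
Qed.

Lemma dqB e f g : dq e (fun t => f t - g t) = (fun t => dq e f t - dq e g t).
Proof. by apply/funext => t; rewrite /dq; ring. Qed.

Lemma dqD e f g : dq e (fun t => f t + g t) = (fun t => dq e f t + dq e g t).
Proof. by apply/funext => t; rewrite /dq; ring. Qed.

Lemma dqZ e c f : dq e (fun t => c * f t) = (fun t => c * dq e f t).
Proof. by apply/funext => t; rewrite /dq; ring. Qed.

Lemma avgB e f g : continuous f -> continuous g ->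
  avg e (fun t => f t - g t) = (fun t => avg e f t - avg e g t).
Proof. by move=> cf cg; apply/funext => t; rewrite /avg intgB// mulrBl. Qed.

Lemma avgD e f g : continuous f -> continuous g ->
  avg e (fun t => f t + g t) = (fun t => avg e f t + avg e g t).
Proof. by move=> cf cg; apply/funext => t; rewrite /avg intgD// mulrDl. Qed.

Lemma avgZ e c f : continuous f -> avg e (fun t => c * f t) = (fun t => c * avg e f t).
Proof. by move=> cf; apply/funext => t; rewrite /avg intgZ// mulrA. Qed.

Lemma avg_shift e s f : continuous f -> avg e (fun t => f (t + s)) = (fun t => avg e f (t + s)).
Proof. by move=> cf; apply/funext => t; rewrite /avg intg_shift// addrAC. Qed.

Lemma avg_dq e s f : continuous f -> avg e (dq s f) = dq s (avg e f).
Proof.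
move=> cf; apply/funext => t; have cs : continuous (fun t => f (t + s)) by exact: cont_shift.
rewrite {1}/dq (_ : (fun t => _ / s) = (fun t => s^-1 * (f (t + s) - f t))); last first.
  by apply/funext => x; rewrite mulrC.
by rewrite avgZ; [rewrite avgB// avg_shift// /dq mulrC|cont].
Qed.

Lemma avg_le e f g a b : 0 < e -> continuous f -> continuous g ->
  (forall t, a <= t <= b + e -> f t <= g t) -> forall t, a <= t <= b -> avg e f t <= avg e g t.
Proof.
move=> e0 cf cg fg t /andP[a1 tb]; rewrite /avg ler_pM2r ?invr_gt0//.
apply: intg_le => // [|s /andP[ts st]]; first by rewrite lerDl ltW.
by apply: fg; rewrite (le_trans a1 ts) (le_trans st)// lerD2r.
Qed.

Lemma avg_cst e c t : 0 < e -> avg e (fun=> c) t = c.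
Proof. by move=> e0; rewrite /avg intg_cst; have := lt0r_neq0 e0 => ?; field. Qed.

Lemma avg_bound e f c a b : 0 < e -> continuous f ->
  (forall t, a <= t <= b + e -> `|f t| <= c) -> forall t, a <= t <= b -> `|avg e f t| <= c.
Proof.
move=> e0 cf fc t tab; rewrite ler_norml; apply/andP; split.
  rewrite -(avg_cst (- c) t e0); apply: (avg_le e0 (@contC _ _) cf _ tab) => s /fc.
  by rewrite ler_norml => /andP[].
rewrite -[leRHS](avg_cst c t e0); apply: (avg_le e0 cf (@contC _ _) _ tab) => s /fc.
by rewrite ler_norml => /andP[].
Qed.

Lemma dq_bound e f c a b : 0 < e -> (forall t, a <= t <= b + e -> `|f t| <= c) ->
  forall t, a <= t <= b -> `|dq e f t| <= 2 * c / e.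
Proof.
move=> e0 fc t /andP[a1 tb]; rewrite /dq normrM (gtr0_norm (x := e^-1)) ?invr_gt0//.
rewrite ler_pM2r ?invr_gt0//; apply: (le_trans (ler_normB _ _)).
have h1 : `|f (t + e)| <= c by apply: fc; rewrite lerD2r tb andbT (le_trans a1)// lerDl ltW.
have h2 : `|f t| <= c by apply: fc; rewrite a1 (le_trans tb)// lerDl ltW.
lra.
Qed.

Lemma avg_intL e f t : 0 < e -> continuous f -> avg e f t = intL f t (t + e) / e.
Proof. by move=> e0 cf; rewrite /avg intL_intg// lerDl ltW. Qed.

Lemma dq_intL e f df a b t : 0 < e -> abs_cont f df a (b + e) -> a <= t <= b ->
  dq e f t = intL df t (t + e) / e.
Proof.
move=> e0 [_ H] /andP[a1 tb]; rewrite /dq H//; first by rewrite lerDl ltW.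
by rewrite lerD2r.
Qed.

Lemma l2_avg N e (v : nat -> R -> R) c a b : 0 < e -> (forall i, (i < N)%N -> continuous (v i.+1)) ->
  (forall t, a <= t <= b + e -> l2 N (v^~ t) <= c) ->
  forall t, a <= t <= b -> l2 N (fun j => avg e (v j) t) <= c.
Proof.
move=> e0 cv vc t /andP[a1 tb].
have c0 : 0 <= c.
  apply: le_trans (l2_ge0 N (v^~ t)) (vc t _).
  by rewrite a1 (le_trans tb)// lerDl ltW.
have te : t <= t + e by rewrite lerDl ltW.
rewrite (@eq_l2 _ _ _ (fun j => e^-1 * intL (v j) t (t + e))); last first.
  by move=> i iN; rewrite avg_intL 1?mulrC//; exact: cv.
have iv i : (i < N)%N -> ible (v i.+1) t (t + e).
  by move=> iN; apply: ible_cont; apply: continuous_subspaceT; exact: cv.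
rewrite l2Z gtr0_norm ?invr_gt0// mulrC ler_pdivrMr//.
apply: (le_trans (l2_intL iv)).
have -> : c * e = intL (fun=> c) t (t + e) by rewrite intL_cst//; ring.
apply: intL_le; [exact: l2_ible|exact: ible_cst|].
move=> s /andP[ts st]; apply: vc; rewrite (le_trans a1 (ltW ts))/=.
by apply: (le_trans (ltW st)); rewrite lerD2r.
Qed.

(* Swapping the integrals by means of a primitive of [G]. *)
Lemma intL_moving_avg G e a b : 0 < e -> a <= b -> (forall t, a < t < b + e -> 0 <= G t) ->
  ible G a (b + e) ->
  ible (fun t => intL G t (t + e) / e) a b /\
  intL (fun t => intL G t (t + e) / e) a b <= intL G a (b + e).
Proof.
move=> e0 ab G0 iG; have abe : a <= b + e by apply: (le_trans ab); rewrite lerDl ltW.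
pose P t := intL G a (clamp a (b + e) t).
have cP : continuous P by apply: clamp_cont => //; exact: intL_continuous.
have PE t : a <= t <= b -> intL G t (t + e) / e = (P (t + e) - P t) / e.
  move=> /andP[a1 tb]; have te : t <= t + e by rewrite lerDl ltW.
  have teb : t + e <= b + e by rewrite lerD2r.
  rewrite /P !clamp_id ?(le_trans a1)// ?a1 ?(le_trans te)//.
  rewrite (@intL_cat _ G a t (t + e))//; last exact: ible_sub iG.
  by congr (_ / _); ring.
have cd : continuous (fun t => e^-1 * (P (t + e) - P t)).
  have c1 : continuous (fun t => P (t + e)) by exact: cont_shift.
  by cont.
have PE' t : a <= t <= b -> intL G t (t + e) / e = e^-1 * (P (t + e) - P t).
  by move=> /PE ->; rewrite mulrC.
split.
  apply: (@eq_ible _ (fun t => e^-1 * (P (t + e) - P t))).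
   by move=> t /andP[a1 tb]; rewrite PE'// !ltW.
  by apply: ible_cont; exact: continuous_subspaceT.
rewrite (@eq_Rint _ _ (fun t => e^-1 * (P (t + e) - P t))); last first.
  by move=> t /andP[a1 tb]; rewrite PE'// !ltW.
have c1 : continuous (fun t => P (t + e)) by exact: cont_shift.
rewrite intL_intg// intgZ; last by cont.
rewrite intgB// intg_shift// mulrC ler_pdivrMr//.
have -> : intg P (a + e) (b + e) - intg P a b = intg P b (b + e) - intg P a (a + e).
  by rewrite /intg; ring.
have aae : a <= a + e by rewrite lerDl ltW.
have bbe : b <= b + e by rewrite lerDl ltW.
have Pge0 t : a <= t <= b + e -> 0 <= P t.
  move=> tab; rewrite /P clamp_id//; apply: intL_ge0 => x /andP[ax xt]; apply: G0.
  by rewrite ax (lt_le_trans xt)//; case/andP: tab.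
have h1 : 0 <= intg P a (a + e).
  apply: intg_ge0 => // t /andP[a1 te]; apply: Pge0; rewrite a1 (le_trans te)//.
  by rewrite lerD2r.
have h2 : intg P b (b + e) <= intg (fun=> intL G a (b + e)) b (b + e).
  apply: intg_le => //; first exact: contC.
  move=> t /andP[bt tbe]; rewrite /P clamp_id ?(le_trans ab)//.
  by apply: intL_sub_le => //; exact: le_trans bt.
rewrite intg_cst in h2.
have -> : intL G a (b + e) * e = intL G a (b + e) * (b + e - b) by ring.
lra.
Qed.

(** The quotient is the mean of the derivative over a time [e]. Minkowski in space and
    [intL_moving_avg] in time lose no constant, only an enlargement of the interval by [e]. *)
Lemma intL_l2_dq N e (f df : nat -> R -> R) a b : 0 < e -> a <= b ->
  (forall i, (i < N)%N -> continuous (f i.+1)) ->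
  (forall i, (i < N)%N -> abs_cont (f i.+1) (df i.+1) a (b + e)) ->
  intL (fun t => l2 N (fun j => dq e (f j) t)) a b <= intL (fun t => l2 N (df^~ t)) a (b + e).
Proof.
move=> e0 ab cf af; have idf i : (i < N)%N -> ible (df i.+1) a (b + e) by move=> /af[].
have G0 t : 0 <= l2 N (df^~ t) by exact: l2_ge0.
have [i1 i2] := intL_moving_avg e0 ab (fun t _ => G0 t) (l2_ible idf).
apply: le_trans i2; apply: intL_le => //.
  apply: l2_ible => i iN; apply: ible_cont; apply: continuous_subspaceT.
  by apply: dq_cont; exact: cf.
move=> t /andP[a1 tb]; have tab : a <= t <= b by rewrite !ltW.
rewrite (@eq_l2 _ _ _ (fun j => e^-1 * intL (df j) t (t + e))); last first.
  by move=> i iN; rewrite mulrC; apply: dq_intL tab => //; exact: af.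
rewrite l2Z gtr0_norm ?invr_gt0// [leRHS]mulrC ler_pM2l ?invr_gt0//.
apply: l2_intL => i iN; apply: ible_sub (idf i iN); first exact: ltW.
by rewrite lerD2r ltW.
Qed.

Lemma abs_cont_C1 f df a b : (forall t, is_derive t (1 : R) f (df t)) -> continuous df ->
  abs_cont f df a b.
Proof.
move=> d c; split; first by apply: ible_cont; exact: continuous_subspaceT.
by move=> s t _ st _; rewrite intL_intg// (intg_FTC _ _ c d).
Qed.

Lemma abs_cont_prim f a b : continuous f -> abs_cont (prim f) f a b.
Proof. by move=> cf; apply: abs_cont_C1 => // t; exact: is_derive_prim. Qed.

(** A mean is the difference quotient of a primitive. *)
Lemma intL_l2_avg N e (v : nat -> R -> R) a b : 0 < e -> a <= b ->
  (forall i, (i < N)%N -> continuous (v i.+1)) ->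
  intL (fun t => l2 N (fun j => avg e (v j) t)) a b <= intL (fun t => l2 N (v^~ t)) a (b + e).
Proof.
move=> e0 ab cv; apply: (@intL_l2_dq N e (fun j => prim (v j))) => // i iN.
  by apply: continuous_prim; exact: cv.
by apply: abs_cont_prim; exact: cv.
Qed.

Lemma intL_sqr_dq e f df a b : 0 < e -> a <= b -> continuous f -> abs_cont f df a (b + e) ->
  L2 df a (b + e) ->
  intL (fun t => dq e f t ^+ 2) a b <= intL (fun t => df t ^+ 2) a (b + e).
Proof.
move=> e0 ab cf af Ldf; have [_ idf2] := Ldf.
have [i1 i2] := intL_moving_avg e0 ab (fun t _ => sqr_ge0 (df t)) idf2.
apply: le_trans i2; apply: intL_le => //.
  by apply: ible_cont; apply: continuous_subspaceT; apply: contX; exact: dq_cont.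
move=> t /andP[a1 tb]; have tab : a <= t <= b by rewrite !ltW.
rewrite (dq_intL e0 af tab) exprMn.
have te : t <= t + e by rewrite lerDl ltW.
have Lt : L2 df t (t + e) by apply: L2_sub Ldf; [exact: ltW|rewrite lerD2r ltW].
have := intL_sqr_le te Lt; rewrite (_ : t + e - t = e); last by ring.
move=> h; rewrite [e^-1 ^+ 2]expr2 mulrA ler_pM2r ?invr_gt0// ler_pdivrMr//.
by rewrite mulrC.
Qed.

Lemma intL_sqr_avg e f a b : 0 < e -> a <= b -> continuous f ->
  intL (fun t => avg e f t ^+ 2) a b <= intL (fun t => f t ^+ 2) a (b + e).
Proof.
move=> e0 ab cf; apply: (@intL_sqr_dq e (prim f)) => //; first exact: continuous_prim.
  exact: abs_cont_prim.
by apply: L2_cont; exact: continuous_subspaceT.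
Qed.

End steklov.

Arguments avg_cont {R} e [f].
Arguments dq_cont {R} e [f].
Notation avg3 e f := (avg e (avg e (avg e f))).

(** * Density of continuous functions in L1 and L2 *)

Section density.
Context {R : realType}.
Implicit Types (f v df : R -> R) (e t a b c : R).
Local Notation leb := (@lebesgue_measure R).

Lemma heine_dist f a b e : continuous f -> 0 < e ->
  exists2 d, 0 < d & forall s t, a <= s <= b -> a <= t <= b -> `|s - t| < d -> `|f s - f t| <= e.
Proof.
move=> cf e0; have e2 : 0 < e / 2 by lra.
have /compact_near_coveringP H := @segment_compact R a b.
have [] := H R (0^'+) (fun d x => forall t, `|x - t| < d -> `|f x - f t| <= e) _ _.
  move=> x _; have /cvgrPdist_le/(_ _ e2)[d d0 Hd] := cf x.
  rewrite /= in d0; have d2 : 0 < d / 2 by lra.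
  exists (ball x (d / 2), [set r | r < d / 2]) => /=.
   by split; [exact: (nbhsx_ballx x _ d2)|exact: nbhs_right_lt].
  move=> [y r] /= [xy rd] t yt.
  have xy' : `|x - y| < d by apply: (lt_le_trans xy); lra.
  have xt : `|x - t| < d.
   rewrite (_ : x - t = (x - y) + (y - t)); last by ring.
   apply: (le_lt_trans (ler_normD _ _)).
   by rewrite /ball /= in xy; lra.
  have h1 := Hd y xy'; have h2 := Hd t xt.
  rewrite /= in h1 h2.
  rewrite (_ : f y - f t = (f x - f t) - (f x - f y)); last by ring.
  apply: (le_trans (ler_normB _ _)); lra.
move=> d0 /= d00 Hd; exists (d0 / 2); first by lra.
move=> s t sab _ st; apply: (Hd (d0 / 2) _ _ s) => //=; last by lra.
  by rewrite sub0r normrN gtr0_norm//; lra.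
Qed.

Lemma L1_dense v a b e : ible v a b -> 0 < e ->
  exists2 f, continuous f & intL (fun t => `|v t - f t|) a b <= e.
Proof.
move=> iv e0.
have [g [cg ig Hg]] := @approximation_continuous_integrable R `]a, b[ v
  (measurable_itv _) (leb_oo_fin a b) iv.
have := cvge0_near Hg e0 => -[n _ /(_ n (leqnn n)) h].
exists (g n); first exact: cg.
have i1 : ible (fun t => `|v t - g n t|) a b.
  by apply: ible_norm; apply: ibleB => //; exact: ig.
by rewrite -lee_fin -intLE//.
Qed.

(** After truncation at level [c], the square of a difference is at most [2 c] times the difference,
    so L1 density upgrades to L2 density. *)
Lemma clamp_sqr_dist c (x y : R) : 0 <= c -> (clamp (- c) c x - clamp (- c) c y) ^+ 2 <= 2 * c * `|x - y|.
Proof.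
move=> c0; have cc : - c <= c by lra.
have h1 := clamp_dist (- c) c x y; have /andP[h2 h3] := clamp_in x cc; have /andP[h4 h5] := clamp_in y cc.
rewrite -sqr_normr// expr2; apply: ler_pM => //.
by rewrite ler_norml; split_lra.
Qed.

Lemma L2_dense_clamp v a b c e : measurable_fun `]a, b[ v -> ible v a b -> 0 <= c -> 0 < e ->
  exists f, [/\ continuous f, forall t, `|f t| <= c &
   intL (fun t => (clamp (- c) c (v t) - f t) ^+ 2) a b <= e].
Proof.
move=> mv iv c0 e0; have cc : - c <= c by lra.
have [|f cf Hf] := @L1_dense v a b (e / (2 * c + 1)) iv; first by apply: divr_gt0; lra.
have ccl : continuous (clamp (- c) c) by apply: (@clamp_cont _ id) => //; apply: continuous_subspaceT => x; exact: cvg_id.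
have cg : continuous (fun t => clamp (- c) c (f t)).
  by move=> t; apply: (@continuous_comp _ _ _ f); [exact: cf|exact: ccl].
exists (fun t => clamp (- c) c (f t)); split => //.
  by move=> t; rewrite ler_norml; exact: clamp_in.
have mcl : measurable_fun `]a, b[ (fun t => clamp (- c) c (v t)).
  by apply: (@measurableT_comp _ _ _ _ _ _ (clamp (- c) c)) => //; exact: continuous_measurable_fun.
have idf : ible (fun t => `|v t - f t|) a b.
  apply: ible_norm; apply: ibleB => //.
  by apply: ible_cont; exact: continuous_subspaceT.
have L1 : L2 (fun t => clamp (- c) c (v t)) a b.
  by apply: (@L2_bounded _ _ _ _ c) => // t _; rewrite ler_norml; exact: clamp_in.
have [_ L2'] := L2B L1 (L2_cont (continuous_subspaceT cg)).
apply: (@le_trans _ _ (intL (fun t => 2 * c * `|v t - f t|) a b)).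
  apply: intL_le => //; first exact: ibleZ.
  by move=> t _; exact: clamp_sqr_dist.
rewrite intLZ//; apply: (@le_trans _ _ (2 * c * (e / (2 * c + 1)))).
  by apply: ler_wpM2l => //; lra.
rewrite mulrA ler_pdivrMr; last by lra.
by rewrite mulrC ler_wpM2l//; lra.
Qed.

Lemma clamp_residual c (x : R) : 0 <= c -> `|x - clamp (- c) c x| <= `|x|.
Proof.
move=> c0; have cc : - c <= c by lra.
have [xc|cx] := leP x c; last first.
  rewrite /clamp (min_l (ltW cx)) (max_r cc) !ger0_norm; lra.
have [cx|xc'] := leP (- c) x; first by rewrite clamp_id ?cx// subrr normr0.
by rewrite /clamp (min_r xc) (max_l (ltW xc')) !ler0_norm; lra.
Qed.

Lemma L2_truncation v a b e : L2 v a b -> 0 < e ->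
  exists2 c, 0 <= c & intL (fun t => (v t - clamp (- c) c (v t)) ^+ 2) a b <= e.
Proof.
move=> [mv iv2] e0.
have mcl (n : nat) : measurable_fun `]a, b[ (fun t => (v t - clamp (- n%:R) n%:R (v t)) ^+ 2).
  apply: measurable_funX; apply: measurable_funB => //.
  apply: (@measurableT_comp _ _ _ _ _ _ (clamp (- n%:R) n%:R)) => //; apply: continuous_measurable_fun.
  by apply: (@clamp_cont _ id) => //; [rewrite ge0_cp// |apply: continuous_subspaceT => x; exact: cvg_id].
have clE (n : nat) (x : R) : `|x| <= n%:R -> clamp (- n%:R) n%:R x = x.
  by rewrite ler_norml => ?; rewrite clamp_id.
have cl_le (n : nat) (x : R) : (x - clamp (- n%:R) n%:R x) ^+ 2 <= x ^+ 2.
  have n0 : (0 : R) <= n%:R by exact: ler0n.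
  rewrite -sqr_normr// -[leRHS]sqr_normr// ler_sqr ?nnegrE//.
  exact: clamp_residual.
have [] := @dominated_convergence _ _ _ leb `]a, b[ (measurable_itv _)
   (fun n t => ((v t - clamp (- n%:R) n%:R (v t)) ^+ 2)%:E) (fun=> 0%E) (fun t => (v t ^+ 2)%:E) _ _ _ iv2 _.
- by move=> n; apply/measurable_EFinP; exact: mcl.
- exact: measurable_cst.
- apply: aeW => t _; apply: near_cvge0 => [n|d d0]; first by rewrite lee_fin sqr_ge0.
  near=> n; rewrite clE ?subrr ?expr0n ?lee_fin ?(ltW d0)//.
  by near: n; exact: nbhs_infty_ger.
- by apply: aeW => t n _; rewrite /= lee_fin ger0_norm ?sqr_ge0.
move=> _ _; rewrite integral0 => H.
have [n _ /(_ n (leqnn n)) h] := cvge0_near H e0.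
exists n%:R; first exact: ler0n.
rewrite -lee_fin -intLE//; apply: ible_le iv2; first exact: mcl.
by move=> t _; rewrite ger0_norm ?sqr_ge0.
Unshelve. all: by end_near. Qed.

(** The truncation error and the approximation of the truncated function take a quarter each,
    because of the factor 2 in the square of a sum. *)
Lemma L2_dense v a b e : L2 v a b -> 0 < e ->
  exists2 f, continuous f & intL (fun t => (v t - f t) ^+ 2) a b <= e.
Proof.
move=> Lv e0; have e4 : 0 < e / 4 by lra.
have [c c0 h1] := L2_truncation Lv e4; have [mv iv2] := Lv.
have cc : - c <= c by lra.
have [f [cf fc h2]] := L2_dense_clamp mv (L2_ible Lv) c0 e4.
exists f => //.
have ccl : continuous (clamp (- c) c) by apply: (@clamp_cont _ id) => //; apply: continuous_subspaceT => x; exact: cvg_id.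
have L1 : L2 (fun t => clamp (- c) c (v t)) a b.
  apply: (@L2_bounded _ _ _ _ c) => [|t _]; last by rewrite ler_norml; exact: clamp_in.
  by apply: (@measurableT_comp _ _ _ _ _ _ (clamp (- c) c)) => //; exact: continuous_measurable_fun.
have := intL_sqrD_le (L2B Lv L1) (L2B L1 (L2_cont (continuous_subspaceT cf))).
under [X in intL X]eq_fun do rewrite addrA subrK.
move=> h; apply: le_trans h _; lra.
Qed.

End density.

(** * Convergence of Steklov means as the averaging step tends to 0 *)

Section steklov_limit.
Context {R : realType}.

Let norm_split3 (x y z w r : R) : `|y - z| <= r -> `|x - w| <= `|x - y| + (r + `|z - w|).
Proof.
move=> h; rewrite (_ : x - w = (x - y) + ((y - z) + (z - w))); last by ring.
apply: (le_trans (ler_normD _ _)); rewrite lerD2l; apply: (le_trans (ler_normD _ _)).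
by rewrite lerD2r.
Qed.

Let sqr_split3 (x y z w r s : R) : `|y - z| <= r -> r <= 1 -> r <= s ->
  (x - w) ^+ 2 <= 3 * (x - y) ^+ 2 + (3 * s + 3 * (z - w) ^+ 2).
Proof.
move=> h r1 rs; have h' : (y - z) ^+ 2 <= s.
  rewrite -sqr_normr// expr2 -[leRHS]mul1r.
  by apply: ler_pM => //; [exact: le_trans r1|exact: le_trans rs].
have := sqr_ge0 ((x - y) - (y - z)); have := sqr_ge0 ((y - z) - (z - w)).
have := sqr_ge0 ((x - y) - (z - w)).
rewrite (_ : x - w = (x - y) + (y - z) + (z - w)); last by ring.
by move: (x - y) (y - z) (z - w) h' => a b c; rewrite !expr2 => *; lra.
Qed.

Implicit Types (f v df : R -> R) (e t a b c T L : R).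

Let frac_le (k d L : R) : 0 < k -> 0 <= d -> 0 <= L -> d / (k * (L + 1)) * L <= d / k.
Proof.
move=> k0 d0 L0; have kL : 0 < k * (L + 1) by apply: mulr_gt0 => //; lra.
rewrite mulrAC ler_pdivrMr// mulrA divfK ?lt0r_neq0// ler_wpM2l//; lra.
Qed.

Lemma avg3_near f T L d : continuous f -> 0 <= L -> L < T -> 0 < d ->
  exists e0, [/\ 0 < e0, L + 3 * e0 <= T & forall e, 0 < e <= e0 ->
   forall t, 0 <= t <= L -> `|f t - avg3 e f t| <= d].
Proof.
move=> cf L0 LT d0; have [r r0 Hr] := @heine_dist R f 0 T d cf d0.
exists (Num.min ((T - L) / 3) (r / 4)).
have e00 : 0 < Num.min ((T - L) / 3) (r / 4) by rewrite lt_min; split_lra.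
have h1 : Num.min ((T - L) / 3) (r / 4) <= (T - L) / 3 by rewrite ge_min lexx.
have h2 : Num.min ((T - L) / 3) (r / 4) <= r / 4 by rewrite ge_min lexx orbT.
split => //; first by lra.
move=> e /andP[ep ee] t /andP[t0 tL].
have c0 : continuous (fun s => f t - f s) by apply: contB => //; exact: contC.
have c1 := avg_cont e cf; have c2 := avg_cont e c1.
have E1 g : continuous g -> (fun s => f t - avg e g s) = avg e (fun s => f t - g s).
  move=> cg; rewrite (@avgB _ e (fun=> f t))//; last exact: contC.
  by apply/funext => s; rewrite avg_cst.
have -> : f t - avg3 e f t = avg3 e (fun s => f t - f s) t.
  by rewrite -E1// -E1// -E1.
have b1 s : t <= s <= t + e + e -> `|avg e (fun s => f t - f s) s| <= d.
  apply: avg_bound => // x /andP[tx xt]; apply: Hr; [split_lra..|].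
  by rewrite distrC ger0_norm; lra.
have b2 s : t <= s <= t + e -> `|avg e (avg e (fun s => f t - f s)) s| <= d.
  apply: avg_bound => //; exact: avg_cont.
have c3 := avg_cont e (avg_cont e c0).
by apply: (avg_bound ep c3 b2); rewrite !lexx.
Qed.

Lemma avg2_dq_prim e f : avg e (avg e (dq e (prim f))) = avg3 e f.
Proof. by []. Qed.

Lemma intL_norm_dq e f df a b : 0 < e -> a <= b -> continuous f -> abs_cont f df a (b + e) ->
  intL (fun t => `|dq e f t|) a b <= intL (fun t => `|df t|) a (b + e).
Proof.
move=> e0 ab cf af; have [idf _] := af.
have [i1 i2] := intL_moving_avg e0 ab (fun t _ => normr_ge0 (df t)) (ible_norm idf).
apply: le_trans i2; apply: intL_le => //.
  by apply: ible_cont; apply: continuous_subspaceT; apply: cont_norm; exact: dq_cont.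
move=> t /andP[a1 tb]; have tab : a <= t <= b by rewrite !ltW.
rewrite (dq_intL e0 af tab) normrM (gtr0_norm (x := e^-1)) ?invr_gt0// ler_pM2r ?invr_gt0//.
by apply: intL_norm; apply: ible_sub idf; [exact: ltW|rewrite lerD2r ltW].
Qed.

Lemma intL_norm_avg e f a b : 0 < e -> a <= b -> continuous f ->
  intL (fun t => `|avg e f t|) a b <= intL (fun t => `|f t|) a (b + e).
Proof.
by move=> e0 ab cf; apply: (@intL_norm_dq e (prim f)) => //; [exact: continuous_prim|exact: abs_cont_prim].
Qed.

(** [avg e (avg e (dq e f))] is the triple mean of the derivative, written with the continuous [f]
    because [df] is only integrable. Triple means of continuous functions converge uniformly, and
    the operator contracts L1 norms up to an enlargement of the interval; density does the rest. *)
Lemma steklov_L1 f df T L d : continuous f -> abs_cont f df 0 T -> 0 <= L -> L < T -> 0 < d ->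
  exists e0, [/\ 0 < e0, L + 3 * e0 <= T & forall e, 0 < e <= e0 ->
   intL (fun t => `|df t - avg e (avg e (dq e f)) t|) 0 L <= d].
Proof.
move=> cf af L0 LT d0; have [idf _] := af.
have d4 : 0 < d / 4 by lra.
have [g cg Hg] := L1_dense idf d4.
have d5 : 0 < d / (4 * (L + 1)) by apply: divr_gt0 => //; lra.
have [e0 [e00 e0T H]] := avg3_near cg L0 LT d5.
exists e0; split => // e /andP[ep ee].
have LT' : L <= T by exact: ltW.
have Le : L + e + e + e <= T by lra.
pose F t := prim g t - f t; have cG := continuous_prim cg.
have cF : continuous F by apply: contB.
have aF : abs_cont F (fun t => g t - df t) 0 (L + e + e + e).
  by apply: (abs_cont_sub _ Le (abs_contB (abs_cont_prim 0 T cg) af)).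
have c1 := dq_cont e cf; have c2 := avg_cont e c1; have c3 := avg_cont e c2.
have c4 := avg_cont e (avg_cont e (avg_cont e cg)).
have c5 := dq_cont e cF; have c6 := avg_cont e c5; have c7 := avg_cont e c6.
have ibc (h : R -> R) : continuous h -> ible (fun t => `|h t|) 0 L.
  by move=> ch; apply: ible_norm; exact: cont_ible.
have i1 : ible (fun t => `|df t - g t|) 0 T.
  exact: (ible_norm (ibleB idf (cont_ible 0 T cg))).
have i1' : ible (fun t => `|df t - g t|) 0 L by exact: ible_sub (lexx 0) LT' i1.
have E t : avg e (avg e (dq e F)) t = avg3 e g t - avg e (avg e (dq e f)) t.
  have cdG := dq_cont e cG; have caG := avg_cont e cdG.
  by rewrite /F dqB (@avgB _ e _ _ cdG c1) (@avgB _ e _ _ caG c2) avg2_dq_prim.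
have e0' : L + e + e + e = L + 3 * e by ring.
apply: (@le_trans _ _ (intL (fun t => `|df t - g t| + (d / (4 * (L + 1)) + `|avg e (avg e (dq e F)) t|)) 0 L)).
  apply: intL_le.
  - apply: ible_norm; apply: ibleB; [exact: ible_sub (lexx 0) LT' idf|exact: cont_ible c3].
  - apply: (ibleD i1'); apply: ibleD; [exact: ible_cst|exact: (ibc _ c7)].
  move=> t /andP[t0 tL]; have he : 0 < e <= e0 by rewrite ep ee.
  have ht : 0 <= t <= L by rewrite !ltW.
  have h := H e he t ht.
  by rewrite E; exact: norm_split3 h.
have h1 : intL (fun t => `|df t - g t|) 0 L <= d / 4.
  by apply: le_trans Hg; apply: (intL_sub_le (lexx 0) L0 LT' i1) => x _; exact: normr_ge0.
have h2 : intL (fun t => `|avg e (avg e (dq e F)) t|) 0 L <= d / 4.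
  apply: (le_trans (intL_norm_avg ep L0 c6)).
  apply: (le_trans (intL_norm_avg ep _ c5)); first lra.
  apply: (le_trans (intL_norm_dq ep _ cF aF)); first lra.
  apply: le_trans Hg; rewrite (_ : (fun t => `|g t - df t|) = (fun t => `|df t - g t|)); last first.
   by apply/funext => t; rewrite distrC.
  by apply: intL_sub_le => //; lra.
rewrite (intLD i1' (ibleD (ible_cst _ 0 L) (ibc _ c7))).
rewrite (intLD (ible_cst _ 0 L) (ibc _ c7)).
rewrite intL_cst// subr0.
have h3 : d / (4 * (L + 1)) * L <= d / 4 by apply: frac_le => //; exact: ltW.
lra.
Qed.

Lemma steklov_L2 f df T L d : continuous f -> abs_cont f df 0 T -> L2 df 0 T ->
  0 <= L -> L < T -> 0 < d ->
  exists e0, [/\ 0 < e0, L + 3 * e0 <= T & forall e, 0 < e <= e0 ->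
   intL (fun t => (df t - avg e (avg e (dq e f)) t) ^+ 2) 0 L <= d].
Proof.
move=> cf af Ldf L0 LT d0; have d9 : 0 < d / 9 by lra.
have [g cg Hg] := L2_dense Ldf d9.
pose r := Num.min 1 (d / (9 * (L + 1))).
have d5 : 0 < d / (9 * (L + 1)) by apply: divr_gt0 => //; lra.
have r0 : 0 < r by rewrite lt_min ltr01.
have r1 : r <= 1 by rewrite ge_min lexx.
have r2 : r <= d / (9 * (L + 1)) by rewrite ge_min lexx orbT.
have [e0 [e00 e0T H]] := avg3_near cg L0 LT r0.
exists e0; split => // e /andP[ep ee].
have LT' : L <= T by exact: ltW.
have Le : L + e + e + e <= T by lra.
pose F t := prim g t - f t; have cG := continuous_prim cg.
have cF : continuous F by apply: contB.
have aF : abs_cont F (fun t => g t - df t) 0 (L + e + e + e).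
  by apply: (abs_cont_sub _ Le (abs_contB (abs_cont_prim 0 T cg) af)).
have c1 := dq_cont e cf; have c2 := avg_cont e c1; have c3 := avg_cont e c2.
have c4 := avg_cont e (avg_cont e (avg_cont e cg)).
have c5 := dq_cont e cF; have c6 := avg_cont e c5; have c7 := avg_cont e c6.
have Lc (h : R -> R) b : continuous h -> L2 h 0 b.
  by move=> ch; exact: cont_L2.
have Li1 := L2B Ldf (Lc g T cg); have i1 := Li1.2.
have i1' := ible_sub (lexx 0) LT' i1.
have E t : avg e (avg e (dq e F)) t = avg3 e g t - avg e (avg e (dq e f)) t.
  have cdG := dq_cont e cG; have caG := avg_cont e cdG.
  by rewrite /F dqB (@avgB _ e _ _ cdG c1) (@avgB _ e _ _ caG c2) avg2_dq_prim.
have ic := (Lc _ L c7).2.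
apply: (@le_trans _ _ (intL (fun t => 3 * (df t - g t) ^+ 2 + (3 * (d / (9 * (L + 1))) + 3 * avg e (avg e (dq e F)) t ^+ 2)) 0 L)).
  apply: intL_le.
  - by have [] := L2B (L2_sub (lexx 0) LT' Ldf) (Lc _ L c3).
  - exact: (ibleD (ibleZ 3 i1') (ibleD (ible_cst _ 0 L) (ibleZ 3 ic))).
  move=> t /andP[t0 tL]; have he : 0 < e <= e0 by rewrite ep ee.
  have ht : 0 <= t <= L by rewrite !ltW.
  have h := H e he t ht.
  rewrite E.
  exact: sqr_split3 h r1 r2.
have h1 : intL (fun t => (df t - g t) ^+ 2) 0 L <= d / 9.
  by apply: le_trans Hg; apply: intL_sub_le => // x _; exact: sqr_ge0.
have h2 : intL (fun t => avg e (avg e (dq e F)) t ^+ 2) 0 L <= d / 9.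
  apply: (le_trans (intL_sqr_avg ep L0 c6)).
  apply: (le_trans (intL_sqr_avg ep _ c5)); first lra.
  have Lgd : L2 (fun t => g t - df t) 0 T by apply: L2B => //; exact: Lc.
  apply: (le_trans (intL_sqr_dq ep _ cF aF (L2_sub _ _ Lgd))); [lra|lra|lra|].
  apply: le_trans Hg; rewrite (_ : (fun t => (g t - df t) ^+ 2) = (fun t => (df t - g t) ^+ 2)); last first.
   by apply/funext => t; rewrite -sqrrN opprB.
  by apply: intL_sub_le => //; [lra|move=> x _; exact: sqr_ge0].
rewrite (intLD (ibleZ 3 i1') (ibleD (ible_cst _ 0 L) (ibleZ 3 ic))).
rewrite (intLD (ible_cst _ 0 L) (ibleZ 3 ic)) intL_cst// subr0 (intLZ 3 i1') (intLZ 3 ic).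
have h3 : d / (9 * (L + 1)) * L <= d / 9 by apply: frac_le => //; exact: ltW.
lra.
Qed.

End steklov_limit.

(** * From small residuals to a small error on the potential *)

Section core.
Context {R : realType}.
Implicit Types (N : nat) (w : nat -> R).

Lemma edge_sum_le N w :
  \sum_(i < N.+1) (w i.+1 - w i) ^+ 2 <= 4 * (\sum_(i < N) w i.+1 ^+ 2 + w 0%N ^+ 2 + w N.+1 ^+ 2).
Proof.
have h : \sum_(i < N.+1) (w i.+1 - w i) ^+ 2 <= \sum_(i < N.+1) (2 * w i.+1 ^+ 2 + 2 * w i ^+ 2).
  by apply: ler_sum => i _; have := sqr_ge0 (w i.+1 + w i); rewrite !expr2; lra.
apply: (le_trans h); rewrite big_split/= -!mulr_sumr big_ord_recr/= big_ord_recl/=.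
rewrite (eq_bigr (fun i : 'I_N => w i.+1 ^+ 2)) => [|i _]; last by rewrite /bump.
have := sqr_ge0 (w 0%N); have := sqr_ge0 (w N.+1); lra.
Qed.

Lemma second_difference_sum_le N w :
  \sum_(i < N) (w i.+2 - 2 * w i.+1 + w i) ^+ 2 <= 4 * \sum_(i < N.+1) (w i.+1 - w i) ^+ 2.
Proof.
have h : \sum_(i < N) (w i.+2 - 2 * w i.+1 + w i) ^+ 2
   <= \sum_(i < N) (2 * (w i.+2 - w i.+1) ^+ 2 + 2 * (w i.+1 - w i) ^+ 2).
  apply: ler_sum => i _; rewrite (_ : w i.+2 - _ + _ = (w i.+2 - w i.+1) - (w i.+1 - w i)); last by ring.
  have := sqr_ge0 ((w i.+2 - w i.+1) + (w i.+1 - w i)).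
  by move: (w i.+2 - w i.+1) (w i.+1 - w i) => x y; rewrite !expr2; lra.
apply: (le_trans h); rewrite big_split/= -!mulr_sumr.
have h1 : \sum_(i < N) (w i.+2 - w i.+1) ^+ 2 <= \sum_(i < N.+1) (w i.+1 - w i) ^+ 2.
  rewrite [leRHS]big_ord_recl/= (eq_bigr (fun i : 'I_N => (w i.+2 - w i.+1) ^+ 2)) ?lerDr ?sqr_ge0// => i _.
have h2 : \sum_(i < N) (w i.+1 - w i) ^+ 2 <= \sum_(i < N.+1) (w i.+1 - w i) ^+ 2.
  by rewrite [leRHS]big_ord_recr/= lerDl sqr_ge0.
lra.
Qed.

(** Inverse inequality: one more space difference costs [2 / h]. *)
Lemma l2_laplacian_le N w c : 0 <= c ->
  mesh N * \sum_(i < N.+1) ((w i.+1 - w i) / mesh N) ^+ 2 <= c ^+ 2 ->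
  l2 N (laplacian_h N w) <= 2 * c / mesh N.
Proof.
move=> c0 h; have h0 := @mesh_gt0 R N; have hn := lt0r_neq0 h0.
apply: l2_le; first by apply: divr_ge0; [apply: mulr_ge0|exact: ltW].
have e1 : \sum_(i < N) laplacian_h N w i.+1 ^+ 2 =
   (\sum_(i < N) (w i.+2 - 2 * w i.+1 + w i) ^+ 2) / mesh N ^+ 4.
  by rewrite mulr_suml; apply: eq_bigr => i _; rewrite /laplacian_h/=; field.
have e2 : \sum_(i < N.+1) ((w i.+1 - w i) / mesh N) ^+ 2 =
   (\sum_(i < N.+1) (w i.+1 - w i) ^+ 2) / mesh N ^+ 2.
  by rewrite mulr_suml; apply: eq_bigr => i _; field.
rewrite e1; rewrite e2 in h; have := second_difference_sum_le N w.
set A := \sum_(i < N) _ in h *; set B := \sum_(i < N.+1) _ in h * => AB.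
have -> : (2 * c / mesh N) ^+ 2 = 4 * c ^+ 2 / mesh N ^+ 2 by field.
have -> : mesh N * (A / mesh N ^+ 4) = mesh N * (A / mesh N ^+ 2) / mesh N ^+ 2 by field.
rewrite ler_pM2r ?invr_gt0 ?exprn_gt0//.
apply: (le_trans _ (ler_wpM2l _ h)) => //.
have -> : 4 * (mesh N * (B / mesh N ^+ 2)) = mesh N / mesh N ^+ 2 * (4 * B) by ring.
rewrite (_ : mesh N * (A / mesh N ^+ 2) = mesh N / mesh N ^+ 2 * A); last by ring.
by apply: ler_wpM2l AB; apply: divr_ge0; [exact: ltW|exact: sqr_ge0].
Qed.

(** All that the Carleman argument sees of the wave problem: [u] is the error, [Y] the reference
    grid function, [f] the error on the potential and [rho] the residual. [d] bounds whatever is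
    small; [K0], [Rb] and [r] are bounds on [Y] fixed beforehand. At the two boundary nodes second
    derivatives are controlled in L2 in time only, as boundary data in H2 allow. *)
Record residual_bounds (N : nat) (L m K0 Rb r d : R) (u du ddu Y rho : nat -> R -> R)
   (f q : nat -> R) : Prop := ResidualBounds {
  rb_u : forall j t, (j <= N.+1)%N -> is_derive t (1 : R) (u j) (du j t);
  rb_du : forall j, (j <= N.+1)%N -> continuous (du j);
  rb_ddu : forall i t, (i < N)%N -> is_derive t (1 : R) (du i.+1) (ddu i.+1 t);
  rb_ddu_cont : forall i, (i < N)%N -> continuous (ddu i.+1);
  rb_abs_cont : forall j, (j <= N.+1)%N -> abs_cont (du j) (ddu j) 0 L;
  rb_L2 : forall j, (j <= N.+1)%N -> L2 (ddu j) 0 L;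
  rb_eq : forall i (t : R), (i < N)%N -> 0 <= t <= L ->
   ddu i.+1 t - laplacian_h N (u^~ t) i.+1 + q i.+1 * u i.+1 t = f i.+1 * Y i.+1 t - rho i.+1 t;
  rb_rho_cont : forall i, (i < N)%N -> continuous (rho i.+1);
  rb_rho : forall t : R, 0 <= t <= L -> l2 N (rho^~ t) <= d;
  rb_drho : exists drho : nat -> R -> R,
   (forall i, (i < N)%N -> abs_cont (rho i.+1) (drho i.+1) 0 L) /\
   intL (fun t => l2 N (drho^~ t)) 0 L <= d;
  rb_Y : forall i t, (i < N)%N -> 0 <= t <= L -> `|Y i.+1 t| <= K0;
  rb_Y_lip : forall i s t, (i < N)%N -> 0 <= s <= L -> 0 <= t <= L ->
   `|Y i.+1 t - Y i.+1 s| <= Rb * `|t - s|;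
  rb_Y0 : forall i, (i < N)%N -> r <= `|Y i.+1 0|;
  rb_q : forall i, (i < N)%N -> `|q i.+1| <= m;
  rb_f : forall i, (i < N)%N -> `|f i.+1| <= 2 * m;
  rb_flux : intL (fun t => ((du N.+1 t - du N t) / mesh N) ^+ 2) 0 L <= d ^+ 2;
  rb_left : intL (fun t => ddu 0%N t ^+ 2) 0 L <= d ^+ 2;
  rb_right : intL (fun t => ddu N.+1 t ^+ 2) 0 L <= d ^+ 2;
  rb_jumps : mesh N * \sum_(i < N.+1) intL (fun t => (ddu i.+1 t - ddu i t) ^+ 2) 0 L <= d ^+ 2;
  rb_init_lap : l2 N (laplacian_h N (u^~ 0)) <= d;
  rb_init : forall j, (j <= N.+1)%N -> `|u j 0| <= d;
  rb_init_slope : mesh N * \sum_(i < N.+1) ((du i.+1 0 - du i 0) / mesh N) ^+ 2 <= d ^+ 2;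
  rb_init_t : forall j, (j <= N.+1)%N -> `|du j 0| <= d }.

(** [X] will bound the acceleration for times up to [kappa h], and [A] is the coefficient of [kappa]
    in the bound of the defect [e]; the numbers come from the squares of sums in [data_arith]. *)
Definition data_cst (m X A : R) := 18 * X ^+ 2 + 2 * A ^+ 2 + 2 * (10 + 2 * m) ^+ 2 + 52.

Let data_arith (kappa m X A d b1 b2 b3 b4 b5 b6 : R) : 0 < kappa -> kappa <= 1 -> 0 <= m ->
  b1 <= 2 * d ^+ 2 + 4 * d ^+ 2 / kappa ^+ 2 -> b2 <= d ^+ 2 ->
  b3 <= 2 * d ^+ 2 + 2 * (2 * kappa * X + 3 * d) ^+ 2 -> b4 <= (d + kappa * X) ^+ 2 ->
  b5 <= ((10 + 2 * m) * d + kappa * A) ^+ 2 -> b6 <= d ^+ 2 ->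
  b1 + b2 + b3 + b4 + b5 + b6 <= data_cst m X A * (kappa ^+ 2 + d ^+ 2 / kappa ^+ 2).
Proof.
move=> k0 k1 m0 h1 h2 h3 h4 h5 h6.
have hd : d ^+ 2 <= d ^+ 2 / kappa ^+ 2.
  rewrite ler_pdivlMr ?exprn_gt0// ler_piMr ?sqr_ge0//.
  by rewrite expr2 -[leRHS]mulr1; apply: ler_pM => //; exact: ltW.
have g3 : (2 * kappa * X + 3 * d) ^+ 2 <= 8 * (kappa ^+ 2 * X ^+ 2) + 18 * d ^+ 2.
  by rewrite -exprMn; have := sqr_ge0 (2 * (kappa * X) - 3 * d); rewrite !expr2; lra.
have g4 : (d + kappa * X) ^+ 2 <= 2 * d ^+ 2 + 2 * (kappa ^+ 2 * X ^+ 2).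
  by rewrite -exprMn; have := sqr_ge0 (d - kappa * X); rewrite !expr2; lra.
have g5 : ((10 + 2 * m) * d + kappa * A) ^+ 2 <= 2 * ((10 + 2 * m) ^+ 2 * d ^+ 2) + 2 * (kappa ^+ 2 * A ^+ 2).
  by rewrite -!exprMn; move: ((10 + 2 * m) * d) (kappa * A) => x y; have := sqr_ge0 (x - y); rewrite !expr2; lra.
set D := d ^+ 2 / kappa ^+ 2 in h1 hd *; set d2 := d ^+ 2 in h1 h2 h3 h6 hd g3 g4 g5 *.
have d20 : 0 <= d2 by exact: sqr_ge0.
have h1' : b1 <= 2 * d2 + 4 * D by rewrite /D mulrA.
have M0 : 0 <= (10 + 2 * m) ^+ 2 by exact: sqr_ge0.
have X20 : 0 <= X ^+ 2 by exact: sqr_ge0.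
have A20 : 0 <= A ^+ 2 by exact: sqr_ge0.
have k20 : 0 <= kappa ^+ 2 by exact: sqr_ge0.
rewrite /data_cst; move: (X ^+ 2) (A ^+ 2) ((10 + 2 * m) ^+ 2) (kappa ^+ 2) X20 A20 M0 k20 g3 g4 g5 => x y z k {}X20 {}A20 {}M0 {}k20 {}g3 {}g4 {}g5.
have p1 := ler_wpM2l M0 hd; have p0 : 0 <= D by exact: le_trans hd.
have p2 := mulr_ge0 X20 p0; have p3 := mulr_ge0 A20 p0; have p4 := mulr_ge0 M0 k20.
lra.
Qed.

Section bounds.
Variables (N : nat) (kappa m K0 Rb r d : R) (u du ddu Y rho : nat -> R -> R) (f q : nat -> R).
Let h : R := mesh N.
Let tau := kappa * h.
Let L := 1 + tau.
Hypothesis H : residual_bounds N L m K0 Rb r d u du ddu Y rho f q.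
Hypotheses (k0 : 0 < kappa) (k1 : kappa <= 1) (m0 : 0 <= m) (Rb0 : 0 <= Rb) (K00 : 0 <= K0)
  (d0 : 0 <= d) (d1 : d <= 1) (km : kappa ^+ 2 * (4 + m) <= 1/2).

Let h0 : 0 < h. Proof. exact: mesh_gt0. Qed.
Let h1 : h <= 1. Proof. exact: mesh_le1. Qed.
Let tau0 : 0 < tau. Proof. exact: mulr_gt0. Qed.
Let tau1 : tau <= 1. Proof. by rewrite -[leRHS]mulr1; apply: ler_pM => //; exact: ltW. Qed.
Let tauk : tau <= kappa. Proof. by rewrite ger_pMr. Qed.
Let LE : 0 + tau <= L. Proof. by rewrite lerD2r. Qed.
Let L1 : 1 <= L. Proof. by rewrite lerDl ltW. Qed.

(** Taylor remainder on [[0, tau]]. If [X] bounds the acceleration it is of size [tau^2 X]; since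
    [tau = kappa h], the [h^-2] of a Laplacian leaves only [kappa^2 X]. *)
Let w t j := u j t - u j 0 - t * du j 0.

Lemma in_time t : 0 <= t <= tau -> 0 <= t <= L.
Proof. by move=> /andP[-> tt]/=; apply: (le_trans tt); rewrite /L lerDr. Qed.

Let ddu_cont : continuous (fun t => l2 N (ddu^~ t)).
Proof. by apply: l2_continuous => i iN; exact: rb_ddu_cont H i iN. Qed.

Let du_l2 X t : (forall s, 0 <= s <= tau -> l2 N (ddu^~ s) <= X) -> 0 <= t <= tau ->
  l2 N (fun j => du j t - du j 0) <= t * X.
Proof.
move=> HX /andP[t0 tt]; rewrite (@eq_l2 _ _ _ (fun j => intL (ddu j) 0 t)); last first.
  move=> i iN; have [_ ->] // := rb_abs_cont H (ltnW iN : (i.+1 <= N.+1)%N).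
  by rewrite (le_trans tt)// /L lerDr.
have ci i : (i < N)%N -> ible (ddu i.+1) 0 t by move=> iN; exact: cont_ible (rb_ddu_cont H iN).
apply: (le_trans (l2_intL ci)).
have -> : t * X = intL (fun=> X) 0 t by rewrite intL_cst// subr0 mulrC.
apply: intL_le; [exact: l2_ible|exact: ible_cst|].
by move=> s /andP[s0 st]; apply: HX; rewrite ltW//= (le_trans (ltW st)).
Qed.

Let wE j t : (j <= N.+1)%N -> 0 <= t -> w t j = intL (fun s => du j s - du j 0) 0 t.
Proof.
move=> jN t0; have cd := rb_du H jN; have cs : continuous (fun s => du j s - du j 0).
  by apply: contB => //; exact: contC.
rewrite intL_intg// intgB//; last exact: contC.
by rewrite intg_cst (intg_FTC _ _ cd (fun t => rb_u H t jN)) /w; ring.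
Qed.

Let w_l2 X t : 0 <= X -> (forall s, 0 <= s <= tau -> l2 N (ddu^~ s) <= X) -> 0 <= t <= tau ->
  l2 N (w t) <= tau ^+ 2 * X.
Proof.
move=> X0 HX /andP[t0 tt]; rewrite (@eq_l2 _ _ _ (fun j => intL (fun s => du j s - du j 0) 0 t)); last first.
  by move=> i iN; apply: wE => //; exact: ltnW.
have ci i : (i < N)%N -> ible (fun s => du i.+1 s - du i.+1 0) 0 t.
  move=> iN; apply: cont_ible; apply: contB; first by apply: rb_du H _ _; exact: ltnW.
  exact: contC.
apply: (le_trans (l2_intL ci)).
apply: (@le_trans _ _ (intL (fun=> tau * X) 0 t)).
  apply: intL_le; [exact: l2_ible|exact: ible_cst|].
  move=> s /andP[s0 st]; have st' : s <= tau by rewrite (le_trans (ltW st)).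
  apply: (le_trans (du_l2 HX _)); first by rewrite ltW.
  by rewrite ler_wpM2r.
rewrite intL_cst// subr0 mulrC expr2 -mulrA.
by apply: ler_wpM2r => //; apply: mulr_ge0 => //; exact: ltW.
Qed.

(** At the boundary nodes the acceleration is small in L2 in time only, so the remainder is of order
    [tau^(3/2) d] instead of [tau^2]; the extra mesh factor of a discrete norm compensates for this
    in [w_edges]. *)
Let w_bdry j t : (j <= N.+1)%N -> intL (fun t => ddu j t ^+ 2) 0 L <= d ^+ 2 -> 0 <= t <= tau ->
  w t j ^+ 2 <= tau ^+ 3 * d ^+ 2.
Proof.
move=> jN Hj tI; have /andP[t0 tt] := tI; rewrite wE//.
have cs : continuous (fun s => du j s - du j 0).
  by apply: contB; [exact: rb_du H _ jN|exact: contC].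
apply: (le_trans (intL_sqr_le t0 (cont_L2 _ _ cs))); rewrite subr0.
have h2 : intL (fun s => (du j s - du j 0) ^+ 2) 0 t <= intL (fun=> tau * d ^+ 2) 0 t.
  apply: intL_le; [exact: (cont_L2 _ _ cs).2|exact: ible_cst|].
  move=> s /andP[s0 st]; have st' : s <= tau by rewrite (le_trans (ltW st)).
  have sL : 0 <= s <= L by apply: in_time; rewrite ltW.
  have L0 : 0 <= (0 : R) <= L by rewrite lexx (le_trans _ L1).
  apply: (le_trans (abs_cont_dist2 (rb_abs_cont H jN) (rb_L2 H jN) L0 sL)).
  rewrite subr0 gtr0_norm//; apply: ler_pM => //; [exact: ltW|].
  exact: intL_sqr_ge0.
rewrite intL_cst// subr0 in h2.
apply: (le_trans (ler_wpM2l t0 h2)).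
have -> : tau ^+ 3 * d ^+ 2 = tau * (tau * d ^+ 2 * tau) by ring.
have c0 : 0 <= tau * d ^+ 2 by apply: mulr_ge0; [exact: ltW|exact: sqr_ge0].
by apply: ler_pM => //; [exact: mulr_ge0|exact: ler_wpM2l].
Qed.

Let w_edges X t : 0 <= X -> (forall s, 0 <= s <= tau -> l2 N (ddu^~ s) <= X) -> 0 <= t <= tau ->
  h * \sum_(i < N.+1) ((w t i.+1 - w t i) / h) ^+ 2 <= (tau * (2 * kappa * X + 3 * d)) ^+ 2.
Proof.
move=> X0 HX tI.
have -> : \sum_(i < N.+1) ((w t i.+1 - w t i) / h) ^+ 2 = (\sum_(i < N.+1) (w t i.+1 - w t i) ^+ 2) / h ^+ 2.
  by rewrite mulr_suml; apply: eq_bigr => i _; rewrite expr_div_n.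
have b1 := w_bdry (leq0n _) (rb_left H) tI; have b2 := w_bdry (leqnn _) (rb_right H) tI.
have := w_l2 X0 HX tI; rewrite -ler_sqr ?nnegrE ?l2_ge0//; last by apply: mulr_ge0 => //; exact: sqr_ge0.
rewrite l2_sqr -/h => b3.
have := edge_sum_le N (w t); move: (w t 0%N ^+ 2) (w t N.+1 ^+ 2) (\sum_(i < N) w t i.+1 ^+ 2) b1 b2 b3.
move: (\sum_(i < N.+1) (w t i.+1 - w t i) ^+ 2) => A x y z b1 b2 b3 b4.
have hn := lt0r_neq0 h0; rewrite mulrA ler_pdivrMr ?exprn_gt0//.
have tk : tau ^+ 3 = kappa * (tau ^+ 2 * h) by rewrite /tau; ring.
have b5 : h * x <= h ^+ 2 * tau ^+ 2 * d ^+ 2.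
  apply: (le_trans (ler_wpM2l (ltW h0) b1)); rewrite tk.
  have -> : h * (kappa * (tau ^+ 2 * h) * d ^+ 2) = kappa * (h ^+ 2 * tau ^+ 2 * d ^+ 2) by ring.
  by rewrite ler_piMl// -!exprMn sqr_ge0.
have b6 : h * y <= h ^+ 2 * tau ^+ 2 * d ^+ 2.
  apply: (le_trans (ler_wpM2l (ltW h0) b2)); rewrite tk.
  have -> : h * (kappa * (tau ^+ 2 * h) * d ^+ 2) = kappa * (h ^+ 2 * tau ^+ 2 * d ^+ 2) by ring.
  by rewrite ler_piMl// -!exprMn sqr_ge0.
have b7 : (tau ^+ 2 * X) ^+ 2 = h ^+ 2 * tau ^+ 2 * (kappa * X) ^+ 2 by rewrite /tau; ring.
have b8 := ler_wpM2l (ltW h0) b4.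
have hd : h ^+ 2 * tau ^+ 2 * (4 * ((kappa * X) ^+ 2 + 2 * d ^+ 2)) <= h ^+ 2 * tau ^+ 2 * (2 * kappa * X + 3 * d) ^+ 2.
  apply: ler_wpM2l; first by apply: mulr_ge0; exact: sqr_ge0.
  have := mulr_ge0 (mulr_ge0 (ltW k0) X0) d0; have := sqr_ge0 d.
  by rewrite !expr2; lra.
have -> : (tau * (2 * kappa * X + 3 * d)) ^+ 2 * h ^+ 2 = h ^+ 2 * tau ^+ 2 * (2 * kappa * X + 3 * d) ^+ 2 by ring.
apply: le_trans hd; rewrite b7 in b3; lra.
Qed.

(** In the Taylor expansion the initial Laplacian contributes [d]; the one of the initial velocity
    costs [2 / h], compensated by [t <= kappa h], hence [2 d]; the remainder contributes
    [6 d + 4 kappa^2 X]. *)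
Let lap_u X t : 0 <= X -> (forall s, 0 <= s <= tau -> l2 N (ddu^~ s) <= X) -> 0 <= t <= tau ->
  l2 N (laplacian_h N (u^~ t)) <= 9 * d + 4 * kappa ^+ 2 * X.
Proof.
move=> X0 HX tI; have /andP[t0 tt] := tI; have hn := lt0r_neq0 h0.
have b1 := w_edges X0 HX tI; have c0 : 0 <= 2 * kappa * X + 3 * d.
  by apply: addr_ge0; apply: mulr_ge0 => //; apply: mulr_ge0 => //; exact: ltW.
have b2 := l2_laplacian_le (mulr_ge0 (ltW tau0) c0) b1.
have b3 := @l2_laplacian_le N (du^~ 0) d d0 (rb_init_slope H).
rewrite (@eq_l2 _ _ _ (fun j => laplacian_h N (u^~ 0) j + (t * laplacian_h N (du^~ 0) j + laplacian_h N (w t) j))); last first.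
  by move=> i iN; rewrite /laplacian_h /w; field.
apply: (le_trans (l2D _ _ _)); have b4 := rb_init_lap H.
apply: (le_trans (lerD b4 (l2D _ _ _))); rewrite l2Z ger0_norm//.
have b5 : t * l2 N (laplacian_h N (du^~ 0)) <= 2 * d.
  apply: (@le_trans _ _ (tau * (2 * d / h))); first by apply: ler_pM => //; exact: l2_ge0.
  have -> : tau * (2 * d / h) = kappa * (2 * d) by rewrite /tau; field.
  by rewrite ler_piMl// mulr_ge0.
have b6 : 2 * (tau * (2 * kappa * X + 3 * d)) / h = 4 * kappa ^+ 2 * X + 6 * (kappa * d).
  by rewrite /tau; field.
have b7 : kappa * d <= d by rewrite ler_piMl.
rewrite b6 in b2; lra.
Qed.

Let u_l2 X t : 0 <= X -> (forall s, 0 <= s <= tau -> l2 N (ddu^~ s) <= X) -> 0 <= t <= tau ->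
  l2 N (u^~ t) <= 2 * d + kappa ^+ 2 * X.
Proof.
move=> X0 HX tI; have /andP[t0 tt] := tI.
rewrite (@eq_l2 _ _ _ (fun j => u j 0 + (t * du j 0 + w t j))); last first.
  by move=> i iN; rewrite /w; ring.
apply: (le_trans (l2D _ _ _)).
have b1 : l2 N (u^~ 0) <= d by apply: l2_le_sup => // i iN; apply: rb_init H _ _; exact: ltnW.
have b2 : l2 N (du^~ 0) <= d by apply: l2_le_sup => // i iN; apply: rb_init_t H _ _; exact: ltnW.
apply: (le_trans (lerD b1 (l2D _ _ _))); rewrite l2Z ger0_norm//.
have b3 : t * l2 N (du^~ 0) <= d.
  rewrite -[leRHS]mul1r; apply: ler_pM => //; first exact: l2_ge0.
  exact: le_trans tau1.
have b4 := w_l2 X0 HX tI.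
have b5 : tau ^+ 2 * X <= kappa ^+ 2 * X.
  by apply: ler_wpM2r => //; apply: lerXn2r tauk; rewrite nnegrE ltW.
lra.
Qed.

Let X0 := 2 * (10 + 2 * m + 2 * m * K0).

Let X00 : 0 <= X0.
Proof. by apply: mulr_ge0 => //; apply: addr_ge0; [apply: addr_ge0 => //|]; rewrite !mulr_ge0. Qed.

Let m40 : 0 <= 4 + m. Proof. by have mm := m0; lra. Qed.

Let m_l2 (x : nat -> R) (c : R) (y : nat -> R) : (forall i, (i < N)%N -> `|x i.+1| <= c) -> 0 <= c ->
  l2 N (fun j => x j * y j) <= c * l2 N y.
Proof.
move=> xc c0; rewrite -[X in _ <= X * _](ger0_norm c0) -l2Z.
have -> : l2 N (fun j => c * y j) = l2 N (fun j => `|c * y j|).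
  by rewrite /l2; congr (Num.sqrt (_ * _)); apply: eq_bigr => i _; rewrite real_normK ?num_real.
apply: le_l2 => i iN; rewrite !normrM (ger0_norm c0).
by apply: ler_wpM2r => //; exact: xc.
Qed.

(** The equation solved for the acceleration and compared with a target [y]: it serves with [y = 0]
    for the bound [X0], and with [y = f Y(0)] for the defect [e]. *)
Let ddu_le X t : 0 <= X -> (forall s, 0 <= s <= tau -> l2 N (ddu^~ s) <= X) -> 0 <= t <= tau ->
  forall y c, l2 N (fun j => f j * Y j t - y j) <= c ->
  l2 N (fun j => ddu j t - y j) <= (10 + 2 * m) * d + kappa ^+ 2 * (4 + m) * X + c.
Proof.
move=> XX HX tI y c yc; have b1 := lap_u XX HX tI; have b2 := u_l2 XX HX tI.
have tL := in_time tI; have b3 := rb_rho H tL.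
rewrite (@eq_l2 _ _ _ (fun j => (laplacian_h N (u^~ t) j - q j * u j t) +
   ((f j * Y j t - y j) - rho j t))); last first.
  by move=> i iN; have := rb_eq H iN tL; lra.
apply: (le_trans (l2D _ _ _)).
apply: (le_trans (lerD (l2B _ _ _) (l2B _ _ _))).
have b4 := m_l2 (u^~ t) (rb_q H) m0.
have b5 := ler_wpM2l m0 b2; lra.
Qed.

(** Bootstrap on the maximum [X] over [[0, tau]]: [ddu_le] returns [X] with the factor
    [kappa^2 (4 + m) <= 1/2], so [X <= 2 (10 + 2 m + 2 m K0)], which is [X0]. *)
Let ddu_sup t : 0 <= t <= tau -> l2 N (ddu^~ t) <= X0.
Proof.
have [c /itvP cI Hc] := @EVT_max R (fun t => l2 N (ddu^~ t)) 0 tau (ltW tau0)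
  (continuous_subspaceT ddu_cont).
have HX s : 0 <= s <= tau -> l2 N (ddu^~ s) <= l2 N (ddu^~ c).
  by move=> sI; apply: Hc; rewrite in_itv.
have cI' : 0 <= c <= tau by rewrite !cI.
move=> tI; apply: (le_trans (HX t tI)).
have b1 : l2 N (fun j => f j * Y j c - (fun=> 0) j) <= 2 * m * K0.
  apply: l2_le_sup => [|i iN]; first by rewrite !mulr_ge0.
  rewrite subr0 normrM; apply: ler_pM => //; first exact: rb_f H _ iN.
  by apply: rb_Y H _ _ iN _; exact: in_time.
have := ddu_le (l2_ge0 _ _) HX cI' b1; rewrite (@eq_l2 _ N _ (ddu^~ c)); last first.
  by move=> i _; rewrite subr0.
set X := l2 N _; have XX : 0 <= X by exact: l2_ge0.
have b2 := ler_wpM2r XX km; have b3 : (10 + 2 * m) * d <= 10 + 2 * m.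
  by rewrite ler_piMr//; have mm := m0; lra.
rewrite /X0; lra.
Qed.

Let Z j t := dq tau (u j) t.
Let a j t := dq tau (du j) t.
(** Defect of the relation [u'' = f Y] at time 0 once [u''(0)] is replaced by the difference
    quotient of [u']. *)
Let e j := a j 0 - f j * Y j 0.

(** The quotient at 0 is the mean of [ddu] over [[0, tau]], so the equation is used at all these
    times. Replacing [Y] by its initial value costs [2 m Rb tau], and [tau <= kappa]. *)
Let e_l2 : l2 N e <= (10 + 2 * m) * d + kappa * ((4 + m) * X0 + 2 * m * Rb).
Proof.
have cY i : (i < N)%N -> continuous (fun t => ddu i.+1 t - f i.+1 * Y i.+1 0).
  by move=> iN; apply: contB; [exact: rb_ddu_cont H i iN|exact: contC].
have t00 : 0 <= (0 : R) <= L by rewrite lexx (le_trans _ L1).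
rewrite (@eq_l2 _ _ _ (fun j => avg tau (fun t => ddu j t - f j * Y j 0) 0)); last first.
  move=> i iN; rewrite avgB; [|exact: rb_ddu_cont H i iN|exact: contC].
  rewrite avg_cst// /e /a; congr (_ - _).
  by rewrite /dq /avg (intg_FTC _ _ (rb_ddu_cont H iN) (fun t => rb_ddu H t iN)).
apply: (@l2_avg _ N tau (fun j t => ddu j t - f j * Y j 0) _ 0 0) => //; last by rewrite lexx.
rewrite add0r => t tI.
have b1 : l2 N (fun j => f j * Y j t - f j * Y j 0) <= 2 * m * Rb * kappa.
  apply: l2_le_sup => [|i iN]; first by rewrite !mulr_ge0// ltW.
  rewrite -mulrBr normrM -[leRHS]mulrA; apply: ler_pM => //; first exact: rb_f H _ iN.
  apply: (le_trans (rb_Y_lip H iN t00 (in_time tI))); rewrite subr0.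
  case/andP: tI => t0 tt; rewrite ger0_norm//; apply: ler_wpM2l => //; exact: le_trans tauk.
have := ddu_le X00 ddu_sup tI b1.
have b2 : kappa ^+ 2 * (4 + m) * X0 <= kappa * ((4 + m) * X0).
  rewrite -mulrA; apply: ler_wpM2r; first exact: mulr_ge0 m40 X00.
  by rewrite expr2 ger_pMr.
lra.
Qed.

Let Z_l2 : l2 N (fun j => Z j 0) <= d + kappa * X0.
Proof.
rewrite (@eq_l2 _ _ _ (fun j => avg tau (du j) 0)); last first.
  move=> i iN; have iN' : (i.+1 <= N.+1)%N by exact: ltnW.
  by rewrite /Z /dq /avg (intg_FTC _ _ (rb_du H iN') (fun t => rb_u H t iN')).
apply: (@l2_avg _ N tau du _ 0 0) => //; last by rewrite lexx.
  by move=> i iN; apply: rb_du H _ _; exact: ltnW.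
rewrite add0r => t tI; have /andP[t0 tt] := tI.
rewrite (@eq_l2 _ _ _ (fun j => du j 0 + (du j t - du j 0))); last by move=> i _; ring.
have b2 : l2 N (du^~ 0) <= d by apply: l2_le_sup => // i iN; apply: rb_init_t H _ _; exact: ltnW.
apply: (le_trans (l2D _ _ _)); apply: lerD => //.
apply: (le_trans (du_l2 ddu_sup tI)); apply: ler_wpM2r => //; exact: le_trans tauk.
Qed.

(** The quotient [Z(0)] is the initial velocity plus the Taylor remainder divided by [tau], whose
    edge differences are bounded by [w_edges]. *)
Let slope0 : h * \sum_(i < N.+1) ((Z i.+1 0 - Z i 0) / h) ^+ 2 <=
  2 * d ^+ 2 + 2 * (2 * kappa * X0 + 3 * d) ^+ 2.
Proof.
have tt : 0 <= tau <= tau by rewrite ltW//=.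
have b1 := w_edges X00 ddu_sup tt; have b2 := rb_init_slope H; have tn := lt0r_neq0 tau0.
have e1 j : Z j 0 = du j 0 + w tau j / tau by rewrite /Z /dq /w add0r; field.
apply: (@le_trans _ _ (h * \sum_(i < N.+1) (2 * ((du i.+1 0 - du i 0) / h) ^+ 2 +
   2 * (((w tau i.+1 - w tau i) / h) ^+ 2 / tau ^+ 2)))).
  rewrite ler_pM2l//; apply: ler_sum => i _; rewrite !e1.
  have -> : ((w tau i.+1 - w tau i) / h) ^+ 2 / tau ^+ 2 = ((w tau i.+1 - w tau i) / tau / h) ^+ 2.
   by rewrite !expr_div_n mulrAC.
  have -> : (du i.+1 0 + w tau i.+1 / tau - (du i 0 + w tau i / tau)) / h =
   (du i.+1 0 - du i 0) / h + (w tau i.+1 - w tau i) / tau / h by ring.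
  move: ((du i.+1 0 - du i 0) / h) ((w tau i.+1 - w tau i) / tau / h) => x y.
  by have := sqr_ge0 (x - y); rewrite !expr2; lra.
rewrite big_split/= -!mulr_sumr -mulr_suml.
have b3 : h * (\sum_(i < N.+1) ((w tau i.+1 - w tau i) / h) ^+ 2) / tau ^+ 2 <= (2 * kappa * X0 + 3 * d) ^+ 2.
  rewrite ler_pdivrMr ?exprn_gt0//; apply: (le_trans b1); rewrite exprMn mulrC; exact: lexx.
rewrite -/h in b2; move: b2 b3.
move: (\sum_(i < N.+1) _) => A; move: (\sum_(i < N.+1) _) => B b2 b3.
rewrite (_ : h * (2 * A + 2 * (B / tau ^+ 2)) = 2 * (h * A) + 2 * (h * B / tau ^+ 2)); last by ring.
lra.
Qed.

Let Ltau : (1 : R) + tau = L. Proof. by []. Qed.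

Let cdu j : (j <= N.+1)%N -> continuous (du j). Proof. exact: rb_du H j. Qed.
Let ca j : (j <= N.+1)%N -> continuous (a j).
Proof. by move=> jN; apply: dq_cont; exact: cdu. Qed.
Let cZ j : (j <= N.+1)%N -> continuous (Z j).
Proof.
move=> jN; apply: dq_cont; apply: derive_cont (du j) _ => t; exact: rb_u H j t jN.
Qed.

Let cX2 (x : R -> R) : continuous x -> continuous (fun t => x t ^+ 2).
Proof. exact: contX. Qed.

(** With [F] the flux of the velocity, the jump on the last edge is [(F(t + tau) - F(t)) h / tau],
    and [h / tau = 1 / kappa]. This division by [kappa] forces [d] to be much smaller than
    [kappa]. *)
Let bdry_le : intg (bdry N h Z a) 0 1 <= 2 * d ^+ 2 + 4 * d ^+ 2 / kappa ^+ 2.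
Proof.
pose F t := (du N.+1 t - du N t) / h; pose G t := (u N.+1 t - u N t) / h.
have hn := lt0r_neq0 h0; have kn := lt0r_neq0 k0.
have cF : continuous F by rewrite /F; have := cdu (leqnn N.+1); have := cdu (leqnSn N) => c1 c2; cont.
have dG t : is_derive t (1 : R) G (F t).
  have dr := rb_u H t (leqnn N.+1); have dl := rb_u H t (leqnSn N).
  have := is_deriveMl h^-1 (is_deriveB dr dl); rewrite /F /G [X in is_derive _ _ _ X]mulrC.
  by congr is_derive; apply/funext => s; rewrite mulrC.
have aG := abs_cont_C1 0 L dG cF.
have cG : continuous G := derive_cont dG.
have ca1 := ca (leqnn N.+1); have ca2 := ca (leqnSn N).
have cZ1 := cZ (leqnn N.+1); have cZ2 := cZ (leqnSn N).
have cW : continuous (slope h Z N) by rewrite /slope; cont.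
have cb : continuous (jump a N) by rewrite /jump; cont.
rewrite (_ : bdry N h Z a = fun t => slope h Z N t ^+ 2 + jump a N t ^+ 2 + a N.+1 t ^+ 2)//.
rewrite intgD; [|by apply: contD; exact: cX2|exact: cX2].
rewrite intgD; [|exact: cX2|exact: cX2].
have b1 : intg (fun t => slope h Z N t ^+ 2) 0 1 <= d ^+ 2.
  rewrite -intL_intg//; last exact: cX2.
  rewrite (_ : (fun t => slope h Z N t ^+ 2) = (fun t => dq tau G t ^+ 2)); last first.
   by apply/funext => t; congr (_ ^+ 2); rewrite /slope /Z /dq /G; ring.
  apply: (le_trans (intL_sqr_dq tau0 ler01 cG aG (cont_L2 _ _ cF))).
  exact: rb_flux H.
have b2 : intg (fun t => jump a N t ^+ 2) 0 1 <= 4 * d ^+ 2 / kappa ^+ 2.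
  have cF1 : continuous (fun t => F (t + tau)) by exact: cont_shift.
  apply: (@le_trans _ _ (intg (fun t => (2 / kappa ^+ 2) * (F (t + tau) ^+ 2 + F t ^+ 2)) 0 1)).
   apply: intg_le => //; first exact: cX2.
   by apply: contM; [exact: contC|apply: contD; exact: cX2].
   move=> t _; rewrite (_ : jump a N t = kappa^-1 * (F (t + tau) - F t)); last first.
   by rewrite /jump /a /dq /F /tau; field; rewrite hn kn.
   rewrite exprMn exprVn [2 / _]mulrC -mulrA; apply: ler_wpM2l; first by rewrite invr_ge0 sqr_ge0.
   by have := sqr_ge0 (F (t + tau) + F t); move: (F _) (F _) => x y; rewrite !expr2; lra.
  rewrite intgZ; last by apply: contD; exact: cX2.
  rewrite intgD; [|exact: cX2|exact: cX2].
  rewrite (intg_shift tau 0 1 (cX2 cF)).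
  have cF2 := cX2 cF; have F2 := rb_flux H.
  rewrite -/h -/(F _) in F2; rewrite (intL_intg cF2) in F2; last by apply: le_trans L1.
  have p1 : intg (fun t => F t ^+ 2) 1 L >= 0 by apply: intg_ge0 => // t _; exact: sqr_ge0.
  have p2 : intg (fun t => F t ^+ 2) 0 (0 + tau) >= 0.
   by apply: intg_ge0 => // [|t _]; [rewrite lerDl ltW|exact: sqr_ge0].
  have p3 := intg_cat (fun t => F t ^+ 2) 0 1 L.
  have p4 := intg_cat (fun t => F t ^+ 2) 0 (0 + tau) (1 + tau).
  rewrite -/(L) in p4 *.
  have -> : 4 * d ^+ 2 / kappa ^+ 2 = 2 / kappa ^+ 2 * (2 * d ^+ 2) by field.
  apply: ler_wpM2l; first by apply: divr_ge0 => //; exact: sqr_ge0.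
  lra.
have b3 : intg (fun t => a N.+1 t ^+ 2) 0 1 <= d ^+ 2.
  rewrite -intL_intg//; last exact: cX2.
  apply: (le_trans (intL_sqr_dq tau0 ler01 (cdu (leqnn _)) (rb_abs_cont H (leqnn _)) (rb_L2 H (leqnn _)))).
  exact: rb_right H.
lra.
Qed.

Let jumps_le : intg (jumps N h a) 0 1 <= d ^+ 2.
Proof.
have cb i : (i < N.+1)%N -> continuous (fun t => jump a i t).
  by move=> iN; have c1 := ca iN; have c2 := ca (ltnW iN); rewrite /jump; cont.
rewrite (_ : jumps N h a = fun t => h * \sum_(i < N.+1) jump a i t ^+ 2)//.
have cs i : (i < N.+1)%N -> continuous (fun t => jump a i t ^+ 2) by move=> /cb; exact: cX2.
rewrite intgZ; last by apply: cont_sum => i _; exact: cs.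
rewrite intg_sum; last by move=> i _; exact: cs.
apply: le_trans (rb_jumps H); rewrite ler_pM2l//; apply: ler_sum => i _.
have iN := ltn_ord i; rewrite -intL_intg//; last exact: cs.
rewrite (_ : (fun t => jump a i t ^+ 2) = (fun t => dq tau (fun t => du i.+1 t - du i t) t ^+ 2)); last first.
  by apply/funext => t; congr (_ ^+ 2); rewrite /jump /a /dq; ring.
apply: (intL_sqr_dq tau0 ler01).
- by apply: contB; apply: cdu => //; exact: ltnW.
- by apply: abs_contB; apply: rb_abs_cont H _ _ => //; exact: ltnW.
- by apply: L2B; apply: rb_L2 H _ _ => //; exact: ltnW.
Qed.

Let rhot j t := dq tau (rho j) t.

Let rho_le : 0 <= intg (rho_norm N h rhot) 0 1 <= d.
Proof.
have [drho [ar Hr]] := rb_drho H.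
have cr i : (i < N)%N -> continuous (rhot i.+1).
  by move=> iN; apply: dq_cont; exact: rb_rho_cont H i iN.
have cn : continuous (fun t => l2 N (rhot^~ t)) by exact: l2_continuous.
rewrite (_ : intg _ 0 1 = intL (fun t => l2 N (rhot^~ t)) 0 1); last by rewrite (intL_intg cn ler01).
apply/andP; split; first by apply: intL_ge0 => t _; exact: l2_ge0.
by apply: le_trans Hr; apply: intL_l2_dq => //; exact: rb_rho_cont H.
Qed.

Let e_sum_le : h * (\sum_(i < N) e i.+1 ^+ 2) <= ((10 + 2 * m) * d + kappa * ((4 + m) * X0 + 2 * m * Rb)) ^+ 2.
Proof.
have e0 : 0 <= (4 + m) * X0 + 2 * m * Rb.
by apply: addr_ge0; [exact: mulr_ge0 m40 X00|rewrite !mulr_ge0].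
rewrite -(l2_sqr N e); apply: lerXn2r e_l2; rewrite nnegrE ?l2_ge0//.
by apply: addr_ge0; apply: mulr_ge0 => //; [apply: addr_ge0 => //; exact: mulr_ge0|exact: ltW].
Qed.

Lemma data_le : data N h Z a rhot e <=
  data_cst m X0 ((4 + m) * X0 + 2 * m * Rb) * (kappa ^+ 2 + d ^+ 2 / kappa ^+ 2).
Proof.
have e0 : 0 <= (4 + m) * X0 + 2 * m * Rb.
  by apply: addr_ge0; [exact: mulr_ge0 m40 X00|rewrite !mulr_ge0].
have /andP[r0 r1] := rho_le.
have p2 := e_sum_le.
have p1 : h * (\sum_(i < N) Z i.+1 0 ^+ 2) <= (d + kappa * X0) ^+ 2.
  rewrite -(l2_sqr N (Z^~ 0)); apply: lerXn2r Z_l2; rewrite nnegrE ?l2_ge0//.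
  by apply: addr_ge0 => //; apply: mulr_ge0 => //; exact: ltW.
have p3 : intg (rho_norm N h rhot) 0 1 ^+ 2 <= d ^+ 2 by apply: lerXn2r r1; rewrite nnegrE.
exact: (data_arith k0 k1 m0 bdry_le jumps_le slope0 p1 p2 p3).
Qed.

(** Difference quotients of [u] take the place of [u'] because the boundary components have their
    second derivative in L2 only, whereas the multipliers require a continuous [a] at every node. *)
Lemma core_conclusion beta n C K : K = 2 / r ^+ 2 -> 0 < r -> 0 <= C ->
  (forall N (Z a acc : nat -> R -> R) (f q : nat -> R) (Rr rho : nat -> R -> R) (e : nat -> R),
  (forall j t, (j <= N.+1)%N -> is_derive t (1 : R) (Z j) (a j t)) ->
  (forall j, (j <= N.+1)%N -> continuous (a j)) ->
  (forall i t, (i < N)%N -> is_derive t (1 : R) (a i.+1) (acc i.+1 t)) ->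
  (forall i, (i < N)%N -> continuous (rho i.+1)) ->
  (forall i (t : R), (i < N)%N -> 0 <= t <= 1 -> `|Rr i.+1 t| <= Rb) ->
  (forall i, (i < N)%N -> `|q i.+1| <= m) ->
  (forall i, (i < N)%N -> f i.+1 ^+ 2 <= K * (a i.+1 0 ^+ 2 + e i.+1 ^+ 2)) ->
  (forall i (t : R), (i < N)%N -> 0 <= t <= 1 ->
   acc i.+1 t - laplacian_h N (Z^~ t) i.+1 + q i.+1 * Z i.+1 t = f i.+1 * Rr i.+1 t - rho i.+1 t) ->
  mesh N * \sum_(i < N) weight beta n N i.+1 0 * a i.+1 0 ^+ 2 <= C * data N (mesh N) Z a rho e) ->
  mesh N * \sum_(i < N) Num.min 1 (weight beta n N i.+1 0) * f i.+1 ^+ 2 <=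
  K * (C + 1) * (data_cst m X0 ((4 + m) * X0 + 2 * m * Rb) * (kappa ^+ 2 + d ^+ 2 / kappa ^+ 2)).
Proof.
move=> KE r0 C0 carleman; set D := data_cst _ _ _ * _; have r2 : 0 < r ^+ 2 by rewrite exprn_gt0.
have K0' : 0 <= K by rewrite KE divr_ge0// ltW.
(* [f Y(0) = a(0) - e] by definition of [e], and [|Y(0)| >= r]; the square of a difference gives the
   2 in [K = 2 / r^2]. *)
have fK i : (i < N)%N -> f i.+1 ^+ 2 <= K * (a i.+1 0 ^+ 2 + e i.+1 ^+ 2).
  move=> iN; have hy := rb_Y0 H iN; rewrite KE mulrAC ler_pdivlMr//.
  apply: (@le_trans _ _ ((f i.+1 * Y i.+1 0) ^+ 2)).
   rewrite exprMn; apply: ler_wpM2l; first exact: sqr_ge0.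
   by rewrite -(real_normK (num_real (Y i.+1 0))); apply: lerXn2r hy; rewrite nnegrE// ltW.
  have -> : f i.+1 * Y i.+1 0 = a i.+1 0 - e i.+1 by rewrite /e; ring.
  move: (a i.+1 0) (e i.+1) => x y; have := sqr_ge0 (x + y); have := sqr_ge0 x; have := sqr_ge0 y.
  by rewrite !expr2; lra.
have := carleman N Z a (fun j => dq tau (ddu j)) f q (fun j => dq tau (Y j)) rhot e.
move=> /(_ _ _ _ _ _ (rb_q H) fK) hc.
have {}hc : mesh N * \sum_(i < N) weight beta n N i.+1 0 * a i.+1 0 ^+ 2 <= C * data N h Z a rhot e.
  apply: hc.
  - move=> j t jN; apply: (@dq_derive _ tau (u j) (du j)) => s; exact: rb_u H j s jN.
  - by move=> j jN; exact: ca.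
  - move=> i t iN; apply: (@dq_derive _ tau (du i.+1) (ddu i.+1)) => s; exact: rb_ddu H i s iN.
  - by move=> i iN; apply: dq_cont; exact: rb_rho_cont H i iN.
  - move=> i t iN /andP[t0 t1].
   have tL : 0 <= t <= L by rewrite t0 (le_trans t1).
   have ttL : 0 <= t + tau <= L by rewrite (addr_ge0 t0 (ltW tau0))/= lerD2r.
   rewrite /dq normrM (gtr0_norm (x := tau^-1)) ?invr_gt0// ler_pdivrMr//.
   apply: (le_trans (rb_Y_lip H iN tL ttL)); rewrite (_ : t + tau - t = tau); last by ring.
   by rewrite gtr0_norm.
  - move=> i t iN /andP[t0 t1].
   have tL : 0 <= t <= L by rewrite t0 (le_trans t1).
   have ttL : 0 <= t + tau <= L by rewrite (addr_ge0 t0 (ltW tau0))/= lerD2r.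
   have e1 := rb_eq H iN tL; have e2 := rb_eq H iN ttL.
   rewrite /rhot /Z /dq /laplacian_h -/h.
   have -> : f i.+1 * ((Y i.+1 (t + tau) - Y i.+1 t) / tau) - (rho i.+1 (t + tau) - rho i.+1 t) / tau
   = ((f i.+1 * Y i.+1 (t + tau) - rho i.+1 (t + tau)) - (f i.+1 * Y i.+1 t - rho i.+1 t)) / tau by ring.
   by rewrite -e1 -e2 /laplacian_h -/h; ring.
have hd := data_le; have hD : data N h Z a rhot e <= D by exact: hd.
have he : h * \sum_(i < N) e i.+1 ^+ 2 <= D.
  have z0 x y : 0 <= 2 * (x : R) ^+ 2 + 2 * (y : R) ^+ 2 by apply: addr_ge0; apply: mulr_ge0 => //; exact: sqr_ge0.
  have b0 : (0 : R) <= 2 * d ^+ 2 + 4 * d ^+ 2 / kappa ^+ 2.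
   by apply: addr_ge0; [|apply: divr_ge0; [|exact: sqr_ge0]]; apply: mulr_ge0 => //; exact: sqr_ge0.
  have := data_arith k0 k1 m0 b0 (sqr_ge0 d) (z0 d _) (sqr_ge0 _) e_sum_le (sqr_ge0 d).
  by move=> /(_ X0); rewrite !add0r addr0.
(* Capping the weight at 1 keeps the Carleman bound for the part in [a] and lets the defect [e]
   enter with factor 1. *)
have hw (i : 'I_N) : Num.min 1 (weight beta n N i.+1 0) * f i.+1 ^+ 2 <=
   K * (weight beta n N i.+1 0 * a i.+1 0 ^+ 2 + e i.+1 ^+ 2).
  have w0 : 0 <= weight beta n N i.+1 0 :> R by exact: pospow_ge0.
  have m1 : Num.min 1 (weight beta n N i.+1 0) <= 1 :> R by rewrite ge_min lexx.
  have m2 : Num.min 1 (weight beta n N i.+1 0) <= weight beta n N i.+1 0 :> R by rewrite ge_min lexx orbT.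
  have m3 : 0 <= Num.min 1 (weight beta n N i.+1 0) :> R by rewrite le_min ler01.
  apply: (le_trans (ler_wpM2l m3 (fK i (ltn_ord i)))).
  rewrite mulrCA; apply: ler_wpM2l => //; rewrite mulrDr; apply: lerD; first by apply: ler_wpM2r => //; exact: sqr_ge0.
  by rewrite ler_piMl// sqr_ge0.
apply: (le_trans (ler_wpM2l (ltW h0) (ler_sum _ (fun i _ => hw i)))).
rewrite -mulr_sumr big_split/= mulrCA mulrDr -mulrA; apply: ler_wpM2l => //.
rewrite mulrDl mul1r; apply: lerD => //.
by apply: (le_trans hc); apply: ler_wpM2l.
Qed.

End bounds.
(** A counting argument; carrying the bound [n h] along with the bound [c] closes the induction. *)
Let near_left_sum n (h c : R) : 0 <= h -> 0 <= c ->
  \sum_(i < n) (if i.+1%:R * h < c then h else 0) <= c.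
Proof.
move=> h0 c0; suff [] : \sum_(i < n) (if i.+1%:R * h < c then h else 0) <= n%:R * h /\
  \sum_(i < n) (if i.+1%:R * h < c then h else 0) <= c by [].
elim: n => [|n [IH1 IH2]]; first by rewrite big_ord0 mul0r.
rewrite big_ord_recr/=; case: ifPn => hc; last first.
  by rewrite addr0; split=> //; apply: (le_trans IH1); rewrite ler_wpM2r// ler_nat.
have -> : n.+1%:R * h = n%:R * h + h by rewrite -natr1 mulrDl mul1r.
have h1 : \sum_(i < n) (if i.+1%:R * h < c then h else 0) + h <= n%:R * h + h by rewrite lerD2r.
split=> //; apply: (le_trans h1); apply: ltW; apply: le_lt_trans hc.
by rewrite -natr1 mulrDl mul1r.
Qed.

Theorem core_estimate (m K0 Rb r e : R) : 0 <= m -> 0 <= Rb -> 0 <= K0 -> 0 < r -> 0 < e ->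
  exists kappa d, [/\ 0 < kappa <= 1, 0 < d <= 1 & forall N u du ddu Y rho f q,
   residual_bounds N (1 + kappa * mesh N) m K0 Rb r d u du ddu Y rho f q ->
   mesh N * \sum_(i < N) f i.+1 ^+ 2 <= e].
Proof.
move=> m0 Rb0 K00 r0 e0; have m20 := sqr_ge0 m.
(* The slope will be [beta = 1 + s]. For [x >= 2 s] the initial weight is at least [s^n]; on the
   rest, of length [2 s], the bound [f^2 <= 4 m^2] costs [8 m^2 s <= e / 2]. *)
pose s := e / (16 * m ^+ 2 + 1).
have den0 : 0 < 16 * m ^+ 2 + 1 by lra.
have s0 : 0 < s by exact: divr_gt0.
have s1 : 8 * m ^+ 2 * s <= e / 2.
  rewrite /s mulrA ler_pdivrMr//; move: (m ^+ 2) m20 => y y0.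
  by have := mulr_ge0 y0 (ltW e0); lra.
have K2 : 0 <= 2 / r ^+ 2 by apply: divr_ge0 => //; exact: sqr_ge0.
have [|n [C [C0 HC]]] := @discrete_carleman R (1 + s) Rb m (2 / r ^+ 2) _ K2; first by lra.
pose om := Num.min 1 (pospow n s).
have om0 : 0 < om by rewrite lt_min ltr01/= /pospow max_r ?ltW// exprn_gt0.
pose X0 := 2 * (10 + 2 * m + 2 * m * K0).
pose Dc := data_cst m X0 ((4 + m) * X0 + 2 * m * Rb).
pose G := om^-1 * (2 / r ^+ 2 * (C + 1) * Dc).
have Dc0 : 0 <= Dc.
  rewrite /Dc /data_cst; have := sqr_ge0 X0; have := sqr_ge0 ((4 + m) * X0 + 2 * m * Rb).
  by have := sqr_ge0 (10 + 2 * m); move: (_ ^+ 2) (_ ^+ 2) (_ ^+ 2) => *; lra.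
have G0 : 0 <= G.
  apply: mulr_ge0; first by rewrite invr_ge0 ltW.
  by apply: mulr_ge0 => //; apply: mulr_ge0 => //; lra.
(* The second term yields [k^2 (4 + m) <= 1/2], which absorbs the acceleration; the third makes the
   final error [2 k^2 G] at most [e / 2]. *)
pose k := Num.min 1 (Num.min (1 / (2 * (4 + m))) (e / (4 * (G + 1)))).
have k0 : 0 < k by rewrite !lt_min ltr01/= !divr_gt0//; lra.
have k1 : k <= 1 by rewrite ge_min lexx.
have k2 : k <= 1 / (2 * (4 + m)) by rewrite !ge_min lexx orbT.
have k3 : k <= e / (4 * (G + 1)) by rewrite !ge_min lexx !orbT.
have kk : k ^+ 2 <= k by rewrite expr2 ger_pMr.
(* With [d = k^2] the two errors [k^2] and [d^2 / k^2] are equal. *)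
exists k, (k ^+ 2); split; [by rewrite k0|by rewrite exprn_gt0//= (le_trans kk)|].
move=> N u du ddu Y rho f q H; have h0 := @mesh_gt0 R N.
have km : k ^+ 2 * (4 + m) <= 1 / 2.
  have : k * (4 + m) <= 1 / (2 * (4 + m)) * (4 + m) by apply: ler_wpM2r => //; lra.
  rewrite (_ : 1 / (2 * (4 + m)) * (4 + m) = 1 / 2); last by field; apply: lt0r_neq0; lra.
  by apply: le_trans; apply: ler_wpM2r => //; lra.
have d1 : k ^+ 2 <= 1 by exact: le_trans k1.
have := core_conclusion H k0 k1 m0 Rb0 K00 (sqr_ge0 k) d1 km erefl r0 C0 HC.
rewrite -/X0 -/Dc => Hc.
have kd : k ^+ 2 + (k ^+ 2) ^+ 2 / k ^+ 2 = 2 * k ^+ 2 by field; exact: lt0r_neq0.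
have hi (i : 'I_N) : mesh N * f i.+1 ^+ 2 <= mesh N * (om^-1 * (Num.min 1 (weight (1 + s) n N i.+1 0) * f i.+1 ^+ 2))
   + 4 * m ^+ 2 * (if i.+1%:R * mesh N < 2 * s then mesh N else 0).
  have w0 : 0 <= Num.min 1 (weight (1 + s) n N i.+1 0) :> R.
   by rewrite le_min ler01; exact: pospow_ge0.
  have f0 := sqr_ge0 (f i.+1); case: ifPn => hx.
   have fm : f i.+1 ^+ 2 <= 4 * m ^+ 2.
   rewrite (_ : 4 * m ^+ 2 = (2 * m) ^+ 2); last by ring.
   rewrite -sqr_normr//; apply: lerXn2r (rb_f H (ltn_ord i)); rewrite nnegrE//.
   exact: mulr_ge0.
   have p1 : 0 <= mesh N * (om^-1 * (Num.min 1 (weight (1 + s) n N i.+1 0) * f i.+1 ^+ 2)).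
   by apply: mulr_ge0; [exact: ltW|apply: mulr_ge0; [rewrite invr_ge0 ltW|exact: mulr_ge0]].
   have := ler_wpM2l (ltW h0) fm; rewrite [mesh N * (4 * _)]mulrC; lra.
  rewrite mulr0 addr0; apply: ler_wpM2l; first exact: ltW.
  rewrite mulrA ler_peMl// ler_pdivlMl// mulr1 /om le_min ge_min lexx/= ge_min; apply/orP; right.
  rewrite /weight subr0; have hx' : 2 * s <= i.+1%:R * mesh N by rewrite leNgt.
  have sx : s <= 1 - (1 + s) * (1 - i.+1%:R * mesh N).
   move: (i.+1%:R * mesh N) hx' => x hx'; have x0 : 0 <= x by lra.
   by have := mulr_ge0 (ltW s0) x0; lra.
  exact: pospow_le.
rewrite mulr_sumr; apply: (le_trans (ler_sum _ (fun i _ => hi i))).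
rewrite big_split/= -!mulr_sumr.
have h1 : 4 * m ^+ 2 * \sum_(i < N) (if i.+1%:R * mesh N < 2 * s then mesh N else 0) <= e / 2.
  apply: le_trans s1; have s20 : 0 <= 2 * s by lra.
  have := ler_wpM2l (_ : 0 <= 4 * m ^+ 2) (near_left_sum N (ltW h0) s20).
  move=> /(_ ltac:(lra)); lra.
have h2 : mesh N * (om^-1 * \sum_(i < N) (Num.min 1 (weight (1 + s) n N i.+1 0) * f i.+1 ^+ 2)) <= e / 2.
  rewrite mulrCA; apply: (le_trans (ler_wpM2l _ Hc)); first by rewrite invr_ge0 ltW.
  rewrite kd (_ : om^-1 * _ = 2 * k ^+ 2 * G); last by rewrite /G; ring.
  have h3 : k * (4 * (G + 1)) <= e by rewrite -ler_pdivlMr//; lra.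
  have h4 := ler_wpM2r G0 kk; lra.
lra.
Qed.

End core.

(** * What the second observation controls *)

Section observations.
Context {R : realType}.
Local Notation leb := (@lebesgue_measure R).

(* No measurability is needed: the integral of a nonnegative function is the
   supremum of the integrals of the simple functions below it. *)
Lemma ge0_le_integral_any {d} {X : measurableType d} (mu : {measure set X -> \bar R})
   (f g : X -> \bar R) : (forall x, (0 <= f x)%E) -> (forall x, (f x <= g x)%E) ->
  (\int[mu]_x f x <= \int[mu]_x g x)%E.
Proof.
move=> f0 fg; have g0 x : (0 <= g x)%E by exact: le_trans (fg x).
rewrite !ge0_integralTE//; apply: le_ereal_sup => _ [h hf <-].
by exists h => // x; exact: le_trans (fg x).
Qed.

Lemma affine_ext_derive N (f : nat -> R) i (x : R) : (i < N.+1)%N ->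
  i%:R * mesh N < x < i.+1%:R * mesh N ->
  mesh N * derive1 (affine_ext N f) x = f i.+1 - f i.
Proof.
move=> iN /andP[x1 x2]; have h0 := @mesh_gt0 R N; have hn := lt0r_neq0 h0.
pose g (y : R) := (y / mesh N - i%:R) * (f i.+1 - f i) + f i.
have dg : is_derive x (1 : R) g ((f i.+1 - f i) / mesh N).
  have d1 : is_derive x (1 : R) (fun y : R => (f i.+1 - f i) / mesh N * y) ((f i.+1 - f i) / mesh N * 1).
   by apply: is_deriveMl; exact: is_derive_id.
  have d2 : is_derive x (1 : R) (fun y : R => (f i.+1 - f i) / mesh N * y + (f i - i%:R * (f i.+1 - f i))) ((f i.+1 - f i) / mesh N * 1 + 0).
   by apply: is_deriveD.
  move: d2; rewrite mulr1 addr0; congr is_derive; apply/funext => y; rewrite /g; ring.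
have near_g : \near x, g x = affine_ext N f x.
  have xI : x \in `](i%:R * mesh N), (i.+1%:R * mesh N)[ by rewrite in_itv/= x1.
  near=> y; have : y \in `](i%:R * mesh N), (i.+1%:R * mesh N)[ by near: y; exact: near_in_itvoo.
  rewrite in_itv/= => /andP[y1 y2]; have s01 : 0 <= y / mesh N - i%:R <= 1.
   rewrite subr_ge0 ler_pdivlMr// ltW//= lerBlDr ler_pdivrMr// (_ : 1 + i%:R = i.+1%:R) ?ltW//.
   by rewrite -natr1 addrC.
  have := affine_extE f (iN : (i <= N)%N) s01; rewrite (_ : (_ + _) * mesh N = y) => [->|]; last by field.
  by rewrite /g; ring.
have := near_eq_is_derive near_g dg => dd.
by rewrite derive1E (@derive_val _ _ _ _ _ _ _ dd) mulrCA mulfV// mulr1.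
Unshelve. all: by end_near. Qed.

(** On each open cell the integrand is the square of an increment, constant in space, so by Tonelli
    the sum is the double integral of an explicit function. That function lies below the integrand,
    whatever happens at the nodes, and [ge0_le_integral_any] allows the comparison. *)
Lemma second_observation_le N (T : R) (F : nat -> R -> R) (e : R) : 0 < T -> 0 <= e ->
  (forall j, (j <= N.+1)%N -> L2 (F j) 0 T) ->
  (L2_norm2 (`]0%R, T[ `*` `]0%R, 1%R[)
   (fun z => (mesh N * derive1 (affine_ext N (fun j => F j z.1)) z.2)%R) <= e%:E)%E ->
  mesh N * \sum_(i < N.+1) intL (fun t => (F i.+1 t - F i t) ^+ 2) 0 T <= e ^+ 2.
Proof.
move=> T0 e0 LF; have h0 := @mesh_gt0 R N.
rewrite /L2_norm2 Lp_norm2_le// => H.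
pose I : set R := `]0, T[%classic; pose J (i : nat) : set R := `]i%:R * mesh N, i.+1%:R * mesh N[%classic.
pose w (i : nat) (t : R) : R := ((fun t => F i.+1 t - F i t) \_ I) t ^+ 2.
have mw (i : 'I_N.+1) : measurable_fun setT (w i).
  have mI : measurable I by exact: measurable_itv.
  have iN := ltn_ord i; have [m1 _] := LF i.+1 iN; have [m2 _] := LF i (ltnW iN).
  have m3 := (@measurable_restrictT _ _ _ _ I (fun t => F i.+1 t - F i t) mI).1 (measurable_funB m1 m2).
  exact: (measurable_funX 2 m3).
pose a i (z : R * R) : R := w i z.1 * \1_(J i) z.2.
have ma (i : 'I_N.+1) : measurable_fun setT (a i).
  apply: measurable_funM; first exact: measurableT_comp (mw i) measurable_fst.
  have mJ : measurable_fun setT (\1_(J i) : R -> R) by apply: measurable_indic; exact: measurable_itv.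
  exact: measurableT_comp mJ measurable_snd.
have a0 i z : 0 <= a i z by rewrite /a /w mulr_ge0// sqr_ge0.
have ia (i : 'I_N.+1) : (\int[leb \x leb]_z (a i z)%:E)%E = (mesh N * intL (fun t => (F i.+1 t - F i t) ^+ 2) 0 T)%:E.
  have Iw : (\int[leb]_t (w i t)%:E)%E = (intL (fun t => (F i.+1 t - F i t) ^+ 2) 0 T)%:E.
   rewrite -intLE; last first.
   have iN := ltn_ord i; exact: (L2B (LF i.+1 iN) (LF i (ltnW iN))).2.
   rewrite [RHS]integral_mkcond; apply: eq_integral => t _.
   by rewrite /w !patchE; case: ifP => //; rewrite expr0n.
  have Ji : (\int[leb]_x (\1_(J i) x)%:E)%E = (mesh N)%:E.
   have mJ : measurable (J i) by exact: measurable_itv.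
   apply: etrans (integral_indic leb measurableT mJ) _.
   have ii : i%:R * mesh N <= i.+1%:R * mesh N :> R by rewrite ler_pM2r// ler_nat.
   apply: (etrans _ (etrans (leb_oo ii) _)); first by congr (leb _); exact: setIT.
   by rewrite -mulrBl -natr1 addrAC subrr add0r mul1r.
  have maE : measurable_fun setT (fun z => (a i z)%:E) by apply/measurable_EFinP; exact: ma.
  have aE0 z : (0 <= (a i z)%:E)%E by rewrite lee_fin.
  have mJE : measurable_fun setT (fun x : R => (\1_(J i) x : R)%:E).
   by apply/measurable_EFinP; apply: measurable_indic; exact: measurable_itv.
  have mwE : measurable_fun setT (fun x : R => (w i x)%:E) by apply/measurable_EFinP; exact: mw.
  have FT := @fubini_tonelli1 _ _ _ _ R leb leb _ maE aE0.
  refine (etrans FT _).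
  rewrite /fubini_F (_ : (fun x => _) = (fun x => (mesh N)%:E * (w i x)%:E)%E); last first.
   apply/funext => x; rewrite /a /=; under eq_integral do rewrite EFinM.
   apply: (etrans (ge0_integralZl leb measurableT mJE _ _)).
   - by move=> y _; rewrite lee_fin.
   - by rewrite lee_fin sqr_ge0.
   - by rewrite Ji muleC.
  apply: (etrans (ge0_integralZl leb measurableT mwE _ _)).
  - by move=> x _; rewrite lee_fin sqr_ge0.
  - by rewrite lee_fin ltW.
  - by rewrite Iw EFinM.
have sumE : (\int[leb \x leb]_z (\sum_(i < N.+1) a i z)%:E)%E =
   (mesh N * \sum_(i < N.+1) intL (fun t => (F i.+1 t - F i t) ^+ 2) 0 T)%:E.
  under eq_integral do rewrite -sumEFin.
  have maE (i : 'I_N.+1) : measurable_fun setT (fun z => (a i z)%:E) by apply/measurable_EFinP; exact: ma.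
  have aE0 (i : 'I_N.+1) (z : R * R) : setT z -> (0 <= (a i z)%:E)%E by rewrite lee_fin.
  refine (etrans (@ge0_integral_sum _ _ R (leb \x leb)%E setT measurableT 'I_N.+1 (fun i z => (a i z)%:E) maE aE0 (index_enum _)) _).
  by under eq_bigr do rewrite ia; rewrite sumEFin mulr_sumr.
rewrite -lee_fin -sumE; apply: le_trans H; rewrite [leRHS]integral_mkcond.
apply: ge0_le_integral_any => [z|z]; first by rewrite lee_fin; apply: sumr_ge0.
rewrite patchE; case: ifPn => [|zD]; last first.
  rewrite lee_fin big1// => i _; rewrite /a /w patchE; case: ifPn => [z1|]; last by rewrite expr0n mul0r.
  rewrite indicE; case: (boolP (z.2 \in J i)) => [z2|]; last by rewrite mulr0.
  case/negP: zD; rewrite inE; split; first exact: set_mem z1.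
  have := set_mem z2; rewrite /J /= !in_itv/= => /andP[b1 b2]; apply/andP; split.
   by apply: le_lt_trans b1; rewrite mulr_ge0// ltW.
  by apply: (lt_le_trans b2); exact: node_le1.
rewrite inE => -[z1 z2]; rewrite lee_fin.
have [/existsP[k zk]|/existsPn no] := boolP [exists k : 'I_N.+1, z.2 \in J k]; last first.
  rewrite big1 ?sqr_ge0// => i _; rewrite /a indicE; have := no i.
  by move=> /negbTE ->; rewrite mulr0.
have := set_mem zk; rewrite /J /= in_itv/= => zk'.
rewrite (affine_ext_derive _ (ltn_ord k) zk') (bigD1 k)//= big1 ?addr0.
  by rewrite /a /w indicE zk mulr1 patchE mem_set.
move=> i ik; rewrite /a indicE; case: (boolP (z.2 \in J i)) => [zi|]; last by rewrite mulr0.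
have := set_mem zi; rewrite /J /= in_itv/= => /andP[c1 c2]; have /andP[c3 c4] := zk'.
case/eqP: ik; apply/val_inj/eqP; rewrite eqn_leq.
have := lt_trans c1 c4; have := lt_trans c3 c2; rewrite !ltr_pM2r// !ltr_nat !ltnS.
by move=> -> ->.
Qed.

End observations.

(** * Cell averages and piecewise constant extensions *)

Section cells.
Context {R : realType}.
Implicit Types (v G : R -> R) (N i j n : nat) (f : nat -> R).

Lemma sum_intL_le G n (a b : nat -> R) (s e : R) : s <= e ->
  (forall i, (i < n)%N -> [/\ s <= a i, a i <= b i & b i <= e]) ->
  (forall i k, (i < k < n)%N -> b i <= a k) ->
  ible G s e -> (forall x, s < x < e -> 0 <= G x) ->
  \sum_(i < n) intL G (a i) (b i) <= intL G s e.
Proof.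
move=> se H1 H2 iG G0.
suff H k c : (k <= n)%N -> s <= c -> c <= e -> (forall i, (i < k)%N -> b i <= c) ->
   \sum_(i < k) intL G (a i) (b i) <= intL G s c.
  by apply: H => // i /H1[].
elim: k c => [|k IH] c kn sc ce Hc.
  by rewrite big_ord0; apply: intL_ge0 => x /andP[sx xc]; apply: G0; rewrite sx (lt_le_trans xc).
have [ska akb _] := H1 k kn; have bc := Hc k (ltnSn k).
rewrite big_ord_recr/=; have ac : a k <= c by exact: le_trans bc.
rewrite (@intL_cat _ G s (a k) c)//; last exact: ible_sub iG.
apply: lerD.
  apply: IH => //; [exact: ltnW|exact: le_trans ce|].
  by move=> i ik; apply: H2; rewrite ik.
apply: intL_sub_le => //; first exact: ible_sub iG.
by move=> x /andP[ax xc]; apply: G0; rewrite (le_lt_trans ska ax) (lt_le_trans xc).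
Qed.

(** Cauchy-Schwarz on each of the disjoint intervals: length at most [h] against a kernel of size
    [B / h]. It serves the cell averages, with [B = 1], and the functionals attached to edges. *)
Lemma local_functionals_le N n (a b : nat -> R) (k : nat -> R -> R) v (B : R) :
  (forall i, (i < n)%N -> [/\ 0 <= a i, a i <= b i, b i <= 1 & b i - a i <= mesh N]) ->
  (forall i l, (i < l < n)%N -> b i <= a l) ->
  (forall i, (i < n)%N -> measurable_fun `]a i, b i[ (k i)) ->
  (forall i x, (i < n)%N -> a i < x < b i -> `|k i x| <= B / mesh N) ->
  L2 v 0 1 ->
  mesh N * \sum_(i < n) intL (fun x => k i x * v x) (a i) (b i) ^+ 2 <= B ^+ 2 * intL (fun x => v x ^+ 2) 0 1.
Proof.
move=> H1 H2 mk kB Lv; have h0 := @mesh_gt0 R N; have hn := lt0r_neq0 h0; have [_ iv] := Lv.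
have sum_le : \sum_(i < n) intL (fun x => v x ^+ 2) (a i) (b i) <= intL (fun x => v x ^+ 2) 0 1.
  apply: sum_intL_le => // [i /H1[]//|x _]; exact: sqr_ge0.
apply: (@le_trans _ _ (B ^+ 2 * \sum_(i < n) intL (fun x => v x ^+ 2) (a i) (b i))); last first.
  by apply: ler_wpM2l => //; exact: sqr_ge0.
rewrite !mulr_sumr; apply: ler_sum => i _; have iN := ltn_ord i.
have [a0 ab b1 bah] := H1 i iN; have Lvi := L2_sub a0 b1 Lv.
have Lk := L2M_bounded (mk i iN) (fun x => kB i x iN) Lvi.
have := intL_sqr_le ab Lk.
have h2 : intL (fun x => (k i x * v x) ^+ 2) (a i) (b i) <= (B / mesh N) ^+ 2 * intL (fun x => v x ^+ 2) (a i) (b i).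
  rewrite -intLZ; last exact: Lvi.2.
  apply: intL_le; [exact: Lk.2|by apply: ibleZ; exact: Lvi.2|].
  move=> x xab; rewrite exprMn; apply: ler_wpM2r; first exact: sqr_ge0.
  have h3 := kB i x iN xab; rewrite -sqr_normr//; apply: lerXn2r (h3) => //.
  by rewrite nnegrE (le_trans _ h3).
have V0 : 0 <= intL (fun x => v x ^+ 2) (a i) (b i) by exact: intL_sqr_ge0.
move=> h1; have h3 : intL (fun x => k i x * v x) (a i) (b i) ^+ 2 <= mesh N * ((B / mesh N) ^+ 2 * intL (fun x => v x ^+ 2) (a i) (b i)).
  apply: (le_trans h1); apply: ler_pM => //; [by rewrite subr_ge0|exact: intL_sqr_ge0].
apply: (le_trans (ler_wpM2l (ltW h0) h3)); rewrite le_eqVlt; apply/orP; left; apply/eqP; field.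
by [].
Qed.

(** The cell is the one on which [const_ext] takes the value of node [j], so that [cavg] recovers
    grid values from their extension. *)
Definition cavg N j v : R := intL v ((j%:R - 1/2) * mesh N) ((j%:R + 1/2) * mesh N) / mesh N.

Lemma cell_in N i : (i < N)%N -> [/\ 0 <= (i.+1%:R - 1/2) * mesh N :> R,
  (i.+1%:R - 1/2) * mesh N <= (i.+1%:R + 1/2) * mesh N :> R,
  (i.+1%:R + 1/2) * mesh N <= 1 :> R &
  (i.+1%:R + 1/2) * mesh N - (i.+1%:R - 1/2) * mesh N = mesh N :> R].
Proof.
move=> iN; have h0 := @mesh_gt0 R N; split.
- by rewrite pmulr_lge0// -natr1; have := ler0n R i; lra.
- by rewrite ler_pM2r//; lra.
- rewrite ler_pdivrMr ?ltr0n// mul1r; have : (i.+1%:R : R) <= N%:R by rewrite ler_nat.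
  by rewrite -[N.+1%:R]natr1; lra.
- by rewrite -mulrBl (_ : _ - _ = 1) ?mul1r//; lra.
Qed.

Lemma cavg_l2 N v (c : R) : L2 v 0 1 -> 0 <= c -> intL (fun x => v x ^+ 2) 0 1 <= c ^+ 2 ->
  l2 N (fun j => cavg N j v) <= c.
Proof.
move=> Lv c0 vc; have h0 := @mesh_gt0 R N; apply: l2_le => //; apply: le_trans vc.
have := @local_functionals_le N N (fun i => (i.+1%:R - 1/2) * mesh N) (fun i => (i.+1%:R + 1/2) * mesh N)
  (fun _ _ => (mesh N)^-1) v 1.
move=> H; rewrite -[leRHS]mul1r -[X in _ <= X * _](expr1n _ 2); apply: le_trans (H _ _ _ _ Lv).
- rewrite ler_pM2l//; apply: ler_sum => i _; have [a0 ab b1 _] := cell_in (ltn_ord i).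
  rewrite intLZ; last by apply: ible_sub (L2_ible Lv).
  by rewrite /cavg mulrC.
- by move=> i /cell_in[-> -> -> ->].
- move=> i l /andP[il _]; rewrite ler_pM2r//; have : (i.+1%:R : R) + 1 <= l.+1%:R by rewrite natr1 ler_nat.
  by lra.
- by move=> i _; exact: measurable_cst.
- by move=> i x _ _; rewrite div1r gtr0_norm// invr_gt0.
Qed.

Lemma cavgB N i u v : (i < N)%N -> ible u 0 1 -> ible v 0 1 ->
  cavg N i.+1 (fun x => u x - v x) = cavg N i.+1 u - cavg N i.+1 v.
Proof.
move=> iN iu iv; have [a0 ab b1 _] := cell_in iN.
by rewrite /cavg (intLB (ible_sub a0 b1 iu) (ible_sub a0 b1 iv)) mulrBl.
Qed.

Lemma cavgD N i u v : (i < N)%N -> ible u 0 1 -> ible v 0 1 ->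
  cavg N i.+1 (fun x => u x + v x) = cavg N i.+1 u + cavg N i.+1 v.
Proof.
move=> iN iu iv; have [a0 ab b1 _] := cell_in iN.
by rewrite /cavg (intLD (ible_sub a0 b1 iu) (ible_sub a0 b1 iv)) mulrDl.
Qed.

Lemma cavgZ N i c v : (i < N)%N -> ible v 0 1 ->
  cavg N i.+1 (fun x => c * v x) = c * cavg N i.+1 v.
Proof.
move=> iN iv; have [a0 ab b1 _] := cell_in iN.
by rewrite /cavg (intLZ _ (ible_sub a0 b1 iv)) mulrA.
Qed.

Lemma cavg_dist N i v (c d : R) : (i < N)%N -> ible v 0 1 ->
  (forall x, (i.+1%:R - 1/2) * mesh N < x < (i.+1%:R + 1/2) * mesh N -> `|v x - c| <= d) ->
  `|cavg N i.+1 v - c| <= d.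
Proof.
move=> iN iv vc; have [a0 ab b1 E] := cell_in iN; have h0 := @mesh_gt0 R N; have hn := lt0r_neq0 h0.
have iv' : ible v ((i.+1%:R - 1/2) * mesh N) ((i.+1%:R + 1/2) * mesh N) by exact: ible_sub iv.
have h1 : intL v ((i.+1%:R - 1/2) * mesh N) ((i.+1%:R + 1/2) * mesh N) <= (c + d) * mesh N.
  rewrite -[X in _ <= _ * X]E -intL_cst//; apply: intL_le => // [|x /vc]; first exact: ible_cst.
  by rewrite ler_norml => /andP[_]; lra.
have h2 : (c - d) * mesh N <= intL v ((i.+1%:R - 1/2) * mesh N) ((i.+1%:R + 1/2) * mesh N).
  rewrite -[X in _ * X <= _]E -intL_cst//; apply: intL_le => // [|x /vc]; first exact: ible_cst.
  by rewrite ler_norml => /andP[]; lra.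
have g1 : cavg N i.+1 v <= c + d by rewrite /cavg ler_pdivrMr.
have g2 : c - d <= cavg N i.+1 v by rewrite /cavg ler_pdivlMr.
by rewrite ler_norml; split_lra.
Qed.

Lemma const_ext_cell N f j (x : R) : (1 <= j <= N)%N ->
  (j%:R - 1/2) * mesh N <= x < (j%:R + 1/2) * mesh N -> const_ext N f x = f j.
Proof.
move=> /andP[j1 jN] /andP[x1 x2]; have h0 := @mesh_gt0 R N.
rewrite /const_ext (bigD1_seq j)/= ?iota_uniq ?mem_index_iota ?j1 ?ltnS//.
rewrite big1 ?addr0 => [|k kj]; first by rewrite indicE mem_set ?mulr1//= in_itv/= x1.
rewrite indicE memNset ?mulr0//= in_itv/= => /andP[y1 y2].
have := le_lt_trans x1 y2; have := le_lt_trans y1 x2; rewrite !ltr_pM2r// => z1 z2.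
have k1 : (k < j.+1)%N by rewrite -(ltr_nat R) -natr1; lra.
have k2 : (j < k.+1)%N by rewrite -(ltr_nat R) -natr1; lra.
by move: kj; rewrite eqn_leq -ltnS k1 -ltnS k2.
Qed.

Lemma const_ext_out N f (x : R) :
  (forall j, (1 <= j <= N)%N -> ~~ ((j%:R - 1/2) * mesh N <= x < (j%:R + 1/2) * mesh N)) ->
  const_ext N f x = 0.
Proof.
move=> H; rewrite /const_ext big_seq big1// => j; rewrite mem_index_iota ltnS => /H h.
by rewrite indicE memNset ?mulr0//= in_itv/=; exact/negP.
Qed.

Lemma const_ext_cases N (x : R) :
  (exists j, [/\ (1 <= j <= N)%N, (j%:R - 1/2) * mesh N <= x < (j%:R + 1/2) * mesh N &
   forall f, const_ext N f x = f j]) \/ (forall f, const_ext N f x = 0).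
Proof.
have [H|H] := pselect (exists j, (1 <= j <= N)%N /\ (j%:R - 1/2) * mesh N <= x < (j%:R + 1/2) * mesh N).
  by case: H => j [jN xj]; left; exists j; split=> // f; exact: const_ext_cell.
right=> f; apply: const_ext_out => j jN; apply/negP => xj; apply: H; by exists j.
Qed.

Lemma const_extM N f g (x : R) : const_ext N f x * const_ext N g x = const_ext N (fun j => f j * g j) x.
Proof. by have [[j [_ _ H]]|H] := const_ext_cases N x; rewrite !H ?mulr0. Qed.

Lemma const_extB N f g (x : R) : const_ext N f x - const_ext N g x = const_ext N (fun j => f j - g j) x.
Proof. by have [[j [_ _ H]]|H] := const_ext_cases N x; rewrite !H ?subr0. Qed.

Lemma const_ext_meas N f (D : set R) : measurable D -> measurable_fun D (const_ext N f).
Proof.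
by move=> mD; apply: measurable_sum => j; apply: measurable_funM.
Qed.

Lemma const_ext_le N f (c x : R) : 0 <= c -> (forall j, (1 <= j <= N)%N -> `|f j| <= c) -> `|const_ext N f x| <= c.
Proof. by move=> c0 fc; have [[j [jN _ H]]|H] := const_ext_cases N x; rewrite H ?normr0//; exact: fc. Qed.

Lemma const_ext_L2 N f (a b : R) : L2 (const_ext N f) a b.
Proof.
apply: (@L2_bounded _ _ _ _ (\sum_(j < N.+1) `|f j|)); first exact: const_ext_meas.
move=> x _; apply: const_ext_le => [|j /andP[_ jN]]; first by apply: sumr_ge0.
have jN' : (j < N.+1)%N by [].
by rewrite (bigD1 (Ordinal jN'))//= lerDl; apply: sumr_ge0.
Qed.

Lemma cavg_const_ext N f i : (i < N)%N -> cavg N i.+1 (const_ext N f) = f i.+1.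
Proof.
move=> iN; have [a0 ab b1 E] := cell_in iN; have hn := lt0r_neq0 (@mesh_gt0 R N).
rewrite /cavg (@eq_Rint _ _ (fun=> f i.+1)) ?intL_cst ?E//; first by field.
by move=> x /andP[x1 x2]; apply: const_ext_cell => //; rewrite ltW.
Qed.

Lemma intL_const_ext N f : intL (const_ext N f) 0 1 = mesh N * \sum_(i < N) f i.+1.
Proof.
have h0 := @mesh_gt0 R N.
have ic j : ible (fun x => f j * \1_(`[(j%:R - 1/2) * mesh N, (j%:R + 1/2) * mesh N[%classic) x) 0 1.
  apply: ibleZ; apply: (@ible_le _ _ (fun=> 1)); last exact: ible_cst.
   by apply: measurable_indic; exact: measurable_itv.
  by move=> x _; rewrite indicE; case: (_ \in _); rewrite ?normr1 ?normr0.
rewrite /const_ext intL_sum => [|j _]; last exact: ic.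
rewrite big_add1/= big_mkord mulr_sumr; apply: eq_bigr => i _.
have [a0 ab b1 E] := cell_in (ltn_ord i); set A := (_ - _) * _ in a0 ab E *; set B := (_ + _) * _ in ab b1 E *.
have A1 := le_trans ab b1; have icA := ic i.+1; rewrite -/A -/B in icA.
rewrite (intL_cat a0 A1 icA) (intL_cat ab b1 (ible_sub a0 (lexx 1) icA)).
have -> : intL (fun x => f i.+1 * \1_`[A, B[ x) 0 A = 0.
  rewrite (@eq_Rint _ _ (fun=> 0)) ?intL_cst ?mul0r// => x /andP[x1 x2].
  by rewrite indicE memNset ?mulr0//= in_itv/= leNgt x2.
have -> : intL (fun x => f i.+1 * \1_`[A, B[ x) B 1 = 0.
  rewrite (@eq_Rint _ _ (fun=> 0)) ?intL_cst ?mul0r// => x /andP[x1 x2].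
  by rewrite indicE memNset ?mulr0//= in_itv/= [x < B]ltNge (ltW x1) andbF.
rewrite (@eq_Rint _ _ (fun=> f i.+1)) ?intL_cst ?E => [|//|x /andP[x1 x2]]; first by ring.
by rewrite indicE mem_set ?mulr1//= in_itv/= ltW.
Qed.

Lemma intL_const_ext_sqr N f : intL (fun x => const_ext N f x ^+ 2) 0 1 = mesh N * \sum_(i < N) f i.+1 ^+ 2.
Proof.
rewrite -(intL_const_ext N (fun j => f j ^+ 2)); congr intL.
by apply/funext => x; rewrite expr2 const_extM.
Qed.

Lemma mesh_small (d : R) : 0 < d -> \forall N \near \oo, mesh N < d.
Proof.
move=> d0; near=> N; rewrite invf_plt ?posrE ?ltr0n//.
have : d^-1 < N%:R by near: N; exact: nbhs_infty_gtr.
by move=> /lt_le_trans; apply; rewrite ler_nat.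
Unshelve. all: by end_near. Qed.

(** Uniform continuity handles the cells; the two half cells at the ends, where [const_ext] is 0,
    have total length [h] and contribute at most [m^2 h]. *)
Lemma sample_cvg (g : R -> R) (m e : R) : continuous g -> 0 <= m -> (forall x, `|g x| <= m) -> 0 < e ->
  \forall N \near \oo, intL (fun x => (g x - const_ext N (fun j => g (j%:R * mesh N)) x) ^+ 2) 0 1 <= e.
Proof.
move=> cg m0 gm e0; pose s := Num.min 1 (e / 2).
have s0 : 0 < s by rewrite lt_min ltr01/=; lra.
have s1 : s <= 1 by rewrite ge_min lexx.
have s2 : s <= e / 2 by rewrite ge_min lexx orbT.
have [d d0 Hd] := heine_dist 0 1 cg s0.
have m1 : 0 < 2 * (m ^+ 2 + 1) by have := sqr_ge0 m; lra.
near=> N; have h0 := @mesh_gt0 R N; have h1 := @mesh_le1 R N.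
have hd : mesh N < d by near: N; exact: mesh_small.
have he : mesh N < e / (2 * (m ^+ 2 + 1)) by near: N; apply: mesh_small; exact: divr_gt0.
pose ce := const_ext N (fun j => g (j%:R * mesh N)); pose one := const_ext N (fun=> 1 : R).
have F_le x : 0 <= x <= 1 -> (g x - ce x) ^+ 2 <= s ^+ 2 + m ^+ 2 * (1 - one x).
  move=> x01; rewrite /ce /one; have [[j [/andP[j1 jN] xj H]]|H] := const_ext_cases N x; rewrite !H.
   rewrite subrr mulr0 addr0 -sqr_normr//; apply: lerXn2r; rewrite ?nnegrE ?(ltW s0)//.
   apply: Hd => //.
   apply/andP; split; first by apply: mulr_ge0 => //; exact: ltW.
   by apply: node_le1; exact: leqW.
   rewrite ltr_norml; move: xj hd; rewrite !mulrDl mulNr; move: (j%:R * mesh N) => y.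
   by move: (mesh N) h0 => h *; split_lra.
  rewrite !subr0 mulr1 -sqr_normr//.
  have : `|g x| ^+ 2 <= m ^+ 2 by apply: lerXn2r (gm x); rewrite nnegrE.
  by have := sqr_ge0 s; lra.
have i1 : ible one 0 1 by exact: L2_ible (const_ext_L2 _ _ _ _).
have iF : ible (fun x => (g x - ce x) ^+ 2) 0 1.
  by have [] := L2B (cont_L2 0 1 cg) (const_ext_L2 N (fun j => g (j%:R * mesh N)) 0 1).
have ic : ible (fun x => 1 - one x) 0 1 by apply: ibleB => //; exact: ible_cst.
apply: (@le_trans _ _ (intL (fun x => s ^+ 2 + m ^+ 2 * (1 - one x)) 0 1)).
  apply: intL_le => //; first by apply: ibleD; [exact: ible_cst|exact: ibleZ].
  by move=> x /andP[x0 x1]; apply: F_le; rewrite !ltW.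
rewrite intLD; [|exact: ible_cst|exact: ibleZ].
rewrite intLZ// intLB//; last exact: ible_cst.
rewrite !intL_cst// intL_const_ext sumr_const card_ord subr0 !mulr1 -[1 *+ N]/(N%:R).
have -> : mesh N * N%:R = 1 - mesh N :> R by have := @meshM R N; rewrite -natr1 mulrDr mulr1; lra.
rewrite subKr; move: he; rewrite ltr_pdivlMr// => he.
have s3 : s ^+ 2 <= e / 2 by apply: le_trans s2; rewrite expr2 ger_pMr.
by have := ltW h0; lra.
Unshelve. all: by end_near. Qed.

End cells.

(** * Families of functions of space indexed by time *)

Section time_families.
Context {R : realType}.
Implicit Types (T : R) (F G DF : R -> R -> R) (a b e s t x : R).

Lemma within_segment_dist T s (P : R -> Prop) :
  (\forall t \near within `[0, T] (nbhs s), P t) ->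
  exists2 d, 0 < d & forall t, 0 <= t <= T -> `|s - t| < d -> P t.
Proof.
move=> /near_within_dist[d d0 H]; exists d => // t tT st.
by apply: H => //=; rewrite in_itv.
Qed.

Lemma within_punctured_dist T s (P : R -> Prop) :
  (\forall t \near within (`[0, T] `\ s) (nbhs s), P t) ->
  exists2 d, 0 < d & forall t, 0 <= t <= T -> t != s -> `|s - t| < d -> P t.
Proof.
move=> /near_within_dist[d d0 H]; exists d => // t tT ts st.
by apply: H => //=; split; [rewrite in_itv|exact/eqP].
Qed.

(** Continuity with values in L2(0,1), in epsilon-delta form and for concrete functions: the form in
    which the limits of [wave_solution] are used. *)
Definition L2cont T F := (forall t, 0 <= t <= T -> L2 (F t) 0 1) /\
  forall s, 0 <= s <= T -> forall e, 0 < e -> exists2 d, 0 < d &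
  forall t, 0 <= t <= T -> `|s - t| < d -> intL (fun x => (F t x - F s x) ^+ 2) 0 1 <= e ^+ 2.

Definition supcont T F :=
  forall s, 0 <= s <= T -> forall e, 0 < e -> exists2 d, 0 < d &
  forall t, 0 <= t <= T -> `|s - t| < d -> forall x, 0 <= x <= 1 -> `|F t x - F s x| <= e.

Definition L2diff T F G := forall s, 0 <= s <= T -> forall e, 0 < e -> exists2 d, 0 < d &
  forall t, 0 <= t <= T -> t != s -> `|s - t| < d ->
  intL (fun x => ((F t x - F s x) / (t - s) - G s x) ^+ 2) 0 1 <= e ^+ 2.

Lemma locally_bounded_segment T (f : R -> R) :
  (forall s, 0 <= s <= T -> exists d M, 0 < d /\ forall t, 0 <= t <= T -> `|s - t| < d -> f t <= M) ->
  exists2 M, 0 <= M & forall t, 0 <= t <= T -> f t <= M.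
Proof.
move=> H; have /compact_near_coveringP K := @segment_compact R 0 T.
have [] := K R +oo%R (fun M x => 0 <= x <= T -> f x <= M) _ _.
  move=> s; rewrite /= in_itv/= => /H[d [M [d0 HM]]].
  exists (ball s d, [set r | M < r]) => /=.
   by split; [exact: nbhsx_ballx|apply: nbhs_pinfty_gt; exact: num_real].
  move=> [t r] /= [st Mr] tT; apply: le_trans (ltW Mr); exact: HM.
move=> M [_ HM]; exists (Num.max 0 (M + 1)); first by rewrite le_max lexx.
move=> t tT; rewrite le_max; apply/orP; right; by apply: HM => //=; rewrite ltrDl.
Qed.

(** Sobolev's inequality [abs_cont_sup] applied to differences of two times. *)
Lemma H1_supcont T F DF : (forall t, 0 <= t <= T -> abs_cont (F t) (DF t) 0 1) ->
  L2cont T F -> L2cont T DF -> supcont T F.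
Proof.
move=> ac [LF cF] [LD cD] s sT e e0; have e2 : 0 < e / 2 by lra.
have [d1 d10 H1] := cF s sT _ e2; have [d2 d20 H2] := cD s sT _ e2.
exists (Num.min d1 d2); first by rewrite lt_min d10.
move=> t tT; rewrite lt_min => /andP[st1 st2] x xI.
have := abs_cont_sup ltr01 (abs_contB (ac t tT) (ac s sT)) (L2B (LF t tT) (LF s sT))
  (L2B (LD t tT) (LD s sT)) xI.
have := H1 t tT st1; have := H2 t tT st2; rewrite subr0 expr1n !mul1r mulr1 => h1 h2 h3.
rewrite -ler_sqr ?nnegrE ?(ltW e0)// sqr_normr//.
by apply: (le_trans h3); rewrite (_ : e ^+ 2 = 2 * (e / 2) ^+ 2 + 2 * (e / 2) ^+ 2); [lra|field].
Qed.

Lemma supcont_continuous T F x : 0 <= T -> 0 <= x <= 1 -> supcont T F ->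
  continuous (fun t => F (clamp 0 T t) x).
Proof.
move=> T0 xI cF; apply: dist_continuous => t e e0.
have tT := clamp_in t T0; have [d d0 H] := cF _ tT e e0.
exists d => // s ts; rewrite distrC; apply: H => //; first exact: clamp_in.
exact: le_lt_trans (clamp_dist _ _ _ _) ts.
Qed.

Lemma supcont_bounded T F : supcont T F ->
  (forall t, 0 <= t <= T -> exists M, forall x, 0 <= x <= 1 -> `|F t x| <= M) ->
  exists2 M, 0 <= M & forall t x, 0 <= t <= T -> 0 <= x <= 1 -> `|F t x| <= M.
Proof.
move=> cF bF; pose f t := sup [set `|F t x| | x in [set x | 0 <= x <= 1]].
have fle t x : 0 <= t <= T -> 0 <= x <= 1 -> `|F t x| <= f t.
  move=> /bF[M HM] xI; apply: ub_le_sup; last by exists x.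
  by exists M => _ [y yI <-]; exact: HM.
have [s sT|M M0 HM] := @locally_bounded_segment T f.
  have [d d0 H] := cF s sT 1 ltr01; have [M HM] := bF s sT.
  exists d, (1 + M); split=> // t tT st; apply: ge_sup.
   by exists `|F t 0|, 0 => //=; rewrite lexx ler01.
  move=> _ [y yI <-]; rewrite -(subrK (F s y) (F t y)).
  by apply: (le_trans (ler_normD _ _)); apply: lerD; [exact: H|exact: HM].
by exists M => // t x tT xI; apply: le_trans (HM t tT); exact: fle.
Qed.

Lemma L2cont_bounded T F : L2cont T F ->
  exists2 M, 0 <= M & forall t, 0 <= t <= T -> intL (fun x => F t x ^+ 2) 0 1 <= M ^+ 2.
Proof.
move=> [LF cF]; have [s sT|M M0 HM] := @locally_bounded_segment T (fun t => intL (fun x => F t x ^+ 2) 0 1).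
  have [d d0 H] := cF s sT 1 ltr01; exists d, (2 + 2 * intL (fun x => F s x ^+ 2) 0 1); split=> // t tT st.
  have := intL_sqrD_le (L2B (LF t tT) (LF s sT)) (LF s sT).
  under eq_fun do rewrite subrK; have := H t tT st; rewrite expr1n; lra.
exists (M + 1); first by lra.
move=> t /HM h; apply: (le_trans h); rewrite sqrrD1; have := sqr_ge0 M; lra.
Qed.

(** Integration against a bounded kernel turns a family into a scalar function of time, to which the
    one-variable tools apply. Cell averages and edge functionals are instances. *)
Definition lf (k : R -> R) a b (v : R -> R) := intL (fun x => k x * v x) a b.

Definition bker (k : R -> R) a b B := [/\ 0 <= a, a <= b, b <= 1, 0 <= B &
  measurable_fun `]a, b[ k /\ forall x, a < x < b -> `|k x| <= B].

Lemma lf_ible k a b B v : bker k a b B -> L2 v 0 1 -> ible (fun x => k x * v x) a b.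
Proof.
move=> [a0 ab b1 B0 [mk kB]] Lv; apply: L2_ible.
exact: L2M_bounded mk kB (L2_sub a0 b1 Lv).
Qed.

Lemma lfB k a b B u v : bker k a b B -> L2 u 0 1 -> L2 v 0 1 ->
  lf k a b (fun x => u x - v x) = lf k a b u - lf k a b v.
Proof.
move=> kB Lu Lv; rewrite /lf -(intLB (lf_ible kB Lu) (lf_ible kB Lv)).
by apply: eq_Rint => x _; rewrite mulrBr.
Qed.

Lemma lfZ k a b B c v : bker k a b B -> L2 v 0 1 ->
  lf k a b (fun x => c * v x) = c * lf k a b v.
Proof.
move=> kB Lv; rewrite /lf -(intLZ _ (lf_ible kB Lv)).
by apply: eq_Rint => x _; rewrite mulrCA.
Qed.

Lemma lf_le k a b B v e : bker k a b B -> L2 v 0 1 -> 0 <= e ->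
  intL (fun x => v x ^+ 2) 0 1 <= e ^+ 2 -> `|lf k a b v| <= B * e.
Proof.
move=> [a0 ab b1 B0 [mk kB]] Lv e0 ve.
have Lv' := L2_sub a0 b1 Lv; have Lk := L2M_bounded mk kB Lv'.
rewrite -ler_sqr ?nnegrE ?mulr_ge0// sqr_normr//.
apply: (le_trans (intL_sqr_le ab Lk)).
have h1 : intL (fun x => (k x * v x) ^+ 2) a b <= B ^+ 2 * e ^+ 2.
  apply: (@le_trans _ _ (B ^+ 2 * intL (fun x => v x ^+ 2) a b)).
   rewrite -intLZ; last exact: Lv'.2.
   apply: intL_le; [exact: Lk.2|by apply: ibleZ; exact: Lv'.2|].
   move=> x xI; rewrite exprMn; apply: ler_wpM2r; first exact: sqr_ge0.
   by rewrite -sqr_normr//; apply: lerXn2r (kB x xI); rewrite nnegrE.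
  apply: ler_wpM2l; first exact: sqr_ge0.
  apply: le_trans ve; apply: intL_sub_le => //; first exact: Lv.2.
  by move=> x _; exact: sqr_ge0.
rewrite exprMn; apply: le_trans h1; apply: ler_piMl; first exact: intL_sqr_ge0.
lra.
Qed.

Lemma lf_cont T k a b B F : 0 <= T -> bker k a b B -> L2cont T F ->
  continuous (fun t => lf k a b (F (clamp 0 T t))).
Proof.
move=> T0 kB [LF cF]; have [_ _ _ B0 _] := kB; apply: dist_continuous => t e e0.
have B1 : 0 < B + 1 by lra.
have tT := clamp_in t T0; have [d d0 H] := cF _ tT (e / (B + 1)) (divr_gt0 e0 B1).
exists d => // s ts; have sT := clamp_in s T0.
rewrite distrC -(lfB kB (LF _ sT) (LF _ tT)).
apply: (le_trans (lf_le kB (L2B (LF _ sT) (LF _ tT)) (ltW (divr_gt0 e0 B1)) _)).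
  by apply: H => //; exact: le_lt_trans (clamp_dist _ _ _ _) ts.
by rewrite mulrA ler_pdivrMr// mulrC ler_pM2l//; lra.
Qed.

Lemma dist_is_derive (f : R -> R) x l : (forall e, 0 < e -> exists2 d, 0 < d &
   forall y, y != x -> `|x - y| < d -> `|(f y - f x) / (y - x) - l| <= e) ->
  is_derive x (1 : R) f l.
Proof.
move=> H; have c : (fun h => h^-1 *: (f (h *: 1 + x) - f x)) @ 0^' --> l.
  apply/cvgrPdist_le => e e0; have [d d0 Hd] := H e e0.
  near=> h; have h0 : h != 0 by near: h; exact: nbhs_dnbhs_neq.
  have hd : `|h| < d by near: h; apply: dnbhs0_lt.
  rewrite distrC; have := Hd (h + x); rewrite addrK => /(_ _ _).
  rewrite /GRing.scale/= mulr1 mulrC; apply.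
   by rewrite -subr_eq0 addrK.
  by rewrite opprD addrCA subrr addr0 normrN.
by apply: DeriveDef; [apply/cvg_ex; exists l|exact: cvg_lim c].
Unshelve. all: by end_near. Qed.

(** The clamped function may have kinks at 0 and [T], so differentiability is used strictly inside,
    through the mean value theorem for [f] minus a primitive of [df]. *)
Lemma difference_quotient_FTC T (f df : R -> R) : 0 < T ->
  continuous (fun t => f (clamp 0 T t)) -> continuous (fun t => df (clamp 0 T t)) ->
  (forall s, 0 <= s <= T -> forall e, 0 < e -> exists2 d, 0 < d &
   forall t, 0 <= t <= T -> t != s -> `|s - t| < d -> `|(f t - f s) / (t - s) - df s| <= e) ->
  abs_cont (fun t => f (clamp 0 T t)) (fun t => df (clamp 0 T t)) 0 T.
Proof.
move=> T0 cf cdf H; split; first exact: cont_ible.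
move=> s t s0 st tT; rewrite intL_intg//; have cl x : 0 <= x <= T -> clamp 0 T x = x by exact: clamp_id.
pose g x := f (clamp 0 T x) - prim (fun t => df (clamp 0 T t)) x.
have cg : continuous g by apply: contB => //; exact: continuous_prim.
have dg x : x \in `]s, t[ -> is_derive x (1 : R) g 0.
  rewrite in_itv/= => /andP[sx xt].
  have xT : 0 <= x <= T by rewrite (le_trans s0 (ltW sx)) (le_trans (ltW xt)).
  rewrite -(subrr (df (clamp 0 T x))); apply: is_deriveB; last exact: is_derive_prim.
  rewrite (cl x xT); apply: dist_is_derive => e e0; have [d d0 Hd] := H x xT e e0.
  exists (Num.min d (Num.min (x - s) (t - x))); first by rewrite !lt_min d0 !subr_gt0 sx.
  move=> y yx; rewrite !lt_min => /and3P[h1 h2 h3].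
  have yT : 0 <= y <= T by move: h2 h3; rewrite !ltr_norml => /andP[? ?] /andP[? ?]; split_lra.
  by rewrite (cl x xT) (cl y yT); exact: Hd.
suff : g t = g s by rewrite /g /intg; lra.
move: st; rewrite le_eqVlt => /predU1P[->//|st].
have [] := @MVT R g (fun=> 0) s t st dg (continuous_subspaceT cg).
by move=> c _; rewrite mul0r; lra.
Qed.

Lemma lf_abs_cont T k a b B F G : 0 < T -> bker k a b B -> L2cont T F -> L2cont T G -> L2diff T F G ->
  abs_cont (fun t => lf k a b (F (clamp 0 T t))) (fun t => lf k a b (G (clamp 0 T t))) 0 T.
Proof.
move=> T0 kB cF cG dF; have [_ _ _ B0 _] := kB; have [LF _] := cF; have [LG _] := cG.
apply: (@difference_quotient_FTC T (fun t => lf k a b (F t)) (fun t => lf k a b (G t))) => //.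
- exact: lf_cont (ltW T0) kB cF.
- exact: lf_cont (ltW T0) kB cG.
move=> s sT e e0; have B1 : 0 < B + 1 by lra.
have [d d0 H] := dF s sT (e / (B + 1)) (divr_gt0 e0 B1).
exists d => // t tT ts st; have Ld := L2B (LF t tT) (LF s sT).
have E : (lf k a b (F t) - lf k a b (F s)) / (t - s) - lf k a b (G s) =
   lf k a b (fun x => (t - s)^-1 * (F t x - F s x) - G s x).
  by rewrite (lfB kB (L2Z _ Ld) (LG s sT)) (lfZ _ kB Ld) (lfB kB (LF t tT) (LF s sT)) mulrC.
rewrite E; apply: (le_trans (lf_le kB (L2B (L2Z _ Ld) (LG s sT)) (ltW (divr_gt0 e0 B1)) _)).
  by under eq_fun do rewrite mulrC; exact: H.
by rewrite mulrA ler_pdivrMr// mulrC ler_pM2l//; lra.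
Qed.

End time_families.

(** * Regularity of the continuous solution in usable form *)

Section wave_solution_facts.
Context {R : realType}.
Variables (T : R) (p : R -> R) (g : R -> R -> R) (g0 g1 y0 y1 : R -> R)
  (y : wave_solution T p g g0 g1 y0 y1).
Hypothesis T0 : 0 < T.
Implicit Types (s t e x : R).

Lemma H1_norm_le (f df : R -> R) e : 0 <= e -> L2 f 0 1 -> L2 df 0 1 ->
  (H1_norm 0 1 f df <= e%:E)%E ->
  intL (fun x => f x ^+ 2) 0 1 <= e ^+ 2 /\ intL (fun x => df x ^+ 2) 0 1 <= e ^+ 2.
Proof.
move=> e0 Lf Ld H; rewrite -!L2_norm_le//; split; apply: le_trans H; rewrite /H1_norm.
  by rewrite leeDl// Lp_norm_ge0.
by rewrite leeDr// Lp_norm_ge0.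
Qed.

Lemma H2_norm_le a b (f df ddf : R -> R) e : 0 <= e -> L2 f a b -> L2 df a b -> L2 ddf a b ->
  (H2_norm a b f df ddf <= e%:E)%E ->
  [/\ intL (fun x => f x ^+ 2) a b <= e ^+ 2, intL (fun x => df x ^+ 2) a b <= e ^+ 2 &
   intL (fun x => ddf x ^+ 2) a b <= e ^+ 2].
Proof.
move=> e0 Lf Ld Ldd H; rewrite -!L2_norm_le//; split; apply: le_trans H; rewrite /H2_norm.
- by rewrite -addeA leeDl// adde_ge0// Lp_norm_ge0.
- by apply: (@le_trans _ _ (L2_norm a b f + L2_norm a b df)%E); [rewrite leeDr// Lp_norm_ge0|rewrite leeDl// Lp_norm_ge0].
- by rewrite leeDr// adde_ge0// Lp_norm_ge0.
Qed.

Let L2s t : L2 (sol y t) 0 1. Proof. exact: L2_cont (@H2_cont _ _ _ _). Qed.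
Let L2ds t : L2 (dH2 (sol y t)) 0 1. Proof. exact: L2_cont (@W1_cont _ _ _ _ _). Qed.
Let L2dds t : L2 (ddH2 (sol y t)) 0 1. Proof. exact: W1_2_L2. Qed.
Let L2st t : L2 (sol_t y t) 0 1. Proof. exact: L2_cont (@W1_cont _ _ _ _ _). Qed.
Let L2dst t : L2 (wder (sol_t y t)) 0 1. Proof. exact: W1_2_L2. Qed.
Let L2stt t : 0 <= t <= T -> L2 (sol_tt y t) 0 1.
Proof. by move=> tT; apply: L2_of_in_Lp; apply: sol_tt_L2; rewrite in_itv. Qed.

Let sol_near s e : 0 <= s <= T -> 0 < e -> exists2 d, 0 < d & forall t, 0 <= t <= T -> `|s - t| < d ->
  [/\ intL (fun x => (sol y t x - sol y s x) ^+ 2) 0 1 <= e ^+ 2,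
   intL (fun x => (dH2 (sol y t) x - dH2 (sol y s) x) ^+ 2) 0 1 <= e ^+ 2 &
   intL (fun x => (ddH2 (sol y t) x - ddH2 (sol y s) x) ^+ 2) 0 1 <= e ^+ 2].
Proof.
move=> sT e0; have := sol_cont y; move=> /(_ s); rewrite in_itv/= => /(_ sT) c.
have [d d0 H] := within_segment_dist (cvge0_near c e0); exists d => // t tT st.
by apply: H2_norm_le (H t tT st); [exact: ltW|exact: L2B..].
Qed.

Lemma sol_L2cont : L2cont T (fun t => sol y t).
Proof.
split=> [t _|s sT e e0]; first exact: L2s.
by have [d d0 H] := sol_near sT e0; exists d => // t tT st; have [] := H t tT st. Qed.

Lemma dsol_L2cont : L2cont T (fun t => dH2 (sol y t)).
Proof.
split=> [t _|s sT e e0]; first exact: L2ds.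
by have [d d0 H] := sol_near sT e0; exists d => // t tT st; have [] := H t tT st. Qed.

Lemma ddsol_L2cont : L2cont T (fun t => ddH2 (sol y t)).
Proof.
split=> [t _|s sT e e0]; first exact: L2dds.
by have [d d0 H] := sol_near sT e0; exists d => // t tT st; have [] := H t tT st. Qed.

Let sol_t_near s e : 0 <= s <= T -> 0 < e -> exists2 d, 0 < d & forall t, 0 <= t <= T -> `|s - t| < d ->
  intL (fun x => (sol_t y t x - sol_t y s x) ^+ 2) 0 1 <= e ^+ 2 /\
  intL (fun x => (wder (sol_t y t) x - wder (sol_t y s) x) ^+ 2) 0 1 <= e ^+ 2.
Proof.
move=> sT e0; have := sol_t_cont y; move=> /(_ s); rewrite in_itv/= => /(_ sT) c.
have [d d0 H] := within_segment_dist (cvge0_near c e0); exists d => // t tT st.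
by apply: H1_norm_le (H t tT st); [exact: ltW|exact: L2B..].
Qed.

Lemma sol_t_L2cont : L2cont T (fun t => sol_t y t).
Proof.
split=> [t _|s sT e e0]; first exact: L2st.
by have [d d0 H] := sol_t_near sT e0; exists d => // t tT st; have [] := H t tT st. Qed.

Lemma dsol_t_L2cont : L2cont T (fun t => wder (sol_t y t)).
Proof.
split=> [t _|s sT e e0]; first exact: L2dst.
by have [d d0 H] := sol_t_near sT e0; exists d => // t tT st; have [] := H t tT st. Qed.

Lemma sol_tt_L2cont : L2cont T (fun t => sol_tt y t).
Proof.
split=> // s sT e e0; have := sol_tt_cont y; move=> /(_ s); rewrite in_itv/= => /(_ sT) c.
have [d d0 H] := within_segment_dist (cvge0_near c e0); exists d => // t tT st.
rewrite -(L2_norm_le (ltW e0) (L2B (L2stt tT) (L2stt sT))); exact: H.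
Qed.

Let quotient_L2 (u v w : R -> R) (c : R) : L2 u 0 1 -> L2 v 0 1 -> L2 w 0 1 ->
  L2 (fun x => (u x - v x) / c - w x) 0 1.
Proof.
move=> Lu Lv Lw; have := L2B (L2Z c^-1 (L2B Lu Lv)) Lw.
by congr L2; apply/funext => x; rewrite mulrC.
Qed.

Let sol_diff s e : 0 <= s <= T -> 0 < e -> exists2 d, 0 < d & forall t, 0 <= t <= T -> t != s -> `|s - t| < d ->
  intL (fun x => ((sol y t x - sol y s x) / (t - s) - sol_t y s x) ^+ 2) 0 1 <= e ^+ 2 /\
  intL (fun x => ((dH2 (sol y t) x - dH2 (sol y s) x) / (t - s) - wder (sol_t y s) x) ^+ 2) 0 1 <= e ^+ 2.
Proof.
move=> sT e0; have := sol_deriv y; move=> /(_ s); rewrite in_itv/= => /(_ sT) c.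
have [d d0 H] := within_punctured_dist (cvge0_near c e0).
exists d => // t tT ts st.
by apply: H1_norm_le (H t tT ts st); [exact: ltW|exact: quotient_L2..].
Qed.

Lemma sol_L2diff : L2diff T (fun t => sol y t) (fun t => sol_t y t).
Proof. by move=> s sT e e0; have [d d0 H] := sol_diff sT e0; exists d => // t tT ts st; have [] := H t tT ts st. Qed.

Lemma dsol_L2diff : L2diff T (fun t => dH2 (sol y t)) (fun t => wder (sol_t y t)).
Proof. by move=> s sT e e0; have [d d0 H] := sol_diff sT e0; exists d => // t tT ts st; have [] := H t tT ts st. Qed.

Lemma sol_t_L2diff : L2diff T (fun t => sol_t y t) (fun t => sol_tt y t).
Proof.
move=> s sT e e0; have := sol_t_deriv y; move=> /(_ s); rewrite in_itv/= => /(_ sT) c.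
have [d d0 H] := within_punctured_dist (cvge0_near c e0).
exists d => // t tT ts st.
rewrite -(L2_norm_le (ltW e0) (quotient_L2 _ (L2st t) (L2st s) (L2stt sT))); exact: H.
Qed.

Lemma sol_abs_cont t : abs_cont (sol y t) (dH2 (sol y t)) 0 1.
Proof. exact: H2_abs_cont ltr01. Qed.

Lemma dsol_abs_cont t : abs_cont (dH2 (sol y t)) (ddH2 (sol y t)) 0 1.
Proof. exact: H1_abs_cont ltr01. Qed.

Lemma sol_t_abs_cont t : abs_cont (sol_t y t) (wder (sol_t y t)) 0 1.
Proof. exact: H1_abs_cont ltr01. Qed.

Lemma sol_supcont : supcont T (fun t => sol y t).
Proof. by apply: H1_supcont sol_L2cont dsol_L2cont => t _; exact: sol_abs_cont. Qed.

Lemma dsol_supcont : supcont T (fun t => dH2 (sol y t)).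
Proof. by apply: H1_supcont dsol_L2cont ddsol_L2cont => t _; exact: dsol_abs_cont. Qed.

Lemma sol_t_supcont : supcont T (fun t => sol_t y t).
Proof. by apply: H1_supcont sol_t_L2cont dsol_t_L2cont => t _; exact: sol_t_abs_cont. Qed.

End wave_solution_facts.

(** * Steklov means in L1 in time with values in L2 *)

Section l1l2.
Context {R : realType}.
Implicit Types (T L d e t : R) (f w : nat -> R -> R) (G : R -> R -> R).
Local Notation leb := (@lebesgue_measure R).

Lemma intL_minkowski (u v : R -> R) a b c d : L2 u a b -> L2 v a b -> 0 <= c -> 0 <= d ->
  intL (fun x => u x ^+ 2) a b <= c ^+ 2 -> intL (fun x => v x ^+ 2) a b <= d ^+ 2 ->
  intL (fun x => (u x - v x) ^+ 2) a b <= (c + d) ^+ 2.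
Proof.
move=> Lu Lv c0 d0 uc vd; have := intL_cauchy_schwarz Lu Lv; have iuv := L2M_ible Lu Lv.
set S := intL (fun x => u x * v x) a b => cs.
have -> : intL (fun x => (u x - v x) ^+ 2) a b = intL (fun x => u x ^+ 2) a b + intL (fun x => v x ^+ 2) a b - 2 * S.
  rewrite -intLD; [|exact: Lu.2|exact: Lv.2]; rewrite /S -intLZ//.
  rewrite -intLB; [|by apply: ibleD; [exact: Lu.2|exact: Lv.2]|exact: ibleZ].
  by apply: eq_Rint => x _; ring.
have : `|S| <= c * d.
  rewrite -ler_sqr ?nnegrE ?mulr_ge0// sqr_normr// exprMn.
  by apply: (le_trans cs); apply: ler_pM => //; exact: intL_sqr_ge0.
by rewrite ler_norml sqrrD => /andP[? ?]; lra.
Qed.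

(** Tonelli's theorem for the square of the difference, extended by 0 outside the rectangle. *)
Lemma L2_norm_meas T N w G :
  (forall j, (1 <= j <= N)%N -> measurable_fun `]0, T[ (w j)) ->
  measurable_fun (`]0, T[ `*` `]0, 1[ : set (R * R)) (fun z => G z.1 z.2) ->
  measurable_fun `]0, T[ (fun t => L2_norm 0 1 (const_ext N (fun j => w j t) \- G t)).
Proof.
move=> mw mG; pose D : set (R * R) := `]0, T[ `*` `]0, 1[.
have mI : measurable (`]0, T[%classic : set R) by exact: measurable_itv.
have mJ : measurable (`]0, 1[%classic : set R) by exact: measurable_itv.
have mD : measurable D by exact: measurableX.
pose F (z : R * R) := const_ext N (fun j => w j z.1) z.2 - G z.1 z.2.
have mF : measurable_fun D F.
  apply: measurable_funB => //; rewrite /const_ext.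
  rewrite (_ : (fun z : R * R => _) = (fun z : R * R => \sum_(1 <= j < N.+1)
   (if (1 <= j <= N)%N then w j z.1 * \1_(`[(j%:R - 1/2) * mesh N, (j%:R + 1/2) * mesh N[%classic) z.2 else 0))); last first.
   by apply/funext => z; rewrite big_seq [RHS]big_seq; apply: eq_bigr => j; rewrite mem_index_iota ltnS => ->.
  apply: measurable_sum => j; have [jN|jN] := boolP (0 < j <= N)%N; last exact: measurable_cst.
  apply: measurable_funM.
   apply: (@measurable_comp _ _ _ _ _ _ `]0, T[%classic _ _ fst) => //.
   - by move=> _ [[t x] [/= tT _] <-].
   - exact: mw.
   - by apply: measurable_funTS; exact: measurable_fst.
  have m1 : measurable_fun setT (\1_(`[(j%:R - 1/2) * mesh N, (j%:R + 1/2) * mesh N[%classic) : R -> R).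
   by apply: measurable_indic; exact: measurable_itv.
  by apply: measurable_funTS; exact: measurableT_comp m1 measurable_snd.
pose H : R * R -> \bar R := (fun z => (F z ^+ 2)%:E) \_ D.
have mH : measurable_fun setT H.
  apply/(measurable_restrictT _ mD); apply/measurable_EFinP; exact: measurable_funX.
have H0 z : (0 <= H z)%E by rewrite /H patchE; case: ifP => // _; rewrite lee_fin sqr_ge0.
have mt := @measurable_fun_fubini_tonelli_F _ _ _ _ R leb H mH H0.
have m2 : measurable_fun setT (fun t : R => (fubini_F leb H t `^ 2^-1)%E).
  exact: measurableT_comp (measurable_poweR _) mt.
apply: (eq_measurable_fun (fun t : R => (fubini_F leb H t `^ 2^-1)%E)); last exact: measurable_funTS m2.
move=> t; rewrite inE => tT; rewrite /L2_norm Lp_norm2E /fubini_F; congr (_ `^ _)%E.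
rewrite [RHS]integral_mkcond; apply: eq_integral => x _.
rewrite /H !patchE; case: ifPn; case: ifPn => // x1 z1.
  by case/negP: x1; rewrite inE; have := set_mem z1 => -[].
by case/negP: z1; rewrite inE; split => //; exact: set_mem x1.
Qed.

(** The coefficients do not depend on the values [v]: projecting a coarse grid function that varies
    in time gives fixed combinations of its finitely many components. *)
Lemma cavg_const_ext_sum N N0 i (v : nat -> R) : (i < N)%N ->
  cavg N i.+1 (const_ext N0 v) = \sum_(1 <= k < N0.+1)
   cavg N i.+1 (\1_(`[(k%:R - 1/2) * mesh N0, (k%:R + 1/2) * mesh N0[%classic)) * v k.
Proof.
move=> iN; have [a0 ab b1 _] := @cell_in R N i iN.
have ii k : ible (\1_(`[(k%:R - 1/2) * mesh N0, (k%:R + 1/2) * mesh N0[%classic) : R -> R)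
   ((i.+1%:R - 1/2) * mesh N) ((i.+1%:R + 1/2) * mesh N).
  apply: (@ible_le _ _ (fun=> 1)); last exact: ible_cst.
   by apply: measurable_indic; exact: measurable_itv.
  by move=> x _; rewrite indicE; case: (_ \in _); rewrite ?normr1 ?normr0.
rewrite /cavg /const_ext intL_sum => [|k _]; last exact: ibleZ.
by rewrite mulr_suml; apply: eq_bigr => k _; rewrite intLZ//; ring.
Qed.

Lemma avg_sum (r : seq nat) (c : nat -> R) f e : (forall k, continuous (f k)) ->
  avg e (fun t => \sum_(k <- r) c k * f k t) = (fun t => \sum_(k <- r) c k * avg e (f k) t).
Proof.
move=> cf; apply/funext => t; rewrite /avg intg_sum => [|k _]; last by apply: contM; [exact: contC|exact: cf].
by rewrite mulr_suml; apply: eq_bigr => k _; rewrite intgZ ?mulrA//; exact: cf.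
Qed.

Lemma dq_sum (r : seq nat) (c : nat -> R) f e :
  dq e (fun t => \sum_(k <- r) c k * f k t) = (fun t => \sum_(k <- r) c k * dq e (f k) t).
Proof.
apply/funext => t; rewrite /dq -sumrB mulr_suml; apply: eq_bigr => k _.
by rewrite -mulrBr mulrA.
Qed.

Lemma abs_cont_sum (r : seq nat) (c : nat -> R) f w a b : (forall k, k \in r -> abs_cont (f k) (w k) a b) ->
  abs_cont (fun t => \sum_(k <- r) c k * f k t) (fun t => \sum_(k <- r) c k * w k t) a b.
Proof.
elim: r => [|k r IH] H.
  rewrite (_ : (fun t => _) = fun=> 0); last by apply/funext => t; rewrite big_nil.
  rewrite (_ : (fun t => \sum_(k <- [::]) c k * w k t) = fun=> 0); last by apply/funext => t; rewrite big_nil.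
  by split=> [|s t _ st _]; [exact: ible_cst|rewrite subrr intL_cst// mul0r].
rewrite (_ : (fun t => _) = fun t => c k * f k t + \sum_(k <- r) c k * f k t); last first.
  by apply/funext => t; rewrite big_cons.
rewrite (_ : (fun t => \sum_(k <- k :: r) c k * w k t) = fun t => c k * w k t + \sum_(k <- r) c k * w k t); last first.
  by apply/funext => t; rewrite big_cons.
apply: abs_contD; first by apply: abs_contZ; apply: H; rewrite mem_head.
by apply: IH => j jr; apply: H; rewrite inE jr orbT.
Qed.

Lemma finite_uniform n (P : nat -> R -> Prop) :
  (forall k, (k < n)%N -> exists2 e0, 0 < e0 & forall e, 0 < e <= e0 -> P k e) ->
  exists2 e0, 0 < e0 & forall e, 0 < e <= e0 -> forall k, (k < n)%N -> P k e.
Proof.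
elim: n => [|n IH] H; first by exists 1.
have [k kn|e1 e10 H1] := IH; first exact: H (leqW kn).
have [e2 e20 H2] := H n (ltnSn n).
exists (Num.min e1 e2); first by rewrite lt_min e10.
move=> e; rewrite le_min => /and3P[e0 ee1 ee2] k; rewrite ltnS leq_eqVlt => /predU1P[->|kn].
  by apply: H2; rewrite e0.
by apply: H1 => //; rewrite e0.
Qed.

Lemma section_meas T G t : measurable_fun (`]0, T[ `*` `]0, 1[ : set (R * R)) (fun z => G z.1 z.2) ->
  (`]0, T[%classic : set R) t -> measurable_fun (`]0, 1[ : set R) (G t).
Proof.
move=> mG tT; pose D : set (R * R) := `]0, T[ `*` `]0, 1[.
have mD : measurable D by apply: measurableX; exact: measurable_itv.
apply: (@measurable_comp _ _ _ _ _ _ D (fun z => G z.1 z.2) _ (fun x : R => (t, x))) => //.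
  by move=> _ [x x1 <-]; split.
by apply: measurable_funTS; exact: pair1_measurable.
Qed.

(** Both extensions are compared with [G]; cell averages contract the L2 norm and reproduce grid
    functions. An infinite norm makes the bound trivial. *)
Lemma projection_dist N N0 (v v0 : nat -> R) (G : R -> R) : measurable_fun (`]0, 1[ : set R) G ->
  ((l2 N (fun j => v j - cavg N j (const_ext N0 v0)))%:E <=
   L2_norm 0 1 (const_ext N v \- G)%R + L2_norm 0 1 (const_ext N0 v0 \- G)%R)%E.
Proof.
move=> mG.
have step M (x : nat -> R) (a : R) : L2_norm 0 1 (const_ext M x \- G) = a%:E ->
   [/\ 0 <= a, L2 (fun s => const_ext M x s - G s) 0 1 & intL (fun s => (const_ext M x s - G s) ^+ 2) 0 1 <= a ^+ 2].
  move=> E; have a0 : 0 <= a by rewrite -lee_fin -E Lp_norm_ge0.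
  have Lx : L2 (fun s => const_ext M x s - G s) 0 1.
   apply: L2_of_norm; last by rewrite -/(_ \- _) E ltry.
   by apply: measurable_funB => //; exact: const_ext_meas.
  by split=> //; rewrite -L2_norm_le// E.
have n1 := Lp_norm_ge0 leb `]0, 1[%classic 2%:E (const_ext N v \- G).
have n2 := Lp_norm_ge0 leb `]0, 1[%classic 2%:E (const_ext N0 v0 \- G).
rewrite -/(L2_norm 0 1 _) in n1; rewrite -/(L2_norm 0 1 _) in n2.
have := step N v; have := step N0 v0; move: n1 n2.
case: (L2_norm 0 1 (const_ext N v \- G)) => [a||]; case: (L2_norm 0 1 (const_ext N0 v0 \- G)) => [b||] //;
  try by move=> *; rewrite leey.
move=> _ _ /(_ b erefl)[b0 Lb Hb] /(_ a erefl)[a0 La Ha].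
rewrite lee_fin (@eq_l2 _ _ _ (fun j => cavg N j (fun s => (const_ext N v s - G s) - (const_ext N0 v0 s - G s)))); last first.
  move=> i iN; rewrite -[X in X - _](cavg_const_ext v iN) -cavgB//; [|exact: L2_ible (const_ext_L2 _ _ _ _)..].
  by congr cavg; apply/funext => s; ring.
apply: cavg_l2; [exact: L2B|exact: addr_ge0|exact: intL_minkowski].
Qed.

Lemma lf_sum_norm N N0 (v : nat -> R) : l2 N (fun j => cavg N j (const_ext N0 v)) <= \sum_(1 <= k < N0.+1) `|v k|.
Proof.
apply: (@le_trans _ _ (l2 N0 v)).
  apply: cavg_l2; [exact: const_ext_L2|exact: l2_ge0|].
  by rewrite intL_const_ext_sqr l2_sqr.
by rewrite big_add1 big_mkord; exact: l2_le_sum.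
Qed.

Lemma l2_split3 N (x a b c : nat -> R) : (forall i, (i < N)%N -> x i.+1 = a i.+1 + (b i.+1 + c i.+1)) ->
  l2 N x <= l2 N a + (l2 N b + l2 N c).
Proof.
move=> H; rewrite (@eq_l2 _ N x (fun j => a j + (b j + c j)) H); apply: (le_trans (l2D _ _ _)); rewrite lerD2l; exact: l2D.
Qed.

(* The limit [G] is only used through [f N0] for one fixed large [N0], whose
   components are finitely many scalar functions. *)
Lemma steklov_L1L2 T L (f w : nat -> nat -> R -> R) (G : R -> R -> R) d :
  0 <= L -> L < T -> 0 < d ->
  (forall N j, continuous (f N j)) ->
  (forall N j, abs_cont (f N j) (w N j) 0 T) ->
  measurable_fun (`]0, T[ `*` `]0, 1[ : set (R * R)) (fun z => G z.1 z.2) ->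
  L1L2_norm T (fun t => const_ext N (fun j => w N j t) \- G t) @[N --> \oo] --> 0%E ->
  exists e0, [/\ 0 < e0, L + 3 * e0 <= T & forall e, 0 < e <= e0 -> \forall N \near \oo,
   intL (fun t => l2 N (fun j => w N j t - avg e (avg e (dq e (f N j))) t)) 0 L <= d].
Proof.
move=> L0 LT d0 cf af mG cG; have T0 : 0 < T by exact: le_lt_trans LT.
have d5 : 0 < d / 5 by lra.
have iw N j : ible (w N j) 0 T by have [] := af N j.
have near0 := cvge0_near cG d5; have [N0 _ HN0] := near0.
have {HN0}A0 := HN0 N0 (leqnn N0).
have d6 : 0 < d / 5 / N0.+1%:R by rewrite divr_gt0.
have [k kN|e1 e10 He1] := @finite_uniform N0.+1
  (fun k e => L + 3 * e <= T /\ intL (fun t => `|w N0 k t - avg e (avg e (dq e (f N0 k))) t|) 0 L <= d / 5 / N0.+1%:R).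
  have [e0 [e00 eT He]] := steklov_L1 (cf N0 k) (af N0 k) L0 LT d6.
  exists e0 => // e /andP[ep ee]; split; first by lra.
  by apply: He; rewrite ep.
exists e1; split => //; first by have [] := He1 e1 _ 0%N (ltn0Sn _); rewrite ?e10/=.
move=> e eI; have ep : 0 < e by case/andP: eI.
have LeT : L + 3 * e <= T by have [] := He1 e eI 0%N (ltn0Sn _).
have He k : (k < N0.+1)%N -> intL (fun t => `|w N0 k t - avg e (avg e (dq e (f N0 k))) t|) 0 L <= d / 5 / N0.+1%:R.
  by move=> kN; have [] := He1 e eI k kN.
near=> N; have AN : (L1L2_norm T (fun t => const_ext N (fun j => w N j t) \- G t)%R <= (d / 5)%:E)%E by near: N; exact: (cvge0_near cG d5).
(* The coarse functions projected on the grid [N]; their Steklov error reduces to finitely many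
   scalar ones. Of the five fifths of [d], two go to [w - v], two to its smoothed version and one to
   [v] itself. *)
pose v j t := \sum_(1 <= k < N0.+1)
   cavg N j (\1_(`[(k%:R - 1/2) * mesh N0, (k%:R + 1/2) * mesh N0[%classic)) * w N0 k t.
pose F j t := \sum_(1 <= k < N0.+1)
   cavg N j (\1_(`[(k%:R - 1/2) * mesh N0, (k%:R + 1/2) * mesh N0[%classic)) * f N0 k t.
have aF j : abs_cont (F j) (v j) 0 T by apply: abs_cont_sum => k _; exact: af.
have cF j : continuous (F j) by apply: cont_sum => k _; apply: contM; [exact: contC|exact: cf].
have iv j : ible (v j) 0 T by have [] := aF j.
have vE i t : (i < N)%N -> v i.+1 t = cavg N i.+1 (const_ext N0 (fun k => w N0 k t)).
  by move=> iN; rewrite (cavg_const_ext_sum _ _ iN).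
have wv : intL (fun t => l2 N (fun j => w N j t - v j t)) 0 T <= 2 * (d / 5).
  have il : ible (fun t => l2 N (fun j => w N j t - v j t)) 0 T.
   by apply: (@l2_ible _ N (fun j t => w N j t - v j t)) => i _; exact: ibleB.
  rewrite -lee_fin -intLE//.
  have mN M : measurable_fun `]0, T[ (fun t => L2_norm 0 1 (const_ext M (fun j => w M j t) \- G t)).
   by apply: L2_norm_meas => // j _; exact: ible_meas (iw M j).
  apply: (@le_trans _ _ (L1L2_norm T (fun t => const_ext N (fun j => w N j t) \- G t)%R +
   L1L2_norm T (fun t => const_ext N0 (fun j => w N0 j t) \- G t)%R)%E); last first.
   by rewrite (_ : 2 * (d / 5) = d / 5 + d / 5) ?EFinD ?leeD//; ring.
  rewrite /L1L2_norm -ge0_integralD//; try (by move=> t _; exact: Lp_norm_ge0); try exact: mN.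
  apply: ge0_le_integral => //.
  - by move=> t _; rewrite lee_fin l2_ge0.
  - by apply/measurable_EFinP; exact: ible_meas il.
  - exact: (emeasurable_funD (mN N) (mN N0)).
  move=> t tT; rewrite (@eq_l2 _ _ _ (fun j => w N j t - cavg N j (const_ext N0 (fun k => w N0 k t)))); last first.
   by move=> i iN; rewrite vE.
  apply: projection_dist; exact: section_meas mG tT.
have c1 j := dq_cont e (cf N j); have c2 j := avg_cont e (c1 j); have c3 j := avg_cont e (c2 j).
have C0 j : continuous (fun t => F j t - f N j t) by apply: contB.
have C1 j := dq_cont e (C0 j); have C2 j := avg_cont e (C1 j); have C3 j := avg_cont e (C2 j).
have D1 j := dq_cont e (cF j); have D2 j := avg_cont e (D1 j); have D3 j := avg_cont e (D2 j).
have T3 : L + e + e + e <= T by lra.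
have t3 : intL (fun t => l2 N (fun j => avg e (avg e (dq e (fun t => F j t - f N j t))) t)) 0 L <= 2 * (d / 5).
  apply: (le_trans (intL_l2_avg ep L0 (fun i _ => C2 i.+1))).
  apply: (le_trans (intL_l2_avg ep _ (fun i _ => C1 i.+1))); first lra.
  apply: (le_trans (@intL_l2_dq _ N e (fun j t => F j t - f N j t) (fun j t => v j t - w N j t) _ _ ep _ (fun i _ => C0 i.+1) (fun i _ => abs_cont_sub (lexx 0) T3 (abs_contB (aF i.+1) (af N i.+1))))); first lra.
  rewrite (@eq_Rint _ _ (fun t => l2 N (fun j => w N j t - v j t))) => [|t _]; last first.
   by rewrite -l2N; apply: eq_l2 => i _; rewrite opprB.
  apply: le_trans wv.
  apply: intL_sub_le => //; [lra| |by move=> t _; exact: l2_ge0].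
  by apply: (@l2_ible _ N (fun j t => w N j t - v j t)) => i _; exact: ibleB.
have ME j t : avg e (avg e (dq e (F j))) t = \sum_(1 <= k < N0.+1)
   cavg N j (\1_(`[(k%:R - 1/2) * mesh N0, (k%:R + 1/2) * mesh N0[%classic)) * avg e (avg e (dq e (f N0 k))) t.
  rewrite /F dq_sum avg_sum; last by move=> k; exact: dq_cont (cf N0 k).
  by rewrite avg_sum// => k; exact: avg_cont (dq_cont _ (cf N0 k)).
have ck0 k : continuous (avg e (avg e (dq e (f N0 k)))) by apply: avg_cont; apply: avg_cont; exact: dq_cont.
have ik0 k : ible (fun t => `|w N0 k t - avg e (avg e (dq e (f N0 k))) t|) 0 L.
  by apply: ible_norm; apply: ibleB; [exact: ible_sub (lexx 0) (ltW LT) (iw N0 k)|exact: cont_ible].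
have vL j : ible (v j) 0 L := ible_sub (lexx 0) (ltW LT) (iv j).
have wL j : ible (w N j) 0 L := ible_sub (lexx 0) (ltW LT) (iw N j).
have t2 : intL (fun t => l2 N (fun j => v j t - avg e (avg e (dq e (F j))) t)) 0 L <= d / 5.
  apply: (@le_trans _ _ (intL (fun t => \sum_(1 <= k < N0.+1) `|w N0 k t - avg e (avg e (dq e (f N0 k))) t|) 0 L)).
   apply: intL_le; [|by apply: ible_sum|].
   apply: (@l2_ible _ N (fun j t => v j t - avg e (avg e (dq e (F j))) t)) => i _.
   by apply: ibleB => //; exact: cont_ible.
   move=> t _; apply: le_trans (lf_sum_norm N N0 _); rewrite le_eqVlt; apply/orP; left; apply/eqP.
   apply: eq_l2 => i iN; rewrite (cavg_const_ext_sum _ _ iN) ME /v -sumrB.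
   by apply: eq_bigr => k _; rewrite mulrBr.
  rewrite intL_sum//; apply: (@le_trans _ _ (\sum_(1 <= k < N0.+1) d / 5 / N0.+1%:R)).
   by rewrite big_nat [leRHS]big_nat; apply: ler_sum => k /andP[_ kN]; exact: He.
  by rewrite sumr_const_nat subSS subn0 -[leLHS]mulr_natr mulrAC ler_pdivrMr// ler_pM2l// ler_nat.
have i1 : ible (fun t => l2 N (fun j => w N j t - v j t)) 0 L.
  by apply: (@l2_ible _ N (fun j t => w N j t - v j t)) => i _; exact: ibleB.
have i2 : ible (fun t => l2 N (fun j => v j t - avg e (avg e (dq e (F j))) t)) 0 L.
  apply: (@l2_ible _ N (fun j t => v j t - avg e (avg e (dq e (F j))) t)) => i _.
  by apply: ibleB => //; exact: cont_ible.
have i3 : ible (fun t => l2 N (fun j => avg e (avg e (dq e (fun t => F j t - f N j t))) t)) 0 L.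
  by apply: (@l2_ible _ N (fun j t => avg e (avg e (dq e (fun t => F j t - f N j t))) t)) => i _; exact: cont_ible.
apply: (@le_trans _ _ (intL (fun t => l2 N (fun j => w N j t - v j t) + (l2 N (fun j => v j t - avg e (avg e (dq e (F j))) t)
   + l2 N (fun j => avg e (avg e (dq e (fun t => F j t - f N j t))) t))) 0 L)).
  apply: intL_le; [|by apply: ibleD => //; exact: ibleD|].
   apply: (@l2_ible _ N (fun j t => w N j t - avg e (avg e (dq e (f N j))) t)) => i _.
   by apply: ibleB => //; exact: cont_ible.
  move=> t _; apply: l2_split3 => i _.
  have EE : avg e (avg e (dq e (fun t => F i.+1 t - f N i.+1 t))) t =
   avg e (avg e (dq e (F i.+1))) t - avg e (avg e (dq e (f N i.+1))) t.
   by rewrite dqB (@avgB _ e _ _ (D1 i.+1) (c1 i.+1)) (@avgB _ e _ _ (D2 i.+1) (c2 i.+1)).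
  by rewrite EE !addrA !subrK.
rewrite intLD//; last exact: ibleD.
rewrite intLD//.
have t1 : intL (fun t => l2 N (fun j => w N j t - v j t)) 0 L <= 2 * (d / 5).
  apply: le_trans wv; apply: intL_sub_le => //; [exact: ltW| |by move=> t _; exact: l2_ge0].
  by apply: (@l2_ible _ N (fun j t => w N j t - v j t)) => i _; exact: ibleB.
lra.
Unshelve. all: by end_near. Qed.

End l1l2.

(** * Triple means in time *)

Section triple_average.
Context {R : realType}.
Implicit Types (f : R -> R) (e t T L : R).

Lemma eq_avg e f f' t : 0 < e -> continuous f -> continuous f' ->
  (forall s, t <= s <= t + e -> f s = f' s) -> avg e f t = avg e f' t.
Proof.
move=> e0 cf cf' H; congr (_ / _); apply: eq_intg => //.
by rewrite lerDl ltW.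
Qed.

Lemma dq_eq_avg e f df T t : 0 < e -> continuous df -> abs_cont f df 0 T ->
  0 <= t -> t + e <= T -> dq e f t = avg e df t.
Proof.
move=> e0 cdf [_ H] t0 tT; have te : t <= t + e by rewrite lerDl ltW.
by rewrite /dq /avg H// intL_intg.
Qed.

(** Means and quotients commute, and the quotient of an absolutely continuous function is the mean
    of its derivative; each of the two quotients is traded for a mean. *)
Lemma second_dq_avg e f f1 f2 T t : 0 < e -> continuous f -> continuous f1 -> continuous f2 ->
  abs_cont f f1 0 T -> abs_cont f1 f2 0 T -> 0 <= t -> t + 3 * e <= T ->
  dq e (dq e (avg e f)) t = avg3 e f2 t.
Proof.
move=> e0 cf c1 c2 a1 a2 t0 tT; have cd := dq_cont e cf.
have cdd := dq_cont e cd.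
rewrite -(avg_dq e e cf) -(avg_dq e e cd); apply: eq_avg => //.
  by apply: avg_cont; exact: avg_cont.
move=> s /andP[ts st].
have -> : dq e (dq e f) s = dq e (avg e f1) s.
  by rewrite {1 3}/dq !(dq_eq_avg e0 c1 a1)//; lra.
rewrite -(avg_dq e e c1); apply: eq_avg => //; [exact: dq_cont|exact: avg_cont|].
by move=> x /andP[sx xs]; apply: (dq_eq_avg e0 c2 a2); lra.
Qed.

Lemma first_dq_avg e f f1 T t : 0 < e -> continuous f -> continuous f1 ->
  abs_cont f f1 0 T -> 0 <= t -> t + 3 * e <= T ->
  dq e (avg e (avg e f)) t = avg3 e f1 t.
Proof.
move=> e0 cf c1 a1 t0 tT; have cd := dq_cont e cf.
have cA := avg_cont e cf; have cAd := avg_cont e cd.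
rewrite -(avg_dq e e cA); apply: eq_avg => //.
- by rewrite -avg_dq.
- by apply: avg_cont; exact: avg_cont.
move=> s /andP[ts st]; rewrite -avg_dq//; apply: eq_avg => //; first exact: avg_cont.
by move=> x /andP[sx xs]; apply: (dq_eq_avg e0 c1 a1); lra.
Qed.

Lemma avg3_linear e f1 f2 f3 f4 (k t : R) : continuous f1 -> continuous f2 -> continuous f3 -> continuous f4 ->
  avg3 e (fun s => f1 s - f2 s + f3 s - k * f4 s) t =
  avg3 e f1 t - avg3 e f2 t + avg3 e f3 t - k * avg3 e f4 t.
Proof.
have H g1 g2 g3 g4 : continuous g1 -> continuous g2 -> continuous g3 -> continuous g4 ->
   avg e (fun s => g1 s - g2 s + g3 s - k * g4 s) = (fun s => avg e g1 s - avg e g2 s + avg e g3 s - k * avg e g4 s).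
  move=> c1 c2 c3 c4; have c5 := contB c1 c2; have c6 := contD c5 c3; have c7 := contM (@contC _ k) c4.
  by rewrite (@avgB _ e _ _ c6 c7) (@avgD _ e _ _ c5 c3) (@avgB _ e _ _ c1 c2) (@avgZ _ e k _ c4).
move=> c1 c2 c3 c4; have a1 := avg_cont e c1; have a2 := avg_cont e c2.
have a3 := avg_cont e c3; have a4 := avg_cont e c4.
have b1 := avg_cont e a1; have b2 := avg_cont e a2.
have b3 := avg_cont e a3; have b4 := avg_cont e a4.
by rewrite (H _ _ _ _ c1 c2 c3 c4) (H _ _ _ _ a1 a2 a3 a4) (H _ _ _ _ b1 b2 b3 b4).
Qed.

Lemma avg3_laplacian N e (f : nat -> R -> R) i t : (forall j, (j <= i.+2)%N -> continuous (f j)) ->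
  continuous (fun s => laplacian_h N (f^~ s) i.+1) /\
  avg3 e (fun s => laplacian_h N (f^~ s) i.+1) t =
  laplacian_h N (fun j => avg3 e (f j) t) i.+1.
Proof.
move=> cf; have H (v : nat -> R -> R) : (forall j, (j <= i.+2)%N -> continuous (v j)) ->
   continuous (fun s => laplacian_h N (v^~ s) i.+1) /\
   avg e (fun s => laplacian_h N (v^~ s) i.+1) = (fun s => laplacian_h N (fun j => avg e (v j) s) i.+1).
  move=> cv; have c2 := cv _ (leqnn i.+2); have c1 := cv i.+1 (leqnSn _); have c0 := cv i (leqW (leqnSn _)).
  have k2 : continuous (fun s => 2 * v i.+1 s) by cont.
  have k3 : continuous (fun s => v i.+2 s - 2 * v i.+1 s) by cont.
  have k4 : continuous (fun s => v i.+2 s - 2 * v i.+1 s + v i s) by cont.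
  have E : (fun s => laplacian_h N (v^~ s) i.+1) = (fun s => (mesh N ^+ 2)^-1 * (v i.+2 s - 2 * v i.+1 s + v i s)).
   by apply/funext => s; rewrite /laplacian_h/= mulrC.
  split; first by rewrite E; apply: contM k4; exact: contC.
  rewrite E (@avgZ _ e _ _ k4) (@avgD _ e _ _ k3 c0) (@avgB _ e _ _ c2 k2) (@avgZ _ e _ _ c1).
  by apply/funext => s; rewrite /laplacian_h/= mulrC.
have h1 j : (j <= i.+2)%N -> continuous (avg e (f j)) by move=> /cf; exact: avg_cont.
have h2 j : (j <= i.+2)%N -> continuous (avg e (avg e (f j))) by move=> /h1; exact: avg_cont.
by split; [exact: (H _ cf).1|rewrite (H _ cf).2 (H _ h1).2 (H _ h2).2].
Qed.

Lemma avg3_bound e f c L t : 0 < e -> continuous f -> (forall s, 0 <= s <= L + 3 * e -> `|f s| <= c) ->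
  0 <= t <= L -> `|avg3 e f t| <= c.
Proof.
move=> e0 cf fc tL; have c1 := avg_cont e cf; have c2 := avg_cont e c1.
have b1 : forall s, 0 <= s <= L + e + e -> `|avg e f s| <= c.
  by apply: avg_bound => // s sI; apply: fc; move: sI => /andP[? ?]; split_lra.
have b2 : forall s, 0 <= s <= L + e -> `|avg e (avg e f) s| <= c by exact: avg_bound e0 c1 b1.
exact: avg_bound e0 c2 b2 t tL.
Qed.

Lemma l2_avg_le N e (v : nat -> R -> R) t : 0 < e -> (forall i, (i < N)%N -> continuous (v i.+1)) ->
  l2 N (fun j => avg e (v j) t) <= intL (fun s => l2 N (v^~ s)) t (t + e) / e.
Proof.
move=> e0 cv; rewrite (@eq_l2 _ _ _ (fun j => e^-1 * intL (v j) t (t + e))); last first.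
  by move=> i iN; rewrite avg_intL 1?mulrC//; exact: cv.
rewrite l2Z gtr0_norm ?invr_gt0// mulrC ler_pM2r ?invr_gt0//.
by apply: l2_intL => i iN; exact: cont_ible (cv i iN).
Qed.

Lemma intL_shift f s a b : continuous f -> a <= b ->
  intL (fun x => f (x + s)) a b = intL f (a + s) (b + s).
Proof.
move=> cf ab; have ab' : a + s <= b + s by rewrite lerD2r.
by rewrite (intL_intg (@cont_shift _ _ s cf) ab) (intL_intg cf ab') (intg_shift s a b cf).
Qed.

Lemma avg3_l2_bound N e (v : nat -> R -> R) c L T : 0 < e -> 0 <= L -> L + 3 * e <= T ->
  (forall j, continuous (v j)) -> intL (fun s => l2 N (v^~ s)) 0 T <= c ->
  (forall t, 0 <= t <= L -> l2 N (fun j => avg3 e (v j) t) <= c / e) /\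
  intL (fun t => l2 N (fun j => dq e (avg e (avg e (v j))) t)) 0 L <= 2 * c / e.
Proof.
move=> e0 L0 LT cv vc; have c1 j := avg_cont e (cv j); have c2 j := avg_cont e (c1 j).
have li (w : nat -> R -> R) a b : (forall j, continuous (w j)) -> ible (fun s => l2 N (w^~ s)) a b.
  by move=> cw; apply: l2_ible => i _; exact: cont_ible.
have step a : 0 <= a -> a <= L + e -> intL (fun s => l2 N (fun j => avg e (avg e (v j)) s)) 0 a <= c.
  move=> a0 aL; apply: (le_trans (intL_l2_avg e0 a0 (fun i _ => c1 i.+1))).
  apply: (le_trans (intL_l2_avg e0 _ (fun i _ => cv i.+1))); first lra.
  apply: le_trans vc; apply: intL_sub_le; [lra|lra|lra|exact: li|].
  by move=> x _; exact: l2_ge0.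
have sub t : 0 <= t <= L -> intL (fun s => l2 N (fun j => avg e (avg e (v j)) s)) t (t + e) <= c.
  move=> /andP[t0 tL]; apply: (le_trans (intL_sub_le t0 _ _ (li _ 0 (L + e) c2) _)).
  - by rewrite lerDl ltW.
  - by rewrite lerD2r.
  - by move=> x _; exact: l2_ge0.
  by apply: step; lra.
split=> [t tL|].
  apply: (le_trans (l2_avg_le t e0 (fun i _ => c2 i.+1))).
  by rewrite ler_pM2r ?invr_gt0//; exact: sub.
apply: (@le_trans _ _ (intL (fun t => e^-1 * (l2 N (fun j => avg e (avg e (v j)) (t + e)) + l2 N (fun j => avg e (avg e (v j)) t))) 0 L)).
  have lc : continuous (fun t => l2 N (fun j => avg e (avg e (v j)) t)).
   by apply: (@l2_continuous _ N (fun j => avg e (avg e (v j)))) => i _.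
  apply: intL_le.
  - by apply: (li (fun j => dq e (avg e (avg e (v j))))) => j; exact: dq_cont.
  - exact: (ibleZ _ (cont_ible 0 L (contD (@cont_shift _ _ e lc) lc))).
  move=> t _; rewrite (@eq_l2 _ _ _ (fun j => e^-1 * (avg e (avg e (v j)) (t + e) - avg e (avg e (v j)) t))); last first.
   by move=> i _; rewrite mulrC.
  by rewrite l2Z gtr0_norm ?invr_gt0// ler_pM2l ?invr_gt0//; exact: l2B.
have lc : continuous (fun t => l2 N (fun j => avg e (avg e (v j)) t)).
  by apply: (@l2_continuous _ N (fun j => avg e (avg e (v j)))) => i _.
have ls := @cont_shift _ _ e lc.
rewrite (intLZ _ (cont_ible 0 L (contD ls lc))).
rewrite (intLD (cont_ible 0 L ls) (cont_ible 0 L lc)).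
have -> : intL (fun x => l2 N (fun j => avg e (avg e (v j)) (x + e))) 0 L =
   intL (fun x => l2 N (fun j => avg e (avg e (v j)) x)) (0 + e) (L + e).
  exact: (intL_shift e lc L0).
have h1 := step L L0 (ltac:(lra)).
have h2 : intL (fun x => l2 N (fun j => avg e (avg e (v j)) x)) (0 + e) (L + e) <= c.
  apply: (le_trans _ (step (L + e) _ _)); [|lra|lra].
  apply: intL_sub_le; [lra|by rewrite lerD2r|lra|exact: (li _ 0 (L + e) c2)|].
  by move=> x _; exact: l2_ge0.
rewrite mulrC ler_pM2r ?invr_gt0//; lra.
Qed.

Lemma dq_sup_bounds e f c L t : 0 < e -> continuous f -> (forall s, 0 <= s <= L + 3 * e -> `|f s| <= c) ->
  0 <= t <= L -> `|dq e (avg e (avg e f)) t| <= 2 * c / e /\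
  `|dq e (dq e (avg e f)) t| <= 2 * (2 * c / e) / e /\
  `|dq e (dq e (dq e f)) t| <= 2 * (2 * (2 * c / e) / e) / e.
Proof.
move=> e0 cf fc tL; have c1 := avg_cont e cf.
have b1 : forall s, 0 <= s <= L + e + e -> `|avg e f s| <= c.
  by apply: avg_bound => // s sI; apply: fc; move: sI => /andP[? ?]; split_lra.
have b1' : forall s, 0 <= s <= L + e -> `|avg e (avg e f) s| <= c by exact: avg_bound e0 c1 b1.
have b2 : forall s, 0 <= s <= L + e -> `|dq e (avg e f) s| <= 2 * c / e by exact: dq_bound e0 b1.
have b3 : forall s, 0 <= s <= L + e + e -> `|dq e f s| <= 2 * c / e.
  by apply: dq_bound => // s sI; apply: fc; move: sI => /andP[? ?]; split_lra.
have b4 : forall s, 0 <= s <= L + e -> `|dq e (dq e f) s| <= 2 * (2 * c / e) / e by exact: dq_bound e0 b3.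
by split; [exact: dq_bound e0 b1' t tL|split; [exact: dq_bound e0 b2 t tL|exact: dq_bound e0 b4 t tL]].
Qed.

End triple_average.

Notation sqm N := (Num.sqrt (mesh N)).

(** * The reference grid function and its residual *)

Section comparison_grid_function.
Context {R : realType}.
Variables (T : R) (p : R -> R) (g : R -> R -> R) (g0 g1 y0 y1 : R -> R)
  (y : wave_solution T p g g0 g1 y0 y1).
Hypothesis T0 : 0 < T.
Implicit Types (N i j : nat) (s t x e : R).

Definition midpt N i : R := (i%:R + 1/2) * mesh N.

Lemma midpt_in N i : (i <= N)%N -> 0 <= midpt N i <= 1.
Proof.
move=> iN; have h0 := @mesh_gt0 R N; apply/andP; split.
  by apply: mulr_ge0; [have := ler0n R i; lra|exact: ltW].
rewrite /midpt ler_pdivrMr ?ltr0n// mul1r; have : (i%:R : R) <= N%:R by rewrite ler_nat.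
by rewrite -[N.+1%:R]natr1; lra.
Qed.

(* The grid function whose discrete Laplacian is the cell average of [y_xx]. *)
Definition Yz N j t : R := sol y (clamp 0 T t) 0
  + mesh N * \sum_(i < j) dH2 (sol y (clamp 0 T t)) (midpt N i).
(** Cell averages can be differentiated twice in time, whereas [Yz], made of point values of [y_x],
    has the exact Laplacian. The argument passes from one to the other at the price [2 K sqrt h] of
    [Yz_cz]. *)
Definition cz N j t : R := cavg N j (sol y (clamp 0 T t)).
Definition czt N j t : R := cavg N j (sol_t y (clamp 0 T t)).
Definition cztt N j t : R := cavg N j (sol_tt y (clamp 0 T t)).

Let T0' : 0 <= T := ltW T0.
Let clT t : 0 <= clamp 0 T t <= T. Proof. exact: clamp_in. Qed.

Lemma dsol_continuous x : 0 <= x <= 1 -> continuous (fun t => dH2 (sol y (clamp 0 T t)) x).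
Proof. by move=> xI; apply: (supcont_continuous T0' xI (dsol_supcont y)). Qed.

Lemma sol_continuous x : 0 <= x <= 1 -> continuous (fun t => sol y (clamp 0 T t) x).
Proof. by move=> xI; apply: (supcont_continuous T0' xI (sol_supcont y)). Qed.

Lemma Yz_continuous N j : (j <= N.+1)%N -> continuous (Yz N j).
Proof.
move=> jN; apply: contD; first by apply: sol_continuous; rewrite lexx ler01.
apply: contM; first exact: contC.
apply: cont_sum => i _; apply: dsol_continuous; apply: midpt_in.
by rewrite -ltnS; exact: leq_trans (ltn_ord i) jN.
Qed.

Lemma Yz_cont N i j : (i < N)%N -> (j <= i.+2)%N -> continuous (Yz N j).
Proof. by move=> iN ji; apply: Yz_continuous; exact: leq_trans ji (iN : (i.+1 < N.+1)%N). Qed.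

(** The slopes of [Yz] are the values of [y_x] at the midpoints of the edges, and a cell lies
    between two consecutive midpoints. *)
Lemma laplacian_Yz N i t : (i < N)%N ->
  laplacian_h N (Yz N ^~ t) i.+1 = cavg N i.+1 (ddH2 (sol y (clamp 0 T t))).
Proof.
move=> iN; have hn := lt0r_neq0 (@mesh_gt0 R N).
rewrite /laplacian_h /Yz/= !big_ord_recr/= /cavg.
have [_ ac] := dsol_abs_cont y (clamp 0 T t); have [a0 ab b1 _] := @cell_in R N i iN.
rewrite -(ac _ _ a0 ab b1) -/(midpt N i.+1).
have -> : (i.+1%:R - 1/2) * mesh N = midpt N i by rewrite /midpt -natr1; congr (_ * _); lra.
by move: (dH2 _ _) (dH2 _ _) (\sum_(_ < _) _) (sol _ _ _) => *; field.
Qed.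

Definition wave_bound (K : R) := forall t, 0 <= t <= T ->
  [/\ intL (fun x => ddH2 (sol y t) x ^+ 2) 0 1 <= K ^+ 2,
   intL (fun x => dH2 (sol y t) x ^+ 2) 0 1 <= K ^+ 2 &
   forall x, 0 <= x <= 1 -> `|sol y t x| <= K /\ `|sol_t y t x| <= K].

Lemma wave_boundP : exists2 K, 0 <= K & wave_bound K.
Proof.
have bdd (f : R -> R) : {within `[0, 1], continuous f} -> exists M, forall x, 0 <= x <= 1 -> `|f x| <= M.
  move=> cf; have cF := clamp_cont ler01 cf.
  have [c _ Hc] := EVT_max ler01 (continuous_subspaceT (cont_norm cF)).
  exists (`|f (clamp 0 1 c)|) => x xI; have := Hc x; rewrite (clamp_id xI) in_itv/=; exact.
have [M1 M10 H1] := L2cont_bounded (ddsol_L2cont y).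
have [M2 M20 H2] := L2cont_bounded (dsol_L2cont y).
have [M3 M30 H3] := supcont_bounded (sol_supcont y) (fun t _ => bdd _ (@H2_cont _ _ _ (sol y t))).
have [M4 M40 H4] := supcont_bounded (sol_t_supcont y) (fun t _ => bdd _ (@W1_cont _ _ _ _ (sol_t y t))).
exists (M1 + M2 + M3 + M4); first by rewrite !addr_ge0.
move=> t tT; split=> [||x xI].
- by apply: (le_trans (H1 t tT)); apply: lerXn2r; rewrite ?nnegrE ?addr_ge0//; lra.
- by apply: (le_trans (H2 t tT)); apply: lerXn2r; rewrite ?nnegrE ?addr_ge0//; lra.
- by have := H3 t x tT xI; have := H4 t x tT xI; split; lra.
Qed.

Variables (K : R) (K0 : 0 <= K) (HK : wave_bound K).

Let holder N (f df : R -> R) x x' : abs_cont f df 0 1 -> L2 df 0 1 -> intL (fun x => df x ^+ 2) 0 1 <= K ^+ 2 ->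
  0 <= x <= 1 -> 0 <= x' <= 1 -> `|x - x'| <= mesh N -> `|f x - f x'| <= K * sqm N.
Proof.
move=> af Ld dK xI xI' xx; have h0 := ltW (@mesh_gt0 R N).
rewrite -ler_sqr ?nnegrE ?mulr_ge0 ?sqrtr_ge0// sqr_normr// exprMn sqr_sqrtr//.
apply: (le_trans (abs_cont_dist2 af Ld xI' xI)); rewrite mulrC.
by apply: ler_pM => //; exact: intL_sqr_ge0.
Qed.

Let node_in N j : (j <= N.+1)%N -> 0 <= (j%:R * mesh N : R) <= 1.
Proof. by move=> jN; rewrite node_le1// mulr_ge0// ltW// mesh_gt0. Qed.

Let sol_holder N t x x' : 0 <= t <= T -> 0 <= x <= 1 -> 0 <= x' <= 1 -> `|x - x'| <= mesh N ->
  `|sol y t x - sol y t x'| <= K * sqm N.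
Proof.
move=> tT; have [_ dK _] := HK tT.
exact: holder (sol_abs_cont y t) (L2_cont (@W1_cont _ _ _ _ _)) dK.
Qed.

Lemma dsol_holder N t x x' : 0 <= t <= T -> 0 <= x <= 1 -> 0 <= x' <= 1 -> `|x - x'| <= mesh N ->
  `|dH2 (sol y t) x - dH2 (sol y t) x'| <= K * sqm N.
Proof.
move=> tT; have [dK _ _] := HK tT.
exact: holder (dsol_abs_cont y t) (W1_2_L2 _) dK.
Qed.

(** Midpoint rule on each edge: [y_x] is Holder of exponent [1/2], so an edge contributes
    [h K sqrt h], and there are [1 / h] edges. *)
Lemma Yz_node N j t : (j <= N.+1)%N ->
  `|Yz N j t - sol y (clamp 0 T t) (j%:R * mesh N)| <= K * sqm N.
Proof.
move=> jN; have h0 := @mesh_gt0 R N; set c := K * sqm N.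
have c0 : 0 <= c by rewrite mulr_ge0// sqrtr_ge0.
suff : `|Yz N j t - sol y (clamp 0 T t) (j%:R * mesh N)| <= (j%:R * mesh N) * c.
  by move=> /le_trans; apply; rewrite ler_piMl// node_le1.
elim: j jN => [|j IH] jN; first by rewrite /Yz big_ord0 mulr0 addr0 !mul0r subrr normr0.
have {IH}IH := IH (ltnW jN); set s := clamp 0 T t in IH *.
have jI := node_in (ltnW jN); have jI' := node_in jN; have hI := midpt_in (jN : (j <= N)%N).
have [id ac] := sol_abs_cont y s.
have /andP[j0 j1] := jI; have /andP[_ j1'] := jI'.
have jj : j%:R * mesh N <= j.+1%:R * mesh N :> R by rewrite ler_pM2r// ler_nat.
have jE : j.+1%:R * mesh N = j%:R * mesh N + mesh N :> R by rewrite -natr1 mulrDl mul1r.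
have hE : midpt N j = j%:R * mesh N + mesh N / 2 by rewrite /midpt; lra.
have d1 : `|intL (dH2 (sol y s)) (j%:R * mesh N) (j.+1%:R * mesh N) - mesh N * dH2 (sol y s) (midpt N j)| <= mesh N * c.
  have idj := ible_sub j0 j1' id.
  have dist x : j%:R * mesh N < x < j.+1%:R * mesh N -> `|dH2 (sol y s) x - dH2 (sol y s) (midpt N j)| <= c.
   move=> /andP[x1 x2]; apply: dsol_holder => //; first exact: clT.
   by rewrite (le_trans j0 (ltW x1)) (le_trans (ltW x2)).
   by rewrite hE ler_norml; split_lra.
  have -> : mesh N * dH2 (sol y s) (midpt N j) = intL (fun=> dH2 (sol y s) (midpt N j)) (j%:R * mesh N) (j.+1%:R * mesh N).
   by rewrite intL_cst// jE; ring.
  rewrite -intLB//; last exact: ible_cst.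
  have iB := ibleB idj (ible_cst (dH2 (sol y s) (midpt N j)) _ _).
  apply: (le_trans (intL_norm iB)).
  apply: (le_trans (intL_le (ible_norm iB) (ible_cst c _ _) dist)).
  by rewrite intL_cst// jE; lra.
have E : sol y s (j.+1%:R * mesh N) = sol y s (j%:R * mesh N) + intL (dH2 (sol y s)) (j%:R * mesh N) (j.+1%:R * mesh N).
  by rewrite -(ac _ _ j0 jj j1'); ring.
rewrite E; move: IH d1; rewrite /Yz big_ord_recr/= -/s jE (mulrDl _ _ c).
move: (intL _ _ _) (dH2 _ _) (sol y s _) (sol y s 0) (\sum_(i < j) _) => I D S S0 Sg.
norm_lra.
Qed.

Lemma cz_node N i t : (i < N)%N ->
  `|cz N i.+1 t - sol y (clamp 0 T t) (i.+1%:R * mesh N)| <= K * sqm N.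
Proof.
move=> iN; have [a0 ab b1 _] := @cell_in R N i iN; have h0 := @mesh_gt0 R N.
have iv := ible_cont (@H2_cont _ _ _ (sol y (clamp 0 T t))).
apply: (cavg_dist iN iv).
move=> x /andP[x1 x2]; apply: sol_holder => //.
- by rewrite (le_trans a0 (ltW x1)) (le_trans (ltW x2)).
- by apply: node_in; exact: ltnW.
- by move: x1 x2; rewrite !mulrDl => *; rewrite ler_norml; split_lra.
Qed.

Lemma Yz_cz N i t : (i < N)%N -> `|Yz N i.+1 t - cz N i.+1 t| <= 2 * K * sqm N.
Proof.
move=> iN; have iN' : (i.+1 <= N.+1)%N by exact: ltnW.
have := @Yz_node N i.+1 t iN'; have := @cz_node N i t iN.
norm_lra.
Qed.

Lemma Yz_right N t : `|Yz N N.+1 t - sol y (clamp 0 T t) 1| <= K * sqm N.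
Proof. by have := @Yz_node N N.+1 t (leqnn _); rewrite mulrC meshM. Qed.

Lemma cavg_lf N i v : (i < N)%N -> L2 v 0 1 ->
  cavg N i.+1 v = lf (fun _ : R => (mesh N)^-1) ((i.+1%:R - 1/2) * mesh N) ((i.+1%:R + 1/2) * mesh N) v.
Proof.
move=> iN Lv; have [a0 ab b1 _] := @cell_in R N i iN.
by rewrite /cavg /lf (intLZ _ (ible_sub a0 b1 (L2_ible Lv))) mulrC.
Qed.

Lemma cell_bker N i : (i < N)%N ->
  bker (fun _ : R => (mesh N)^-1) ((i.+1%:R - 1/2) * mesh N) ((i.+1%:R + 1/2) * mesh N) (mesh N)^-1.
Proof.
move=> iN; have [a0 ab b1 _] := @cell_in R N i iN; have h0 := @mesh_gt0 R N.
split=> //; first by rewrite invr_ge0 ltW.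
by split=> [|x _]; [exact: measurable_cst|rewrite gtr0_norm// invr_gt0].
Qed.

Let cavg_family N i F : (i < N)%N -> L2cont T F ->
  (fun t => cavg N i.+1 (F (clamp 0 T t))) =
  (fun t => lf (fun _ : R => (mesh N)^-1) ((i.+1%:R - 1/2) * mesh N) ((i.+1%:R + 1/2) * mesh N) (F (clamp 0 T t))).
Proof. by move=> iN [LF _]; apply/funext => t; apply: cavg_lf => //; exact: LF. Qed.

Lemma cavg_continuous N i F : (i < N)%N -> L2cont T F -> continuous (fun t => cavg N i.+1 (F (clamp 0 T t))).
Proof. by move=> iN cF; rewrite cavg_family//; exact: lf_cont T0' (cell_bker iN) cF. Qed.

Lemma cavg_abs_cont N i F G : (i < N)%N -> L2cont T F -> L2cont T G -> L2diff T F G ->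
  abs_cont (fun t => cavg N i.+1 (F (clamp 0 T t))) (fun t => cavg N i.+1 (G (clamp 0 T t))) 0 T.
Proof. by move=> iN cF cG dF; rewrite !cavg_family//; exact: lf_abs_cont T0 (cell_bker iN) cF cG dF. Qed.

Lemma cz_continuous N i : (i < N)%N -> continuous (cz N i.+1).
Proof. by move=> iN; exact: cavg_continuous iN (sol_L2cont y). Qed.

Lemma czt_continuous N i : (i < N)%N -> continuous (czt N i.+1).
Proof. by move=> iN; exact: cavg_continuous iN (sol_t_L2cont y). Qed.

Lemma cztt_continuous N i : (i < N)%N -> continuous (cztt N i.+1).
Proof. by move=> iN; exact: cavg_continuous iN (sol_tt_L2cont y). Qed.

Lemma cz_abs_cont N i : (i < N)%N -> abs_cont (cz N i.+1) (czt N i.+1) 0 T.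
Proof. by move=> iN; exact: cavg_abs_cont iN (sol_L2cont y) (sol_t_L2cont y) (sol_L2diff y). Qed.

Lemma czt_abs_cont N i : (i < N)%N -> abs_cont (czt N i.+1) (cztt N i.+1) 0 T.
Proof. by move=> iN; exact: cavg_abs_cont iN (sol_t_L2cont y) (sol_tt_L2cont y) (sol_t_L2diff y). Qed.

Lemma czt_le N i t : (i < N)%N -> `|czt N i.+1 t| <= K.
Proof.
move=> iN; have [a0 ab b1 _] := @cell_in R N i iN; have [_ _ H] := HK (clT t).
rewrite -[czt _ _ _]subr0; have iv := ible_cont (@W1_cont _ _ _ _ (sol_t y (clamp 0 T t))).
apply: (cavg_dist iN iv).
move=> x /andP[x1 x2]; rewrite subr0; apply: (H x _).2.
by rewrite (le_trans a0 (ltW x1)) (le_trans (ltW x2)).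
Qed.

Lemma Yz_le N j t : (j <= N.+1)%N -> `|Yz N j t| <= 2 * K.
Proof.
move=> jN; have := @Yz_node N j t jN; have [_ _ H] := HK (clT t).
have [h _] := H _ (node_in jN).
have s1 : K * sqm N <= K by rewrite ler_piMr// -[leRHS]sqrtr1 ler_wsqrtr// mesh_le1.
move: h s1; rewrite !ler_norml => /andP[? ?] ? /andP[? ?]; split_lra.
Qed.

Section steklov_of_Yz.
Variables (e L : R) (e0 : 0 < e) (L0 : 0 <= L) (LT : L + 3 * e <= T) (N : nat).
Hypothesis hN : 4 * K * sqm N / e <= 1.

(** Three means, because two time derivatives fall on the reference function and a third on the
    residual; each derivative turns one [avg] into a [dq]. *)
Definition Yh j t := avg3 e (Yz N j) t.
Definition dYh j t := dq e (avg e (avg e (Yz N j))) t.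
Definition ddYh j t := dq e (dq e (avg e (Yz N j))) t.

Lemma Yh_derive j t : (j <= N.+1)%N -> is_derive t (1 : R) (Yh j) (dYh j t).
Proof. by move=> jN; apply: avg_derive; do 2 apply: avg_cont; exact: Yz_continuous. Qed.

Lemma dYh_derive j t : (j <= N.+1)%N -> is_derive t (1 : R) (dYh j) (ddYh j t).
Proof.
by move=> jN; apply: dq_derive => s; apply: avg_derive; apply: avg_cont; exact: Yz_continuous.
Qed.

Lemma dYh_continuous j : (j <= N.+1)%N -> continuous (dYh j).
Proof. by move=> jN; apply: dq_cont; do 2 apply: avg_cont; exact: Yz_continuous. Qed.

Lemma ddYh_continuous j : (j <= N.+1)%N -> continuous (ddYh j).
Proof. by move=> jN; do 2 apply: dq_cont; apply: avg_cont; exact: Yz_continuous. Qed.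

Lemma Yh_le j t : (j <= N.+1)%N -> 0 <= t <= L -> `|Yh j t| <= 2 * K.
Proof.
move=> jN tL; apply: (avg3_bound e0 (Yz_continuous jN) _ tL) => s _; exact: Yz_le.
Qed.

Let Ez i t := Yz N i.+1 t - cz N i.+1 t.

(** The cell averages have a time derivative bounded by [K]; the difference [Yz - cz] loses [1 / e]
    under the quotient, and [hN] keeps the result below 1. *)
Let dYh_le i t : (i < N)%N -> 0 <= t <= L -> `|dYh i.+1 t| <= K + 1.
Proof.
move=> iN tL; have iN' : (i.+1 <= N.+1)%N by exact: ltnW.
have cY := Yz_continuous iN'; have cc := cz_continuous iN; have ct := czt_continuous iN.
have cE : continuous (Ez i) by exact: contB.
have [h _] := dq_sup_bounds e0 cE (fun s _ => @Yz_cz N i s iN) tL.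
have /andP[t0 tL'] := tL.
have t3 : t + 3 * e <= T by have LT' := LT; lra.
have E2 := first_dq_avg e0 cc ct (cz_abs_cont iN) t0 t3.
have b2 := avg3_bound e0 ct (fun s _ => @czt_le N i s iN) tL.
have aE : dYh i.+1 t = dq e (avg e (avg e (cz N i.+1))) t + dq e (avg e (avg e (Ez i))) t.
  by rewrite /Ez (avgB e cY cc) (avgB e (avg_cont e cY) (avg_cont e cc)) dqB addrC subrK.
rewrite aE; apply: (le_trans (ler_normD _ _)); apply: lerD; first by rewrite E2.
apply: (le_trans h); apply: le_trans hN.
by rewrite le_eqVlt; apply/orP; left; apply/eqP; ring.
Qed.

Lemma Yh_lip i s t : (i < N)%N -> 0 <= s <= L -> 0 <= t <= L ->
  `|Yh i.+1 t - Yh i.+1 s| <= (K + 1) * `|t - s|.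
Proof.
move=> iN; wlog st : s t / s <= t.
  move=> W sL tL; have [/W|/ltW/W] := leP s t; first exact.
  by rewrite distrC (distrC t); apply.
move=> /andP[s0 sL] /andP[t0 tL]; have iN' : (i.+1 <= N.+1)%N by exact: ltnW.
have cd := dYh_continuous iN'.
rewrite -(intg_FTC _ _ cd (fun t => Yh_derive t iN')) (ger0_norm (x := t - s)) ?subr_ge0//.
apply: (le_trans (intg_norm cd st)); rewrite -(intg_cst (K + 1)).
apply: intg_le => //; [exact: cont_norm|exact: contC|].
move=> x /andP[sx xt]; apply: dYh_le => //.
by rewrite (le_trans s0 sx) (le_trans xt).
Qed.

Let residual_algebra (ddU lapU q u gt yh lapy dd m3X m3c m3g pj D lapd : R) :
  ddU - lapU + q * u = gt -> m3X = lapy - m3c + m3g - pj * yh -> D = dd - m3c -> lapd = lapU - lapy ->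
  ddU - dd - lapd + q * (u - yh) = (pj - q) * yh - (- (gt - m3g) - m3X + D).
Proof. by move=> <- -> -> ->; ring. Qed.

(** The residual has three parts: the source against its triple mean; the triple mean of the defect
    of the equation, with [Yz] in the Laplacian and the potential term and [cztt] as acceleration;
    two time quotients of [Yz - cz], since [ddYh] differentiates [Yz] while the acceleration is that
    of cell averages. *)
Lemma residual_equation i t (q pj ddU : R) (U : nat -> R -> R) (gj : R -> R) :
  (i < N)%N -> 0 <= t <= L -> continuous gj ->
  ddU - laplacian_h N (U^~ t) i.+1 + q * U i.+1 t = gj t ->
  ddU - ddYh i.+1 t - laplacian_h N (fun j => U j t - Yh j t) i.+1 + q * (U i.+1 t - Yh i.+1 t)
   = (pj - q) * Yh i.+1 t - (- (gj t - avg3 e gj t) -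
   avg3 e (fun s => laplacian_h N (Yz N ^~ s) i.+1 - cztt N i.+1 s + gj s - pj * Yz N i.+1 s) t
   + dq e (dq e (avg e (Ez i))) t).
Proof.
move=> iN tL cg HU; have iN' : (i.+1 <= N.+1)%N by exact: ltnW.
have cYj j : (j <= i.+2)%N -> continuous (Yz N j) by move=> ji; apply: Yz_continuous; exact: leq_trans ji (iN : (i.+1 < N.+1)%N).
have cY := Yz_continuous iN'; have cc := cz_continuous iN; have ctt := cztt_continuous iN.
have [cl E] := @avg3_laplacian R N e (Yz N) i t cYj.
have E2 : dq e (dq e (avg e (Ez i))) t = ddYh i.+1 t - avg3 e (cztt N i.+1) t.
  have /andP[t0 tL'] := tL.
  have t3 : t + 3 * e <= T by have LT' := LT; lra.
  rewrite -(second_dq_avg e0 cc (czt_continuous iN) ctt (cz_abs_cont iN) (czt_abs_cont iN) t0 t3).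
  by rewrite /Ez (@avgB _ e _ _ cY cc) !dqB.
have lapE : laplacian_h N (fun j => U j t - Yh j t) i.+1 = laplacian_h N (U^~ t) i.+1 - laplacian_h N (Yh^~ t) i.+1.
  by rewrite /laplacian_h; move: (U _ _) (U _ _) (U _ _) (Yh _ _) (Yh _ _) (Yh _ _) => *; ring.
have lapE' := etrans lapE (congr1 (fun x => laplacian_h N (U^~ t) i.+1 - x) (esym E)).
exact: (residual_algebra HU (avg3_linear e pj t cl ctt cg cY) E2 lapE').
Qed.

End steklov_of_Yz.
End comparison_grid_function.

(** * Discrete slopes from convergence in the dual norm *)

Section dual_norm.
Context {R : realType}.

Lemma derive_affine (f df : R -> R) (c d x : R) : (forall x, is_derive x (1 : R) f (df x)) ->
  is_derive x (1 : R) (fun x => f (c * x + d)) (c * df (c * x + d)).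
Proof.
move=> H; have d1 : is_derive x (1 : R) (fun x => c * x + d) c.
  rewrite -[X in is_derive _ _ _ X]addr0; apply: is_deriveD.
  by rewrite -[X in is_derive _ _ _ X]mulr1; apply: is_deriveMl; exact: is_derive_id.
by have := @is_derive1_comp _ f (fun x => c * x + d) x _ _ (H _) d1; rewrite mulrC.
Qed.

Lemma cont_affine_comp (c d : R) (f : R -> R) : continuous f -> continuous (fun x => f (c * x + d)).
Proof.
move=> cf x; apply: (@continuous_comp _ _ _ (fun x => c * x + d) f); last exact: cf.
by apply: contD; [apply: contM; [exact: contC|move=> y; exact: cvg_id]|exact: contC].
Qed.

Arguments cont_affine_comp c d [f].

Lemma intg_affine (f : R -> R) (c d a b : R) : continuous f -> c != 0 ->
  intg (fun x => f (c * x + d)) a b = intg f (c * a + d) (c * b + d) / c.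
Proof.
move=> cf c0; have dP x : is_derive x (1 : R) (fun x => c^-1 * prim f (c * x + d)) (f (c * x + d)).
  have := is_deriveMl c^-1 (derive_affine c d x (fun x => is_derive_prim x cf)).
  by rewrite mulrA mulVf// mul1r.
by rewrite (intg_FTC _ _ (cont_affine_comp c d cf) dP) /intg -mulrBr mulrC.
Qed.

(* The combination of two scales makes the integral over a cell exact. *)
Lemma unit_mean_step : exists S k : R -> R, exists B : R,
  [/\ smooth S, forall x, is_derive x (1 : R) S (k x), continuous k, 0 < B &
   [/\ forall x, `|k x| <= B, forall x, x <= 0 -> S x = 0 /\ k x = 0,
   forall x, 1/4 <= x -> S x = 1 /\ k x = 0 & intg S 0 1 = 1]].
Proof.
have [s [ds [B [ss dsE cds dsB [s0 s1 s01 dz]]]]] := @smooth_step R.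
have B0 : 0 <= B by have /andP[] := dsB 0 => /le_trans h /h.
have cs : continuous s := derive_cont dsE.
pose S x := 2 * s (8 * x + 0) - s (4 * x + 0); pose k x := 16 * ds (8 * x + 0) - 4 * ds (4 * x + 0).
have c8 := cont_affine_comp 8 0 cs; have c4 := cont_affine_comp 4 0 cs.
have k8 := cont_affine_comp 8 0 cds; have k4 := cont_affine_comp 4 0 cds.
exists S, k, (20 * B + 1); split.
- move=> n; have h1 := @ncont_affine R n s 8 0 2 (ss n); have h2 := @ncont_affine R n s 4 0 (- 1) (ss n).
  by have := ncontD h1 h2; congr ncont; apply/funext => x; rewrite mulN1r.
- move=> x; have h1 := is_deriveMl 2 (derive_affine 8 0 x dsE).
  have h2 := derive_affine 4 0 x dsE; have h3 := is_deriveB h1 h2.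
  by apply: is_derive_eq h3 _; rewrite /k; ring.
- by rewrite /k; apply: contB; [exact: (contM (@contC R 16) k8)|exact: (contM (@contC R 4) k4)].
- by lra.
- split.
  + move=> x; rewrite /k; have := dsB (8 * x + 0); have := dsB (4 * x + 0).
   by move=> /andP[? ?] /andP[? ?]; rewrite ler_norml; split_lra.
  + move=> x x0; have h8 : 8 * x + 0 <= 0 by lra.
   have h4 : 4 * x + 0 <= 0 by lra.
   by rewrite /S /k !s0// !dz ?h8 ?h4//; split; ring.
  + move=> x x1; have h8 : 1 <= 8 * x + 0 by lra.
   have h4 : 1 <= 4 * x + 0 by lra.
   by rewrite /S /k !s1// !dz ?h8 ?h4 ?orbT//; split; ring.
  have tail (c : R) : 1 <= c -> intg s 0 c = intg s 0 1 + (c - 1).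
   move=> c1; rewrite (intg_chasles s 1 0 c); congr (_ + _).
   rewrite (eq_intg cs (@contC R 1) c1) => [|t /andP[t1 _]]; last exact: s1.
   by rewrite intg_cst mul1r.
  have n8 : (8 : R) != 0 by rewrite pnatr_eq0.
  have n4 : (4 : R) != 0 by rewrite pnatr_eq0.
  have c28 : continuous (fun x : R => 2 * s (8 * x + 0)) := contM (@contC R 2) c8.
  rewrite /S (intgB 0 1 c28 c4) (intgZ _ 0 1 c8) (intg_affine 0 0 1 cs n8) (intg_affine 0 0 1 cs n4).
  rewrite !mulr0 !mulr1 !addr0 (tail 8) ?ler1n// (tail 4) ?ler1n//.
  by move: (intg s 0 1) => I; clear; lra.
Qed.

(** For [k] the derivative of the step [S]: the derivative of [S] rescaled to the mesh and started
    at the midpoint of edge [i], of mass 1 and with support of length [h / 4]. *)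
Definition edge_kernel (k : R -> R) N i x : R := k ((mesh N)^-1 * x - (i%:R + 1/2)) / mesh N.
Definition edge_lf k N i v := lf (edge_kernel k N i) (midpt N i) (midpt N i + mesh N / 4) v.
Local Notation mid N i := (midpt N i : R).

Section test_functions.
Variables (S k : R -> R) (B : R).
Hypotheses (sS : smooth S) (dS : forall x, is_derive x (1 : R) S (k x)) (ck : continuous k) (B0 : 0 < B).
Hypotheses (kB : forall x, `|k x| <= B) (S0 : forall x, x <= 0 -> S x = 0 /\ k x = 0)
  (S1 : forall x, 1/4 <= x -> S x = 1 /\ k x = 0) (IS : intg S 0 1 = 1).
Variable (N : nat).
Local Notation h := (mesh N : R).
Let h0 : 0 < h. Proof. exact: mesh_gt0. Qed.
Let hn : h != 0. Proof. exact: lt0r_neq0. Qed.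
Let cS : continuous S := derive_cont dS.

Let Si i x := S (h^-1 * x - (i%:R + 1/2)).
Let ki i x := edge_kernel k N i x.

Let arg_half i x : h^-1 * x - (i%:R + 1/2) = (x - mid N i) / h.
Proof. by rewrite /midpt; field. Qed.

Let cSi i : continuous (Si i). Proof. exact: cont_affine_comp. Qed.
Let cki i : continuous (ki i).
Proof. by apply: contM; [exact: cont_affine_comp|exact: contC]. Qed.

Let dSi i x : is_derive x (1 : R) (Si i) (ki i x).
Proof.
apply: is_derive_eq (derive_affine h^-1 (- (i%:R + 1/2)) x dS) _.
by rewrite /ki /edge_kernel mulrC.
Qed.

Lemma edge_kernel_left i x : x <= mid N i -> edge_kernel k N i x = 0.
Proof.
move=> xi; rewrite /edge_kernel arg_half (S0 _).2 ?mul0r//.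
by rewrite pmulr_lle0 ?invr_gt0// subr_le0.
Qed.

Lemma edge_kernel_right i x : mid N i + h / 4 <= x -> edge_kernel k N i x = 0.
Proof.
move=> xi; rewrite /edge_kernel arg_half (S1 _).2 ?mul0r//.
by rewrite ler_pdivlMr//; lra.
Qed.

Lemma edge_in i : (i <= N)%N -> [/\ 0 <= mid N i, mid N i <= mid N i + h / 4, mid N i + h / 4 <= 1 &
  mid N i + h / 4 <= mid N i.+1].
Proof.
move=> iN; have /andP[a _] := @midpt_in R N i iN; have hh := h0; split=> //; first lra.
  have : (i%:R + 3/4) * h <= 1.
   rewrite ler_pdivrMr ?ltr0n// mul1r; have : (i%:R : R) <= N%:R by rewrite ler_nat.
   by rewrite -[N.+1%:R]natr1; lra.
  by rewrite /midpt; lra.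
by rewrite /midpt -natr1; lra.
Qed.

Lemma edge_bker i : (i <= N)%N -> bker (edge_kernel k N i) (mid N i) (mid N i + h / 4) (B / h).
Proof.
move=> iN; have [a ab b _] := edge_in iN; split=> //; first by rewrite divr_ge0// ltW.
split=> [|x _]; first by apply: measurable_funTS; apply: continuous_measurable_fun; exact: (@cki i).
rewrite /edge_kernel normrM (gtr0_norm (x := h^-1)) ?invr_gt0//.
by rewrite ler_pM2r ?invr_gt0.
Qed.

Lemma edge_lf_le v : L2 v 0 1 ->
  h * \sum_(i < N.+1) edge_lf k N i v ^+ 2 <= B ^+ 2 * intL (fun x => v x ^+ 2) 0 1.
Proof.
move=> Lv; apply: (@local_functionals_le R N N.+1 (@midpt R N) (fun i => mid N i + h / 4) (edge_kernel k N) v B) => //.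
- by move=> i iN; have [a ab b _] := edge_in iN; split=> //; have hh := h0; lra.
- move=> i l /andP[il _]; have hh := h0; have : (i%:R : R) + 1 <= l%:R by rewrite natr1 ler_nat.
  by move=> il'; have := ler_wpM2r (ltW h0) il'; rewrite /midpt; lra.
- by move=> i iN; have [_ _ _ _ []] := edge_bker iN.
- by move=> i x iN xI; have [_ _ _ _ [_]] := edge_bker iN; apply.
Qed.

Lemma edge_lf_cst i c : (i <= N)%N -> edge_lf k N i (fun=> c) = c.
Proof.
move=> iN; have [a ab b _] := edge_in iN; rewrite /edge_lf /lf.
rewrite (@eq_Rint _ _ (fun x => c * ki i x)) => [|x _]; last by rewrite mulrC.
rewrite intLZ; last exact: cont_ible _ _ (@cki i).
rewrite intL_intg// (intg_FTC _ _ (@cki i) (dSi i)) /Si !arg_half (S1 _).1; last first.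
  by rewrite ler_pdivlMr//; lra.
by rewrite (S0 _).1 ?subr0 ?mulr1// subrr mul0r.
Qed.

(** The cell of node [j + 1] runs from midpoint [j] to midpoint [j + 1]. The ramp lies in the cell
    that starts at midpoint [i], and there the normalisation [intg S 0 1 = 1] makes the mean exactly
    1. *)
Let cavg_Si i j : (i <= N)%N -> (j < N)%N -> cavg N j.+1 (Si i) = (i < j.+1)%:R.
Proof.
move=> iN jN; have [a0 ab b1 E] := @cell_in R N j jN; have hh := h0.
rewrite /cavg intL_intg//.
have [ij|ji|ij] := ltngtP i j.
- have il : (i%:R : R) + 1 <= j%:R by rewrite natr1 ler_nat.
  rewrite (eq_intg (@cSi i) (@contC R 1) ab) => [|x /andP[x1 _]].
   by rewrite intg_cst E mul1r mulfV// ltnS ltnW.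
  rewrite /Si (S1 _).1// arg_half ler_pdivlMr//; apply: le_trans (_ : (j.+1%:R - 1/2) * h - mid N i <= _); last by rewrite lerD2r.
  by have := ler_wpM2r (ltW h0) il; rewrite /midpt -[j.+1%:R]natr1; lra.
- rewrite (eq_intg (@cSi i) (@contC R 0) ab) => [|x /andP[_ x2]].
   by rewrite intg_cst mul0r mul0r ltnS leqNgt ji.
  have il : (j%:R : R) + 1 <= i%:R by rewrite natr1 ler_nat.
  rewrite /Si (S0 _).1// arg_half pmulr_lle0 ?invr_gt0// subr_le0; apply: (le_trans x2).
  by have := ler_wpM2r (ltW h0) il; rewrite /midpt -natr1; lra.
- rewrite ij ltnSn (intg_affine _ _ _ cS) ?invr_neq0// invrK.
  have -> : h^-1 * ((j.+1%:R - 1/2) * h) - (j%:R + 1/2) = 0 by rewrite -natr1; field.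
  have -> : h^-1 * ((j.+1%:R + 1/2) * h) - (j%:R + 1/2) = 1 by rewrite -natr1; field.
  by rewrite IS mul1r mulfV.
Qed.

Section bumps.
Variables (w : nat -> R).
Hypothesis w0 : \sum_(i < N.+1) w i = 0.

(** Smoothed steps combined with total weight 0, hence with compact support: a test function whose
    derivative pairs through the edge functionals. *)
Definition bump_fun (x : R) := \sum_(i < N.+1) h * w i * S (h^-1 * x - (i%:R + 1/2)).
Let dphi x := \sum_(i < N.+1) h * w i * ki i x.

Let bump_derive x : is_derive x (1 : R) bump_fun (dphi x).
Proof. by apply: is_derive_sumf => i _; apply: is_deriveMl; exact: dSi. Qed.

Let cdphi : continuous dphi.
Proof. by apply: cont_sum => i _; apply: contM; [exact: contC|exact: cki]. Qed.

Let cbump : continuous bump_fun := derive_cont bump_derive.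

Let bump_smooth n : ncont n bump_fun.
Proof. by apply: ncont_sum => i; exact: (@ncont_affine R n S h^-1 (- (i%:R + 1/2)) (h * w i) (sS n)). Qed.

Let bump0 x : x <= mid N 0 -> bump_fun x = 0.
Proof.
move=> x0; rewrite /bump_fun big1// => i _; rewrite arg_half (S0 _).1 ?mulr0//.
rewrite pmulr_lle0 ?invr_gt0// subr_le0 (le_trans x0)//.
by rewrite /midpt ler_pM2r// lerD2r ler_nat.
Qed.

Let bump1 x : mid N N + h / 4 <= x -> bump_fun x = 0.
Proof.
move=> x1; rewrite /bump_fun (eq_bigr (fun i : 'I_N.+1 => h * w i)).
  by rewrite -mulr_sumr w0 mulr0.
move=> i _; rewrite arg_half (S1 _).1 ?mulr1// ler_pdivlMr//.
have iN : (i%:R : R) <= N%:R by rewrite ler_nat -ltnS.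
by have := ler_wpM2r (ltW h0) iN; move: x1; rewrite /midpt; lra.
Qed.

Lemma bump_test : test_fun 0 1 bump_fun.
Proof.
split; first exact: smooth_derivable bump_smooth.
have [a0 _ _ _] := edge_in (leq0n N); have hh := h0; exists (mid N 0), (mid N N + h / 4); split.
- by rewrite /midpt mulr_gt0// add0r; lra.
- have : (N%:R + 3/4) * h < 1.
   by rewrite ltr_pdivrMr ?ltr0n// mul1r -[N.+1%:R]natr1; lra.
  by rewrite /midpt; lra.
- move=> x; apply: contra_neqP => /negP; rewrite negb_and -!ltNge => /orP[/ltW/bump0//|/ltW/bump1//].
Qed.

Lemma bump_test' : test_fun 0 1 (derive1 bump_fun).
Proof.
have [H _] := bump_test; split=> [n x|].
  by have := H n.+1 x; rewrite derive1Sn.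
have hh := h0; exists (mid N 0), (mid N N + h / 4); split.
- by rewrite /midpt mulr_gt0// add0r; lra.
- have : (N%:R + 3/4) * h < 1.
   by rewrite ltr_pdivrMr ?ltr0n// mul1r -[N.+1%:R]natr1; lra.
  by rewrite /midpt; lra.
- move=> x; rewrite (derive1_fun bump_derive); apply: contra_neqP => /negP.
  rewrite negb_and -!ltNge => /orP[x1|x1]; rewrite /dphi big1// => i _.
   rewrite /ki edge_kernel_left ?mulr0// (le_trans (ltW x1))//.
   by rewrite /midpt ler_pM2r// lerD2r ler_nat.
  rewrite /ki edge_kernel_right ?mulr0// (le_trans _ (ltW x1))// lerD2r.
  by rewrite /midpt ler_pM2r// lerD2r ler_nat -ltnS.
Qed.

Let int_ki_sqr i : (i <= N)%N -> intL (fun x => ki i x ^+ 2) 0 1 <= B ^+ 2 / h.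
Proof.
move=> iN; have [a ab b _] := edge_in iN; have hh := h0.
have ab' := le_trans ab b; have ck2 := @contX R _ 2 (@cki i).
rewrite (intL_cat a ab' (cont_ible 0 1 ck2)) (intL_cat ab b (cont_ible _ 1 ck2)).
rewrite (@eq_Rint _ _ (fun=> 0) 0) => [|x /andP[_ x2]]; last by rewrite /ki edge_kernel_left ?expr0n// ltW.
rewrite (@eq_Rint _ _ (fun=> 0) (mid N i + h / 4) 1) => [|x /andP[x2 _]]; last by rewrite /ki edge_kernel_right ?expr0n// ltW.
rewrite !intL_cst// !mul0r add0r addr0.
apply: (@le_trans _ _ (intL (fun=> (B / h) ^+ 2) (mid N i) (mid N i + h / 4))).
  apply: intL_le; [exact: cont_ible|exact: ible_cst|].
  move=> x xI; have [_ _ _ _ [_ H]] := edge_bker iN; have {}H := H x xI.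
  by rewrite -sqr_normr//; apply: lerXn2r H; rewrite nnegrE// divr_ge0// ltW.
rewrite intL_cst// (_ : (B / h) ^+ 2 * (mid N i + h / 4 - mid N i) = (B ^+ 2 / h) / 4); last by field.
by rewrite ler_pdivrMr// ler_peMr ?ler1n// divr_ge0 ?sqr_ge0// ltW.
Qed.

Let ki_disjoint i j x : (i < j <= N)%N -> ki i x * ki j x = 0.
Proof.
move=> /andP[ij jN]; have iN : (i <= N)%N := leq_trans (ltnW ij) jN.
have [xj|jx] := leP x (mid N j); first by rewrite /ki [X in _ * X]edge_kernel_left ?mulr0.
rewrite /ki edge_kernel_right ?mul0r//; have [_ _ _ e] := edge_in iN.
apply: (le_trans e); apply: le_trans (ltW jx).
by rewrite /midpt ler_pM2r// lerD2r ler_nat.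
Qed.

Let dphi_sqr x : dphi x ^+ 2 = \sum_(i < N.+1) (h * w i) ^+ 2 * ki i x ^+ 2.
Proof.
rewrite expr2 /dphi mulr_suml; apply: eq_bigr => i _.
rewrite (bigD1 i)//= mulrDr -expr2 exprMn mulr_sumr big1 ?addr0// => j ji.
have [ij|ij|/val_inj ij] := ltngtP i j; last by rewrite ij eqxx in ji.
  have := @ki_disjoint i j x; rewrite ij -ltnS ltn_ord => /(_ isT) e.
  by rewrite mulrACA e mulr0.
have := @ki_disjoint j i x; rewrite ij -ltnS ltn_ord => /(_ isT) e.
by rewrite mulrACA (mulrC (ki i x)) e mulr0.
Qed.

Definition edge_norm2 := h * \sum_(i < N.+1) w i ^+ 2.

(** The kernels have disjoint supports, so the square of the derivative is a plain sum; the
    function, which vanishes at 0, is bounded by its derivative. *)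
Lemma bump_H1 (c : R) : 0 <= c -> B ^+ 2 * edge_norm2 <= c ^+ 2 ->
  (H1_norm 0 1 bump_fun (derive1 bump_fun) <= (2 * c)%:E)%E.
Proof.
move=> c0 Hc; rewrite (derive1_fun bump_derive).
have D : intL (fun x => dphi x ^+ 2) 0 1 <= c ^+ 2.
  apply: le_trans Hc; rewrite (_ : (fun x => dphi x ^+ 2) = (fun x => \sum_(i < N.+1) (h * w i) ^+ 2 * ki i x ^+ 2)); last first.
   by apply/funext => x; exact: dphi_sqr.
  have ik i : ible (fun x => ki i x ^+ 2) 0 1 by apply: cont_ible; apply: contX; exact: cki.
  rewrite intL_sum => [|i _]; last by apply: ibleZ; exact: ik.
  rewrite /edge_norm2 mulrCA !mulr_sumr; apply: ler_sum => i _.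
  rewrite intLZ//; apply: (le_trans (ler_wpM2l (sqr_ge0 _) (int_ki_sqr (ltn_ord i)))).
  by rewrite le_eqVlt; apply/orP; left; apply/eqP; field.
have P : intL (fun x => bump_fun x ^+ 2) 0 1 <= c ^+ 2.
  apply: (@le_trans _ _ (intL (fun=> c ^+ 2) 0 1)); last by rewrite intL_cst// subr0 mulr1.
  apply: intL_le; [by apply: cont_ible; exact: contX|exact: ible_cst|].
  move=> x /andP[x0 x1]; apply: le_trans D.
  have z0 : bump_fun 0 = 0 by apply: bump0; have [] := edge_in (leq0n N).
  have := abs_cont_dist2 (abs_cont_C1 0 1 bump_derive cdphi) (cont_L2 0 1 cdphi)
   (_ : 0 <= 0 <= 1) (_ : 0 <= x <= 1).
  rewrite z0 !subr0 => H; apply: (le_trans (H _ _)); [by rewrite lexx ler01|by rewrite !ltW|].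
  by rewrite gtr0_norm// ler_piMl ?intL_sqr_ge0// ltW.
rewrite /H1_norm (_ : 2 * c = c + c); last by ring.
by rewrite EFinD leeD// L2_norm_le//; exact: cont_L2.
Qed.

(** The identity is exact: the cell averages of the bump are partial sums of [h w], so summation by
    parts turns the Laplacian into slopes, while the weak derivative of [z] meets the derivative of
    the bump, a combination of edge kernels. *)
Lemma bump_pairing (a : nat -> R) (z : H1 0 1) :
  distribution_of 0 1 (const_ext N (laplacian_h N a)) bump_fun
   - distr_deriv (distr_deriv (distribution_of 0 1 z)) bump_fun =
  h * \sum_(i < N.+1) w i * (edge_lf k N i (wder z) - (a i.+1 - a i) / h).
Proof.
have Lz := W1_2_L2 z.
have p1 : distr_deriv (distr_deriv (distribution_of 0 1 z)) bump_fun =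
   - (h * \sum_(i < N.+1) w i * edge_lf k N i (wder z)).
  rewrite /distr_deriv opprK /distribution_of (@W1_wder _ _ _ _ z _ bump_test'); congr (- _).
  rewrite -/(intL _ 0 1) (derive1_fun bump_derive) mulr_sumr.
  have ik i : ible (fun x => ki i x * wder z x) 0 1 by exact: L2M_ible (cont_L2 0 1 (@cki i)) Lz.
  rewrite (@eq_Rint _ _ (fun x => \sum_(i < N.+1) h * w i * (ki i x * wder z x))) => [|x _]; last first.
   by rewrite /dphi mulr_sumr; apply: eq_bigr => i _; ring.
  rewrite intL_sum => [|i _]; last by apply: ibleZ; exact: ik.
  apply: eq_bigr => i _; rewrite intLZ// -mulrA; congr (_ * (_ * _)).
  have iN : (i <= N)%N := ltn_ord i; have [a0 ab b _] := edge_in iN; have ab' := le_trans ab b.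
  rewrite (intL_cat a0 ab' (ik i)) (intL_cat ab b (ible_sub a0 (lexx 1) (ik i))).
  rewrite (@eq_Rint _ _ (fun=> 0) 0) => [|x /andP[_ x2]]; last by rewrite /ki edge_kernel_left ?mul0r// ltW.
  rewrite (@eq_Rint _ _ (fun=> 0) (mid N i + h / 4) 1) => [|x /andP[x2 _]]; last by rewrite /ki edge_kernel_right ?mul0r// ltW.
  by rewrite !intL_cst// !mul0r add0r addr0.
rewrite p1 opprK; pose l := laplacian_h N a; pose b j := h * \sum_(i < N.+1) (i < j)%:R * w i.
have bE j : (j < N)%N -> cavg N j.+1 bump_fun = b j.+1.
  move=> jN; have [a0 ab b1 _] := @cell_in R N j jN.
  rewrite /cavg /bump_fun intL_sum => [|i _]; last by apply: ibleZ; exact: cont_ible _ _ (@cSi i).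
  rewrite mulr_suml /b mulr_sumr; apply: eq_bigr => i _.
  rewrite intLZ; last exact: cont_ible _ _ (@cSi i).
  by rewrite -mulrA -/(cavg N j.+1 (Si i)) cavg_Si ?(ltn_ord i : (i <= N)%N)//; ring.
have p2 : distribution_of 0 1 (const_ext N l) bump_fun = h * \sum_(j < N) l j.+1 * b j.+1.
  rewrite /distribution_of -/(intL _ 0 1) /const_ext.
  have ic j : ible (fun x => \1_(`[(j%:R - 1/2) * h, (j%:R + 1/2) * h[%classic) x * bump_fun x) 0 1.
   apply: L2M_ible (cont_L2 0 1 cbump); apply: (@L2_bounded _ _ _ _ 1) => [|x _].
   by apply: measurable_indic; exact: measurable_itv.
   by rewrite indicE; case: (_ \in _); rewrite ?normr1 ?normr0.
  rewrite (@eq_Rint _ _ (fun x => \sum_(1 <= j < N.+1) l j * (\1_(`[(j%:R - 1/2) * h, (j%:R + 1/2) * h[%classic) x * bump_fun x))) => [|x _]; last first.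
   by rewrite mulr_suml; apply: eq_bigr => j _; rewrite mulrA.
  rewrite intL_sum => [|j _]; last by apply: ibleZ; exact: ic.
  rewrite big_add1/= big_mkord mulr_sumr; apply: eq_bigr => j _; have jN := ltn_ord j.
  rewrite intLZ// mulrCA -bE//; congr (_ * _).
  have [a0 ab b1 E] := @cell_in R N j jN; have a1 := le_trans ab b1.
  rewrite (intL_cat a0 a1 (ic j.+1)) (intL_cat ab b1 (ible_sub a0 (lexx 1) (ic j.+1))).
  rewrite (@eq_Rint _ _ (fun=> 0) 0) => [|x /andP[_ x2]]; last first.
   by rewrite indicE memNset ?mul0r//= in_itv/= leNgt x2.
  rewrite (@eq_Rint _ _ (fun=> 0) ((j.+1%:R + 1/2) * h) 1) => [|x /andP[x2 _]]; last first.
   by rewrite indicE memNset ?mul0r//= in_itv/= [x < _]ltNge (ltW x2) andbF.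
  rewrite !intL_cst// ?mul0r ?add0r ?addr0; rewrite /cavg mulrCA mulfV// mulr1.
  apply: eq_Rint => x /andP[x1 x2].
  have xm : x \in (`[(j.+1%:R - 1/2) * h, (j.+1%:R + 1/2) * h[%classic : set R) by rewrite inE/= in_itv/= (ltW x1) x2.
  by rewrite indicE xm mul1r.
have bS j : b j.+1 = b j + h * (if (j < N.+1)%N then w j else 0).
  rewrite /b -mulrDr; congr (_ * _); case: ifPn => jN; last first.
   rewrite addr0; apply: eq_bigr => i _; rewrite -leqNgt in jN.
   by rewrite ltnS (leq_trans (ltn_ord i) jN) (leq_trans (ltnW (ltn_ord i)) jN).
  rewrite (bigD1 (Ordinal jN))//= ltnSn mul1r [in RHS](bigD1 (Ordinal jN))//= ltnn mul0r add0r addrC.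
  congr (_ + _); apply: eq_bigr => i ij; congr (_%:R * _).
  rewrite ltnS leq_eqVlt; have -> : (i == j :> nat) = false by apply/negbTE; move: ij; rewrite -val_eqE.
  by [].
have b00 : b 0%N = 0 by rewrite /b big1 ?mulr0// => i _; rewrite mul0r.
have bN : b N.+1 = 0.
  by rewrite /b (eq_bigr (fun i : 'I_N.+1 => w i)) ?w0 ?mulr0// => i _; rewrite ltn_ord mul1r.
have p3 : \sum_(j < N) l j.+1 * b j.+1 = - \sum_(i < N.+1) w i * ((a i.+1 - a i) / h).
  have lE j : l j.+1 = ((a j.+2 - a j.+1) / h - (a j.+1 - a j) / h) / h.
   by rewrite /l /laplacian_h/=; field.
  pose s j := (a j.+1 - a j) / h.
  have H n : (n <= N)%N -> \sum_(j < n) l j.+1 * b j.+1 = s n * b n.+1 / h - \sum_(i < n.+1) w i * s i.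
   elim: n => [|n IH] nN.
   by rewrite big_ord0 big_ord_recr big_ord0/= add0r bS b00/= add0r; field.
   rewrite big_ord_recr/= (IH (ltnW nN)) [in RHS]big_ord_recr/= (bS n.+1) ltnS nN lE -/(s n.+1) -/(s n).
   by move: (\sum_(_ < _) _) => Q; field.
  by rewrite H// bN mulr0 mul0r sub0r.
rewrite p2 p3 mulrN addrC -mulrBr -sumrB; congr (_ * _); apply: eq_bigr => i _; ring.
Qed.

End bumps.

(** Duality with the optimal weights, [th] minus its mean, normalised. The mean has to be removed
    because test functions vanish at both ends: the dual norm sees slopes up to a constant only. *)
Lemma Hm1_norm_edges (a : nat -> R) (z : H1 0 1) (d : R) : 0 <= d ->
  (Hm1_norm 0 1 (distribution_of 0 1 (const_ext N (laplacian_h N a))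
   \- distr_deriv (distr_deriv (distribution_of 0 1 z)))%R <= d%:E)%E ->
  forall th : nat -> R, (forall i, th i = edge_lf k N i (wder z) - (a i.+1 - a i) / h) ->
  h * \sum_(i < N.+1) (th i - h * \sum_(j < N.+1) th j) ^+ 2 <= (2 * B * d) ^+ 2.
Proof.
move=> d0 H th thE; pose mean := h * \sum_(j < N.+1) th j; pose w i := th i - mean.
have w0 : \sum_(i < N.+1) w i = 0.
  rewrite /w sumrB sumr_const card_ord -mulr_natl /mean mulrA /mesh mulfV ?pnatr_eq0// mul1r.
  by apply/eqP; rewrite subr_eq0.
pose q := h * \sum_(i < N.+1) w i ^+ 2.
have q0 : 0 <= q by apply: mulr_ge0; [exact: ltW|apply: sumr_ge0 => i _; exact: sqr_ge0].
change (q <= (2 * B * d) ^+ 2).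
have [qz|qn] := eqVneq q 0; first by rewrite qz sqr_ge0.
have qp : 0 < q by rewrite lt_neqAle eq_sym qn.
have sq : 0 < Num.sqrt q by rewrite sqrtr_gt0.
have s2 : Num.sqrt q ^+ 2 = q by rewrite sqr_sqrtr.
(* Normalisation giving the bump and its derivative an L2 norm of at most [1/2] each, [H1_norm]
   being their sum. *)
pose s := 2 * B * Num.sqrt q; have sp : 0 < s by rewrite !mulr_gt0.
have sn : s != 0 := lt0r_neq0 sp; have Bn : B != 0 := lt0r_neq0 B0.
pose w' i := w i / s.
have w'0 : \sum_(i < N.+1) w' i = 0 by rewrite -mulr_suml w0 mul0r.
have n2 : edge_norm2 w' = q / s ^+ 2.
  rewrite /edge_norm2 /q -mulrA mulr_suml; congr (_ * _); apply: eq_bigr => i _.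
  by rewrite /w' exprMn exprVn.
have nb : B ^+ 2 * edge_norm2 w' <= (1/2) ^+ 2.
  rewrite n2 le_eqVlt; apply/orP; left; apply/eqP; rewrite -[q in LHS]s2 /s; field.
  by rewrite Bn lt0r_neq0.
have half0 : 0 <= 1/2 :> R by lra.
have h1 := bump_H1 half0 nb; have bt := bump_test w'0.
have P : distribution_of 0 1 (const_ext N (laplacian_h N a)) (bump_fun w')
   - distr_deriv (distr_deriv (distribution_of 0 1 z)) (bump_fun w') = h * \sum_(i < N.+1) w' i * th i.
  by rewrite bump_pairing//; congr (_ * _); apply: eq_bigr => i _; rewrite thE.
have pw : h * \sum_(i < N.+1) w' i * th i = Num.sqrt q / (2 * B).
  have -> : \sum_(i < N.+1) w' i * th i = \sum_(i < N.+1) (w' i * w i) + \sum_(i < N.+1) w' i * mean.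
   by rewrite -big_split/=; apply: eq_bigr => i _; rewrite /w; ring.
  rewrite -mulr_suml w'0 mul0r addr0.
  have -> : \sum_(i < N.+1) w' i * w i = (\sum_(i < N.+1) w i ^+ 2) / s.
   by rewrite mulr_suml; apply: eq_bigr => i _; rewrite /w'; ring.
  rewrite mulrA -/q -[q in LHS]s2 /s; field.
  by rewrite Bn lt0r_neq0.
have le1 : `|h * \sum_(i < N.+1) w' i * th i| <= d.
  rewrite -lee_fin; apply: le_trans H; apply: ereal_sup_ubound.
  exists (bump_fun w'); last by rewrite /= P.
  by split=> //; apply: le_trans h1 _; rewrite lee_fin; lra.
have main : Num.sqrt q <= 2 * B * d.
  move: le1; rewrite pw ger0_norm; last by rewrite divr_ge0 ?sqrtr_ge0// mulr_ge0// ltW.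
  by rewrite ler_pdivrMr ?mulr_gt0//; lra.
by rewrite -s2 lerXn2r ?nnegrE ?sqrtr_ge0// !mulr_ge0// ltW.
Qed.

End test_functions.
End dual_norm.

(** * Boundary data and observations against the smoothed reference *)

Section matching.
Context {R : realType}.

Lemma cont_zero_int (D : R -> R) a b : a < b -> continuous D ->
  (forall s t, a <= s -> s <= t -> t <= b -> intL D s t = 0) -> forall x, a <= x <= b -> D x = 0.
Proof.
move=> ab cD H x /andP[ax xb]; apply/eqP; rewrite -normr_le0; apply: ger0_ge_eps => e e0; rewrite add0r.
have [d d0 Hd] := @heine_dist R D a b e cD e0.
pose d' := Num.min d (b - a) / 2.
have d'0 : 0 < d' by rewrite divr_gt0// lt_min d0 subr_gt0.
have dd' : 2 * d' <= d by rewrite /d' mulrC divfK ?pnatr_eq0// ge_min lexx.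
have dba : 2 * d' <= b - a by rewrite /d' mulrC divfK ?pnatr_eq0// ge_min lexx orbT.
have [s [t [as_ st tb near]]] : exists s t, [/\ a <= s, s < t, t <= b & forall y, s < y < t -> `|x - y| < d].
  have [xb'|xb'] := leP (x + d') b; [exists x, (x + d')|exists (x - d'), x]; split; try lra;
   by move=> y /andP[? ?]; rewrite ltr_norml; lra.
have E : intL (fun y => D x - D y) s t = D x * (t - s).
  by rewrite (intLB (ible_cst _ _ _) (cont_ible _ _ cD)) (H _ _ as_ (ltW st) tb) subr0 intL_cst// ltW.
have ib : ible (fun y => D x - D y) s t := ibleB (ible_cst _ _ _) (cont_ible _ _ cD).
have := intL_norm ib; rewrite E normrM (gtr0_norm (x := t - s)) ?subr_gt0// => le1.
have le2 : intL (fun y => `|D x - D y|) s t <= e * (t - s).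
  have -> : e * (t - s) = intL (fun=> e) s t by rewrite intL_cst// ltW.
  apply: intL_le; [exact: ible_norm|exact: ible_cst|].
  by move=> y /andP[sy yt]; apply: Hd; [rewrite ax xb|lra|apply: near; rewrite sy yt].
by have := le_trans le1 le2; rewrite ler_pM2r// subr_gt0.
Qed.

(** [semidiscrete_solution] prescribes boundary values only; this transfers the equality to the
    continuous derivatives that the records carry. *)
Lemma H2_deriv_eq (a b : R) (u v : H2 a b) : a < b -> (forall x, a <= x <= b -> u x = v x) ->
  forall x, a <= x <= b -> dH2 u x = dH2 v x.
Proof.
move=> ab uv x xI; have cu := clamp_cont (ltW ab) (@W1_cont _ _ _ _ (dH2 u)).
have cv := clamp_cont (ltW ab) (@W1_cont _ _ _ _ (dH2 v)).
have := @cont_zero_int (fun x => dH2 u (clamp a b x) - dH2 v (clamp a b x)) a b ab (contB cu cv) _ x xI.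
rewrite (clamp_id xI) => H; apply/eqP; rewrite -subr_eq0; apply/eqP; apply: H => s t as_ st tb.
have [iu Hu] := H2_abs_cont u ab; have [iv Hv] := H2_abs_cont v ab.
rewrite (@eq_Rint _ _ (fun x => dH2 u x - dH2 v x)) => [|z /andP[? ?]]; last by rewrite !clamp_id//; lra.
rewrite intLB -?Hu -?Hv//; try exact: ible_sub iu; try exact: ible_sub iv.
by rewrite !uv ?subrr//; lra.
Qed.

(** The Steklov approximations of [w] are built from the zero function, hence vanish; their
    convergence to [w] forces its norm to be 0. *)
Lemma null_primitive (w : R -> R) T L : abs_cont (fun=> 0) w 0 T -> L2 w 0 T -> 0 <= L -> L < T ->
  intL (fun t => w t ^+ 2) 0 L = 0.
Proof.
move=> aw Lw L0 LT; apply/eqP; rewrite eq_le intL_sqr_ge0 andbT.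
apply: ger0_ge_eps => d d0; rewrite add0r.
have [e [e0 _ H]] := steklov_L2 (@contC R 0) aw Lw L0 LT d0.
have := H e; rewrite e0 lexx => /(_ isT); rewrite (_ : dq e _ = fun=> 0).
  rewrite (_ : avg e (fun=> 0) = fun=> 0); last by apply/funext => t; exact: avg_cst.
  rewrite (_ : avg e (fun=> 0) = fun=> 0); last by apply/funext => t; exact: avg_cst.
  by rewrite (@eq_Rint _ _ (fun t => w t ^+ 2)) => // t _; rewrite subr0.
by apply/funext => t; rewrite /dq subrr mul0r.
Qed.

Lemma H2_second_eq (T L : R) (u v : H2 0 T) : 0 <= L -> L < T -> (forall x, 0 <= x <= T -> u x = v x) ->
  intL (fun t => (ddH2 u t - ddH2 v t) ^+ 2) 0 L = 0.
Proof.
move=> L0 LT uv; have T0 : 0 < T := le_lt_trans L0 LT.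
have [iu Hu] := H1_abs_cont (dH2 u) T0; have [iv Hv] := H1_abs_cont (dH2 v) T0.
apply: (@null_primitive _ T) => //; last exact: L2B (W1_2_L2 _) (W1_2_L2 _).
split; first exact: ibleB.
move=> s t s0 st tT; rewrite intLB -?Hu -?Hv//; try exact: ible_sub iu; try exact: ible_sub iv.
by rewrite !(H2_deriv_eq T0 uv) ?subrr//; lra.
Qed.

Lemma H2_clamp_abs_cont (T : R) (u : H2 0 T) : 0 < T ->
  [/\ continuous (fun t => u (clamp 0 T t)), continuous (fun t => dH2 u (clamp 0 T t)),
   abs_cont (fun t => u (clamp 0 T t)) (fun t => dH2 u (clamp 0 T t)) 0 T &
   abs_cont (fun t => dH2 u (clamp 0 T t)) (ddH2 u) 0 T].
Proof.
move=> T0; have cd := clamp_cont (ltW T0) (@W1_cont _ _ _ _ (dH2 u)).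
have cu := clamp_cont (ltW T0) (@H2_cont _ _ _ u).
have [iu Hu] := H2_abs_cont u T0; have [id_ Hd] := H1_abs_cont (dH2 u) T0.
split=> //; split=> //; first exact: cont_ible.
  move=> s t s0 st tT; rewrite !clamp_id ?Hu//; try lra.
  by apply: eq_Rint => x /andP[? ?]; rewrite clamp_id//; lra.
by move=> s t s0 st tT; rewrite !clamp_id ?Hd//; lra.
Qed.

Lemma dq2_avg_boundary e (f f1 : R -> R) T t : 0 < e -> continuous f -> continuous f1 -> abs_cont f f1 0 T ->
  0 <= t -> t + 3 * e <= T -> dq e (dq e (avg e f)) t = avg e (avg e (dq e f1)) t.
Proof.
move=> e0 cf cf1 af t0 tT.
have E s : 0 <= s -> s + 2 * e <= T -> dq e (avg e f) s = avg e (avg e f1) s.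
  move=> s0 sT; rewrite -(avg_dq e e cf); apply: eq_avg => //; first exact: dq_cont.
   exact: avg_cont.
  by move=> x /andP[? ?]; apply: (dq_eq_avg e0 cf1 af); lra.
rewrite (avg_dq e e cf1) (avg_dq e e (avg_cont e cf1)) {1}/dq [in RHS]/dq !E//; lra.
Qed.

Lemma H1_value_le T (f df : R -> R) d t : 1 < T -> 0 <= d -> abs_cont f df 0 T -> L2 f 0 T -> L2 df 0 T ->
  intL (fun x => f x ^+ 2) 0 T <= d ^+ 2 -> intL (fun x => df x ^+ 2) 0 T <= d ^+ 2 -> 0 <= t <= T ->
  `|f t| <= 2 * (1 + T) * d.
Proof.
move=> T1 d0 af Lf Ld h1 h2 tI; have T0 : 0 < T by lra.
have := abs_cont_sup T0 af Lf Ld tI; rewrite subr0 => H.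
have T20 : 0 <= 2 * T ^+ 2 by rewrite mulr_ge0 ?sqr_ge0.
have h3 := ler_wpM2l T20 h2.
have p0 : 0 <= 2 * (1 + T) * d by rewrite !mulr_ge0//; lra.
rewrite -(ler_pXn2r (n := 2)) ?nnegrE// sqr_normr//.
have f0 := sqr_ge0 (f t); have q : f t ^+ 2 <= T * f t ^+ 2 by rewrite ler_peMl// ltW.
have dd := sqr_ge0 d; rewrite !exprMn.
have : 0 <= T * d ^+ 2 by rewrite mulr_ge0// ltW.
have : 0 <= T ^+ 2 * d ^+ 2 by rewrite mulr_ge0// sqr_ge0.
by move: h1 h3 q H; rewrite !expr2; lra.
Qed.

Let sq4 (A B C D a : R) : A <= 0 -> B <= (a / 4) ^+ 2 -> C <= (a / 4) ^+ 2 -> D <= (a / 4) ^+ 2 ->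
  2 * (2 * A + 2 * B) + 2 * (2 * C + 2 * D) <= a ^+ 2.
Proof. by move=> h1 h2 h3 h4; have := sqr_ge0 a; move: h2 h3 h4; rewrite !expr2; lra. Qed.

Let combine4 (X P Q A B C D a : R) : X <= 2 * P + 2 * Q -> P <= 2 * A + 2 * B -> Q <= 2 * C + 2 * D ->
  A <= 0 -> B <= (a / 4) ^+ 2 -> C <= (a / 4) ^+ 2 -> D <= (a / 4) ^+ 2 -> X <= a ^+ 2.
Proof. by move=> h1 h2 h3 h4 h5 h6 h7; have := sq4 h4 h5 h6 h7; lra. Qed.

Let combine3 (X Q B C D a : R) : X <= 2 * B + 2 * Q -> Q <= 2 * C + 2 * D ->
  B <= (a / 4) ^+ 2 -> C <= (a / 4) ^+ 2 -> D <= (a / 4) ^+ 2 -> X <= a ^+ 2.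
Proof. by move=> h1 h3 h5 h6 h7; have := sq4 (lexx 0) h5 h6 h7; have := sqr_ge0 (a / 4); lra. Qed.

Let split3 (b w x y : R) : b - y = (b - w) + ((w - x) + (x - y)).
Proof. by ring. Qed.

Let split4 (b a w x y : R) : b - y = ((b - a) + (a - w)) + ((w - x) + (x - y)).
Proof. by ring. Qed.

Let dist4 (z g a b u v d : R) : `|z - g| <= u -> u <= d / 4 -> `|g - a| <= d / 4 -> `|a - b| <= v -> v <= d / 4 ->
  `|z - b| <= d.
Proof. by rewrite !ler_norml => /andP[? ?] ? /andP[? ?] /andP[? ?] ?; split_lra. Qed.

Let sup_sqr_le (v : R -> R) T L d : 0 <= L -> L < T -> L2 v 0 L ->
  (forall t, 0 <= t <= L -> `|v t| <= d / (25 * (1 + T))) -> intL (fun t => v t ^+ 2) 0 L <= (d / 4) ^+ 2.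
Proof.
move=> L0 LT Lv H; have T1 : 0 < 1 + T by lra.
have Tn := lt0r_neq0 T1; have := H 0; rewrite lexx L0 => /(_ isT)/(le_trans (normr_ge0 _)) d0.
have {}d0 : 0 <= d by move: d0; rewrite pmulr_lge0// invr_gt0 mulr_gt0.
apply: (@le_trans _ _ (intL (fun=> (d / (25 * (1 + T))) ^+ 2) 0 L)).
  apply: intL_le; [exact: Lv.2|exact: ible_cst|] => t /andP[t0 tL].
  have tI : 0 <= t <= L by rewrite !ltW.
  have b := H t tI.
  by rewrite -sqr_normr lerXn2r ?nnegrE// (le_trans _ b).
rewrite intL_cst// subr0 (_ : _ * L = (d / 25) ^+ 2 * (L / (1 + T) ^+ 2)); last by field.
apply: (@le_trans _ _ ((d / 25) ^+ 2)); last by apply: lerXn2r; rewrite ?nnegrE; lra.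
rewrite ler_piMr ?sqr_ge0// ler_pdivrMr ?exprn_gt0// mul1r.
by have := sqr_ge0 T; rewrite !expr2; lra.
Qed.

(** A chain of comparisons: component of the solution, discrete datum, limit datum [gb], its
    smoothing, smoothing of [Yb]. The first link is an equality of values, the second the
    convergence of the data, the third asks for a small [e], the last for a [c] small with respect
    to [e]. *)
Lemma boundary_match (T L d : R) (gb : H2 0 T) : 1 < T -> 0 <= L -> L < T -> 0 < d ->
  exists e0, [/\ 0 < e0, L + 3 * e0 <= T & forall e, 0 < e <= e0 -> exists2 c, 0 < c &
   forall (z zb : H2 0 T) (Yb : R -> R), continuous Yb -> (forall t, 0 <= t <= T -> z t = zb t) ->
   (H2_dist zb gb <= c%:E)%E -> (forall t, 0 <= t <= T -> `|Yb t - gb t| <= c) ->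
   [/\ intL (fun t => (ddH2 z t - dq e (dq e (avg e Yb)) t) ^+ 2) 0 L <= d ^+ 2,
   `|z 0 - avg3 e Yb 0| <= d & `|dH2 z 0 - dq e (avg e (avg e Yb)) 0| <= d]].
Proof.
move=> T1 L0 LT d0; have T0 : 0 < T by lra.
have [cg cg1 ag ag1] := H2_clamp_abs_cont gb T0.
have d40 : 0 < d / 4 by lra.
have [e1 [e10 e1T H1]] := steklov_L2 cg1 ag1 (W1_2_L2 (dH2 gb)) L0 LT (exprn_gt0 2 d40).
have [e2 [e20 e2T H2]] := avg3_near cg L0 LT d40.
have [e3 [e30 e3T H3]] := avg3_near cg1 L0 LT d40.
pose e0 := Num.min 1 (Num.min e1 (Num.min e2 e3)).
have [ea eb ec ed] : [/\ e0 <= 1, e0 <= e1, e0 <= e2 & e0 <= e3].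
  by rewrite /e0; split; rewrite !ge_min lexx ?orbT.
exists e0; split; [by rewrite !lt_min ltr01 e10 e20 e30|by lra|].
move=> e /andP[e_0 ee0].
have e_1 : e <= 1 by lra.
have eLT : L + 3 * e <= T by lra.
have en : e != 0 := lt0r_neq0 e_0.
have Tp : 0 < 1 + T by lra.
have Tn : 1 + T != 0 := lt0r_neq0 Tp.
(* Two quotients multiply a uniform error by [4 / e^2]: here [c] becomes [d / (25 (1 + T))], which
   [sup_sqr_le] turns into [(d / 4)^2]. *)
pose c := d * e ^+ 2 / (100 * (1 + T)).
have c0 : 0 < c by rewrite divr_gt0 ?mulr_gt0 ?exprn_gt0//; lra.
have c1 : 2 * (1 + T) * c <= d / 4.
  rewrite (_ : 2 * (1 + T) * c = d / 50 * e ^+ 2); last by rewrite /c; field.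
  apply: (@le_trans _ _ (d / 50)); last lra.
  rewrite -[leRHS]mulr1 ler_pM2l; first exact: (exprn_ile1 2 (ltW e_0) e_1).
  by lra.
have c2 : c <= d / 4.
  by apply: le_trans c1; rewrite ler_peMl ?ltW//; lra.
have c3 : 2 * c / e <= d / 4.
  have c6 : c * (1 + T) = d * e ^+ 2 / 100 by rewrite /c; field.
  have c7 : c <= c * (1 + T) by rewrite ler_peMr ?ltW//; lra.
  have c8 : d * e ^+ 2 <= d * e by rewrite ler_pM2l// expr2 -[leRHS]mul1r ler_pM2r.
  have c9 : 0 < d * e by rewrite mulr_gt0.
  by rewrite ler_pdivrMr//; lra.
have c4 : 2 * (2 * c / e) / e = d / (25 * (1 + T)) by rewrite /c; field; rewrite ?en ?Tn.
exists c => // z zb Yb cY zE D Yg.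
have az := H2_abs_cont zb T0; have ab := H2_abs_cont gb T0.
have adz := H1_abs_cont (dH2 zb) T0; have adb := H1_abs_cont (dH2 gb) T0.
have Lz := L2_cont (@H2_cont _ _ _ zb); have Lb := L2_cont (@H2_cont _ _ _ gb).
have Ldz := L2_cont (@W1_cont _ _ _ _ (dH2 zb)); have Ldb := L2_cont (@W1_cont _ _ _ _ (dH2 gb)).
have Lddz := W1_2_L2 (dH2 zb); have Lddb := W1_2_L2 (dH2 gb); have Lddz' := W1_2_L2 (dH2 z).
have [D0 D1 D2] := H2_norm_le (ltW c0) (L2B Lz Lb) (L2B Ldz Ldb) (L2B Lddz Lddb) D.
have T00 : 0 <= (0 : R) <= T by rewrite lexx ltW.
have V0 := H1_value_le T1 (ltW c0) (abs_contB az ab) (L2B Lz Lb) (L2B Ldz Ldb) D0 D1 T00.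
have V1 := H1_value_le T1 (ltW c0) (abs_contB adz adb) (L2B Ldz Ldb) (L2B Lddz Lddb) D1 D2 T00.
have cD := contB cg cY.
have DB s : 0 <= s <= L + 3 * e -> `|gb (clamp 0 T s) - Yb s| <= c.
  by move=> /andP[? ?]; have sI : 0 <= s <= T by [lra]; rewrite clamp_id// distrC Yg.
have cdY : continuous (dq e (dq e (avg e Yb))).
  by apply: dq_cont; apply: dq_cont; exact: avg_cont.
split.
- have P t : 0 < t < L -> ddH2 z t - dq e (dq e (avg e Yb)) t =
   ((ddH2 z t - ddH2 zb t) + (ddH2 zb t - ddH2 gb t)) +
   ((ddH2 gb t - avg e (avg e (dq e (fun t => dH2 gb (clamp 0 T t)))) t)
   + dq e (dq e (avg e (fun s => gb (clamp 0 T s) - Yb s))) t).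
   move=> /andP[? ?]; rewrite -(dq2_avg_boundary e_0 cg cg1 ag); [|lra|lra].
   rewrite (@avgB _ e _ _ cg cY) dqB dqB.
   exact: split4.
  rewrite (@eq_Rint _ _ (fun t => (((ddH2 z t - ddH2 zb t) + (ddH2 zb t - ddH2 gb t)) +
   ((ddH2 gb t - avg e (avg e (dq e (fun t => dH2 gb (clamp 0 T t)))) t)
   + dq e (dq e (avg e (fun s => gb (clamp 0 T s) - Yb s))) t)) ^+ 2)) => [|t tI]; last by rewrite P.
  have s0 v : L2 v 0 T -> L2 v 0 L by apply: L2_sub => //; exact: ltW.
  have LA := L2B (s0 _ Lddz') (s0 _ Lddz); have LB := L2B (s0 _ Lddz) (s0 _ Lddb).
  have LC := L2B (s0 _ Lddb) (cont_L2 0 L (avg_cont e (avg_cont e (dq_cont e cg1)))).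
  have LD := cont_L2 0 L (dq_cont e (dq_cont e (avg_cont e cD))).
  have I1 := intL_sqrD_le (L2D LA LB) (L2D LC LD); have I2 := intL_sqrD_le LA LB; have I3 := intL_sqrD_le LC LD.
  have zA : intL (fun t => (ddH2 z t - ddH2 zb t) ^+ 2) 0 L <= 0 by rewrite (H2_second_eq L0 LT zE).
  have zB : intL (fun t => (ddH2 zb t - ddH2 gb t) ^+ 2) 0 L <= (d / 4) ^+ 2.
   apply: (@le_trans _ _ (c ^+ 2)); last by rewrite lerXn2r// nnegrE ltW.
   apply: le_trans D2; apply: intL_sub_le => //; [exact: ltW|exact: (L2B Lddz Lddb).2|].
   by move=> x _; exact: sqr_ge0.
  have zC := H1 e _; rewrite e_0 (le_trans ee0 eb) in zC; have {}zC := zC isT.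
  have zD : intL (fun t => dq e (dq e (avg e (fun s => gb (clamp 0 T s) - Yb s))) t ^+ 2) 0 L <= (d / 4) ^+ 2.
   apply: (sup_sqr_le L0 LT LD) => t tI.
   by have [_ [b _]] := dq_sup_bounds e_0 cD DB tI; rewrite c4 in b.
  exact: combine4 I1 I2 I3 zA zB zC zD.
- have h0 : 0 <= (0 : R) <= L by rewrite lexx.
  have b1 := avg3_bound e_0 cD DB h0; have := H2 e _ 0 h0; rewrite e_0 (le_trans ee0 ec) => /(_ isT).
  rewrite clamp_id// zE//; move: b1; rewrite (@avgB _ e _ _ cg cY).
  rewrite (@avgB _ e _ _ (avg_cont e cg) (avg_cont e cY)).
  rewrite (@avgB _ e _ _ (avg_cont e (avg_cont e cg)) (avg_cont e (avg_cont e cY))).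
  by move=> b1 b2; exact: dist4 V0 c1 b2 b1 c2.
- have h0 : 0 <= (0 : R) <= L by rewrite lexx.
  have [b1 _] := dq_sup_bounds e_0 cD DB h0; have := H3 e _ 0 h0; rewrite e_0 (le_trans ee0 ed) => /(_ isT).
  rewrite -(first_dq_avg e_0 cg cg1 ag (lexx 0)); last lra.
  rewrite clamp_id// (H2_deriv_eq T0 zE)//; move: b1; rewrite (@avgB _ e _ _ cg cY).
  rewrite (@avgB _ e _ _ (avg_cont e cg) (avg_cont e cY)) dqB.
  by move=> b1 b2; exact: dist4 V1 c1 b2 b1 c3.
Qed.

(** As for the boundary data, but the flux is compared through one time derivative, so the uniform
    error is divided by [e] only once. *)
Lemma flux_match (T L d : R) (F : H1 0 T) : 1 < T -> 0 <= L -> L < T -> 0 < d ->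
  exists e0, [/\ 0 < e0, L + 3 * e0 <= T & forall e, 0 < e <= e0 -> exists2 c, 0 < c &
   forall b Yb : R -> R, L2 b 0 T -> continuous Yb ->
   (L2_norm 0 T (b \- wder F)%R <= c%:E)%E -> (forall t, 0 <= t <= T -> `|Yb t - F t| <= c) ->
   intL (fun t => (b t - dq e (avg e (avg e Yb)) t) ^+ 2) 0 L <= d ^+ 2].
Proof.
move=> T1 L0 LT d0; have T0 : 0 < T by lra.
have cF := clamp_cont (ltW T0) (@W1_cont _ _ _ _ F).
have aF : abs_cont (fun t => F (clamp 0 T t)) (wder F) 0 T.
  have [iF HF] := H1_abs_cont F T0; split=> // s t s0 st tT; rewrite !clamp_id ?HF//; lra.
have d40 : 0 < d / 4 by lra.
have [e1 [e10 e1T H1]] := steklov_L2 cF aF (W1_2_L2 F) L0 LT (exprn_gt0 2 d40).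
exists e1; split=> // e /andP[e_0 ee]; have en : e != 0 := lt0r_neq0 e_0.
have Tp : 0 < 1 + T by lra.
have Tn : 1 + T != 0 := lt0r_neq0 Tp.
exists (Num.min (d / 4) (d * e / (50 * (1 + T)))).
  by rewrite lt_min d40 divr_gt0 ?mulr_gt0//; lra.
set c := Num.min _ _; have [c1 c2] : c <= d / 4 /\ c <= d * e / (50 * (1 + T)).
  by rewrite /c; split; rewrite ge_min lexx ?orbT.
have c0 : 0 < c by rewrite lt_min d40 divr_gt0 ?mulr_gt0//; lra.
move=> b Yb Lb cY D Yg; have LF := W1_2_L2 F; have cD := contB cF cY.
have DB s : 0 <= s <= L + 3 * e -> `|F (clamp 0 T s) - Yb s| <= c.
  by move=> /andP[? ?]; have sI : 0 <= s <= T by [lra]; rewrite clamp_id// distrC Yg.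
have P t : b t - dq e (avg e (avg e Yb)) t = (b t - wder F t) +
   ((wder F t - avg e (avg e (dq e (fun t => F (clamp 0 T t)))) t)
   + dq e (avg e (avg e (fun s => F (clamp 0 T s) - Yb s))) t).
  rewrite (avg_dq e e cF) (avg_dq e e (avg_cont e cF)).
  rewrite (@avgB _ e _ _ cF cY) (@avgB _ e _ _ (avg_cont e cF) (avg_cont e cY)) dqB.
  exact: split3.
rewrite (@eq_Rint _ _ (fun t => ((b t - wder F t) +
   ((wder F t - avg e (avg e (dq e (fun t => F (clamp 0 T t)))) t)
   + dq e (avg e (avg e (fun s => F (clamp 0 T s) - Yb s))) t)) ^+ 2)) => [|t _]; last by rewrite P.
have s0 v : L2 v 0 T -> L2 v 0 L by apply: L2_sub => //; exact: ltW.
have LB := L2B (s0 _ Lb) (s0 _ LF).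
have LC := L2B (s0 _ LF) (cont_L2 0 L (avg_cont e (avg_cont e (dq_cont e cF)))).
have LD := cont_L2 0 L (dq_cont e (avg_cont e (avg_cont e cD))).
have I1 := intL_sqrD_le LB (L2D LC LD); have I3 := intL_sqrD_le LC LD.
have zB : intL (fun t => (b t - wder F t) ^+ 2) 0 L <= (d / 4) ^+ 2.
  apply: (@le_trans _ _ (c ^+ 2)); last by rewrite lerXn2r// nnegrE ltW.
  apply: (@le_trans _ _ (intL (fun t => (b t - wder F t) ^+ 2) 0 T)).
   apply: intL_sub_le => //; [exact: ltW|exact: (L2B Lb LF).2|by move=> x _; exact: sqr_ge0].
  by rewrite -(L2_norm_le (ltW c0) (L2B Lb LF)).
have zC := H1 e _; rewrite e_0 ee in zC; have {}zC := zC isT.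
have zD : intL (fun t => dq e (avg e (avg e (fun s => F (clamp 0 T s) - Yb s))) t ^+ 2) 0 L <= (d / 4) ^+ 2.
  have eLT : L + 3 * e <= T by lra.
  apply: (sup_sqr_le L0 LT LD) => t tI; have [bb _] := dq_sup_bounds e_0 cD DB tI.
  apply: (le_trans bb); rewrite ler_pdivrMr// (_ : d / (25 * (1 + T)) * e = 2 * (d * e / (50 * (1 + T)))); last by field.
  by rewrite ler_pM2l.
exact: combine3 I1 I3 zB zC zD.
Qed.

(** Two time quotients multiply the variation [c] of the reference function along an edge by
    [4 / e^2]; the sum over the [N + 1] edges, multiplied by [h], is a mean. *)
Lemma jumps_match N T L e (F Y : nat -> R -> R) (c d : R) : 0 < e -> 0 <= L -> L + 3 * e <= T -> 0 <= c ->
  (forall j, (j <= N.+1)%N -> L2 (F j) 0 T) -> (forall j, (j <= N.+1)%N -> continuous (Y j)) ->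
  (forall i t, (i <= N)%N -> 0 <= t <= T -> `|Y i.+1 t - Y i t| <= c) ->
  mesh N * \sum_(i < N.+1) intL (fun t => (F i.+1 t - F i t) ^+ 2) 0 T <= d ^+ 2 ->
  mesh N * \sum_(i < N.+1) intL (fun t => ((F i.+1 t - dq e (dq e (avg e (Y i.+1))) t)
   - (F i t - dq e (dq e (avg e (Y i))) t)) ^+ 2) 0 L <= 2 * d ^+ 2 + 2 * ((2 * (2 * c / e) / e) ^+ 2 * L).
Proof.
move=> e0 L0 LT c0 LF cY Yc H; set b := 2 * (2 * c / e) / e.
have h0 : 0 < mesh N :> R := mesh_gt0 _.
have LT' : L <= T by lra.
have B i : (i <= N)%N -> intL (fun t => ((F i.+1 t - dq e (dq e (avg e (Y i.+1))) t)
   - (F i t - dq e (dq e (avg e (Y i))) t)) ^+ 2) 0 L <=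
   2 * intL (fun t => (F i.+1 t - F i t) ^+ 2) 0 T + 2 * (b ^+ 2 * L).
  move=> iN; have c1 := cY i.+1 iN; have c2 := cY i (leqW iN).
  have L1 := LF i.+1 iN; have L2' := LF i (leqW iN); have LB := L2B L1 L2'.
  have cD := contB c1 c2; have cdd := dq_cont e (dq_cont e (avg_cont e cD)).
  rewrite (@eq_Rint _ _ (fun t => ((F i.+1 t - F i t) - dq e (dq e (avg e (fun t => Y i.+1 t - Y i t))) t) ^+ 2)) => [|t _]; last first.
   rewrite (@avgB _ e _ _ c1 c2) dqB dqB; move: (dq e _ t) (dq e _ t) => x y; congr (_ ^+ 2); ring.
  apply: (le_trans (intL_sqrB_le (L2_sub (lexx 0) LT' LB) (cont_L2 0 L cdd))).
  apply: lerD; rewrite ler_pM2l//.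
   by apply: intL_sub_le => //; [exact: LB.2|move=> x _; exact: sqr_ge0].
  have -> : b ^+ 2 * L = b ^+ 2 * (L - 0) by rewrite subr0.
  rewrite -intL_cst//; apply: intL_le; [exact: (cont_L2 0 L cdd).2|exact: ible_cst|].
  move=> t /andP[t0 tL]; have tI : 0 <= t <= L by rewrite !ltW.
  have DB s : 0 <= s <= L + 3 * e -> `|Y i.+1 s - Y i s| <= c by move=> ?; apply: Yc => //; lra.
  have [_ [bb _]] := dq_sup_bounds e0 cD DB tI.
  by rewrite -sqr_normr// lerXn2r ?nnegrE// (le_trans _ bb).
have := ler_sum (P := xpredT) (index_enum 'I_N.+1) (fun (i : 'I_N.+1) _ => B i (ltn_ord i)).
rewrite big_split/= -mulr_sumr sumr_const card_ord => S.
apply: (le_trans (ler_wpM2l (ltW h0) S)); rewrite mulrDr; apply: lerD.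
  by rewrite mulrCA ler_pM2l.
have E X : mesh N * (X *+ N.+1) = X :> R.
  by rewrite mulrnAr -mulrnAl -mulr_natr /mesh mulVf ?pnatr_eq0// mul1r.
by rewrite E.
Qed.

End matching.

(** * Discrete Poincare inequality and slopes *)

Section discrete_sums.
Context {R : realType}.

(** Termwise [|x| <= x^2 / (2 d) + d / 2], together with [n h <= 1]. *)
Lemma sum_abs_le N n k (v : nat -> R) d : 0 < d -> (n <= N.+1)%N -> (k <= n)%N ->
  mesh N * \sum_(i < n) v i ^+ 2 <= d ^+ 2 -> mesh N * \sum_(i < k) `|v i| <= d.
Proof.
move=> d0 nN kn H; have h0 : 0 < mesh N :> R := mesh_gt0 _.
have S1 : \sum_(i < k) `|v i| <= \sum_(i < n) `|v i|.
  by rewrite -(subnKC kn) big_split_ord/= lerDl sumr_ge0.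
have S2 : \sum_(i < n) `|v i| <= \sum_(i < n) (v i ^+ 2 / (2 * d) + d / 2).
  apply: ler_sum => i _; rewrite -sqr_normr//; move: (`|v i|) => x.
  rewrite -subr_ge0 (_ : _ - x = (x - d) ^+ 2 / (2 * d)); last by field; exact: lt0r_neq0.
  by rewrite divr_ge0 ?sqr_ge0// mulr_ge0// ltW.
have S3 : mesh N * \sum_(i < n) (v i ^+ 2 / (2 * d) + d / 2) <= d.
  rewrite big_split/= -mulr_suml sumr_const card_ord mulrDr mulrA -[_ *+ n]mulr_natr.
  have nh : mesh N * n%:R <= 1 :> R.
   by rewrite mulrC ler_pdivrMr ?ltr0n// mul1r ler_nat.
  have p1 : mesh N * (\sum_(i < n) v i ^+ 2) / (2 * d) <= d / 2.
   rewrite ler_pdivrMr ?mulr_gt0//; apply: (le_trans H); rewrite le_eqVlt; apply/orP; left.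
   by apply/eqP; field.
  have p2 : mesh N * (d / 2 * n%:R) <= d / 2.
   by rewrite mulrCA ler_piMr// divr_ge0// ltW.
  by lra.
by apply: le_trans S3; rewrite ler_pM2l//; exact: le_trans S1 S2.
Qed.

Lemma telescope (a : nat -> R) k : \sum_(i < k) (a i.+1 - a i) = a k - a 0%N.
Proof. by elim: k => [|k IH]; rewrite ?big_ord0 ?subrr// big_ord_recr/= IH; ring. Qed.

Lemma grid_value_le N (a : nat -> R) d j : 0 < d -> (j <= N.+1)%N ->
  mesh N * \sum_(i < N.+1) ((a i.+1 - a i) / mesh N) ^+ 2 <= d ^+ 2 -> `|a j - a 0%N| <= d.
Proof.
move=> d0 jN H; have h0 : 0 < mesh N :> R := mesh_gt0 _; have hn := lt0r_neq0 h0.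
have := @sum_abs_le N N.+1 j (fun i => (a i.+1 - a i) / mesh N) d d0 (leqnn _) jN H.
apply: le_trans; rewrite -telescope mulr_sumr; apply: (le_trans (ler_norm_sum _ _ _)).
apply: ler_sum => i _; rewrite normrM (gtr0_norm (x := (mesh N)^-1)) ?invr_gt0//.
by rewrite mulrCA mulfV// mulr1.
Qed.

(** The slopes vary by at most [d]; their mean is the difference of the boundary values, at most
    [2 d], so the first slope is at most [3 d], every slope [4 d] and every value [5 d]. *)
Lemma discrete_poincare N (a : nat -> R) d : 0 < d -> `|a 0%N| <= d -> `|a N.+1| <= d ->
  l2 N (laplacian_h N a) <= d -> forall j, (j <= N.+1)%N -> `|a j| <= 5 * d.
Proof.
move=> d0 a0 aN Ha j jN; have h0 : 0 < mesh N :> R := mesh_gt0 _; have hn := lt0r_neq0 h0.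
pose s i := (a i.+1 - a i) / mesh N.
have Hs : mesh N * \sum_(i < N) laplacian_h N a i.+1 ^+ 2 <= d ^+ 2.
  by rewrite -l2_sqr lerXn2r ?nnegrE ?l2_ge0// ltW.
have sk k : (k <= N)%N -> `|s k - s 0%N| <= d.
  move=> kN; have := @sum_abs_le N N k (fun i => laplacian_h N a i.+1) d d0 (leqnSn _) kN Hs.
  apply: le_trans; rewrite -(telescope s) mulr_sumr; apply: (le_trans (ler_norm_sum _ _ _)).
  apply: ler_sum => i _; rewrite -[X in X * `|_|](gtr0_norm h0) -normrM; rewrite le_eqVlt; apply/orP; left.
  by apply/eqP; congr (`|_|); rewrite /s /laplacian_h/=; field.
have Ss k : mesh N * \sum_(i < k) s i = a k - a 0%N.
  by rewrite -telescope mulr_sumr; apply: eq_bigr => i _; rewrite /s; field.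
have s0 : `|s 0%N| <= 3 * d.
  have E : mesh N * \sum_(i < N.+1) s 0%N = s 0%N.
   by rewrite sumr_const card_ord -mulr_natr mulrCA /mesh mulVf ?pnatr_eq0// mulr1.
  have := Ss N.+1; have : `|mesh N * \sum_(i < N.+1) s i - s 0%N| <= d.
   have -> : mesh N * \sum_(i < N.+1) s i - s 0%N = mesh N * \sum_(i < N.+1) (s i - s 0%N) by rewrite sumrB mulrBr E.
   rewrite normrM (gtr0_norm h0).
   apply: (@le_trans _ _ (mesh N * \sum_(i < N.+1) d)).
   rewrite ler_pM2l//; apply: (le_trans (ler_norm_sum _ _ _)); apply: ler_sum => i _.
   by apply: sk; rewrite -ltnS.
   by rewrite sumr_const card_ord -mulr_natr mulrCA /mesh mulVf ?pnatr_eq0// mulr1.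
  move=> h1 h2; rewrite h2 in h1; move: h1 a0 aN.
  by norm_lra.
have sk4 k : (k <= N)%N -> `|s k| <= 4 * d.
  move=> /sk; move: s0; norm_lra.
have : `|a j - a 0%N| <= 4 * d.
  rewrite -Ss normrM (gtr0_norm h0).
  apply: (@le_trans _ _ (mesh N * \sum_(i < j) 4 * d)).
   rewrite ler_pM2l//; apply: (le_trans (ler_norm_sum _ _ _)); apply: ler_sum => i _.
   by apply: sk4; rewrite -ltnS (leq_trans (ltn_ord i)).
  rewrite sumr_const card_ord -[_ *+ j]mulr_natr mulrCA -[leRHS]mulr1 ler_pM2l//; last lra.
  by rewrite mulrC ler_pdivrMr ?ltr0n// mul1r ler_nat.
by move: a0; norm_lra.
Qed.

Let slope_arith (t Bt d X1 r m : R) : 0 <= d -> X1 <= (2 * Bt) ^+ 2 -> 0 <= Bt <= d / 20 ->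
  r <= 4 * Bt ^+ 2 + 2 * (d / 20) ^+ 2 -> m <= 2 * r + 8 * t ^+ 2 -> 0 <= t <= d / 20 ->
  3 * X1 + 3 * m + 3 * r <= d ^+ 2.
Proof.
move=> d0 h1 /andP[b0 b1] h2 h3 /andP[t0 t1].
have q1 : Bt ^+ 2 <= (d / 20) ^+ 2 by apply: lerXn2r; rewrite ?nnegrE//; lra.
have q2 : t ^+ 2 <= (d / 20) ^+ 2 by apply: lerXn2r; rewrite ?nnegrE//; lra.
have q3 : (d / 20) ^+ 2 = d ^+ 2 / 400 by field.
have q4 := sqr_ge0 d; rewrite exprMn in h1; rewrite q3 in q1 q2 h2.
have e4 : (2 : R) ^+ 2 = 4 by ring.
by rewrite e4 in h1; lra.
Qed.

Let sq_split (u w v : R) : w ^+ 2 <= v -> (u + w) ^+ 2 <= 2 * u ^+ 2 + 2 * v.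
Proof. by have := sqr_ge0 (u - w); rewrite !expr2; lra. Qed.

(** Let [s] be the slope of [b] and [m] the mean of [th]. Then [r = th + s] and [th - m] are small,
    and the mean of [s], which is [b_(N+1) - b_0], is small too; hence so is [m], and
    [s = r - (th - m) - m]. *)
Lemma slopes_of_edges N (th b r1 r2 : nat -> R) (Bt c d : R) : 0 <= d -> 0 <= Bt <= d / 20 -> 0 <= c <= d / 20 ->
  mesh N * \sum_(i < N.+1) (th i - mesh N * \sum_(j < N.+1) th j) ^+ 2 <= (2 * Bt) ^+ 2 ->
  (forall i, (i <= N)%N -> th i + (b i.+1 - b i) / mesh N = r1 i + r2 i) ->
  (forall i, (i <= N)%N -> `|r2 i| <= d / 20) ->
  mesh N * \sum_(i < N.+1) r1 i ^+ 2 <= 2 * Bt ^+ 2 -> `|b 0%N| <= c -> `|b N.+1| <= c ->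
  mesh N * \sum_(i < N.+1) ((b i.+1 - b i) / mesh N) ^+ 2 <= d ^+ 2.
Proof.
move=> d0 bb cc TH rE r2le r1le b0 bN; have h0 : 0 < mesh N :> R := mesh_gt0 _; have hn := lt0r_neq0 h0.
have one X : mesh N * \sum_(i < N.+1) X = X :> R.
  by rewrite sumr_const card_ord mulrnAr -mulrnAl -mulr_natr /mesh mulVf ?pnatr_eq0// mul1r.
have [s sE] : exists s, s = fun i => (b i.+1 - b i) / mesh N by eexists.
have [r rrE] : exists r, r = fun i => th i + s i by eexists.
have [m mD] : exists m, m = mesh N * \sum_(j < N.+1) th j by eexists.
have [rr rrD] : exists rr, rr = mesh N * \sum_(i < N.+1) r i ^+ 2 by eexists.
have [mu muD] : exists mu, mu = mesh N * \sum_(i < N.+1) r i by eexists.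
rewrite -mD in TH.
have rrle : rr <= 4 * Bt ^+ 2 + 2 * (d / 20) ^+ 2.
  apply: (@le_trans _ _ (mesh N * \sum_(i < N.+1) (2 * r1 i ^+ 2 + 2 * (d / 20) ^+ 2))).
   rewrite rrD ler_pM2l//; apply: ler_sum => i _.
   have iN : (i <= N)%N by rewrite -ltnS.
   have -> : r i = r1 i + r2 i by rewrite rrE sE -rE.
   have q := r2le i iN; apply: sq_split.
   by rewrite -sqr_normr//; apply: lerXn2r => //; rewrite nnegrE (le_trans _ q).
  rewrite big_split/= mulrDr one -mulr_sumr mulrCA lerD2r.
  apply: (@le_trans _ _ (2 * (2 * Bt ^+ 2))); first by rewrite ler_pM2l.
  by rewrite mulrA -natrM.
have bE : b N.+1 - b 0%N = mesh N * \sum_(i < N.+1) s i.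
  rewrite -telescope mulr_sumr; apply: eq_bigr => i _; rewrite sE.
  by rewrite mulrCA mulfV// mulr1.
have mE : m = mu - (b N.+1 - b 0%N).
  rewrite bE mD muD -mulrBr -sumrB; congr (_ * _); apply: eq_bigr => i _.
  by rewrite rrE addrK.
have mr : mu ^+ 2 <= rr.
  have : 0 <= mesh N * \sum_(i < N.+1) (r i - mu) ^+ 2.
   by apply: mulr_ge0; [exact: ltW|apply: sumr_ge0 => i _; exact: sqr_ge0].
  have -> : \sum_(i < N.+1) (r i - mu) ^+ 2 = \sum_(i < N.+1) r i ^+ 2 - 2 * mu * \sum_(i < N.+1) r i + \sum_(i < N.+1) mu ^+ 2.
   by rewrite mulr_sumr -sumrB -big_split/=; apply: eq_bigr => i _; ring.
  rewrite mulrDr one mulrBr -rrD mulrCA -muD; move: rr mu {rrD muD mE rrle} => X Y.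
  by rewrite expr2; lra.
have m2 : m ^+ 2 <= 2 * rr + 8 * c ^+ 2.
  rewrite mE.
  have q : (b N.+1 - b 0%N) ^+ 2 <= (2 * c) ^+ 2.
   have /andP[c0 _] := cc.
   rewrite -sqr_normr//; apply: lerXn2r; rewrite ?nnegrE//; first by rewrite mulr_ge0.
   by move: b0 bN; norm_lra.
  move: q mr; move: (b N.+1 - b 0%N) => w; clear; move=> q mr.
  have := sqr_ge0 (mu + w); move: q mr; rewrite !expr2; lra.
apply: le_trans (slope_arith d0 TH bb rrle m2 cc).
rewrite (_ : \sum_(i < N.+1) ((b i.+1 - b i) / mesh N) ^+ 2 = \sum_(i < N.+1) s i ^+ 2); last by rewrite sE.
rewrite rrD -{1}(one (m ^+ 2)) (mulrCA 3) (mulrCA 3) (mulrCA 3) -!mulrDr ler_pM2l//.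
rewrite -!big_split/= mulr_sumr; apply: ler_sum => i _.
have -> : s i = r i - (th i - m) - m by rewrite rrE; ring.
move: (th i - m) (r i) => x w; clear.
have := sqr_ge0 (w + x); have := sqr_ge0 (w + m); have := sqr_ge0 (x - m); rewrite !expr2; lra.
Qed.

Lemma avg3_cst_sub e c (f : R -> R) t : 0 < e -> continuous f ->
  avg3 e (fun s => c - f s) t = c - avg3 e f t.
Proof.
move=> e0 cf; have E : avg e (fun=> c) = fun=> c by apply/funext => s; exact: avg_cst.
rewrite (@avgB _ e _ _ (@contC R c) cf) E (@avgB _ e _ _ (@contC R c) (avg_cont e cf)) E.
by rewrite (@avgB _ e _ _ (@contC R c) (avg_cont e (avg_cont e cf))) E.
Qed.

Lemma l2_avg3 N e (v : nat -> R -> R) c : 0 < e -> (forall i, (i < N)%N -> continuous (v i.+1)) ->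
  (forall t, 0 <= t <= 3 * e -> l2 N (v^~ t) <= c) ->
  l2 N (fun j => avg3 e (v j) 0) <= c.
Proof.
move=> e0 cv H; have z0 (x : R) : 0 <= x -> 0 <= (0 : R) <= x by rewrite lexx.
have H1 t : 0 <= t <= e + e -> l2 N (fun j => avg e (v j) t) <= c.
  by apply: l2_avg => // s sI; apply: H; lra.
have H2 t : 0 <= t <= e -> l2 N (fun j => avg e (avg e (v j)) t) <= c.
  by apply: (@l2_avg R N e (fun j => avg e (v j))) => // i iN; apply: avg_cont; exact: cv.
apply: (@l2_avg R N e (fun j => avg e (avg e (v j))) c 0 0) => //.
- by move=> i iN; do 2 apply: avg_cont; exact: cv.
- by move=> t; rewrite add0r; exact: H2.
- exact: z0.
Qed.

End discrete_sums.

(** * Initial values of the error *)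

Section initial_data.
Context {R : realType}.
Variables (T : R) (p : R -> R) (g : R -> R -> R) (g0 g1 y0 y1 : R -> R)
  (y : wave_solution T p g g0 g1 y0 y1).
Hypothesis T0 : 0 < T.
Let T0' : 0 <= T := ltW T0.

Lemma L2cont_initial (F : R -> R -> R) d : L2cont T F -> 0 < d ->
  exists2 e0, 0 < e0 & forall e, 0 < e <= e0 -> forall t, 0 <= t <= 3 * e ->
   intL (fun x => (F 0 x - F (clamp 0 T t) x) ^+ 2) 0 1 <= d ^+ 2.
Proof.
move=> [_ cF] d0; have z0 : 0 <= (0 : R) <= T by rewrite lexx.
have [c c0 H] := cF 0 z0 d d0; exists (Num.min (T / 3) (c / 4)).
  by rewrite lt_min !divr_gt0.
move=> e /andP[e0]; rewrite le_min => /andP[eT ec] t /andP[t0 te].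
have tT : t <= T by lra.
rewrite clamp_id ?t0// (@eq_Rint _ _ (fun x => (F t x - F 0 x) ^+ 2)) => [|x _]; last first.
  by rewrite -sqrrN opprB.
by apply: H; rewrite ?t0// sub0r normrN ger0_norm//; lra.
Qed.

Let laplacianB N (a b : nat -> R) j :
  laplacian_h N (fun j => a j - b j) j = laplacian_h N a j - laplacian_h N b j.
Proof. by rewrite /laplacian_h; ring. Qed.

Let init_arith (X lapa lapM ca cc cz av P c : R) : X = lapa - lapM -> ca = cc - cz -> cc = lapa -> c = cz ->
  av = c - P -> P = lapM -> X = ca + av.
Proof. by move=> -> -> -> -> -> ->; ring. Qed.

(** The Laplacian of [Yz] consists of cell averages of [y_xx], whose continuity in time removes the
    triple mean at 0; what is left is the L2 convergence of the discrete Laplacians. *)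
Lemma init_laplacian (z0 : H2 0 1) d : (forall x, 0 <= x <= 1 -> sol y 0 x = z0 x) -> 0 < d ->
  exists2 e0, 0 < e0 & forall e, 0 < e <= e0 -> forall N (a : nat -> R),
   (L2_norm 0 1 (const_ext N (laplacian_h N a) \- ddH2 z0)%R <= (d / 2)%:E)%E ->
   l2 N (laplacian_h N (fun j => a j - avg3 e (Yz y N j) 0)) <= d.
Proof.
move=> yz d0; have d20 : 0 < d / 2 by rewrite divr_gt0.
have [e0 e00 H] := L2cont_initial (ddsol_L2cont y) d20.
exists e0 => // e eI N a Ha; have /andP[e_0 _] := eI.
pose F i t := cavg N i (ddH2 (sol y (clamp 0 T t))).
pose c i := cavg N i (ddH2 (sol y 0)).
have cF i : (i < N)%N -> continuous (F i.+1).
  by move=> iN; exact: (cavg_continuous T0 iN (ddsol_L2cont y)).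
have L0 : L2 (ddH2 (sol y 0)) 0 1 := W1_2_L2 _.
have LF t : L2 (ddH2 (sol y (clamp 0 T t))) 0 1 := W1_2_L2 _.
have Lz : L2 (ddH2 z0) 0 1 := W1_2_L2 _.
have Lc := const_ext_L2 N (laplacian_h N a) 0 1.
have cE i : (i < N)%N -> c i.+1 = cavg N i.+1 (ddH2 z0).
  move=> iN; have [a0 ab b1 _] := @cell_in R N i iN; rewrite /c /cavg; congr (_ / _).
  have [_ H1] := H1_abs_cont (dH2 (sol y 0)) ltr01; have [_ H2] := H1_abs_cont (dH2 z0) ltr01.
  have E := H2_deriv_eq ltr01 yz.
  rewrite -(H1 _ _ a0 ab b1) -(H2 _ _ a0 ab b1) !E//.
   by rewrite a0 (le_trans ab b1).
  by rewrite b1 (le_trans a0 ab).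
have E i : (i < N)%N -> laplacian_h N (fun j => a j - avg3 e (Yz y N j) 0) i.+1 =
   cavg N i.+1 (fun x => const_ext N (laplacian_h N a) x - ddH2 z0 x)
   + avg3 e (fun s => c i.+1 - F i.+1 s) 0.
  move=> iN; have cYj j ji := @Yz_cont _ _ _ _ _ _ _ _ y T0 N i j iN ji.
  have [_ E1] := @avg3_laplacian R N e (Yz y N) i 0 cYj.
  have E2 : (fun s => laplacian_h N ((Yz y N)^~ s) i.+1) = F i.+1.
   by apply/funext => s; exact: laplacian_Yz.
  rewrite E2 in E1.
  have e1 := cavgB iN (L2_ible Lc) (L2_ible Lz).
  exact: (init_arith (laplacianB _ _ _ _) e1 (cavg_const_ext _ iN) (cE i iN) (avg3_cst_sub (c i.+1) 0 e_0 (cF i iN)) E1).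
pose W j := cavg N j (fun x => const_ext N (laplacian_h N a) x - ddH2 z0 x)
   + avg3 e (fun s => c j - F j s) 0.
apply: (@le_trans _ _ (l2 N W)).
  by rewrite le_eqVlt; apply/orP; left; apply/eqP; exact: eq_l2.
apply: (le_trans (l2D _ _ _)); have -> : d = d / 2 + d / 2 by field.
apply: lerD.
  apply: cavg_l2; [exact: L2B|exact: ltW|].
  by rewrite -(L2_norm_le (ltW d20) (L2B Lc Lz)).
apply: (@l2_avg3 _ N e (fun i s => c i - F i s)) => // [i iN|t tI].
  by apply: contB; [exact: contC|exact: cF].
rewrite (@eq_l2 _ N _ (fun j => cavg N j (fun x => ddH2 (sol y 0) x - ddH2 (sol y (clamp 0 T t)) x))) => [|i iN]; last first.
  by rewrite (cavgB iN (L2_ible L0) (L2_ible (LF t))).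
by apply: cavg_l2; [exact: L2B|exact: ltW|exact: (H e eI t tI)].
Qed.

Lemma Yz_slope e N i t : 0 < e -> (i <= N)%N ->
  (dq e (avg e (avg e (Yz y N i.+1))) t - dq e (avg e (avg e (Yz y N i))) t) / mesh N =
  dq e (avg e (avg e (fun s => dH2 (sol y (clamp 0 T s)) (midpt N i)))) t.
Proof.
move=> e0 iN; have c1 : continuous (Yz y N i.+1) by apply: Yz_continuous.
have c2 : continuous (Yz y N i) by apply: Yz_continuous => //; exact: leqW.
have cm : continuous (fun s => dH2 (sol y (clamp 0 T s)) (midpt N i)).
  by apply: dsol_continuous => //; exact: midpt_in.
have E : Yz y N i.+1 = fun s => Yz y N i s + mesh N * dH2 (sol y (clamp 0 T s)) (midpt N i).
  by apply/funext => s; rewrite /Yz big_ord_recr/= mulrDr addrA.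
have cm' : continuous (fun s => mesh N * dH2 (sol y (clamp 0 T s)) (midpt N i)) := contM (@contC R _) cm.
rewrite E (@avgD _ e _ _ c2 cm') (@avgD _ e _ _ (avg_cont e c2) (avg_cont e cm')) dqD.
rewrite (@avgZ _ e _ _ cm) (@avgZ _ e _ _ (avg_cont e cm)) dqZ addrC addKr.
by rewrite mulrC mulKf// lt0r_neq0// mesh_gt0.
Qed.

Variables (K : R) (K0 : 0 <= K) (HK : wave_bound y K).
Variables (S k : R -> R) (B : R).
Hypotheses (sS : smooth S) (dS : forall x, is_derive x (1 : R) S (k x)) (ck : continuous k) (B0 : 0 < B).
Hypotheses (kB : forall x, `|k x| <= B) (S0 : forall x, x <= 0 -> S x = 0 /\ k x = 0)
  (S1 : forall x, 1/4 <= x -> S x = 1 /\ k x = 0) (IS : intg S 0 1 = 1).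

(** A substitute for [y_x] at the midpoint for which a time derivative is available: the edge
    functional of the space derivative of [y_t]. *)
Let kappa N i t := edge_lf k N i (dH2 (sol y (clamp 0 T t))).

Lemma edge_lf_dsol N i t : (i <= N)%N ->
  `|edge_lf k N i (dH2 (sol y (clamp 0 T t))) - dH2 (sol y (clamp 0 T t)) (midpt N i)| <= B * (K * sqm N).
Proof.
move=> iN; have h0 : 0 < mesh N :> R := mesh_gt0 _; have hn := lt0r_neq0 h0.
have bk := @edge_bker R k B ck B0 kB N i iN.
have [a0 ab b1 _] := @edge_in R N i iN.
have LF : L2 (dH2 (sol y (clamp 0 T t))) 0 1 by exact: L2_cont (@W1_cont _ _ _ _ _).
set c := dH2 _ (midpt N i).
rewrite -[X in _ - X](@edge_lf_cst R S k dS ck S0 S1 N i c iN) /edge_lf -(lfB bk LF (L2_cst _ _ _)) /lf.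
have LD := L2B LF (L2_cst c 0 1).
apply: (le_trans (intL_norm (lf_ible bk LD))).
have s0 : 0 <= K * sqm N by rewrite mulr_ge0// sqrtr_ge0.
apply: (@le_trans _ _ (intL (fun=> B / mesh N * (K * sqm N)) (midpt N i) (midpt N i + mesh N / 4))).
  apply: intL_le; [exact: ible_norm (lf_ible bk LD)|exact: ible_cst|].
  move=> x xI; have [_ _ _ _ [_ Hk]] := bk; rewrite normrM; apply: ler_pM => //; first exact: Hk.
  have /andP[x1 x2] := xI; apply: (dsol_holder K0 HK); first exact: clamp_in.
  - by split_lra.
  - by split_lra.
  - by rewrite ger0_norm; lra.
rewrite intL_cst// (_ : B / mesh N * _ * _ = B * (K * sqm N) / 4); last by field.
have : 0 <= B * (K * sqm N) by rewrite mulr_ge0// ltW.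
by lra.
Qed.

Let slope_split (A a1 a0 D1 D0 h Q x : R) : (D1 - D0) / h = Q ->
  A - (a1 - a0) / h + ((a1 - D1) - (a0 - D0)) / h = A - x + (x - Q).
Proof. by move=> <-; ring. Qed.

(** Convergence in the dual norm gives the slopes of [a] through edge functionals of the derivative
    of [y_t(0)], up to a mean which the two boundary values restore. The slopes of the smoothed
    reference are quotients of [y_x] at midpoints: passing to [kappa] costs [2 B K sqrt h / e]
    ([r2]), and continuity in time at 0 removes the means ([r1]). *)
Lemma init_slopes d : 0 < d -> exists2 c, 0 < c & exists2 e0, 0 < e0 & forall e, 0 < e <= e0 -> 3 * e <= T ->
  forall N (a : nat -> R), 2 * (B * (K * sqm N)) / e <= d / 20 ->
  (Hm1_norm 0 1 (distribution_of 0 1 (const_ext N (laplacian_h N a))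
   \- distr_deriv (distr_deriv (distribution_of 0 1 y1)))%R <= c%:E)%E ->
  let b j := a j - dq e (avg e (avg e (Yz y N j))) 0 in `|b 0%N| <= c -> `|b N.+1| <= c ->
  mesh N * \sum_(i < N.+1) ((b i.+1 - b i) / mesh N) ^+ 2 <= d ^+ 2.
Proof.
move=> d0; pose c := d / (20 * (1 + B)).
have B0' := B0.
have B1 : 0 < 1 + B by rewrite addr_gt0.
have c0 : 0 < c by rewrite divr_gt0// mulr_gt0.
have Bc : B * c <= d / 20.
  rewrite (_ : d / 20 = (1 + B) * c); last by rewrite /c; field; exact: lt0r_neq0.
  by rewrite ler_pM2r//; lra.
have cd : c <= d / 20.
  rewrite (_ : d / 20 = (1 + B) * c); last by rewrite /c; field; exact: lt0r_neq0.
  by rewrite ler_peMl ?ltW//; lra.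
exists c => //; have [e0 e00 H] := L2cont_initial (dsol_t_L2cont y) c0.
exists e0 => // e eI eT N a eta HH b b0 bN; have /andP[e_0 _] := eI.
have h0 : 0 < mesh N :> R := mesh_gt0 _; have hn := lt0r_neq0 h0.
set z := sol_t y 0.
have HH' : (Hm1_norm 0 1 (distribution_of 0 1 (const_ext N (laplacian_h N a))
   \- distr_deriv (distr_deriv (distribution_of 0 1 z)))%R <= c%:E)%E.
  suff -> : distribution_of 0 1 z = distribution_of 0 1 y1 by [].
  apply/funext => phi; rewrite /distribution_of; apply: eq_Rint => x /andP[x0 x1].
  by rewrite /z sol_t_init// in_itv/= !ltW.
pose th i := edge_lf k N i (wder z) - (a i.+1 - a i) / mesh N.
have bb : 0 <= B * c <= d / 20 by apply/andP; split=> //; apply: mulr_ge0; exact: ltW.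
have cc : 0 <= c <= d / 20 by apply/andP; split=> //; exact: ltW.
have TH := @Hm1_norm_edges R S k B sS dS ck B0 kB S0 S1 IS N a z c (ltW c0) HH' th (fun=> erefl).
pose s i := (b i.+1 - b i) / mesh N.
pose r i := th i + s i.
pose G i t := edge_lf k N i (wder (sol_t y (clamp 0 T t))).
have LG t : L2 (wder (sol_t y t)) 0 1 := W1_2_L2 _.
have cm i : (i <= N)%N -> continuous (fun s => dH2 (sol y (clamp 0 T s)) (midpt N i)).
  by move=> iN; apply: dsol_continuous => //; exact: midpt_in.
have ckap i : (i <= N)%N -> continuous (kappa N i).
  by move=> iN; exact: (lf_cont T0' (@edge_bker R k B ck B0 kB N i iN) (dsol_L2cont y)).
have cG i : (i <= N)%N -> continuous (G i).
  by move=> iN; exact: (lf_cont T0' (@edge_bker R k B ck B0 kB N i iN) (dsol_t_L2cont y)).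
have aG i : (i <= N)%N -> abs_cont (kappa N i) (G i) 0 T.
  move=> iN; exact: (lf_abs_cont T0 (@edge_bker R k B ck B0 kB N i iN) (dsol_L2cont y) (dsol_t_L2cont y) (dsol_L2diff y)).
pose r1 i := avg3 e (fun s => edge_lf k N i (wder z) - G i s) 0.
pose r2 i := dq e (avg e (avg e (fun s => kappa N i s - dH2 (sol y (clamp 0 T s)) (midpt N i)))) 0.
have rE i : (i <= N)%N -> r i = r1 i + r2 i.
  move=> iN; have cmi := cm i iN; have cki := ckap i iN.
  rewrite /r1 (avg3_cst_sub _ _ e_0 (cG i iN)) -(first_dq_avg e_0 cki (cG i iN) (aG i iN) (lexx 0)) ?add0r//.
  rewrite /r2 (@avgB _ e _ _ cki cmi) (@avgB _ e _ _ (avg_cont e cki) (avg_cont e cmi)) dqB.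
  exact: (slope_split _ _ _ _ (Yz_slope 0 e_0 iN)).
have z0T : 0 <= (0 : R) <= 0 by rewrite lexx.
have r2le i : (i <= N)%N -> `|r2 i| <= d / 20.
  move=> iN; apply: le_trans eta.
  have DB s0 : 0 <= s0 <= 0 + 3 * e -> `|kappa N i s0 - dH2 (sol y (clamp 0 T s0)) (midpt N i)| <= B * (K * sqm N).
   by move=> _; exact: edge_lf_dsol.
  by have [] := dq_sup_bounds e_0 (contB (ckap i iN) (cm i iN)) DB z0T.
(* The [N + 1] edges are viewed as the interior nodes of the next finer grid, with indices shifted
   by one, so that [l2_avg3] applies; the two meshes differ by a factor of at most 2. *)
have h'0 : 0 < mesh N.+1 :> R := mesh_gt0 _.
have hh' : mesh N.+1 <= mesh N :> R by rewrite lef_pV2 ?posrE ?ltr0n// ler_nat.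
have h'h : mesh N <= 2 * mesh N.+1 :> R.
  rewrite /mesh -div1r ler_pdivrMr ?ltr0n// mulrAC ler_pdivlMr ?ltr0n// mul1r -natrM ler_nat.
  by rewrite ltn_Pmull.
have r1le : mesh N * \sum_(i < N.+1) r1 i ^+ 2 <= 2 * (B * c) ^+ 2.
  have Q : l2 N.+1 (fun j => avg3 e (fun s => edge_lf k N j.-1 (wder z) - G j.-1 s) 0) <= B * c.
   apply: (@l2_avg3 _ N.+1 e (fun j s => edge_lf k N j.-1 (wder z) - G j.-1 s)) => // [i iN|t tI].
   by apply: contB; [exact: contC|exact: cG].
   apply: l2_le; first by rewrite mulr_ge0 ?ltW.
   apply: (@le_trans _ _ (mesh N * \sum_(i < N.+1) edge_lf k N i (fun x => wder z x - wder (sol_t y (clamp 0 T t)) x) ^+ 2)).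
   rewrite (eq_bigr (fun i : 'I_N.+1 => edge_lf k N i (fun x => wder z x - wder (sol_t y (clamp 0 T t)) x) ^+ 2)).
   by apply: ler_wpM2r => //; apply: sumr_ge0 => i _; exact: sqr_ge0.
   move=> i _; congr (_ ^+ 2); rewrite /= /G /edge_lf.
   by rewrite (lfB (@edge_bker R k B ck B0 kB N i (ltn_ord i : (i <= N)%N)) (LG _) (LG _)).
   apply: (le_trans (@edge_lf_le R k B ck B0 kB N _ (L2B (LG _) (LG _)))).
   by rewrite exprMn ler_pM2l ?exprn_gt0//; exact: (H e eI t tI).
  have Q2 : l2 N.+1 (fun j => avg3 e (fun s => edge_lf k N j.-1 (wder z) - G j.-1 s) 0) ^+ 2 <= (B * c) ^+ 2.
   by apply: lerXn2r => //; rewrite nnegrE ?l2_ge0// mulr_ge0 ?ltW.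
  rewrite l2_sqr in Q2; apply: le_trans (_ : 2 * (mesh N.+1 * \sum_(i < N.+1) r1 i ^+ 2) <= _); last by rewrite ler_pM2l.
  by rewrite mulrA; apply: ler_wpM2r => //; apply: sumr_ge0 => i _; exact: sqr_ge0.
have TH' : mesh N * \sum_(i < N.+1) (th i - mesh N * \sum_(j < N.+1) th j) ^+ 2 <= (2 * (B * c)) ^+ 2.
  by rewrite [2 * (B * c)]mulrA.
exact: (slopes_of_edges (ltW d0) bb cc TH' rE r2le r1le b0 bN).
Qed.

End initial_data.

(** * The semi-discrete solution, its source and the truncation error *)

Section semidiscrete.
Context {R : realType}.
Local Notation leb := (@lebesgue_measure R).

Lemma is_derive_primc (f : R -> R) c t : continuous f ->
  is_derive t (1 : R) (fun s => c + (prim f s - prim f 0)) (f t).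
Proof.
move=> cf; have d2 : is_derive t (1 : R) (fun s => prim f s + (c - prim f 0)) (f t + 0).
  by apply: is_deriveD; exact: is_derive_prim.
by move: d2; rewrite addr0; congr is_derive; apply/funext => s; ring.
Qed.

(** The records live on [[0, T]] and satisfy the equation inside only. Integrating the acceleration
    given by the equation, clamped in time, from the initial values gives functions on the whole
    line, of class C2 at interior nodes; at boundary nodes the second derivative remains an L2
    representative. *)
Lemma semidiscrete_extension N (T : R) (q : nat -> R) (g : nat -> W11 0 T) (g0 g1 : R -> R) (y0 y1 : nat -> R)
   (Y : semidiscrete_solution N T q (fun j => g j : R -> R) g0 g1 y0 y1) : 0 < T ->
  exists U dU ddU : nat -> R -> R,
  [/\ forall j t, is_derive t (1 : R) (U j) (dU j t), forall j, continuous (dU j),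
   forall i, (i < N)%N -> continuous (ddU i.+1) /\ forall t, is_derive t (1 : R) (dU i.+1) (ddU i.+1 t),
   forall j t, 0 <= t <= T -> U j t = Y j t /\ dU j t = dH2 (Y j) t &
   (forall j t, 0 < t < T -> ddU j t = ddH2 (Y j) t) /\
   (forall i t, (i < N)%N -> 0 <= t <= T ->
   ddU i.+1 t - laplacian_h N (U^~ t) i.+1 + q i.+1 * U i.+1 t = g i.+1 (clamp 0 T t))].
Proof.
move=> T0; have T0' := ltW T0.
have cY j : continuous (fun t => Y j (clamp 0 T t)) := clamp_cont T0' (@H2_cont _ _ _ (Y j)).
have cdY j : continuous (fun t => dH2 (Y j) (clamp 0 T t)) := clamp_cont T0' (@W1_cont _ _ _ _ (dH2 (Y j))).
have cg j : continuous (fun t => g j (clamp 0 T t)) := clamp_cont T0' (@W1_cont _ _ _ _ (g j)).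
pose V j t := laplacian_h N (fun k => Y k (clamp 0 T t)) j - q j * Y j (clamp 0 T t) + g j (clamp 0 T t).
have cV j : continuous (V j).
  apply: contD => //; apply: contB; last by apply: contM => //; exact: contC.
  rewrite /laplacian_h; apply: contM; last exact: contC.
  by apply: contD => //; apply: contB => //; apply: contM => //; exact: contC.
pose I j := (0 < j <= N)%N.
pose dU j t := if I j then dH2 (Y j) 0 + (prim (V j) t - prim (V j) 0) else dH2 (Y j) (clamp 0 T t).
pose ddU j t := if I j then V j t else ddH2 (Y j) t.
have dV j t : is_derive t (1 : R) (fun s => dH2 (Y j) 0 + (prim (V j) s - prim (V j) 0)) (V j t).
  by apply: is_derive_primc.
have cdU j : continuous (dU j).
  rewrite /dU; case: (I j); last exact: cdY.
  by apply: derive_cont => t; exact: dV.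
pose U j t := Y j 0 + (prim (dU j) t - prim (dU j) 0).
have II i : (i < N)%N -> I i.+1 by move=> iN; rewrite /I.
have ddE j t : 0 < t < T -> ddU j t = ddH2 (Y j) t.
  move=> /andP[t0 tT]; rewrite /ddU; case: ifPn => // Ij.
  have tI : t \in `]0, T[ by rewrite in_itv/= t0.
  have tc : 0 <= t <= T by rewrite !ltW.
  have := solh_eq Y Ij tI; rewrite /V (clamp_id tc) => <-; ring.
have dE j t : 0 <= t <= T -> dU j t = dH2 (Y j) t.
  move=> tI; have /andP[t0 tT] := tI; rewrite /dU; case: ifPn => [Ij|_]; last by rewrite clamp_id.
  have [_ H] := H1_abs_cont (dH2 (Y j)) T0.
  rewrite -[RHS](addrNK (dH2 (Y j) 0)) (H _ _ (lexx 0) t0 tT) addrC; congr (_ + _).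
  rewrite -/(intg (V j) 0 t) -intL_intg//; apply: eq_Rint => x /andP[x0 xt].
  have xT : 0 < x < T by rewrite x0 (lt_le_trans xt).
  by have := ddE j x xT; rewrite /ddU Ij.
have UE j t : 0 <= t <= T -> U j t = Y j t.
  move=> tI; have /andP[t0 tT] := tI; have [_ H] := H2_abs_cont (Y j) T0.
  rewrite -[RHS](addrNK (Y j 0)) (H _ _ (lexx 0) t0 tT) addrC; congr (_ + _).
  rewrite -/(intg (dU j) 0 t) -intL_intg//; apply: eq_Rint => x /andP[x0 xt].
  by apply: dE; rewrite (ltW x0) (le_trans (ltW xt)).
exists U, dU, ddU; split=> //.
- by move=> j t; exact: is_derive_primc.
- move=> i iN; have e1 : ddU i.+1 = V i.+1 by apply/funext => t; rewrite /ddU II.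
  have e2 : dU i.+1 = fun s => dH2 (Y i.+1) 0 + (prim (V i.+1) s - prim (V i.+1) 0).
   by apply/funext => t; rewrite /dU II.
  by rewrite e1 e2; split=> [|t]; [exact: cV|exact: dV].
- by move=> j t tI; rewrite UE// dE.
- split=> // i t iN tI; rewrite /ddU II// /V.
  rewrite (_ : laplacian_h N (U^~ t) i.+1 = laplacian_h N (fun k => Y k (clamp 0 T t)) i.+1); last first.
   by rewrite /laplacian_h !UE// !clamp_id.
  by rewrite UE// (clamp_id tI); ring.
Qed.

(** The horizon [1 + kappa h] depends on the mesh; the bounds are proved once, on a fixed longer
    interval. *)
Lemma residual_bounds_sub N L' L m K0 Rb r d u du ddu Y rho (f q : nat -> R) : 0 <= L' -> L' <= L ->
  residual_bounds N L m K0 Rb r d u du ddu Y rho f q -> residual_bounds N L' m K0 Rb r d u du ddu Y rho f q.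
Proof.
move=> L0 LL [h1 h2 h3 h4 h5 h6 h7 h8 h9 [drho [h10 h10']] h11 h12 h13 h14 h15 h16 h17 h18 h19 h20 h21 h22 h23].
have tt t : 0 <= t <= L' -> 0 <= t <= L by move=> /andP[-> /le_trans]; apply.
have Ld j : (j <= N.+1)%N -> L2 (ddu j) 0 L by exact: h6.
have sub (v : R -> R) c : L2 v 0 L -> intL (fun t => v t ^+ 2) 0 L <= c -> intL (fun t => v t ^+ 2) 0 L' <= c.
  move=> Lv; apply: le_trans; apply: intL_sub_le => //; first exact: Lv.2.
  by move=> x _; exact: sqr_ge0.
split=> //.
- by move=> j jN; apply: abs_cont_sub (h5 j jN).
- by move=> j jN; apply: L2_sub (h6 j jN).
- by move=> i t iN /tt; exact: h7.
- by move=> t /tt; exact: h9.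
- exists drho; split=> [i iN|]; first by apply: abs_cont_sub (h10 i iN).
  apply: le_trans h10'; apply: intL_sub_le => //; last by move=> x _; exact: l2_ge0.
  by apply: l2_ible => i iN; have [] := h10 i iN.
- by move=> i t iN /tt; exact: h11.
- by move=> i s t iN /tt sL /tt; exact: h12.
- apply: sub h16; apply: cont_L2; apply: contM; last exact: contC.
  by apply: contB; apply: h2.
- by apply: sub h17; exact: Ld.
- by apply: sub h18; exact: Ld.
- apply: le_trans h19; rewrite ler_pM2l ?mesh_gt0//; apply: ler_sum => i _.
  by apply: sub (lexx _); apply: L2B; apply: Ld => //; rewrite ltnW// ltnS.
Qed.

Lemma L1L2_norm_clamp (T : R) N (w : nat -> R -> R) (G : R -> R -> R) : 0 < T ->
  L1L2_norm T (fun t => const_ext N (fun j => w j (clamp 0 T t)) \- G t) =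
  L1L2_norm T (fun t => const_ext N (fun j => w j t) \- G t).
Proof.
move=> T0; rewrite /L1L2_norm; apply: eq_integral => t; rewrite inE/= in_itv/= => /andP[t0 tT].
have tI : 0 <= t <= T by rewrite !ltW.
by rewrite (clamp_id tI).
Qed.

(** [G(t)] is bounded by [G(s)] plus the variation of [G]; integrating over [s] gives the bound, and
    a length [L >= 1] keeps the constant equal to 1. *)
Lemma sup_of_W11 N L (G dG : nat -> R -> R) a b : 1 <= L -> (forall i, (i < N)%N -> continuous (G i.+1)) ->
  (forall i, (i < N)%N -> abs_cont (G i.+1) (dG i.+1) 0 L) ->
  intL (fun t => l2 N (G^~ t)) 0 L <= a -> intL (fun t => l2 N (dG^~ t)) 0 L <= b ->
  forall t, 0 <= t <= L -> l2 N (G^~ t) <= a + b.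
Proof.
move=> L1 cG aG Ha Hb t /andP[t0 tL]; have L0 : 0 < L by lra.
have idG : ible (fun t => l2 N (dG^~ t)) 0 L by apply: l2_ible => i iN; have [] := aG i iN.
have step s s' : 0 <= s -> s <= s' -> s' <= L -> l2 N (fun j => intL (dG j) s s') <= b.
  move=> s0 ss sL; apply: le_trans Hb.
  have ii i : (i < N)%N -> ible (dG i.+1) s s' by move=> iN; apply: ible_sub (aG i iN).1.
  apply: (le_trans (@l2_intL R N dG s s' ii)).
  by apply: intL_sub_le => // x _; exact: l2_ge0.
have key s : 0 <= s <= L -> l2 N (G^~ t) <= l2 N (G^~ s) + b.
  move=> /andP[s0 sL]; have [st|ts] := leP s t.
   rewrite (@eq_l2 R N _ (fun j => G j s + intL (dG j) s t)) => [|i iN]; last first.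
   by rewrite -((aG i iN).2 _ _ s0 st tL); ring.
   by apply: (le_trans (l2D _ _ _)); rewrite lerD2l; exact: step.
  rewrite (@eq_l2 R N _ (fun j => G j s - intL (dG j) t s)) => [|i iN]; last first.
   by rewrite -((aG i iN).2 _ _ t0 (ltW ts) sL); ring.
  by apply: (le_trans (l2B _ _ _)); rewrite lerD2l; apply: step => //; exact: ltW.
have cl : continuous (fun t => l2 N (G^~ t)) by exact: l2_continuous.
have H : intL (fun=> l2 N (G^~ t)) 0 L <= intL (fun s => l2 N (G^~ s) + b) 0 L.
  apply: intL_le; [exact: ible_cst|exact: ibleD (cont_ible _ _ cl) (ible_cst _ _ _)|].
  by move=> s /andP[? ?]; apply: key; rewrite !ltW.
have q1 := intL_cst (l2 N (G^~ t)) (ltW L0); have q2 := intL_cst b (ltW L0).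
rewrite (intLD (cont_ible _ _ cl) (ible_cst _ _ _)) q1 q2 !subr0 in H.
have a0 : 0 <= a by apply: le_trans Ha; apply: intL_ge0 => x _; exact: l2_ge0.
rewrite -(ler_pM2r L0); apply: (le_trans H); rewrite mulrDl lerD2r; apply: (le_trans Ha).
by rewrite ler_peMr.
Qed.

(** [steklov_L1L2] is used twice, with the primitive of the source and with the source itself; this
    controls the difference and its time derivative, and [sup_of_W11] makes it uniform in time. *)
Lemma source_match (T L d : R) (gh : nat -> nat -> W11 0 T) (g : W11L2 T) : 1 <= L -> L < T -> 0 < d ->
  W11L2_norm T (fun t => const_ext N (fun j => gh N j t) \- g t)
   (fun t => const_ext N (fun j => wder (gh N j) t) \- W11L2_dt g t) @[N --> \oo] --> 0%E ->
  exists e0, [/\ 0 < e0, L + 3 * e0 <= T & forall e, 0 < e <= e0 -> \forall N \near \oo,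
   exists dG : nat -> R -> R, let G j t := gh N j (clamp 0 T t) - avg3 e (fun s => gh N j (clamp 0 T s)) t in
   [/\ forall i, (i < N)%N -> abs_cont (G i.+1) (dG i.+1) 0 L,
   forall t, 0 <= t <= L -> l2 N (G^~ t) <= d & intL (fun t => l2 N (dG^~ t)) 0 L <= d]].
Proof.
move=> L1 LT d0 Hg; have T0 : 0 < T by lra.
have L0 : 0 <= L by lra.
have d20 : 0 < d / 2 by rewrite divr_gt0.
have dd : d / 2 <= d by lra.
pose f N j t := gh N j (clamp 0 T t).
have cf N j : continuous (f N j) := clamp_cont (ltW T0) (@W1_cont _ _ _ _ (gh N j)).
have af N j : abs_cont (f N j) (wder (gh N j)) 0 T.
  have [i H] := W11_abs_cont (gh N j) T0; split=> // s t s0 st tT.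
  by rewrite /f !clamp_id ?H//; split_lra.
pose x1 N t := (const_ext N (fun j => gh N j t) \- g t)%R.
pose x2 N t := (const_ext N (fun j => wder (gh N j) t) \- W11L2_dt g t)%R.
have n1 (x : nat -> R -> R -> R) N : (0 <= L1L2_norm T (x N))%E.
  by apply: integral_ge0 => t _; exact: Lp_norm_ge0.
have c0 e : 0 < e -> \forall N \near \oo, (L1L2_norm T (x1 N) + L1L2_norm T (x2 N) <= e%:E)%E.
  by move=> e0; exact: (cvge0_near Hg e0).
have c1 : L1L2_norm T (fun t => const_ext N (fun j => f N j t) \- g t) @[N --> \oo] --> 0%E.
  apply: near_cvge0 => [N|e e0]; first exact: (n1 (fun N t => const_ext N (fun j => f N j t) \- g t)).
  apply: (@filterS nat (nbhs \oo) _ _ _ _ (c0 e e0)) => N HN.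
  have -> : L1L2_norm T (fun t => const_ext N (fun j => f N j t) \- g t)%R = L1L2_norm T (x1 N).
   exact: (@L1L2_norm_clamp T N (fun j => gh N j : R -> R) g T0).
  by apply: le_trans HN; rewrite leeDl//; exact: (n1 x2).
have c2 : L1L2_norm T (fun t => const_ext N (fun j => wder (gh N j) t) \- W11L2_dt g t) @[N --> \oo] --> 0%E.
  apply: near_cvge0 => [N|e e0]; first exact: (n1 x2).
  apply: (@filterS nat (nbhs \oo) _ _ _ _ (c0 e e0)) => N HN.
  by apply: le_trans HN; rewrite leeDr//; exact: (n1 x1).
have [e1 [e10 e1T H1]] := steklov_L1L2 L0 LT d20 (fun N j => continuous_prim (@cf N j))
  (fun N j => abs_cont_prim 0 T (@cf N j)) (W11L2_in g).1 c1.
have [e2 [e20 e2T H2]] := steklov_L1L2 L0 LT d20 cf af (W11L2_dt_in g).1 c2.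
pose e0 := Num.min e1 e2; have [le1 le2] : e0 <= e1 /\ e0 <= e2 by rewrite /e0 !ge_min !lexx orbT.
exists e0; split; [by rewrite lt_min e10|by lra|].
move=> e /andP[e_0 ee]; have eI1 : 0 < e <= e1 by rewrite e_0 (le_trans ee).
have eI2 : 0 < e <= e2 by rewrite e_0 (le_trans ee).
have eLT : L + 3 * e <= T by lra.
apply: (@filterS2 nat (nbhs \oo) _ _ _ _ _ (H1 e eI1) (H2 e eI2)) => N N1 N2.
pose G j t := gh N j (clamp 0 T t) - avg3 e (fun s => gh N j (clamp 0 T s)) t.
have aG i : (i < N)%N -> abs_cont (G i.+1) (fun t => wder (gh N i.+1) t - avg e (avg e (dq e (f N i.+1))) t) 0 L.
  move=> _; apply: abs_contB.
   by apply: abs_cont_sub (af N i.+1); rewrite ?lexx// ltW.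
  have cj := @cf N i.+1.
  rewrite (avg_dq e e cj) (avg_dq e e (avg_cont e cj)).
  apply: abs_cont_C1 => [t|]; first by apply: avg_derive; do 2 apply: avg_cont.
  by apply: dq_cont; do 2 apply: avg_cont.
exists (fun j t => wder (gh N j) t - avg e (avg e (dq e (f N j))) t).
split; [exact: aG| |exact: (le_trans N2 dd)].
move=> t tL; have -> : d = d / 2 + d / 2 by field.
apply: (@sup_of_W11 N L G _ (d / 2) (d / 2) L1 _ aG _ N2 t tL) => [i _|].
  by apply: contB; [exact: cf|do 3 apply: avg_cont; exact: cf].
move: N1; congr (_ <= _); apply: eq_Rint => s _; apply: eq_l2 => i _.
Qed.

Variables (T : R) (p : R -> R) (g : W11L2 T) (g0 g1 y0 y1 : R -> R)
  (y : wave_solution T p g g0 g1 y0 y1).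
Hypothesis T0 : 0 < T.
Variables (K : R) (K0 : 0 <= K) (HK : wave_bound y K).

(** At almost every time the equation of [y] turns the defect into cell averages of
    [(w - g) - (p_j - p) y], plus [p_j (cz - Yz)]. The first term gives [d] after integration in
    time; the other two give [K eta] and [2 m K sqrt h] at each time, hence the factor [T]. *)
Lemma truncation_bound N (w : nat -> R -> R) (pj : nat -> R) (pt : R -> R) (m eta d : R) : 0 <= m -> 0 <= eta -> 0 <= d ->
  (forall j, continuous (w j)) -> measurable_fun (`]0, 1[ : set R) pt -> (forall x, `|pt x| <= m) ->
  {ae leb, forall x, x \in `]0, 1[ -> p x = pt x} ->
  intL (fun x => (pt x - const_ext N pj x) ^+ 2) 0 1 <= eta ^+ 2 ->
  (forall i, (i < N)%N -> `|pj i.+1| <= m) ->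
  (L1L2_norm T (fun t => const_ext N (fun j => w j t) \- g t)%R <= d%:E)%E ->
  intL (fun s => l2 N (fun j => laplacian_h N (Yz y N ^~ s) j - cztt y N j s + w j s - pj j * Yz y N j s)) 0 T
   <= d + T * (K * eta + 2 * m * K * sqm N).
Proof.
move=> m0 eta0 d0 cw mp pm pe Heta pjm Hd.
pose X j s := laplacian_h N (Yz y N ^~ s) j - cztt y N j s + w j s - pj j * Yz y N j s.
pose A t := L2_norm 0 1 (const_ext N (fun j => w j t) \- g t)%R.
pose C := K * eta + 2 * m * K * sqm N.
have C0 : 0 <= C by rewrite addr_ge0// !mulr_ge0// sqrtr_ge0.
have cX i : (i < N)%N -> continuous (X i.+1).
  move=> iN; have cYj j ji := @Yz_cont _ _ _ _ _ _ _ _ y T0 N i j iN ji.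
  have [cl _] := @avg3_laplacian R N 1 (Yz y N) i 0 cYj.
  apply: contB; last by apply: contM; [exact: contC|exact: cYj].
  by apply: contD; [apply: contB => //; exact: cztt_continuous|exact: cw].
have mg : measurable_fun (`]0, T[ `*` `]0, 1[ : set (R * R)) (fun z => g z.1 z.2) := (W11L2_in g).1.
have key t : 0 < t < T -> {ae leb, forall x, x \in `]0, 1[ ->
   sol_tt y t x - ddH2 (sol y t) x + p x * sol y t x = g t x} ->
   ((l2 N (X^~ t))%:E <= A t + C%:E)%E.
  move=> /andP[t0 tT] He; have tI : 0 <= t <= T by rewrite !ltW.
  have [_ _ Hs] := HK tI.
  pose W x := ddH2 (sol y t) x - sol_tt y t x + const_ext N (fun j => w j t) x - const_ext N pj x * sol y t x.
  have Ld : L2 (ddH2 (sol y t)) 0 1 := W1_2_L2 _.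
  have Ltt : L2 (sol_tt y t) 0 1 by have [H _] := sol_tt_L2cont y; exact: H.
  have Ls : L2 (sol y t) 0 1 := L2_cont (@H2_cont _ _ _ _).
  have Lw : L2 (const_ext N (fun j => w j t)) 0 1 by exact: const_ext_L2.
  have cem (f : nat -> R) : measurable_fun (`]0, 1[ : set R) (const_ext N f).
   by apply: const_ext_meas; exact: measurable_itv.
  have Sm : measurable_fun (`]0, 1[ : set R) (sol y t) := Ls.1.
  have Lps : L2 (fun x => const_ext N pj x * sol y t x) 0 1.
   apply: (@L2M_bounded _ _ _ _ _ m) => // x _; apply: const_ext_le => // j /andP[j0 jN].
   by case: j j0 jN => // j _; exact: pjm.
  have LW : L2 W 0 1 := L2B (L2D (L2B Ld Ltt) Lw) Lps.
  have XE i : (i < N)%N -> X i.+1 t = cavg N i.+1 W + pj i.+1 * (cz y N i.+1 t - Yz y N i.+1 t).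
   move=> iN; rewrite /W (cavgB iN (L2_ible (L2D (L2B Ld Ltt) Lw)) (L2_ible Lps)).
   rewrite (cavgD iN (L2_ible (L2B Ld Ltt)) (L2_ible Lw)) (cavgB iN (L2_ible Ld) (L2_ible Ltt)) (cavg_const_ext _ iN).
   have -> : cavg N i.+1 (fun x => const_ext N pj x * sol y t x) = pj i.+1 * cavg N i.+1 (sol y t).
   have e0 := cavgZ (pj i.+1) iN (L2_ible Ls); rewrite -e0 /cavg; congr (_ / _).
   by apply: eq_Rint => x /andP[x1 x2]; rewrite (@const_ext_cell R N pj i.+1)// (ltW x1).
   by rewrite /X laplacian_Yz// /cztt /cz (clamp_id tI); ring.
  have l1 : l2 N (X^~ t) <= l2 N (fun j => cavg N j W) + 2 * m * K * sqm N.
   rewrite (@eq_l2 R N _ (fun j => cavg N j W + pj j * (cz y N j t - Yz y N j t))) => [|i iN]; last exact: XE.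
   apply: (le_trans (l2D _ _ _)); rewrite lerD2l; apply: l2_le_sup => [|i iN].
   by rewrite !mulr_ge0// sqrtr_ge0.
   rewrite normrM distrC (_ : 2 * m * K * _ = m * (2 * K * sqm N)); last by ring.
   by apply: ler_pM => //; [exact: pjm|exact: Yz_cz].
  (* An infinite norm makes the inequality trivial; otherwise the difference of the sources is
     square integrable at this time. *)
  have [Aoo|Afin] := eqVneq (A t) +oo%E; first by rewrite Aoo addye// leey.
  pose gt x := const_ext N (fun j => w j t) x - g t x.
  have mgt : measurable_fun (`]0, 1[ : set R) gt.
   apply: measurable_funB; [exact: cem|apply: (section_meas mg)].
   by rewrite /= in_itv/= t0.
  have Lgt : L2 gt 0 1 by apply: L2_of_norm => //; rewrite ltey.
  pose v x := (const_ext N pj x - pt x) * sol y t x.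
  have bv x : 0 < x < 1 -> `|const_ext N pj x - pt x| <= 2 * m.
   move=> _; rewrite (le_trans (ler_normB _ _))// (_ : 2 * m = m + m); last by ring.
   apply: lerD => //; apply: const_ext_le => // j /andP[j0 jN].
   by case: j j0 jN => // j _; exact: pjm.
  have md : measurable_fun (`]0, 1[ : set R) (fun x => const_ext N pj x - pt x) := measurable_funB (cem _) mp.
  have Lv : L2 v 0 1 := L2M_bounded md bv Ls.
  have Ldf : L2 (fun x => const_ext N pj x - pt x) 0 1 := L2_bounded md bv.
  have Hv : intL (fun x => v x ^+ 2) 0 1 <= (K * eta) ^+ 2.
   apply: (@le_trans _ _ (intL (fun x => K ^+ 2 * (const_ext N pj x - pt x) ^+ 2) 0 1)).
   apply: intL_le; [exact: Lv.2|exact: ibleZ Ldf.2|].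
   move=> x /andP[x0 x1]; rewrite /v exprMn mulrC; apply: ler_wpM2r; first exact: sqr_ge0.
   have xI : 0 <= x <= 1 by rewrite !ltW.
   rewrite -sqr_normr//; apply: lerXn2r; rewrite ?nnegrE//.
   by have [] := Hs x xI.
   rewrite (intLZ _ Ldf.2) exprMn ler_wpM2l ?sqr_ge0//.
   rewrite (@eq_Rint _ _ (fun x => (pt x - const_ext N pj x) ^+ 2))// => x _.
   by rewrite -sqrrN opprB.
  pose a := Num.sqrt (intL (fun x => gt x ^+ 2) 0 1).
  have a0 : 0 <= a := sqrtr_ge0 _.
  have Aa : A t = a%:E by rewrite /A (L2_normE Lgt).
  have Ha : intL (fun x => gt x ^+ 2) 0 1 <= a ^+ 2 by rewrite sqr_sqrtr// intL_sqr_ge0.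
  have LV := L2B Lgt Lv.
  have HV := intL_minkowski Lgt Lv a0 (mulr_ge0 K0 eta0) Ha Hv.
  have EW : intL (fun x => W x ^+ 2) 0 1 = intL (fun x => (gt x - v x) ^+ 2) 0 1.
   apply: EFin_inj; rewrite -(intLE LW.2) -(intLE LV.2); apply: ae_eq_integral => //.
   - by apply/measurable_EFinP; exact: ible_meas LW.2.
   - by apply/measurable_EFinP; exact: ible_meas LV.2.
   - apply: (@filterS2 _ _ (ae_filter_ringOfSetsType leb) _ _ _ _ He pe) => x h1 h2; rewrite /= in_itv/= => xI.
   have xI' : x \in `]0, 1[ by rewrite in_itv.
   rewrite /W /gt /v -(h1 xI') (h2 xI'); congr (_%:E); congr (_ ^+ 2); ring.
  have l3 : l2 N (fun j => cavg N j W) <= a + K * eta.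
   apply: cavg_l2 => //; first by rewrite addr_ge0// mulr_ge0.
   by rewrite EW.
  rewrite Aa -EFinD lee_fin /C; lra.
have cl : continuous (fun t => l2 N (X^~ t)) by exact: l2_continuous.
have il := cont_ible 0 T cl.
have mA : measurable_fun (`]0, T[ : set R) A.
  by apply: L2_norm_meas => // j _; apply: measurable_funTS; apply: continuous_measurable_fun; exact: cw.
rewrite -lee_fin -/(X) -(intLE il).
have mI : measurable (`]0, T[%classic : set R) by exact: measurable_itv.
apply: (@le_trans _ _ (\int[leb]_(t in `]0%R, T[) (A t + C%:E)%E)%E).
  apply: ae_ge0_le_integral => //.
  - by move=> t _; rewrite lee_fin l2_ge0.
  - by apply/measurable_EFinP; exact: ible_meas il.
  - by move=> t _; rewrite adde_ge0// ?lee_fin//; exact: Lp_norm_ge0.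
  - by apply: emeasurable_funD => //; exact: measurable_cst.
  - apply: (@filterS _ _ (ae_filter_ringOfSetsType leb) _ _ _ (sol_eq y)) => t h; rewrite /= in_itv/= => tI; apply: key => //.
   by apply: h; rewrite in_itv.
rewrite ge0_integralD//; last by move=> t _; exact: Lp_norm_ge0.
have e0 := intLE (ible_cst C 0 T); rewrite (intL_cst _ (ltW T0)) subr0 in e0.
by rewrite e0 (mulrC C) EFinD; apply: leeD; [exact: Hd|exact: lexx].
Qed.

End semidiscrete.

(** * Assembling the residual; bounded representative of the potential *)

Section assembly.
Context {R : realType}.
Local Notation leb := (@lebesgue_measure R).

Lemma residual_assembly N (e L T d c cE : R) (G dG X E : nat -> R -> R) : 0 < e -> 0 <= L -> L + 3 * e <= T -> 0 <= c -> 0 <= cE ->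
  (forall i, (i < N)%N -> continuous (G i.+1)) -> (forall i, (i < N)%N -> continuous (X i.+1)) ->
  (forall i, (i < N)%N -> continuous (E i.+1)) -> (forall i, (i < N)%N -> abs_cont (G i.+1) (dG i.+1) 0 L) ->
  (forall t, 0 <= t <= L -> l2 N (G^~ t) <= d / 3) -> intL (fun t => l2 N (dG^~ t)) 0 L <= d / 3 ->
  intL (fun t => l2 N (X^~ t)) 0 T <= c -> 2 * c / e <= d / 3 ->
  (forall i s, (i < N)%N -> `|E i.+1 s| <= cE) -> 2 * (2 * cE / e) / e <= d / 3 ->
  2 * (2 * (2 * cE / e) / e) / e * L <= d / 3 ->
  let rho j t := - G j t - avg3 e (X j) t + dq e (dq e (avg e (E j))) t in
  [/\ forall i, (i < N)%N -> continuous (rho i.+1), forall t, 0 <= t <= L -> l2 N (rho^~ t) <= d &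
   exists drho : nat -> R -> R, (forall i, (i < N)%N -> abs_cont (rho i.+1) (drho i.+1) 0 L) /\
   intL (fun t => l2 N (drho^~ t)) 0 L <= d].
Proof.
move=> e0 L0 LT c0 cE0 cG cX cE_ aG G1 G2 HX X1 HE E1 E2 rho.
(* Set to 0 at the boundary nodes, where nothing is known about [X]; [l2] does not see the
   change. *)
pose X' j := if (0 < j <= N)%N then X j else fun=> 0.
have X'E i : (i < N)%N -> X' i.+1 = X i.+1 by move=> iN; rewrite /X' /= iN.
have cX' j : continuous (X' j).
  rewrite /X'; case: ifP; last by move=> _; exact: contC.
  by case: j => // j jN; apply: cX.
have HX' : intL (fun t => l2 N (X'^~ t)) 0 T <= c.
  by move: HX; congr (_ <= _); apply: eq_Rint => t _; apply: eq_l2 => i iN; rewrite X'E.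
have [S1 S2] := avg3_l2_bound e0 L0 LT cX' HX'.
have T0 t : 0 <= t <= L -> forall i, (i < N)%N -> [/\ `|dq e (dq e (avg e (E i.+1))) t| <= d / 3 &
   `|dq e (dq e (dq e (E i.+1))) t| <= 2 * (2 * (2 * cE / e) / e) / e].
  move=> tI i iN; have [_ [b1 b2]] := dq_sup_bounds e0 (cE_ i iN) (fun s _ => HE i s iN) tI.
  by split=> //; exact: le_trans b1 E1.
have d0 : 0 <= d / 3.
  by apply: le_trans X1; rewrite divr_ge0 ?mulr_ge0// ltW.
have b0 : 0 <= 2 * (2 * (2 * cE / e) / e) / e.
  by have en := ltW e0; rewrite !(mulr_ge0, divr_ge0, invr_ge0).
have cM i : (i < N)%N -> continuous (avg3 e (X i.+1)).
  by move=> iN; do 3 apply: avg_cont; exact: cX.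
have cD i : (i < N)%N -> continuous (dq e (dq e (avg e (E i.+1)))).
  by move=> iN; do 2 apply: dq_cont; apply: avg_cont; exact: cE_.
have X1' : c / e <= d / 3.
  by apply: le_trans X1; rewrite ler_pM2r ?invr_gt0//; lra.
have split3 : d = d / 3 + (d / 3 + d / 3) by field.
split.
- move=> i iN; apply: contD; last exact: cD.
  by apply: contB; [apply: contN; exact: cG|exact: cM].
- move=> t tI; rewrite split3; apply: (le_trans (@l2_split3 R N _ (fun j => - G j t)
   (fun j => - avg3 e (X' j) t) (fun j => dq e (dq e (avg e (E j))) t) _)).
   by move=> i iN; rewrite (X'E i iN) /rho; ring.
  rewrite !l2N; apply: lerD; first exact: G1.
  apply: lerD; first exact: le_trans (S1 t tI) X1'.
  by apply: l2_le_sup => // i iN; have [] := T0 t tI i iN.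
- exists (fun j t => - dG j t - dq e (avg e (avg e (X j))) t + dq e (dq e (dq e (E j))) t); split.
   move=> i iN; apply: abs_contD; last first.
   apply: abs_cont_C1; last by do 3 apply: dq_cont; exact: cE_.
   by move=> t; apply: dq_derive => s; apply: dq_derive => s'; apply: avg_derive; exact: cE_.
   apply: abs_contB; last first.
   apply: abs_cont_C1; last by apply: dq_cont; do 2 apply: avg_cont; exact: cX.
   by move=> t; apply: avg_derive; do 2 apply: avg_cont; exact: cX.
   have := abs_contZ (- 1) (aG i iN).
   by rewrite (_ : (fun x => -1 * G i.+1 x) = fun x => - G i.+1 x) 1?(_ : (fun x => -1 * dG i.+1 x) = fun x => - dG i.+1 x)//;
   apply/funext => x; rewrite mulN1r.
  have idG : ible (fun t => l2 N (dG^~ t)) 0 L by apply: l2_ible => i iN; exact: (aG i iN).1.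
  have cDX j : continuous (dq e (avg e (avg e (X' j)))) by apply: dq_cont; do 2 apply: avg_cont; exact: cX'.
  have iX : ible (fun t => l2 N (fun j => dq e (avg e (avg e (X' j))) t)) 0 L.
   by apply: (@l2_ible R N (fun j => dq e (avg e (avg e (X' j))))) => i iN; exact: cont_ible.
  have cEE i : (i < N)%N -> continuous (dq e (dq e (dq e (E i.+1)))).
   by move=> iN; do 3 apply: dq_cont; exact: cE_.
  pose b := 2 * (2 * (2 * cE / e) / e) / e.
  apply: (@le_trans _ _ (intL (fun t => l2 N (dG^~ t) + (l2 N (fun j => dq e (avg e (avg e (X' j))) t) + b)) 0 L)).
   apply: intL_le.
   + apply: (@l2_ible R N (fun j t => - dG j t - dq e (avg e (avg e (X j))) t + dq e (dq e (dq e (E j))) t)) => i iN.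
   apply: ibleD; last exact: cont_ible (cEE i iN).
   apply: ibleB; first exact: ibleN (aG i iN).1.
   by apply: cont_ible; rewrite -(X'E i iN).
   + exact: ibleD idG (ibleD iX (ible_cst _ _ _)).
   + move=> t /andP[t0 tL]; have tI : 0 <= t <= L by rewrite !ltW.
   apply: (le_trans (@l2_split3 R N _ (fun j => - dG j t)
   (fun j => - dq e (avg e (avg e (X' j))) t) (fun j => dq e (dq e (dq e (E j))) t) _)).
   by move=> i iN; rewrite (X'E i iN); ring.
   rewrite !l2N !lerD2l; apply: l2_le_sup => // i iN; by have [] := T0 t tI i iN.
  rewrite (intLD idG (ibleD iX (ible_cst _ _ _))) (intLD iX (ible_cst _ _ _)) (intL_cst _ L0) subr0.
  by rewrite split3; apply: lerD => //; apply: lerD => //; exact: le_trans S2 X1.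
Qed.

Lemma near_small (A c : R) : 0 < c -> \forall N \near \oo, A * sqm N <= c.
Proof.
move=> c0; have A0 : 0 < `|A| + 1 by rewrite ltr_wpDl.
have s0 : 0 < (c / (`|A| + 1)) ^+ 2 by rewrite exprn_gt0// divr_gt0.
apply: (@filterS nat (nbhs \oo) _ _ _ _ (mesh_small s0)) => N HN.
have q : sqm N <= c / (`|A| + 1).
  rewrite -(ger0_norm (ltW (divr_gt0 c0 A0))) -sqrtr_sqr; apply: ler_wsqrtr; exact: ltW.
apply: (@le_trans _ _ ((`|A| + 1) * sqm N)).
  by apply: ler_wpM2r; [exact: sqrtr_ge0|rewrite (le_trans (ler_norm A))// lerDl].
by apply: (le_trans (ler_wpM2l (ltW A0) q)); rewrite mulrCA mulfV ?mulr1// lt0r_neq0.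
Qed.

Lemma Linfty_clamp (p : R -> R) m : 0 < m -> (Linfty_norm 0 1 p <= m%:E)%E ->
  {ae leb, forall x, x \in `]0, 1[ -> p x = clamp (- m) m (p x)}.
Proof.
move=> m0; rewrite /Linfty_norm /Lp_norm unlock; case: ifPn => [_|]; last first.
  (* The norm with exponent [+oo] is defined by cases on whether the whole space has positive
     measure; it does, since it contains an interval of length 1. *)
  move=> H _; exfalso; move/negP: H; apply.
  apply: (@lt_le_trans _ _ (leb `]0, 1[%classic)).
   by rewrite (leb_oo ler01) subr0 lte_fin.
  by apply: le_measure => //; rewrite inE; [exact: measurable_itv|exact: measurableT].
move=> /ess_supP H; apply: (@filterS _ _ (ae_filter_ringOfSetsType leb) _ _ _ H) => x h xI.
move: h; rewrite /= patchE mem_set// lee_fin ler_norml => h.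
by rewrite clamp_id.
Qed.

End assembly.

(** * Increments of the reference grid function and its last slope *)

Section convergence.
Context {R : realType}.

Lemma eq_L2 (u v : R -> R) a b : (forall x, a < x < b -> u x = v x) -> L2 u a b -> L2 v a b.
Proof.
move=> E [mu iu]; split.
  by apply: eq_measurable_fun mu => x; rewrite inE/= in_itv/=; exact: E.
by apply: eq_ible iu => x xI; rewrite E.
Qed.

Lemma eq_abs_cont (f g df dg : R -> R) a b : (forall x, a <= x <= b -> f x = g x) ->
  (forall x, a < x < b -> df x = dg x) -> abs_cont f df a b -> abs_cont g dg a b.
Proof.
move=> E1 E2 [i H]; split=> [|s t as_ st tb]; first exact: eq_ible i.
rewrite -!E1; [|lra|lra]; rewrite H//; apply: eq_Rint => x /andP[? ?]; apply: E2; split_lra.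
Qed.

Variables (T : R) (p : R -> R) (g : R -> R -> R) (g0 g1 y0 y1 : R -> R)
  (y : wave_solution T p g g0 g1 y0 y1).
Hypothesis T0 : 0 < T.
Variables (K : R) (K0 : 0 <= K) (HK : wave_bound y K).

Lemma Yz_jump N i t : (i <= N)%N -> `|Yz y N i.+1 t - Yz y N i t| <= 3 * K * sqm N.
Proof.
move=> iN; have h0 : 0 < mesh N :> R := mesh_gt0 _.
have n1 := @Yz_node R T p g g0 g1 y0 y1 y T0 K K0 HK N i.+1 t iN.
have n2 := @Yz_node R T p g g0 g1 y0 y1 y T0 K K0 HK N i t (leqW iN).
have cT : 0 <= clamp 0 T t <= T by apply: clamp_in; exact: ltW.
have [_ Hd _] := HK cT.
have nI j : (j <= N.+1)%N -> 0 <= (j%:R * mesh N : R) <= 1.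
  move=> jN; apply/andP; split; first by apply: mulr_ge0 => //; exact: ltW.
  have e1 : N.+1%:R * mesh N = 1 :> R by rewrite /mesh mulfV// pnatr_eq0.
  by rewrite -[leRHS]e1 ler_pM2r// ler_nat.
have Ld : L2 (dH2 (sol y (clamp 0 T t))) 0 1 := L2_cont (@W1_cont _ _ _ _ _).
have D := abs_cont_dist2 (sol_abs_cont y (clamp 0 T t)) Ld (nI i (leqW iN)) (nI i.+1 iN).
have e1 : `|i.+1%:R * mesh N - i%:R * mesh N| = mesh N :> R.
  by rewrite -mulrBl -natr1 addrAC subrr add0r mul1r gtr0_norm.
rewrite e1 in D.
have s0 : 0 <= K * sqm N by rewrite mulr_ge0// sqrtr_ge0.
have n3 : `|sol y (clamp 0 T t) (i.+1%:R * mesh N) - sol y (clamp 0 T t) (i%:R * mesh N)| <= K * sqm N.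
  rewrite -(ler_pXn2r (n := 2)) ?nnegrE// sqr_normr//.
  by apply: (le_trans D); rewrite exprMn (sqr_sqrtr (ltW h0)) (mulrC (K ^+ 2)); apply: ler_wpM2l Hd; exact: ltW.
move: n1 n2 n3; norm_lra.
Qed.

Lemma midpt_last N t : 0 <= t <= T ->
  `|dH2 (sol y (clamp 0 T t)) (midpt N N) - dH2 (sol y t) 1| <= K * sqm N.
Proof.
move=> tI; rewrite (clamp_id tI); apply: (dsol_holder K0 HK tI); [exact: midpt_in|by rewrite ler01 lexx|].
have h0 : 0 < mesh N :> R := mesh_gt0 _.
have e1 : (1 : R) = N.+1%:R * mesh N by rewrite /mesh mulfV// pnatr_eq0.
rewrite [X in _ - X]e1 /midpt -mulrBl normrM (gtr0_norm h0); apply: ler_piMl; first exact: ltW.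
by rewrite -[N.+1%:R]natr1 ler_norml; split_lra.
Qed.

End convergence.

(** * Choice of the parameters and conclusion *)

Theorem theorem4p1 (R : realType) (T m : R) (p : R -> R)
    (* continuous data *)
    (y0 : H2 (0 : R) 1) (y1 : H1 (0 : R) 1)
    (g : W11L2 T) (g0 g1 : H2 0 T)
    (* discrete data, indexed by the number N of interior nodes *)
    (y0h y1h : nat -> nat -> R)
    (gh : nat -> nat -> W11 0 T) (g0h g1h : nat -> H2 0 T)
    (qh : nat -> nat -> R)
    (* the solutions y[p] and y_h[q_h] *)
    (y : wave_solution T p g g0 g1 y0 y1)
    (yh : forall N, semidiscrete_solution N T (qh N)
            (fun j => gh N j : R -> R) (g0h N) (g1h N) (y0h N) (y1h N)) :
  1 < T -> 0 < m ->
  in_Linfty 0 1 p -> (Linfty_norm 0 1 p <= m%:E)%E ->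
  (* compatibility *)
  g0 0 = y0 0 -> g1 0 = y0 1 -> dH2 g0 0 = y1 0 -> dH2 g1 0 = y1 1 ->
  (* convergence of the data *)
  L2_norm 0 1
      (const_ext N (laplacian_h N (with_boundary N (g0h N 0) (g1h N 0) (y0h N)))
       \- ddH2 y0) @[N --> \oo] --> 0%E ->
  Hm1_norm 0 1
      (distribution_of 0 1 (const_ext N (laplacian_h N
         (with_boundary N (dH2 (g0h N) 0) (dH2 (g1h N) 0) (y1h N))))
       \- distr_deriv (distr_deriv (distribution_of 0 1 y1))) @[N --> \oo]
    --> 0%E ->
  W11L2_norm T
      (fun t => const_ext N (fun j => gh N j t) \- g t)
      (fun t => const_ext N (fun j => wder (gh N j) t) \- W11L2_dt g t)
      @[N --> \oo] --> 0%E ->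
  H2_dist (g0h N) g0 @[N --> \oo] --> 0%E ->
  H2_dist (g1h N) g1 @[N --> \oo] --> 0%E ->
  (* positivity *)
  (exists r : R, [/\ 0 < r,
     forall x, x \in `]0, 1[ -> r <= `|y0 x| &
     forall N j, (1 <= j <= N)%N -> r <= `|y0h N j|]) ->
  (* q_h is bounded by m *)
  (forall N j, (1 <= j <= N)%N -> `|qh N j| <= m) ->
  (* convergence of the observations *)
  observation_dist T (Theta_h (yh N)) (Theta_0 y) @[N --> \oo] --> 0%E ->
  L2_norm 0 1 (const_ext N (qh N) \- p) @[N --> \oo] --> 0%E.
Proof.
have ar1 (x A B sq : R) : A <= x / 3 -> B * sq <= x / 3 -> x / 3 + (A + B * sq) <= x by lra.
have ar2 (a b c : R) : 0 < a -> 20 * a <= c -> `|b| <= 5 * a -> `|b| <= c.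
  by move=> ? ? h; apply: (le_trans h); lra.
have ar3 (U Y a c : R) : 0 < c -> 20 * a <= c -> c <= `|U| -> `|U - Y| <= 5 * a -> c / 2 <= `|Y|.
  by move=> ? ? h1 h2; have := ler_normB U (U - Y); rewrite subKr => _; have := ler_normD (U - Y) Y; rewrite subrK; lra.
have ar4 (a b c e : R) : 0 < c -> 20 * c <= e -> `|a - b| <= c -> `|b| <= c -> `|a| <= e.
  by move=> ? ?; norm_lra.
have ar5 (x : R) : 0 < x -> [/\ 0 < x / 2, 0 < x / 3, 0 < x / 20, x / 20 <= x & (x / 3 + x / 3) ^+ 2 <= x ^+ 2].
  by move=> x0; split; try lra; have := sqr_ge0 x; rewrite !expr2; lra.
have ar6 (x : R) : 0 <= x -> x <= (1 + x) ^+ 2 by move=> x0; have := sqr_ge0 x; rewrite !expr2; lra.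
have ar7 (x z A D : R) : x <= z -> 2 * z <= D / 2 -> A = D / 2 -> A + 2 * x <= D by lra.
have ar10 (a b x z h : R) : (a - b - (x - z)) / h = ((a - x) - (b - z)) / h by congr (_ / _); ring.
have ar8 (a b : R) : 0 < a -> 20 * a <= b -> a <= b by lra.
have ar9 (a b c t : R) : a <= b -> t + 3 * b <= c -> 0 <= t -> t + 3 * a <= c /\ 3 * a <= c by lra.
move=> T1 m0 pin pm _ _ _ _ Hlap HH1 Hg Hg0 Hg1 [r [r0 _ Hr]] Hq Hobs.
have T0 : 0 < T by lra.
(* An intermediate horizon: the room between [L] and [T] is for the three means, the room between 1
   and [L] for the time step [kap h]. *)
have [L [L1 LT]] : exists L, 1 < L /\ L < T by exists ((1 + T) / 2); split; lra.
have L0 : 0 <= L by lra.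
(* A representative of [p] bounded by [m] at every point. *)
pose pt x := clamp (- m) m (p x).
have pe := Linfty_clamp m0 pm.
have mm : - m <= m by lra.
have mp : measurable_fun (`]0, 1[ : set R) p by apply: in_Lp_measurable pin; exact: measurable_itv.
have mpt : measurable_fun (`]0, 1[ : set R) pt.
  apply: (@measurableT_comp _ _ _ _ _ _ (clamp (- m) m)) => //; apply: continuous_measurable_fun.
  apply: (@clamp_cont R idfun (- m) m mm); apply: continuous_subspaceT => x; exact: cvg_id.
have ptm x : `|pt x| <= m by rewrite ler_norml; exact: clamp_in.
have Lpt : L2 pt 0 1 by exact: (L2_bounded mpt (fun x _ => ptm x)).
have [K K0 HK] := wave_boundP y.
have yz x : 0 <= x <= 1 -> sol y 0 x = y0 x by move=> xI; apply: sol_init; rewrite in_itv.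
apply: near_cvge0 => [N|e_ e_0]; first exact: Lp_norm_ge0.
have Kp : 0 < K + 1 := ltr_wpDl K0 ltr01.
have K1 : 0 <= K + 1 := ltW Kp.
have K2 : 0 <= 2 * K by lra.
have [r20 _ _ _ _] := ar5 _ r0.
have [_ e30 _ _ e_33] := ar5 _ e_0.
(* Constants of the reference function: size [2 K], Lipschitz constant [K + 1] in time, initial
   modulus at least [r / 2]. They depend neither on the averaging step nor on the mesh. *)
have [kap [d [/andP[kap0 kap1] /andP[d0 d1] core]]] := core_estimate (ltW m0) K1 K2 r20 (exprn_gt0 2 e30).
(* A stricter tolerance for the initial data: [discrete_poincare] multiplies it by 5, and the lower
   bound [r] must survive the error. *)
have [dl [dl0 dld dlr]] : exists dl, [/\ 0 < dl, 20 * dl <= d & 20 * dl <= r].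
  exists (Num.min d r / 20); have le1 : Num.min d r <= d by rewrite ge_min lexx.
  have le2 : Num.min d r <= r by rewrite ge_min lexx orbT.
  by split; [rewrite divr_gt0// lt_min d0| |]; lra.
have [S [k [B [sS dS ck B0 [kB S0 S1 IS]]]]] := @unit_mean_step R.
have [cs cs0 [es es0 Hslope]] := init_slopes T0 K0 HK sS dS ck B0 kB S0 S1 IS dl0.
have [el el0 Hl] := init_laplacian T0 yz dl0.
have [db [db0 dbl dbc]] : exists db, [/\ 0 < db, db <= dl & db <= cs].
  by exists (Num.min dl cs); rewrite lt_min dl0 cs0 !ge_min !lexx orbT.
have [eb0 [eb00 eb0T Hb0]] := boundary_match g0 T1 L0 LT db0.
have [eb1 [eb10 _ Hb1]] := boundary_match g1 T1 L0 LT db0.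
have [ef [ef0 _ Hfl]] := flux_match (sol_flux y) T1 L0 LT d0.
have [d20 d30 _ _ _] := ar5 _ d0.
have [dl20 _ dl200 _ _] := ar5 _ dl0.
have [er [er0 _ Hsr]] := source_match (ltW L1) LT d30 Hg.
(* The averaging step, fixed from here on; the errors that contain negative powers of [e] carry
   [sqrt h] or a tolerance chosen afterwards. *)
have [e [e0 [ees eel eeb0] [eeb1 eef eer]]] : exists e, [/\ 0 < e, [/\ e <= es, e <= el & e <= eb0] &
   [/\ e <= eb1, e <= ef & e <= er]].
  exists (Num.min (Num.min es (Num.min el eb0)) (Num.min eb1 (Num.min ef er))).
  by rewrite !lt_min es0 el0 eb00 eb10 ef0 er0 !ge_min !lexx !orbT.
have [eLT e3T] := ar9 _ _ _ _ eeb0 eb0T L0.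
have en : e != 0 := lt0r_neq0 e0.
have I1 x : e <= x -> 0 < e <= x by rewrite e0.
have [c0 c00 Bd0] := Hb0 e (I1 _ eeb0).
have [c1 c10 Bd1] := Hb1 e (I1 _ eeb1).
have [cf cf0 Fl] := Hfl e (I1 _ eef).
have nsr := Hsr e (I1 _ eer).
have cX0 : 0 < d * e / 6 by rewrite divr_gt0// mulr_gt0.
have cXe : 2 * (d * e / 6) / e = d / 3 by field.
have cX3 : 0 < d * e / 6 / 3 by rewrite divr_gt0.
(* Tolerance for replacing [p] by samples: small against [e], by which the truncation error is
   divided, and against the target [e_]. *)
have [eta [eta0 etaT etae]] : exists eta, [/\ 0 < eta, T * (K * eta) <= d * e / 6 / 3 & eta <= e_ / 3].
  have tk : 0 < T * (K + 1) := mulr_gt0 T0 Kp.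
  exists (Num.min (d * e / 6 / 3 / (T * (K + 1))) (e_ / 3)); split.
  - by rewrite lt_min divr_gt0// e30.
  - set mn := Num.min _ _; have mn1 : mn <= d * e / 6 / 3 / (T * (K + 1)) by rewrite ge_min lexx.
   have mn0 : 0 < mn by rewrite lt_min divr_gt0// e30.
   apply: (@le_trans _ _ (mn * (T * (K + 1)))); last by rewrite -ler_pdivlMr.
   rewrite (_ : mn * (T * (K + 1)) = T * (K * mn) + T * mn); last by ring.
   by rewrite lerDl; apply: mulr_ge0; exact: ltW.
  - by rewrite ge_min lexx orbT.
have [eta20 _ _ _ _] := ar5 _ eta0.
(* [p] has no values at nodes: a continuous function with the same bound [m], close to it in L2, is
   sampled instead. *)
have [phi [cphi phim Hphi]] := L2_dense_clamp mpt (L2_ible Lpt) (ltW m0) (exprn_gt0 2 eta20).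
have nph := sample_cvg cphi (ltW m0) phim (exprn_gt0 2 eta20).
(* The share of the reference function in the jumps; the observation takes the other half of
   [d^2]. *)
have [dj [dj0 Hdj]] : exists dj, 0 < dj /\ 2 * (dj ^+ 2 * L) <= d ^+ 2 / 2.
  exists (d / (2 * (1 + L))); have l1 : 0 < 1 + L := addr_gt0 ltr01 (lt_trans ltr01 L1).
  have l1n := lt0r_neq0 l1.
  split; first by rewrite divr_gt0// mulr_gt0.
  rewrite (_ : 2 * _ = d ^+ 2 / 2 * (L / (1 + L) ^+ 2)); last by field.
  rewrite ler_piMr ?divr_ge0 ?sqr_ge0// ler_pdivrMr ?exprn_gt0// mul1r.
  exact: ar6.
have nm : \forall N \near \oo, mesh N < L - 1 by apply: mesh_small; rewrite subr_gt0.
have n1 := near_small K c10.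
have n2 := near_small K cf0.
have n3 := @near_small R (4 * K / e) 1 ltr01.
have n4 := near_small (2 * (2 * (3 * K) / e) / e) dj0.
have n5 := near_small (2 * (B * K) / e) dl200.
have n6 := near_small (T * (2 * m * K)) cX3.
have n7 := near_small (2 * (2 * (2 * K) / e) / e) d30.
have n8 := near_small (2 * (2 * (2 * (2 * K) / e) / e) / e * L) d30.
have n9 := cvge0_near Hg0 c00.
have n10 := cvge0_near Hg1 c10.
have n11 := cvge0_near Hlap dl20.
have n12 := cvge0_near HH1 cs0.
have n13 := cvge0_near Hobs cf0.
have n14 := cvge0_near Hobs d20.
have n15 := cvge0_near Hg cX3.
near=> N.
have q0 : mesh N < L - 1 by near: N; exact: nm.
have q1 : K * sqm N <= c1 by near: N; exact: n1.
have q2 : K * sqm N <= cf by near: N; exact: n2.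
have q3 : 4 * K / e * sqm N <= 1 by near: N; exact: n3.
have q4 : 2 * (2 * (3 * K) / e) / e * sqm N <= dj by near: N; exact: n4.
have q5 : 2 * (B * K) / e * sqm N <= dl / 20 by near: N; exact: n5.
have q6 : T * (2 * m * K) * sqm N <= d * e / 6 / 3 by near: N; exact: n6.
have q7 : 2 * (2 * (2 * K) / e) / e * sqm N <= d / 3 by near: N; exact: n7.
have q8 : 2 * (2 * (2 * (2 * K) / e) / e) / e * L * sqm N <= d / 3 by near: N; exact: n8.
have q9 : (H2_dist (g0h N) g0 <= c0%:E)%E by near: N; exact: n9.
have q10 : (H2_dist (g1h N) g1 <= c1%:E)%E by near: N; exact: n10.
have q11 : (L2_norm 0 1 (const_ext N (laplacian_h N (with_boundary N (g0h N 0) (g1h N 0) (y0h N))) \- ddH2 y0)%R <= (dl / 2)%:E)%E by near: N; exact: n11.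
have q12 : (Hm1_norm 0 1 (distribution_of 0 1 (const_ext N (laplacian_h N (with_boundary N (dH2 (g0h N) 0) (dH2 (g1h N) 0) (y1h N))))
   \- distr_deriv (distr_deriv (distribution_of 0 1 y1)))%R <= cs%:E)%E by near: N; exact: n12.
have q13 : (observation_dist T (Theta_h (yh N)) (Theta_0 y) <= cf%:E)%E by near: N; exact: n13.
have q14 : (observation_dist T (Theta_h (yh N)) (Theta_0 y) <= (d / 2)%:E)%E by near: N; exact: n14.
have q15 : (W11L2_norm T (fun t => const_ext N (fun j => gh N j t) \- g t)%R
   (fun t => const_ext N (fun j => wder (gh N j) t) \- W11L2_dt g t)%R <= (d * e / 6 / 3)%:E)%E by near: N; exact: n15.
have q16 : intL (fun x => (phi x - const_ext N (fun j => phi (j%:R * mesh N)) x) ^+ 2) 0 1 <= (eta / 2) ^+ 2.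
  by near: N; exact: nph.
have [dG [aG G1 G2]] : exists dG : nat -> R -> R,
   let G j t := gh N j (clamp 0 T t) - avg3 e (fun s => gh N j (clamp 0 T s)) t in
   [/\ forall i, (i < N)%N -> abs_cont (G i.+1) (dG i.+1) 0 L,
   forall t, 0 <= t <= L -> l2 N (G^~ t) <= d / 3 & intL (fun t => l2 N (dG^~ t)) 0 L <= d / 3].
  by near: N; exact: nsr.
pose a0 := with_boundary N (g0h N 0) (g1h N 0) (y0h N).
pose a1 := with_boundary N (dH2 (g0h N) 0) (dH2 (g1h N) 0) (y1h N).
have h0 : 0 < mesh N :> R := mesh_gt0 _.
have sq0 : 0 <= sqm N :> R := sqrtr_ge0 _.
pose pj j := phi (j%:R * mesh N).
have pjm i : `|pj i| <= m := phim _.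
have cw j : continuous (fun t => gh N j (clamp 0 T t)) := clamp_cont (ltW T0) (@W1_cont _ _ _ _ (gh N j)).
have Lce := const_ext_L2 N pj 0 1.
have Lph := cont_L2 0 1 cphi.
have Heta : intL (fun x => (pt x - const_ext N pj x) ^+ 2) 0 1 <= eta ^+ 2.
  have A1 : intL (fun x => (pt x - phi x) ^+ 2) 0 1 <= (eta / 2) ^+ 2.
   by move: Hphi; congr (_ <= _); apply: eq_Rint => x _; rewrite clamp_id//; exact: clamp_in.
  have A2 : intL (fun x => (const_ext N pj x - phi x) ^+ 2) 0 1 <= (eta / 2) ^+ 2.
   by move: q16; congr (_ <= _); apply: eq_Rint => x _; rewrite -sqrrN opprB.
  have := intL_minkowski (L2B Lpt Lph) (L2B Lce Lph) (ltW eta20) (ltW eta20) A1 A2.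
  rewrite (_ : eta / 2 + eta / 2 = eta); last by field.
  by congr (_ <= _); apply: eq_Rint => x _; congr (_ ^+ 2); ring.
have q15' : (L1L2_norm T (fun t => const_ext N (fun j => gh N j (clamp 0 T t)) \- g t)%R <= (d * e / 6 / 3)%:E)%E.
  rewrite (@L1L2_norm_clamp R T N (fun j => gh N j : R -> R) g T0); apply: le_trans q15.
  by rewrite /W11L2_norm leeDl//; apply: integral_ge0 => t _; exact: Lp_norm_ge0.
pose X j s := laplacian_h N (Yz y N ^~ s) j - cztt y N j s + gh N j (clamp 0 T s) - pj j * Yz y N j s.
have TB : intL (fun s => l2 N (X^~ s)) 0 T <= d * e / 6.
  apply: (le_trans (truncation_bound T0 K0 HK (ltW m0) (ltW eta0) (ltW cX3) cw mpt ptm pe Heta (fun i _ => pjm i.+1) q15')).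
  by rewrite mulrDr (mulrA T _ (Num.sqrt _)); exact: ar1.
pose E j t := Yz y N j t - cz y N j t.
pose G j t := gh N j (clamp 0 T t) - avg3 e (fun s => gh N j (clamp 0 T s)) t.
have cG j : continuous (G j) by apply: contB; [exact: cw|do 3 apply: avg_cont; exact: cw].
have cX i : (i < N)%N -> continuous (X i.+1).
  move=> iN; have cYj j ji := @Yz_cont _ _ _ _ _ _ _ _ y T0 N i j iN ji.
  have [cl _] := @avg3_laplacian R N 1 (Yz y N) i 0 cYj.
  apply: contB; last by apply: contM; [exact: contC|exact: cYj].
  by apply: contD; [apply: contB; [exact: cl|exact: cztt_continuous]|exact: cw].
have cE i : (i < N)%N -> continuous (E i.+1).
  by move=> iN; apply: contB; [apply: Yz_continuous => //; exact: ltnW|exact: cz_continuous].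
have E1 : 2 * (2 * (2 * K * sqm N) / e) / e <= d / 3.
  by rewrite (_ : _ / e = 2 * (2 * (2 * K) / e) / e * sqm N) //; ring.
have E2 : 2 * (2 * (2 * (2 * K * sqm N) / e) / e) / e * L <= d / 3.
  by rewrite (_ : _ * L = 2 * (2 * (2 * (2 * K) / e) / e) / e * L * sqm N) //; ring.
have KE : 0 <= 2 * K * sqm N by rewrite mulr_ge0.
have cXe' : 2 * (d * e / 6) / e <= d / 3 by rewrite cXe.
have [rc rl rd] := residual_assembly e0 L0 eLT (ltW cX0) KE (fun i _ => cG i.+1) cX cE aG G1 G2 TB cXe'
  (fun i s iN => Yz_cz T0 K0 HK s iN) E1 E2.
have [U [dU [ddU [UdU cdU Uint UE [ddE Ueq]]]]] := semidiscrete_extension (yh N) T0.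
have T00 : 0 <= (0 : R) <= T by rewrite lexx ltW.
have cYz j : (j <= N.+1)%N -> continuous (Yz y N j) by move=> jN; exact: Yz_continuous.
have aU j : abs_cont (dU j) (ddU j) 0 L.
  apply: abs_cont_sub (lexx 0) (ltW LT) _; apply: eq_abs_cont (H1_abs_cont (dH2 (yh N j)) T0) => x xI.
   by rewrite (UE j x xI).2.
  by rewrite ddE.
have LddT j : L2 (ddH2 (yh N j)) 0 T := W1_2_L2 _.
have LddU j : L2 (ddU j) 0 L.
  by apply: eq_L2 (L2_sub (lexx 0) (ltW LT) (LddT j)) => x /andP[x0 xL]; rewrite ddE// x0 (lt_trans xL).
have ddEL j t : 0 < t < L -> ddU j t = ddH2 (yh N j) t.
  by move=> /andP[t0 tL]; rewrite ddE// t0 (lt_trans tL).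
have left t : 0 <= t <= T -> yh N 0%N t = g0h N t by move=> tI; apply: solh_left; rewrite in_itv.
have right t : 0 <= t <= T -> yh N N.+1 t = g1h N t by move=> tI; apply: solh_right; rewrite in_itv.
have YL t : 0 <= t <= T -> `|Yz y N 0 t - g0 t| <= c0.
  move=> tI; rewrite /Yz big_ord0 mulr0 addr0 (clamp_id tI) (sol_left y); last by rewrite in_itv.
  by rewrite subrr normr0 ltW.
have YR t : 0 <= t <= T -> `|Yz y N N.+1 t - g1 t| <= c1.
  move=> tI; have := Yz_right T0 K0 HK N t; rewrite (clamp_id tI) (sol_right y); last by rewrite in_itv.
  by move=> h; exact: le_trans h q1.
have [l1 l2_ l3] := Bd0 (yh N 0%N) (g0h N) (Yz y N 0) (cYz 0%N isT) left q9 YL.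
have [r1 r2 r3] := Bd1 (yh N N.+1) (g1h N) (Yz y N N.+1) (cYz _ (leqnn _)) right q10 YR.
(* At the two boundary nodes the initial values come from the boundary data, and [H2_deriv_eq]
   provides the initial velocities. *)
have aE j : (j <= N.+1)%N -> yh N j 0 = a0 j /\ dH2 (yh N j) 0 = a1 j.
  move=> jN; rewrite /a0 /a1 /with_boundary; have [->|jn0] := eqVneq j 0%N.
   by rewrite left// (H2_deriv_eq T0 left).
  have [->|jnN] := eqVneq j N.+1; first by rewrite right// (H2_deriv_eq T0 right).
  have jI : (1 <= j <= N)%N by rewrite lt0n jn0 -ltnS ltn_neqAle jnN.
  by rewrite (solh_init (yh N) jI) (solh_t_init (yh N) jI).
pose u j t := U j t - Yh y e N j t; pose du j t := dU j t - dYh y e N j t; pose ddu j t := ddU j t - ddYh y e N j t.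
have u0E j : (j <= N.+1)%N -> u j 0 = a0 j - avg3 e (Yz y N j) 0.
  by move=> jN; rewrite /u (UE j 0 T00).1 (aE j jN).1.
have du0E j : (j <= N.+1)%N -> du j 0 = a1 j - dq e (avg e (avg e (Yz y N j))) 0.
  by move=> jN; rewrite /du (UE j 0 T00).2 (aE j jN).2.
have lap0 : l2 N (laplacian_h N (u^~ 0)) <= dl.
  have := Hl e (I1 _ eel) N a0 q11; congr (_ <= _); apply: eq_l2 => i iN.
  by rewrite /laplacian_h/= !u0E// ltnW// ltnW.
have b0 : `|u 0%N 0| <= dl by rewrite /u (UE 0%N 0 T00).1; exact: le_trans l2_ dbl.
have bN : `|u N.+1 0| <= dl by rewrite /u (UE N.+1 0 T00).1; exact: le_trans r2 dbl.
have uj := discrete_poincare dl0 b0 bN lap0.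
have q5' : 2 * (B * (K * sqm N)) / e <= dl / 20.
  by rewrite (_ : _ / e = 2 * (B * K) / e * sqm N) //; ring.
have db0' : `|a1 0%N - dq e (avg e (avg e (Yz y N 0))) 0| <= dl.
  by rewrite -(aE 0%N isT).2; exact: le_trans l3 dbl.
have Hs := Hslope e (I1 _ ees) e3T N a1 q5' q12.
have {}Hs : mesh N * \sum_(i < N.+1) ((du i.+1 0 - du i 0) / mesh N) ^+ 2 <= dl ^+ 2.
  have := Hs _ _; rewrite -(aE 0%N isT).2 -(aE N.+1 (leqnn _)).2 => /(_ (le_trans l3 dbc) (le_trans r3 dbc)).
  congr (_ <= _); congr (_ * _); apply: eq_bigr => i _.
  by rewrite !du0E// ltnW// ltnS.
have dl_d : dl <= d := ar8 _ _ dl0 dld.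
have tLT t : 0 <= t <= L -> 0 <= t <= T by move=> /andP[-> tL]; exact: le_trans tL (ltW LT).
have tLT' t : 0 < t < L -> 0 <= t <= T by move=> /andP[t0 tL]; apply: tLT; rewrite !ltW.
have sq_le (a b : R) : 0 <= a -> a <= b -> a ^+ 2 <= b ^+ 2.
  by move=> a_ ab; apply: lerXn2r; rewrite ?nnegrE// (le_trans a_).
have LTd := ltW LT.
have db_d : db ^+ 2 <= d ^+ 2 by apply: sq_le; [exact: ltW|exact: le_trans dbl dl_d].
pose f j := pj j - qh N j.
have HB : residual_bounds N L m (2 * K) (K + 1) (r / 2) d u du ddu (Yh y e N)
   (fun j t => - G j t - avg3 e (X j) t + dq e (dq e (avg e (E j))) t) f (qh N).
  split=> //.
  - by move=> j t jN; apply: is_deriveB; [exact: UdU|exact: Yh_derive].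
  - by move=> j jN; apply: contB; [exact: cdU|exact: dYh_continuous].
  - by move=> i t iN; apply: is_deriveB; [exact: (Uint i iN).2|apply: dYh_derive => //; exact: ltnW].
  - by move=> i iN; apply: contB; [exact: (Uint i iN).1|apply: ddYh_continuous => //; exact: ltnW].
  - move=> j jN; apply: abs_contB => //.
   by apply: abs_cont_C1; [move=> t; exact: dYh_derive|exact: ddYh_continuous].
  - by move=> j jN; apply: L2B => //; apply: cont_L2; exact: ddYh_continuous.
  - move=> i t iN tI; have tT := tLT t tI.
   exact: (residual_equation y T0 e0 eLT (pj i.+1) iN tI (cw i.+1) (Ueq i t iN tT)).
  - by move=> i t iN tI; apply: (Yh_le T0 K0 HK e0 _ tI); exact: ltnW.
  - have q3' : 4 * K * sqm N / e <= 1 by rewrite mulrAC.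
   by move=> i s t iN sI tI; exact: (Yh_lip T0 K0 HK e0 eLT q3' iN sI tI).
  (* The lower bound is inherited from the discrete initial data, because [u(0)] is uniformly small
     by [discrete_poincare]. *)
  - move=> i iN; have jI : (1 <= i.+1 <= N)%N by [].
   have iN' : (i.+1 <= N.+1)%N by exact: ltnW.
   apply: (ar3 (U i.+1 0) _ dl) (uj _ iN') => //.
   by rewrite (UE i.+1 0 T00).1 (solh_init (yh N) jI) Hr.
  - by move=> i iN; apply: Hq.
  - move=> i iN; rewrite /f (le_trans (ler_normB _ _))// (_ : 2 * m = m + m); last by ring.
   by apply: lerD => //; apply: Hq.
  - pose b t := backward_h N (fun j => dH2 (yh N j) t) N.+1.
   have Lb : L2 b 0 T.
   have Ld j : L2 (dH2 (yh N j)) 0 T := L2_cont (@W1_cont _ _ _ _ _).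
   have := L2Z (mesh N)^-1 (L2B (Ld N.+1) (Ld N)); congr (L2 _ _ _).
   by apply/funext => t; rewrite /b /backward_h mulrC.
   have cm : continuous (fun s => dH2 (sol y (clamp 0 T s)) (midpt N N)).
   by apply: dsol_continuous => //; exact: midpt_in.
   have ob : (L2_norm 0 T (b \- wder (sol_flux y))%R <= cf%:E)%E.
   by apply: le_trans q13; rewrite /observation_dist leeDl//; exact: Lp_norm_ge0.
   have FB t : 0 <= t <= T -> `|dH2 (sol y (clamp 0 T t)) (midpt N N) - sol_flux y t| <= cf.
   move=> tI; rewrite sol_fluxE; last by rewrite in_itv.
   exact: le_trans (midpt_last K0 HK N tI) q2.
   have := Fl b _ Lb cm ob FB; congr (_ <= _); apply: eq_Rint => t tI; congr (_ ^+ 2).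
   have tT := tLT' t tI.
   rewrite -(Yz_slope y T0 t e0 (leqnn N)) /du /b /backward_h (UE N.+1 t tT).2 (UE N t tT).2 /dYh -mulrBl.
   exact: ar10.
  - by apply: le_trans db_d; move: l1; congr (_ <= _); apply: eq_Rint => t tI; rewrite /ddu ddEL.
  - by apply: le_trans db_d; move: r1; congr (_ <= _); apply: eq_Rint => t tI; rewrite /ddu ddEL.
  - have KK : 0 <= 3 * K * sqm N by rewrite !mulr_ge0.
   have ob : (L2_norm2 (`]0%R, T[ `*` `]0%R, 1%R[)
   (fun z => (mesh N * derive1 (affine_ext N (fun j => ddH2 (yh N j) z.1)) z.2)%R) <= (d / 2)%:E)%E.
   apply: le_trans q14; rewrite /observation_dist.
   rewrite (_ : ((Theta_h (yh N)).2 \- (Theta_0 y).2)%R =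
   fun z => (mesh N * derive1 (affine_ext N (fun j => ddH2 (yh N j) z.1)) z.2)%R); last first.
   by apply/funext => z; rewrite /= subr0.
   by rewrite leeDr//; exact: Lp_norm_ge0.
   have J1 := second_observation_le T0 (ltW d20) (fun j _ => LddT j) ob.
   have J2 := jumps_match e0 L0 eLT KK (fun j _ => LddT j) cYz (fun i t iN _ => Yz_jump T0 K0 HK t iN) J1.
   have J3 : 2 * (2 * (3 * K * sqm N) / e) / e <= dj.
   by rewrite (_ : _ / e = 2 * (2 * (3 * K) / e) / e * sqm N) //; ring.
   have J4 : (2 * (2 * (3 * K * sqm N) / e) / e) ^+ 2 <= dj ^+ 2.
   by apply: sq_le => //; have en' := ltW e0; rewrite !(mulr_ge0, divr_ge0, invr_ge0).
   have J5 : 2 * (d / 2) ^+ 2 + 2 * ((2 * (2 * (3 * K * sqm N) / e) / e) ^+ 2 * L) <= d ^+ 2.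
   have J6 : 2 * (d / 2) ^+ 2 = d ^+ 2 / 2 by field.
   exact: ar7 (ler_wpM2r L0 J4) Hdj J6.
   apply: le_trans J5; apply: le_trans J2; rewrite ler_pM2l//; apply: ler_sum => i _.
   rewrite le_eqVlt; apply/orP; left; apply/eqP; apply: eq_Rint => t tI.
   by rewrite /ddu !ddEL.
  - exact: le_trans lap0 dl_d.
  - by move=> j jN; apply: ar2 dl0 dld (uj j jN).
  - by apply: (le_trans Hs); apply: sq_le; [exact: ltW|].
  - move=> j jN; have H0 : `|du 0%N 0| <= dl by rewrite du0E.
   exact: (ar4 _ _ _ _ dl0 dld (@grid_value_le R N (fun j => du j 0) dl j dl0 jN Hs) H0).
have kL : 0 <= 1 + kap * mesh N by rewrite addr_ge0// mulr_ge0// ltW.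
have kL2 : 1 + kap * mesh N <= L.
  by rewrite -lerBrDl (le_trans _ (ltW q0))// ler_piMl// ltW.
have fin := core N _ _ _ _ _ _ _ (residual_bounds_sub kL kL2 HB).
have Lq := const_ext_L2 N (qh N) 0 1.
rewrite /L2_norm Lp_norm2_le; last exact: ltW.
have -> : (\int[@lebesgue_measure R]_(x in `]0%R, 1%R[) (((const_ext N (qh N) \- p)%R x) ^+ 2)%:E)%E =
   (\int[@lebesgue_measure R]_(x in `]0%R, 1%R[) ((const_ext N (qh N) x - pt x) ^+ 2)%:E)%E.
  apply: ae_eq_integral => //.
  - apply/measurable_EFinP; apply: measurable_funX; apply: measurable_funB => //.
   by apply: const_ext_meas; exact: measurable_itv.
  - by apply/measurable_EFinP; exact: ible_meas (L2B Lq Lpt).2.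
  - apply: (@filterS _ _ (ae_filter_ringOfSetsType (@lebesgue_measure R)) _ _ _ pe) => x h xI.
   by rewrite /= (h xI).
rewrite (intLE (L2B Lq Lpt).2) lee_fin.
have M1 : intL (fun x => (const_ext N pj x - pt x) ^+ 2) 0 1 <= (e_ / 3) ^+ 2.
  apply: (@le_trans _ _ (eta ^+ 2)); last by apply: sq_le => //; exact: ltW.
  by move: Heta; congr (_ <= _); apply: eq_Rint => x _; rewrite -sqrrN opprB.
have M2 : intL (fun x => const_ext N f x ^+ 2) 0 1 <= (e_ / 3) ^+ 2 by rewrite intL_const_ext_sqr.
(* The error on the potential splits as the sampling error of [p] minus the extension of [f], each
   at most [e_ / 3] in L2. *)
have M3 := intL_minkowski (L2B Lce Lpt) (const_ext_L2 N f 0 1) (ltW e30) (ltW e30) M1 M2.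
apply: (@le_trans _ _ ((e_ / 3 + e_ / 3) ^+ 2)); last exact: e_33.
move: M3; congr (_ <= _); apply: eq_Rint => x _; congr (_ ^+ 2).
by rewrite /f -const_extB; ring.
Unshelve. all: by end_near. Qed.
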